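(* Let $G$ be a simple reductive group over a field of characteristic zero, and let $X$ be a finite dimensional $G$-representation over the same field. Then the growth problem $(\mathrm{Rep}(G),X)$ is PF admissible.
   Context: $\mathrm{Rep}(G)$ is the category of finite dimensional $G$-representations. The growth problem $(\mathrm{Rep}(G),X)$ is the growth problem $(R,c)$ where $R$ is the (split) Grothendieck ring of $\mathrm{Rep}(G)$, with $\mathbb{Z}$-basis $C=(c_i)_{i\in I}$ the classes of indecomposable objects, $c_0=1$ the class of the unit object, and $c=[X]$. The structure constants $m_{ij}^k$ in $c_ic_j=\sum_km_{ij}^kc_k$ are nonnegative integers. Good filtration of such $(R,C)$: a sequence of (not necessarily associative) algebras $\big((R_k,C_k)\big)_{k\in\mathbb{Z}_{\geq 0}}$ such that each $C_k\subset C$ is finite, $C_0=\{c_0\}\subset C_1\subset C_2\subset\cdots$ with $\bigcup_kC_k=C$; $c_0$ is the unit of every $R_k$; and $R_k$ has basis $C_k$ with multiplication given by taking the product in $R$ followed by the projection to the span of $C_k$. For an element $c$ that is a finite nonnegative integer combination of $C$ and lies in the span of $C_k$ (true for all large $k$), $\mathrm{PFdim}_kc$ is the Perron--Frobenius eigenvalue (largest nonnegative real eigenvalue) of the matrix of left multiplication by $c$ on $R_k$ in the basis $C_k$. Define $\mathrm{PFdim}^{f}c=\lim_{k\to\infty}\mathrm{PFdim}_kc\in\mathbb{R}_{\geq 0}\cup\{\infty\}$. PF admissible: there exists a good filtration such that (1) $\mathrm{PFdim}^{f}c+\mathrm{PFdim}^{f}d\leq\mathrm{PFdim}^{f}(c+d)$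 and $\mathrm{PFdim}^{f}(c^n)\leq(\mathrm{PFdim}^{f}c)^n$ for all finite nonnegative integer combinations $c,d$ of $C$ and all $n\in\mathbb{Z}_{\geq 0}$; (2) $\mathrm{PFdim}^{f}c_i\geq 1$ for all $c_i\in C$. *)

(* Defs.v *)
From HB Require Import structures.
From mathcomp Require Import all_boot all_order all_algebra finmap.
From mathcomp Require Import generic_quotient mxtens ring.
From mathcomp Require Import all_classical all_reals all_analysis.

Set Implicit Arguments.
Unset Strict Implicit.
Unset Printing Implicit Defensive.

Import Order.TTheory GRing.Theory Num.Theory.

Local Open Scope classical_set_scope.
Local Open Scope quotient_scope.
Local Open Scope ring_scope.

(* -------------------------------------------------------------------------- *)
(* Linear algebraic groups.  An algebraic group over k is given classically,  *)
(* as a Zariski closed subgroup of GL_N(K) defined over k, for an             *)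
(* algebraically closed extension iota : k -> K.  As k has characteristic     *)
(* zero, being defined over k is the same as being the zero locus of          *)
(* functions with coefficients in k, and group schemes are reduced.           *)
(* -------------------------------------------------------------------------- *)

Section Zariski.
Context (k : fieldType) (K : closedFieldType) (iota : {rmorphism k -> K}).
Context (N : nat).

(* k[GL_N] = k[x_ij, 1/det], the k-subalgebra of functions generated by the   *)
(* matrix coordinates and 1/det; only the values on GL_N(K) matter.           *)
Inductive regular : ('M[K]_N -> K) -> Prop :=
| regular_const (a : k) : regular (fun _ => iota a)
| regular_coord (i j : 'I_N) : regular (fun g => g i j)
| regular_inv_det : regular (fun g => (\det g)^-1)
| regular_add (f h : 'M[K]_N -> K) :
    regular f -> regular h -> regular (fun g => f g + h g)
| regular_mul (f h : 'M[K]_N -> K) :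
    regular f -> regular h -> regular (fun g => f g * h g).

Definition zariski_closed (Z : set 'M[K]_N) : Prop :=
  exists2 F : set ('M[K]_N -> K), F `<=` regular &
    Z = [set g | g \in unitmx /\ forall f, F f -> f g = 0].

End Zariski.

Section ClosedSubgroups.
Context (K : closedFieldType) (N : nat).
Implicit Types G H : set 'M[K]_N.

Record is_subgroup G : Prop := IsSubgroup {
  subgroup_unit : G `<=` [set g | g \in unitmx];
  subgroup1 : G 1%:M;
  subgroupM : forall g h, G g -> G h -> G (g *m h);
  subgroupV : forall g, G g -> G (invmx g) }.

(* Connectedness for the K-Zariski topology, i.e. geometric connectedness. *)
Definition zariski_connected G : Prop :=
  forall A B : set 'M[K]_N,
    zariski_closed idfun A -> zariski_closed idfun B ->
    A `|` B = G -> A `&` B = set0 -> A = set0 \/ B = set0.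

Definition normal_subgroup H G : Prop :=
  [/\ is_subgroup H, H `<=` G &
      forall g h, G g -> H h -> H (g *m h *m invmx g)].

Definition unipotent (g : 'M[K]_N) : Prop :=
  iter N (mulmx (g - 1%:M)) 1%:M = 0.

End ClosedSubgroups.

Section AlgebraicGroups.
Context (k : fieldType) (K : closedFieldType) (iota : {rmorphism k -> K}).

Record algebraic_group := AlgebraicGroup {
  gdim : nat;
  gpoints : set 'M[K]_gdim;
  gpoints_closed : zariski_closed iota gpoints;
  gpoints_subgroup : is_subgroup gpoints }.

Arguments gpoints : clear implicits.

(* The second clause says that the geometric unipotent radical, which is the  *)
(* largest closed connected normal unipotent subgroup, is trivial.            *)
Definition reductive (G : algebraic_group) : Prop :=
  zariski_connected (gpoints G) /\
  forall U : set 'M[K]_(gdim G),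
    zariski_closed idfun U -> zariski_connected U ->
    normal_subgroup U (gpoints G) ->
    (forall u, U u -> unipotent u) -> U = [set 1%:M].

(* Simple in the sense of algebraic groups over k: noncommutative, with no    *)
(* nontrivial proper connected normal subgroup defined over k.  Finite        *)
(* normal subgroups are allowed, as in SL_n.                                  *)
Definition simple (G : algebraic_group) : Prop :=
  (exists g h, [/\ gpoints G g, gpoints G h & g *m h <> h *m g]) /\
  forall H : set 'M[K]_(gdim G),
    zariski_closed iota H -> zariski_connected H ->
    normal_subgroup H (gpoints G) ->
    H = [set 1%:M] \/ H = gpoints G.

Definition regular_mx (G : algebraic_group) n (r : 'M[K]_(gdim G) -> 'M[K]_n) : Prop :=
  forall i j, exists2 f, regular iota f & forall g, gpoints G g -> r g i j = f g.

(* Finite dimensional representations G -> GL_n defined over k; only the      *)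
(* values of the map on G are meaningful.                                     *)
Record rep (G : algebraic_group) := Rep {
  rdim : nat;
  rmap :> 'M[K]_(gdim G) -> 'M[K]_rdim;
  rmap_regular : regular_mx rmap;
  rmap1 : rmap 1%:M = 1%:M;
  rmapM : forall g h, gpoints G g -> gpoints G h ->
    rmap (g *m h) = rmap g *m rmap h }.

End AlgebraicGroups.

Arguments gpoints {k K iota} _ _.
Arguments rdim {k K iota G}.

Section Representations.
Context (k : fieldType) (K : closedFieldType) (iota : {rmorphism k -> K}).
Context (G : algebraic_group iota).
Implicit Types V W U : rep G.

Definition rep_iso V W : Prop :=
  exists (P : 'M[k]_(rdim V, rdim W)) (Q : 'M[k]_(rdim W, rdim V)),
    [/\ P *m Q = 1%:M, Q *m P = 1%:M &
        forall g, gpoints G g ->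
          V g *m map_mx iota P = map_mx iota P *m W g].

Lemma regular_mx_const n : @regular_mx _ _ _ G n (fun=> 1%:M : 'M[K]_n).
Proof.
move=> i j; exists (fun=> iota (i == j)%:R); first exact: regular_const.
by move=> g _; rewrite !mxE rmorph_nat.
Qed.

Lemma regular_mx_block m n r s :
  @regular_mx _ _ _ G m r -> @regular_mx _ _ _ G n s ->
  regular_mx (fun g => block_mx (r g) 0 0 (s g)).
Proof.
move=> rr rs i j; case: (split_ordP i) => i' ->; case: (split_ordP j) => j' ->.
- have [f fr fE] := rr i' j'.
  by exists f => // g Gg; rewrite block_mxEul fE.
- exists (fun=> iota 0); first exact: regular_const.
  by move=> g Gg; rewrite block_mxEur mxE rmorph0.
- exists (fun=> iota 0); first exact: regular_const.
  by move=> g Gg; rewrite block_mxEdl mxE rmorph0.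
- have [f fr fE] := rs i' j'.
  by exists f => // g Gg; rewrite block_mxEdr fE.
Qed.

Lemma regular_mx_tens m n r s :
  @regular_mx _ _ _ G m r -> @regular_mx _ _ _ G n s ->
  regular_mx (fun g => tensmx (r g) (s g)).
Proof.
move=> rr rs i j.
case: (mxtens_indexP i) => i1 i2; case: (mxtens_indexP j) => j1 j2.
have [f fr fE] := rr i1 j1; have [h hr hE] := rs i2 j2.
exists (fun g => f g * h g); first exact: regular_mul.
by move=> g Gg; rewrite tensmxE fE // hE.
Qed.

Lemma tensmx11 (R : comPzRingType) m n :
  tensmx (1%:M : 'M[R]_m) (1%:M : 'M[R]_n) = 1%:M.
Proof.
apply/matrixP => i j.
case: (mxtens_indexP i) => i1 i2; case: (mxtens_indexP j) => j1 j2.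
rewrite tensmxE !mxE -natrM mulnb (can_eq (@mxtens_indexK _ _)).
by rewrite xpair_eqE.
Qed.

Lemma const_repM n (g h : 'M[K]_(gdim G)) :
  gpoints G g -> gpoints G h -> 1%:M = 1%:M *m 1%:M :> 'M[K]_n.
Proof. by rewrite mulmx1. Qed.

Definition rep0 : rep G := Rep (@regular_mx_const 0) erefl (@const_repM 0).

Definition rep1 : rep G := Rep (@regular_mx_const 1) erefl (@const_repM 1).

Lemma rep_sum11 V W : block_mx (V 1%:M) 0 0 (W 1%:M) = 1%:M.
Proof. by rewrite !rmap1 -scalar_mx_block. Qed.

Lemma rep_sumM V W g h : gpoints G g -> gpoints G h ->
  block_mx (V (g *m h)) 0 0 (W (g *m h)) =
  block_mx (V g) 0 0 (W g) *m block_mx (V h) 0 0 (W h).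
Proof.
by move=> *; rewrite mulmx_block !mul0mx !mulmx0 !(addr0, add0r) !rmapM.
Qed.

Definition rep_sum V W : rep G :=
  Rep (regular_mx_block (@rmap_regular _ _ _ _ V) (@rmap_regular _ _ _ _ W))
      (rep_sum11 V W) (@rep_sumM V W).

Lemma rep_tensor11 V W : tensmx (V 1%:M) (W 1%:M) = 1%:M.
Proof. by rewrite !rmap1 tensmx11. Qed.

Lemma rep_tensorM V W g h : gpoints G g -> gpoints G h ->
  tensmx (V (g *m h)) (W (g *m h)) = tensmx (V g) (W g) *m tensmx (V h) (W h).
Proof. by move=> *; rewrite !rmapM // tensmx_mul. Qed.

Definition rep_tensor V W : rep G :=
  Rep (regular_mx_tens (@rmap_regular _ _ _ _ V) (@rmap_regular _ _ _ _ W))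
      (rep_tensor11 V W) (@rep_tensorM V W).

Definition indecomposable V : Prop :=
  (0 < rdim V)%N /\
  forall W U, rep_iso V (rep_sum W U) -> rdim W = 0%N \/ rdim U = 0%N.

Lemma rep_iso_refl V : rep_iso V V.
Proof.
exists 1%:M, 1%:M; rewrite mulmx1; split=> // g _.
by rewrite map_mx1 mulmx1 mul1mx.
Qed.

Lemma rep_iso_sym V W : rep_iso V W -> rep_iso W V.
Proof.
move=> [P [Q [PQ QP com]]]; exists Q, P; split=> // g Gg.
rewrite -[LHS]mul1mx -[1%:M](map_mx1 iota) -QP map_mxM -!mulmxA.
rewrite [map_mx iota P *m _]mulmxA -com // -mulmxA -map_mxM PQ map_mx1.
by rewrite mulmx1.
Qed.

Lemma rep_iso_trans V W U : rep_iso V W -> rep_iso W U -> rep_iso V U.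
Proof.
move=> [P [Q [PQ QP com]]] [P' [Q' [PQ' QP' com']]].
exists (P *m P'), (Q' *m Q); split.
- by rewrite mulmxA -(mulmxA P) PQ' mulmx1.
- by rewrite mulmxA -(mulmxA Q') QP mulmx1.
- by move=> g Gg; rewrite map_mxM mulmxA com // -!mulmxA com'.
Qed.

Lemma rep_iso_bij V W (f : 'I_(rdim V) -> 'I_(rdim W)) :
  bijective f -> (forall g i j, W g (f i) (f j) = V g i j) -> rep_iso V W.
Proof.
move=> [f' fK f'K] fE.
exists (\matrix_(i, j) (f i == j)%:R), (\matrix_(i, j) (i == f j)%:R).
split.
- apply/matrixP => i j; rewrite !mxE (bigD1 (f i)) //= !mxE eqxx mul1r.
  rewrite big1 ?addr0 ?(can_eq fK) // => l /negPf nl.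
  by rewrite !mxE eq_sym nl mul0r.
- apply/matrixP => i j; rewrite !mxE (bigD1 (f' i)) //= !mxE f'K eqxx mul1r.
  rewrite big1 ?addr0 // => l /negPf nl.
  by rewrite !mxE -{1}[i]f'K (can_eq fK) eq_sym nl mul0r.
- move=> g _; apply/matrixP => i j; rewrite !mxE (bigD1 (f' j)) //= !mxE.
  rewrite f'K eqxx rmorph1 mulr1 big1 ?addr0 => [|l /negPf nl]; last first.
    by rewrite !mxE -{1}[j]f'K (can_eq fK) nl rmorph0 mulr0.
  rewrite (bigD1 (f i)) //= !mxE eqxx rmorph1 mul1r.
  rewrite big1 ?addr0 => [|l /negPf nl]; last first.
    by rewrite !mxE eq_sym nl rmorph0 mul0r.
  by rewrite -fE f'K.
Qed.

Lemma rep_sum_iso V V' W W' :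
  rep_iso V V' -> rep_iso W W' -> rep_iso (rep_sum V W) (rep_sum V' W').
Proof.
move=> [P [Q [PQ QP com]]] [P' [Q' [PQ' QP' com']]].
exists (block_mx P 0 0 P'), (block_mx Q 0 0 Q'); split.
- rewrite mulmx_block !mul0mx !mulmx0 !(addr0, add0r) PQ PQ'.
  by rewrite -scalar_mx_block.
- rewrite mulmx_block !mul0mx !mulmx0 !(addr0, add0r) QP QP'.
  by rewrite -scalar_mx_block.
- move=> g Gg /=; rewrite map_block_mx !map_mx0 !mulmx_block.
  by rewrite !mul0mx !mulmx0 !(addr0, add0r) com // com'.
Qed.

Lemma rep_tensor_iso V V' W W' :
  rep_iso V V' -> rep_iso W W' -> rep_iso (rep_tensor V W) (rep_tensor V' W').
Proof.
move=> [P [Q [PQ QP com]]] [P' [Q' [PQ' QP' com']]].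
exists (tensmx P P'), (tensmx Q Q'); split.
- by rewrite tensmx_mul PQ PQ' tensmx11.
- by rewrite tensmx_mul QP QP' tensmx11.
- by move=> g Gg /=; rewrite map_mxT !tensmx_mul com // com'.
Qed.

Lemma rep_sum0 V : rep_iso (rep_sum rep0 V) V.
Proof.
apply/rep_iso_sym/(@rep_iso_bij _ (rep_sum rep0 V) (@rshift 0 (rdim V))).
  exists (fun i => i : 'I_(rdim V)) => i; exact: val_inj.
by move=> g i j /=; rewrite block_mxEdr.
Qed.

Lemma rep_sumC V W : rep_iso (rep_sum V W) (rep_sum W V).
Proof.
pose sw m n (i : 'I_(m + n)) : 'I_(n + m) :=
  match fintype.split i with inl a => rshift n a | inr b => lshift m b end.
have swl m n a : @sw m n (lshift n a) = rshift n a.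
  by rewrite /sw (unsplitK (inl _ a)).
have swr m n a : @sw m n (rshift m a) = lshift m a.
  by rewrite /sw (unsplitK (inr _ a)).
apply: (@rep_iso_bij (rep_sum V W) (rep_sum W V) (@sw _ _)).
  exists (@sw _ _) => i.
    by case: (split_ordP i) => a ->; rewrite ?(swl, swr).
  by case: (split_ordP i) => a ->; rewrite ?(swl, swr).
move=> g i j /=.
case: (split_ordP i) => a ->; case: (split_ordP j) => b ->;
  by rewrite ?(swl, swr) ?(block_mxEul, block_mxEur, block_mxEdl, block_mxEdr)
             ?mxE.
Qed.

Lemma rep_sumA V W U :
  rep_iso (rep_sum V (rep_sum W U)) (rep_sum (rep_sum V W) U).
Proof.
pose f := cast_ord (addnA (rdim V) (rdim W) (rdim U)).
apply: (@rep_iso_bij (rep_sum V (rep_sum W U)) (rep_sum (rep_sum V W) U) f).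
  exists (cast_ord (esym (addnA (rdim V) (rdim W) (rdim U)))) => i;
    exact: val_inj.
have f1 a : f (lshift _ a) = lshift _ (lshift _ a) by exact: val_inj.
have f2 a : f (rshift _ (lshift _ a)) = lshift _ (rshift _ a) by exact: val_inj.
have f3 a : f (rshift _ (rshift _ a)) = rshift _ a.
  by apply: val_inj; rewrite /= addnA.
move=> g i j /=.
case: (split_ordP i) => [a ->|i' ->];
  last case: (split_ordP i') => a ->; 
  (case: (split_ordP j) => [b ->|j' ->];
    last case: (split_ordP j') => b ->);
  rewrite ?(f1, f2, f3);
  by rewrite !(block_mxEul, block_mxEur, block_mxEdl, block_mxEdr) ?mxE.
Qed.

Lemma rep_tensorC V W : rep_iso (rep_tensor V W) (rep_tensor W V).
Proof.
pose sw m n (i : 'I_(m * n)) : 'I_(n * m) :=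
  mxtens_index ((mxtens_unindex i).2, (mxtens_unindex i).1).
have swE m n a b : @sw m n (mxtens_index (a, b)) = mxtens_index (b, a).
  by rewrite /sw mxtens_indexK.
apply: (@rep_iso_bij (rep_tensor V W) (rep_tensor W V) (@sw _ _)).
  by exists (@sw _ _) => i; case: (mxtens_indexP i) => a b; rewrite !swE.
move=> g i j /=.
case: (mxtens_indexP i) => a b; case: (mxtens_indexP j) => c d.
by rewrite !swE !tensmxE mulrC.
Qed.

Lemma rep_tensorA V W U :
  rep_iso (rep_tensor V (rep_tensor W U)) (rep_tensor (rep_tensor V W) U).
Proof.
pose f (i : 'I_(rdim V * (rdim W * rdim U))) :
    'I_(rdim V * rdim W * rdim U) :=
  let: (a, bc) := mxtens_unindex i in
  let: (b, c) := mxtens_unindex bc in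
  mxtens_index (mxtens_index (a, b), c).
pose f' (i : 'I_(rdim V * rdim W * rdim U)) :
    'I_(rdim V * (rdim W * rdim U)) :=
  let: (ab, c) := mxtens_unindex i in
  let: (a, b) := mxtens_unindex ab in
  mxtens_index (a, mxtens_index (b, c)).
have fE a b c : f (mxtens_index (a, mxtens_index (b, c))) =
                mxtens_index (mxtens_index (a, b), c).
  by rewrite /f !mxtens_indexK.
have f'E a b c : f' (mxtens_index (mxtens_index (a, b), c)) =
                 mxtens_index (a, mxtens_index (b, c)).
  by rewrite /f' !mxtens_indexK.
apply: (@rep_iso_bij (rep_tensor V (rep_tensor W U))
                     (rep_tensor (rep_tensor V W) U) f).
  exists f' => i.
    by case: (mxtens_indexP i) => a bc; case: (mxtens_indexP bc) => b c;
       rewrite fE f'E.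
  by case: (mxtens_indexP i) => ab c; case: (mxtens_indexP ab) => a b;
     rewrite f'E fE.
move=> g i j /=.
case: (mxtens_indexP i) => a bc; case: (mxtens_indexP bc) => b c.
case: (mxtens_indexP j) => a' bc'; case: (mxtens_indexP bc') => b' c'.
by rewrite !fE !tensmxE mulrA.
Qed.

Lemma rep_tensor1 V : rep_iso (rep_tensor rep1 V) V.
Proof.
apply/rep_iso_sym/(@rep_iso_bij _ (rep_tensor rep1 V)
  (fun i => mxtens_index (ord0 : 'I_1, i))).
  exists (fun i => (mxtens_unindex i).2) => i; first by rewrite mxtens_indexK.
  by case: (mxtens_indexP i) => a b; rewrite mxtens_indexK /= [a]ord1.
by move=> g i j /=; rewrite tensmxE mxE mul1r.
Qed.

Lemma rep_tensor0 V : rep_iso (rep_tensor rep0 V) rep0.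
Proof.
apply: (@rep_iso_bij (rep_tensor rep0 V) rep0
  (fun i : 'I_(0 * rdim V) => i : 'I_0)).
  by exists (fun i : 'I_0 => i : 'I_(0 * rdim V)).
by move=> g [].
Qed.

Lemma rep_tensorDl V W U :
  rep_iso (rep_tensor (rep_sum V W) U)
          (rep_sum (rep_tensor V U) (rep_tensor W U)).
Proof.
pose m := rdim V; pose n := rdim W; pose p := rdim U.
pose f (i : 'I_((m + n) * p)) : 'I_(m * p + n * p) :=
  let: (ab, c) := mxtens_unindex i in
  match fintype.split ab with
  | inl a => lshift _ (mxtens_index (a, c))
  | inr b => rshift _ (mxtens_index (b, c))
  end.
pose f' (i : 'I_(m * p + n * p)) : 'I_((m + n) * p) :=
  match fintype.split i with
  | inl ac => let: (a, c) := mxtens_unindex ac in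
              mxtens_index (lshift n a, c)
  | inr bc => let: (b, c) := mxtens_unindex bc in
              mxtens_index (rshift m b, c)
  end.
have fl a c : f (mxtens_index (lshift n a, c)) = lshift _ (mxtens_index (a, c)).
  by rewrite /f mxtens_indexK (unsplitK (inl _ a)).
have fr b c : f (mxtens_index (rshift m b, c)) = rshift _ (mxtens_index (b, c)).
  by rewrite /f mxtens_indexK (unsplitK (inr _ b)).
have f'l a c : f' (lshift _ (mxtens_index (a, c))) = mxtens_index (lshift n a, c).
  by rewrite /f' (unsplitK (inl _ (mxtens_index (a, c)))) mxtens_indexK.
have f'r b c : f' (rshift _ (mxtens_index (b, c))) = mxtens_index (rshift m b, c).
  by rewrite /f' (unsplitK (inr _ (mxtens_index (b, c)))) mxtens_indexK.
apply: (@rep_iso_bij (rep_tensor (rep_sum V W) U)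
  (rep_sum (rep_tensor V U) (rep_tensor W U)) f).
  exists f' => i.
    case: (mxtens_indexP i) => ab c.
    by case: (split_ordP ab) => a ->; rewrite ?(fl, fr) ?(f'l, f'r).
  by case: (split_ordP i) => ac ->; case: (mxtens_indexP ac) => a c;
     rewrite ?(f'l, f'r) ?(fl, fr).
move=> g i j /=.
case: (mxtens_indexP i) => ab c; case: (split_ordP ab) => a ->;
case: (mxtens_indexP j) => ab' c'; case: (split_ordP ab') => a' ->;
  rewrite ?(fl, fr) ?(block_mxEul, block_mxEur, block_mxEdl, block_mxEdr)
    !tensmxE ?(block_mxEul, block_mxEur, block_mxEdl, block_mxEdr) //;
  by rewrite !mxE mul0r.
Qed.

End Representations.

(* Isomorphism classes of representations, as a semiring under direct sum and *)
(* tensor product.                                                            *)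
Section RepClasses.
Context (k : fieldType) (K : closedFieldType) (iota : {rmorphism k -> K}).
Context (G : algebraic_group iota).

Definition rep_isob : rel {classic rep G} := fun V W => `[<rep_iso V W>].

Lemma rep_isob_refl : reflexive rep_isob.
Proof. by move=> V; apply/asboolP/rep_iso_refl. Qed.

Lemma rep_isob_sym : symmetric rep_isob.
Proof. by move=> V W; apply/asboolP/asboolP; exact: rep_iso_sym. Qed.

Lemma rep_isob_trans : transitive rep_isob.
Proof.
by move=> W V U /asboolP VW /asboolP WU; apply/asboolP/(rep_iso_trans VW).
Qed.

Canonical rep_isob_equiv :=
  EquivRel rep_isob rep_isob_refl rep_isob_sym rep_isob_trans.

Definition rep_class : Type := {eq_quot rep_isob}.
HB.instance Definition _ : EqQuotient _ rep_isob rep_class :=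
  EqQuotient.on rep_class.
HB.instance Definition _ := Choice.on rep_class.

Definition iso_class (V : rep G) : rep_class := \pi_rep_class (V : {classic _}).

Lemma iso_classP V W : iso_class V = iso_class W <-> rep_iso V W.
Proof.
split=> [/eqmodP/asboolP //|VW]; exact/eqmodP/asboolP.
Qed.

Lemma iso_class_repr (x : rep_class) : iso_class (repr x) = x.
Proof. exact: reprK. Qed.

Definition class_add (x y : rep_class) := iso_class (rep_sum (repr x) (repr y)).

Definition class_mul (x y : rep_class) :=
  iso_class (rep_tensor (repr x) (repr y)).

Lemma class_addE V W :
  class_add (iso_class V) (iso_class W) = iso_class (rep_sum V W).
Proof. by apply/iso_classP/rep_sum_iso; apply/iso_classP/iso_class_repr. Qed.

Lemma class_mulE V W :
  class_mul (iso_class V) (iso_class W) = iso_class (rep_tensor V W).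
Proof. by apply/iso_classP/rep_tensor_iso; apply/iso_classP/iso_class_repr. Qed.

Lemma class_addA : associative class_add.
Proof.
elim/quotW=> V; elim/quotW=> W; elim/quotW=> U.
by rewrite (class_addE W) (class_addE V) (class_addE V) class_addE;
   apply/iso_classP/rep_sumA.
Qed.

Lemma class_addC : commutative class_add.
Proof.
elim/quotW=> V; elim/quotW=> W.
by rewrite !class_addE; apply/iso_classP/rep_sumC.
Qed.

Lemma class_add0 : left_id (iso_class (rep0 G)) class_add.
Proof. by elim/quotW=> V; rewrite class_addE; apply/iso_classP/rep_sum0. Qed.

Lemma class_mulA : associative class_mul.
Proof.
elim/quotW=> V; elim/quotW=> W; elim/quotW=> U.
by rewrite (class_mulE W) (class_mulE V) (class_mulE V) class_mulE;
   apply/iso_classP/rep_tensorA.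
Qed.

Lemma class_mulC : commutative class_mul.
Proof.
elim/quotW=> V; elim/quotW=> W.
by rewrite !class_mulE; apply/iso_classP/rep_tensorC.
Qed.

Lemma class_mul1 : left_id (iso_class (rep1 G)) class_mul.
Proof. by elim/quotW=> V; rewrite class_mulE; apply/iso_classP/rep_tensor1. Qed.

Lemma class_mul0 : left_zero (iso_class (rep0 G)) class_mul.
Proof. by elim/quotW=> V; rewrite class_mulE; apply/iso_classP/rep_tensor0. Qed.

Lemma class_mulDl : left_distributive class_mul class_add.
Proof.
elim/quotW=> V; elim/quotW=> W; elim/quotW=> U.
by rewrite (class_addE V) (class_mulE V) (class_mulE W) class_mulE class_addE;
   apply/iso_classP/rep_tensorDl.
Qed.

HB.instance Definition _ :=
  GRing.isNmodule.Build rep_class class_addA class_addC class_add0.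

HB.instance Definition _ := GRing.Nmodule_isComPzSemiRing.Build rep_class
  class_mulA class_mulC class_mul1 class_mulDl class_mul0.

End RepClasses.

(* The ring completion of a commutative semiring: formal differences x.1 - x.2 *)
(* modulo x ~ y iff x.1 + y.2 + u = y.1 + x.2 + u for some u.                  *)
Section Grothendieck.
Context (S : comPzSemiRingType).
Implicit Types x y z : S * S.

Definition diff_eq : rel (S * S) :=
  fun x y => `[<exists u, x.1 + y.2 + u = y.1 + x.2 + u>].

Lemma diff_eq_refl : reflexive diff_eq.
Proof. by move=> x; apply/asboolP; exists 0. Qed.

Lemma diff_eq_sym : symmetric diff_eq.
Proof. by move=> x y; apply/asboolP/asboolP => -[u E]; exists u. Qed.

Lemma diff_eq_trans : transitive diff_eq.
Proof.
move=> y x z /asboolP[u E] /asboolP[v F]; apply/asboolP.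
exists (y.1 + y.2 + u + v).
have -> : x.1 + z.2 + (y.1 + y.2 + u + v) =
          (x.1 + y.2 + u) + (y.1 + z.2 + v) by ring.
by rewrite E F; ring.
Qed.

Canonical diff_eq_equiv :=
  EquivRel diff_eq diff_eq_refl diff_eq_sym diff_eq_trans.

Definition grothendieck : Type := {eq_quot diff_eq}.
HB.instance Definition _ : EqQuotient _ diff_eq grothendieck :=
  EqQuotient.on grothendieck.
HB.instance Definition _ := Choice.on grothendieck.

Definition diff x : grothendieck := \pi_grothendieck x.

Lemma diffP x y :
  diff x = diff y <-> exists u, x.1 + y.2 + u = y.1 + x.2 + u.
Proof. by split=> [/eqmodP/asboolP //|E]; exact/eqmodP/asboolP. Qed.

Lemma diff_repr (a : grothendieck) : diff (repr a) = a.
Proof. exact: reprK. Qed.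

Definition diff_add x y := (x.1 + y.1, x.2 + y.2).

Definition diff_mul x y := (x.1 * y.1 + x.2 * y.2, x.1 * y.2 + x.2 * y.1).

Definition grothendieck_add (a b : grothendieck) :=
  diff (diff_add (repr a) (repr b)).

Definition grothendieck_opp (a : grothendieck) :=
  diff ((repr a).2, (repr a).1).

Definition grothendieck_mul (a b : grothendieck) :=
  diff (diff_mul (repr a) (repr b)).

Lemma grothendieck_addE x y :
  grothendieck_add (diff x) (diff y) = diff (diff_add x y).
Proof.
have /diffP[u E] := diff_repr (diff x).
have /diffP[v F] := diff_repr (diff y).
apply/diffP; exists (u + v) => /=.
set x' := repr _ in E *; set y' := repr _ in F *.
have -> : x'.1 + y'.1 + (x.2 + y.2) + (u + v) =
          (x'.1 + x.2 + u) + (y'.1 + y.2 + v) by ring.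
by rewrite E F; ring.
Qed.

Lemma grothendieck_oppE x : grothendieck_opp (diff x) = diff (x.2, x.1).
Proof.
have /diffP[u E] := diff_repr (diff x).
apply/diffP; exists u => /=.
by rewrite [_ + x.1]addrC -E [x.2 + _]addrC.
Qed.

Lemma diff_mulC x y : diff_mul x y = diff_mul y x.
Proof. by rewrite /diff_mul; congr pair; ring. Qed.

Lemma diff_mul_congl x x' y :
  diff x' = diff x -> diff (diff_mul x' y) = diff (diff_mul x y).
Proof.
move=> /diffP[u E]; apply/diffP; exists (u * y.1 + u * y.2) => /=.
have -> : x'.1 * y.1 + x'.2 * y.2 + (x.1 * y.2 + x.2 * y.1) +
            (u * y.1 + u * y.2) =
          (x'.1 + x.2 + u) * y.1 + (x.1 + x'.2 + u) * y.2 by ring.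
have -> : x.1 * y.1 + x.2 * y.2 + (x'.1 * y.2 + x'.2 * y.1) +
            (u * y.1 + u * y.2) =
          (x.1 + x'.2 + u) * y.1 + (x'.1 + x.2 + u) * y.2 by ring.
by rewrite E.
Qed.

Lemma grothendieck_mulE x y :
  grothendieck_mul (diff x) (diff y) = diff (diff_mul x y).
Proof.
rewrite /grothendieck_mul (diff_mul_congl _ (diff_repr _)) diff_mulC.
by rewrite (diff_mul_congl _ (diff_repr _)) diff_mulC.
Qed.

Lemma grothendieck_addA : associative grothendieck_add.
Proof.
elim/quotW=> x; elim/quotW=> y; elim/quotW=> z.
rewrite (grothendieck_addE y) (grothendieck_addE x y) !grothendieck_addE.
by congr diff; rewrite /diff_add /= !addrA.
Qed.

Lemma grothendieck_addC : commutative grothendieck_add.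
Proof.
elim/quotW=> x; elim/quotW=> y; rewrite !grothendieck_addE.
by congr diff; rewrite /diff_add addrC [x.2 + _]addrC.
Qed.

Lemma grothendieck_add0 : left_id (diff (0, 0)) grothendieck_add.
Proof.
by elim/quotW=> -[a b]; rewrite grothendieck_addE /diff_add /= !add0r.
Qed.

Lemma grothendieck_addN :
  left_inverse (diff (0, 0)) grothendieck_opp grothendieck_add.
Proof.
elim/quotW=> x; rewrite grothendieck_oppE grothendieck_addE.
by apply/diffP; exists 0; rewrite /= !(addr0, add0r) addrC.
Qed.

Lemma grothendieck_mulA : associative grothendieck_mul.
Proof.
elim/quotW=> x; elim/quotW=> y; elim/quotW=> z.
rewrite (grothendieck_mulE y) (grothendieck_mulE x y) !grothendieck_mulE.
by congr diff; rewrite /diff_mul /=; congr pair; ring.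
Qed.

Lemma grothendieck_mulC : commutative grothendieck_mul.
Proof.
by elim/quotW=> x; elim/quotW=> y; rewrite !grothendieck_mulE diff_mulC.
Qed.

Lemma grothendieck_mul1 : left_id (diff (1, 0)) grothendieck_mul.
Proof.
elim/quotW=> -[a b]; rewrite grothendieck_mulE /diff_mul /=.
by rewrite !mul1r !mul0r !addr0.
Qed.

Lemma grothendieck_mulDl : left_distributive grothendieck_mul grothendieck_add.
Proof.
elim/quotW=> x; elim/quotW=> y; elim/quotW=> z.
rewrite (grothendieck_addE x) (grothendieck_mulE x) (grothendieck_mulE y).
rewrite grothendieck_mulE grothendieck_addE.
by congr diff; rewrite /diff_mul /diff_add /=; congr pair; ring.
Qed.

HB.instance Definition _ := GRing.isZmodule.Build grothendieck
  grothendieck_addA grothendieck_addC grothendieck_add0 grothendieck_addN.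

HB.instance Definition _ := GRing.Zmodule_isComPzRing.Build grothendieck
  grothendieck_mulA grothendieck_mulC grothendieck_mul1 grothendieck_mulDl.

End Grothendieck.

Section GrowthProblem.

Record growth_problem := GrowthProblem {
  gp_ring : pzRingType;
  gp_basis : set gp_ring;
  gp_elt : gp_ring }.

Section Coordinates.
Context (A : pzRingType) (C : set A).

Definition is_coord (x : A) (a : {fsfun A -> int with 0}) : Prop :=
  [set` finsupp a] `<=` C /\ x = \sum_(b <- finsupp a) b *~ a b.

Definition Zbasis : Prop := forall x, exists! a, is_coord x a.

(* The coordinates of x; meaningful as soon as C is a Z-basis. *)
Definition coord (x : A) : {fsfun A -> int with 0} :=
  xget [fsfun] [set a | is_coord x a].

(* Finite nonnegative integer combinations of C. *)
Definition nonneg_comb (x : A) : Prop :=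
  exists2 s : seq A, (forall b, b \in s -> C b) & x = \sum_(b <- s) b.

(* C is a Z-basis containing the unit, with nonnegative integers as structure *)
(* constants.                                                                 *)
Record based_ring : Prop := BasedRing {
  based_Zbasis : Zbasis;
  based1 : C 1;
  basedM : forall b c, C b -> C c -> nonneg_comb (b * c) }.

(* The sequence of the bases C_k of a good filtration; it determines the      *)
(* algebras R_k, whose product is truncated_mul below.                        *)
Record good_filtration (F : nat -> {fset A}) : Prop := GoodFiltration {
  filtration0 : F 0%N = [fset 1]%fset;
  filtrationS : forall k, (F k `<=` F k.+1)%fset;
  filtrationU : \bigcup_k [set` F k] = C }.

Definition truncate (D : {fset A}) (x : A) : A :=
  \sum_(b <- D) b *~ coord x b.

Definition truncated_mul (D : {fset A}) (x y : A) : A := truncate D (x * y).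

Context (R : realType).

Definition left_mul_mx (D : {fset A}) (c : A) : 'M[R]_(size D) :=
  \matrix_(i, j) (coord (truncated_mul D c D`_j) D`_i)%:~R.

(* The largest nonnegative real eigenvalue, which exists by Perron-Frobenius. *)
Definition PF_eigenvalue n (M : 'M[R]_n) : R :=
  sup [set a | 0 <= a /\ eigenvalue M a].

Definition PFdim_at (D : {fset A}) (c : A) : R :=
  PF_eigenvalue (left_mul_mx D c).

Definition PFdim (F : nat -> {fset A}) (c : A) : \bar R :=
  limn (fun k => (PFdim_at (F k) c)%:E).

Record PF_filtration (F : nat -> {fset A}) : Prop := PFFiltration {
  PFdimD : forall c d, nonneg_comb c -> nonneg_comb d ->
    (PFdim F c + PFdim F d <= PFdim F (c + d))%E;
  PFdimX : forall c n, nonneg_comb c ->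
    (PFdim F (c ^+ n) <= PFdim F c ^+ n)%E;
  PFdim_ge1 : forall b, C b -> (1 <= PFdim F b)%E }.

End Coordinates.

(* The first two clauses state that (A, C, c) is indeed a growth problem. *)
Definition PF_admissible (R : realType) (P : growth_problem) : Prop :=
  [/\ based_ring (@gp_basis P), nonneg_comb (@gp_basis P) (gp_elt P) &
      exists F, good_filtration (@gp_basis P) F /\
                PF_filtration (@gp_basis P) R F].

End GrowthProblem.

Section RepGrowthProblem.
Context (k : fieldType) (K : closedFieldType) (iota : {rmorphism k -> K}).
Context (G : algebraic_group iota).

(* The split Grothendieck ring of Rep(G). *)
Definition rep_ring : comPzRingType := grothendieck (rep_class G).

Definition rep_ring_class (V : rep G) : rep_ring := diff (iso_class V, 0).

Definition rep_growth_problem (X : rep G) : growth_problem :=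
  @GrowthProblem rep_ring
    [set rep_ring_class V | V in [set V | indecomposable V]]
    (rep_ring_class X).

End RepGrowthProblem.

(* Main.v *)
Require Import Defs.
From HB Require Import structures.
From mathcomp Require Import all_boot all_order all_algebra finmap.
From mathcomp Require Import fingroup perm generic_quotient mxtens ring.
From mathcomp Require Import all_classical all_reals.
From mathcomp Require Import topology ereal normedtype sequences derive exp.

Set Implicit Arguments.
Unset Strict Implicit.
Unset Printing Implicit Defensive.

Import Order.TTheory GRing.Theory Num.Theory numFieldNormedType.Exports.

Local Open Scope classical_set_scope.
Local Open Scope ring_scope.

(** Why the theorem holds.

    The growth part concerns any based ring [A] with basis [C] in which some positive
    power of each basis element is [1] plus a nonnegative combination
    ([PF_filtration_good]).  Say that [c] expands [x] by [a] when [x] is a nonzero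
    nonnegative combination with [a x <= c x] coordinatewise.  Rounding a large
    multiple of a Perron-Frobenius vector of a truncation shows that every number
    below [PFdim_at D c] is such an [a] ([PFdim_at_expands]); conversely an expanded
    element supported in [D] forces [a <= PFdim_at D c], because the resolvent of a
    nonnegative matrix is nonnegative above its real eigenvalues ([PFdim_at_ge]).  So
    [PFdim c] is the supremum of the factors by which [c] expands something, for any
    good filtration, and the three conditions become constructions of expanded
    elements: [x y] for a sum, [sum_i u^(n-1-i) v^i c^i x] for an [n]-th root, and
    [1 + b + ... + b^(m-1)] for a basis element [b] with [b^m = 1 + y].

    It remains to see that the classes of indecomposable representations form a basis
    of this kind.  The main point is complete reducibility over [K]
    ([fixed_vector_lifts]).  The tangent algebra of [G] is defined by left-invariant
    derivations of the ring of functions.  It determines the connected group [G] in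
    two ways: a function killed by all tangent derivations is constant
    ([tangent_null_constant], by Euler's formula and Krull's intersection theorem), and
    the exponential of a nilpotent tangent matrix lies in [G] ([exp_in_group]).
    Cartan's criterion and Engel's theorem turn an invariant subspace of the derived
    algebra that is null for a trace form into one acting nilpotently, hence trivially
    on simple subquotients; in the given matrices it is zero since [G] has no unipotent
    radical ([trace_null_trivial]).  This yields a Casimir element with nonzero trace
    on every nontrivial simple subquotient ([exists_casimir]), and Fitting's
    decomposition for it lifts fixed vectors; trivial subquotients are handled by
    perfectness.

    Perfectness is where simplicity enters: the closure of the commutator subgroup is
    connected and normal, and it is defined over [k] because it is stable under
    [Aut(K/k)] ([simple_perfect]).  The same descent principle, resting on the fact
    that the fixed field of [Aut(K/k)] is [k] ([fixed_field]), shows that homomorphisms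
    over [K] are spanned by homomorphisms over [k].  So every homomorphism over [k]
    is split ([rep_hom_split]), nonzero homomorphisms between indecomposables are
    isomorphisms, and the dimensions of the spaces [Hom(S, -)] are dual functionals
    to the indecomposable classes.

    Finally, every indecomposable representation is a summand of a tensor power of one
    representation whose entries generate the ring of functions; this gives a good
    filtration ([exists_good_filtration]).  As a perfect group acts with determinant
    one, the constant function [1] is a matrix coefficient of a tensor power of [V], so
    the unit is a summand of that power ([power_contains_unit]). *)

(** * Coordinates in a ring with basis *)

Section Coordinates.
Variables (A : pzRingType) (C : set A).
Implicit Types (x y : A) (a : {fsfun A -> int with 0}).

Lemma sum_superset a (r : {fset A}) : (finsupp a `<=` r)%fset ->
  \sum_(b <- finsupp a) b *~ a b = \sum_(b <- r) b *~ a b.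
Proof.
by move=> ar; apply: big_fset_incl => // b _ /fsfun_dflt ->; rewrite mulr0z.
Qed.

Lemma is_coord_fset (f : A -> int) (r : {fset A}) : [set` r] `<=` C ->
  is_coord C (\sum_(b <- r) b *~ f b) [fsfun b in r => f b].
Proof.
move=> rC; have sub : (finsupp [fsfun b in r => f b | 0] `<=` r)%fset.
  by apply/fsubsetP => b; rewrite mem_finsupp fsfun_fun; case: ifP => //; rewrite eqxx.
split; first by move=> b /= /(fsubsetP sub); exact: rC.
rewrite (sum_superset sub); apply: eq_big_seq => b br.
by rewrite fsfun_fun br.
Qed.

Lemma is_coordD x y a b : is_coord C x a -> is_coord C y b ->
  is_coord C (x + y) [fsfun c in (finsupp a `|` finsupp b)%fset => a c + b c].
Proof.
move=> [aC ->] [bC ->].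
rewrite (sum_superset (fsubsetUl _ (finsupp b))) (sum_superset (fsubsetUr (finsupp a) _)).
rewrite -big_split /=; under eq_bigr do rewrite -mulrzDr.
apply: is_coord_fset => c /=; rewrite inE => /orP[]; [exact: aC|exact: bC].
Qed.

(** The functional dual to [b] reads off the coefficient of [b] in any expansion, which
    gives uniqueness. *)
Lemma Zbasis_criterion :
  (forall b, C b -> exists2 psi : A -> int, {morph psi : x y / x + y} &
     psi b != 0 /\ forall c, C c -> c <> b -> psi c = 0) ->
  (forall x, exists y z, [/\ nonneg_comb C y, nonneg_comb C z & x = y - z]) ->
  Zbasis C.
Proof.
move=> dual gen x.
have exN y : nonneg_comb C y -> forall e : int, exists a, is_coord C (y *~ e) a.
  move=> [s sC ->] e; elim: s sC => [|b s IH] sC.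
    exists [fsfun]; split; first by move=> b; rewrite /= finsupp0 inE.
    by rewrite finsupp0 big_seq_fset0 big_nil mul0rz.
  have [|a aP] := IH; first by move=> c cs; apply: sC; rewrite inE cs orbT.
  have Cb : C b by apply: sC; rewrite mem_head.
  have := @is_coord_fset (fun=> e) [fset b]%fset _.
  rewrite big_seq_fset1 => /(_ _) bP; rewrite big_cons mulrzDl.
  by eexists; apply: is_coordD aP; apply: bP => c /=; rewrite inE => /eqP ->.
have [y [z [yn zn ->]]] := gen x.
have [a aP] := exN y yn 1; have [b bP] := exN z zn (-1).
rewrite mulr1z in aP; rewrite mulrN1z in bP.
eexists; split; first exact: is_coordD aP bP.
set a1 := [fsfun c in _ => _]; have : is_coord C (y - z) a1 by exact: is_coordD.
move: a1 (y - z) => a1 w [a1C wE] a2 [a2C wE'].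
apply/fsfunP => c; have [Cc|nC] := pselect (C c); last first.
  by rewrite !fsfun_dflt //; apply/negP; [move/a2C|move/a1C].
have [psi psiD [pc p0]] := dual c Cc.
have psi0 : psi 0 = 0 by have := psiD 0 0; rewrite addr0 -[X in X = _]addr0 => /addrI.
have psiN u : psi (- u) = - psi u.
  by apply/eqP; rewrite -addr_eq0 -psiD addNr psi0.
have psiZ u (e : int) : psi (u *~ e) = psi u * e.
  have psiM (m : nat) : psi (u *+ m) = psi u * m%:Z.
    elim: m => [|m IH]; first by rewrite mulr0n mulr0.
    by rewrite mulrS psiD IH intS mulrDr mulr1.
  by case: e => m; rewrite ?NegzE ?mulrNz ?psiN psiM // mulrN.
have psiE a' : [set` finsupp a'] `<=` C -> psi (\sum_(b <- finsupp a') b *~ a' b) = psi c * a' c.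
  move=> a'C.
  have -> : psi (\sum_(b <- finsupp a') b *~ a' b) = \sum_(b <- finsupp a') psi b * a' b.
    elim: (enum_fset _) => [|b' s IH]; first by rewrite !big_nil.
    by rewrite !big_cons psiD IH psiZ.
  have [ca|ca] := boolP (c \in finsupp a').
    rewrite (big_fsetD1 c) //= big1_fset ?addr0 // => b'.
    by rewrite !inE => /andP[/eqP bc b'a] _; rewrite p0 ?mul0r //; exact: a'C.
  rewrite fsfun_dflt // mulr0 big1_fset // => b' b'a _.
  by rewrite p0 ?mul0r //; [exact: a'C|move=> bc; move: ca; rewrite -bc b'a].
by apply: (mulfI pc); rewrite -!psiE // -wE -wE'.
Qed.

Hypothesis CZ : Zbasis C.
Notation coord := (Defs.coord C).

Lemma coord_is_coord x : is_coord C x (coord x).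
Proof. by have [a [aP _]] := CZ x; apply: (@xgetPex _ [fsfun] [set a | is_coord C x a]); exists a. Qed.

Lemma coord_unique x a : is_coord C x a -> coord x = a.
Proof.
by move=> xa; have [b [_ bu]] := CZ x; rewrite -(bu _ xa) -(bu _ (coord_is_coord x)).
Qed.

Lemma coordD x y b : coord (x + y) b = coord x b + coord y b.
Proof.
rewrite (coord_unique (is_coordD (coord_is_coord x) (coord_is_coord y))) fsfun_fun.
case: ifP => // /negbT; rewrite inE negb_or => /andP[bx by_].
by rewrite !fsfun_dflt ?addr0.
Qed.

Lemma coord0 b : coord 0 b = 0.
Proof. by have := coordD 0 0 b; rewrite addr0 -[X in X = _]addr0 => /addrI. Qed.

Lemma coordN x b : coord (- x) b = - coord x b.
Proof. by apply/eqP; rewrite -addr_eq0 -coordD addNr coord0. Qed.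

Lemma coordMn x m b : coord (x *+ m) b = coord x b *+ m.
Proof. by elim: m => [|m IH]; rewrite ?mulr0n ?coord0 // !mulrS coordD IH. Qed.

Lemma coordMz x (e : int) b : coord (x *~ e) b = coord x b * e.
Proof.
have pos (m : nat) : coord (x *+ m) b = coord x b * m%:Z.
  by rewrite coordMn -mulr_natr natz.
by case: e => m; rewrite ?NegzE ?mulrNz ?coordN pos // mulrN.
Qed.

Lemma coord_sum I (r : seq I) (f : I -> A) b :
  coord (\sum_(i <- r) f i) b = \sum_(i <- r) coord (f i) b.
Proof. by elim: r => [|i r IH]; rewrite ?big_nil ?coord0 // !big_cons coordD IH. Qed.

Lemma coord_basis b c : C b -> coord b c = (b == c).
Proof.
move=> Cb; have := @is_coord_fset (fun=> 1) [fset b]%fset _.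
rewrite big_seq_fset1 mulr1z => /(_ _)/coord_unique ->.
  by rewrite fsfun_fun inE eq_sym; case: eqP.
by move=> d /=; rewrite inE => /eqP ->.
Qed.

Lemma coord_expand x : x = \sum_(b <- finsupp (coord x)) b *~ coord x b.
Proof. by case: (coord_is_coord x). Qed.

Lemma coord_expand_fset x (D : {fset A}) : (forall b, coord x b != 0 -> b \in D) ->
  x = \sum_(b <- D) b *~ coord x b.
Proof.
move=> xD; rewrite {1}(coord_expand x); apply: sum_superset.
by apply/fsubsetP => b; rewrite mem_finsupp; exact: xD.
Qed.

Lemma coord_inj x y : (forall b, coord x b = coord y b) -> x = y.
Proof.
by move=> E; rewrite (coord_expand x) (coord_expand y) (_ : coord x = coord y) //; apply/fsfunP.
Qed.

Lemma nonneg_coord x : nonneg_comb C x <-> forall b, 0 <= coord x b.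
Proof.
split=> [[s sC ->] b|x0].
  rewrite coord_sum big_seq; apply: sumr_ge0 => c /sC Cc.
  by rewrite coord_basis //; case: eqP.
have pos b : coord x b = `|coord x b|%N by rewrite gez0_abs.
exists (flatten [seq nseq `|coord x b|%N b | b <- finsupp (coord x)]).
  move=> b /flattenP[_ /mapP[c cx ->]]; rewrite mem_nseq => /andP[_ /eqP ->].
  by case: (coord_is_coord x) => H _; exact: H.
rewrite big_flatten big_map {1}(coord_expand x); apply: eq_bigr => b _.
rewrite {1}pos -pmulrn; elim: `|_|%N => [|m IH]; first by rewrite big_nil.
by rewrite /= big_cons mulrS IH.
Qed.

Lemma coord_truncate (D : {fset A}) x b : [set` D] `<=` C ->
  coord (truncate C D x) b = if b \in D then coord x b else 0.
Proof.
move=> DC; rewrite /truncate (coord_unique (is_coord_fset (coord x) DC)).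
by rewrite fsfun_fun.
Qed.
End Coordinates.

(** * A Perron-Frobenius lower bound *)

Lemma poly_neg_nbhs (R : realType) (p : {poly R}) (s : R) : p.[s] < 0 ->
  exists2 e, 0 < e & forall t, `|s - t| < e -> p.[t] < 0.
Proof.
move=> p0.
have H : p.[t] @[t --> s] --> p.[s] by exact: continuous_horner.
have [e /= e0 eP] : nbhs s [set t | p.[t] < 0] by exact: (cvgr_lt _ H 0 p0).
by exists e => // t st; exact: eP.
Qed.

Section PerronFrobenius.
Variables (R : realType) (n : nat) (M : 'M[R]_n).
Hypothesis M0 : forall i j, 0 <= M i j.
Implicit Types (t a : R) (y : 'cV[R]_n).

Definition nonneg_col y := forall i, 0 <= y i 0.

(** The sum of all entries: a crude bound for the row sums of a nonnegative matrix,
    hence for its eigenvalues. *)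
Definition row_bound (A : 'M[R]_n) := \sum_i \sum_j A i j.

(** Diagonal dominance: at a least entry of [y], a negative value would make the
    corresponding entry of [(t - A) y] negative. *)
Lemma dominant_monotone (A : 'M[R]_n) t y : (forall i j, 0 <= A i j) -> row_bound A < t ->
  nonneg_col ((t%:M - A) *m y) -> nonneg_col y.
Proof.
move=> A0 At ty i0.
have [i _ imin] := arg_minP (fun i => y i 0) (erefl true : xpredT i0).
suff yi : 0 <= y i 0 by exact: le_trans yi (imin i0 isT).
rewrite leNgt; apply/negP => yi.
have := ty i; rewrite mulmxBl mul_scalar_mx !mxE leNgt => /negP; apply.
rewrite subr_lt0; apply: (@lt_le_trans _ _ ((\sum_j A i j) * y i 0)).
  rewrite ltr_nM2r //; apply: le_lt_trans At; rewrite /row_bound [X in _ <= X](bigD1 i) //= lerDl.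
  by apply: sumr_ge0 => l _; apply: sumr_ge0.
by rewrite mulr_suml; apply: ler_sum => j _; rewrite ler_wpM2l // imin.
Qed.

(** Monotonicity of the resolvent at [t], in a form that does not presuppose
    invertibility. *)
Definition monotone_at t := forall y, nonneg_col ((t%:M - M) *m y) -> nonneg_col y.

Lemma char_mx_at t : map_mx (horner_eval t) (char_poly_mx M) = t%:M - M.
Proof.
apply/matrixP => p q; rewrite !mxE /= /horner_eval hornerD hornerN hornerC.
by rewrite hornerMn hornerX.
Qed.

Lemma horner_char_poly t : (char_poly M).[t] = \det (t%:M - M).
Proof. by rewrite -char_mx_at (det_map_mx (horner_eval t)). Qed.

Lemma eigenvalue_unit t : ~~ eigenvalue M t -> (t%:M - M) \in unitmx.
Proof. by rewrite eigenvalue_root_char unitmxE unitfE /root horner_char_poly. Qed.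

(** The entries of [(t - M)^-1] times the positive factor [det(t - M)^2].  Being
    polynomial in [t], they vary continuously also across eigenvalues. *)
Definition resolvent_sign i j : {poly R} := \adj (char_poly_mx M) i j * char_poly M.

Lemma resolvent_signE i j t : (t%:M - M) \in unitmx ->
  (resolvent_sign i j).[t] = invmx (t%:M - M) i j * (\det (t%:M - M)) ^+ 2.
Proof.
move=> tu.
have aE : (\adj (char_poly_mx M) i j).[t] = \adj (t%:M - M) i j.
  by rewrite -char_mx_at -(map_mx_adj (horner_eval t)) [RHS]mxE.
rewrite /resolvent_sign hornerM horner_char_poly aE /invmx tu !mxE; move: tu; rewrite unitmxE unitfE => d0.
by field.
Qed.

Lemma resolvent_sign_ge0 i j t : (t%:M - M) \in unitmx ->
  (0 <= (resolvent_sign i j).[t]) = (0 <= invmx (t%:M - M) i j).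
Proof.
move=> tu; rewrite resolvent_signE // pmulr_lge0 // exprn_even_gt0 //=.
by rewrite -unitfE -unitmxE.
Qed.

Lemma monotone_resolvent t : (t%:M - M) \in unitmx ->
  monotone_at t <-> forall i j, 0 <= invmx (t%:M - M) i j.
Proof.
move=> tu; split=> [mt i j|rt y ty i].
  have := mt (col j (invmx (t%:M - M))) _ i; rewrite [X in 0 <= X]mxE; apply => l.
  by rewrite colE mulmxA mulmxV // mul1mx mxE ler0n.
rewrite -[y](mulKmx tu) mxE; apply: sumr_ge0 => j _; exact: mulr_ge0.
Qed.

(** As [t - M = (s - M) (1 - (s - t) (s - M)^-1)], the second factor is diagonally
    dominant for [t] close to [s]. *)
Lemma monotone_below s t : monotone_at s -> (s%:M - M) \in unitmx ->
  t <= s -> (s - t) * row_bound (invmx (s%:M - M)) < 1 -> monotone_at t.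
Proof.
move=> ms su ts small y ty; have Rs := proj1 (monotone_resolvent su) ms.
pose A := (s - t) *: invmx (s%:M - M).
have tE : t%:M - M = (s%:M - M) *m (1%:M - A).
  rewrite mulmxBr mulmx1 -scalemxAr mulmxV // scalemx1 raddfB /=.
  by rewrite opprB addrCA addrAC subrr add0r addrC.
apply: (@dominant_monotone A 1).
- by move=> i j; rewrite mxE mulr_ge0 // subr_ge0.
- rewrite /row_bound (eq_bigr (fun i => (s - t) * \sum_j invmx (s%:M - M) i j)) -?mulr_sumr //.
  by move=> i _; rewrite mulr_sumr; apply: eq_bigr => j _; rewrite mxE.
by apply: ms; rewrite mulmxA -tE.
Qed.

(** Monotonicity holds for large [t] by dominance.  At the supremum of the failures it
    could neither hold, since it would persist slightly below, nor fail, since a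
    negative entry of the resolvent would persist slightly above. *)
Lemma monotone_above_eigenvalues a : (forall t, a <= t -> ~~ eigenvalue M t) -> monotone_at a.
Proof.
move=> noev; have un t : a <= t -> (t%:M - M) \in unitmx by move=> at_; apply/eigenvalue_unit/noev.
have [//|bad] := pselect (monotone_at a).
pose b := Num.max a (row_bound M + 1).
pose B := [set t | [/\ a <= t, t <= b & ~ monotone_at t]].
have bB : monotone_at b.
  by move=> y; apply: dominant_monotone => //; rewrite /b lt_max ltrDl ltr01 orbT.
have ab : a <= b by rewrite le_max lexx.
have Ba : B a by [].
have Bub : has_ubound B by exists b => t [].
have Bsup : has_sup B by split=> //; exists a.
pose s := sup B.
have as_ : a <= s by exact: ub_le_sup.
have sb : s <= b by apply: ge_sup; [exists a|move=> t []].
have [ms|nms] := pselect (monotone_at s).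
  (* monotonicity persists slightly below [s] *)
  pose r := row_bound (invmx (s%:M - M)).
  have r0 : 0 <= r.
    apply: sumr_ge0 => i _; apply: sumr_ge0 => j _.
    exact: (proj1 (monotone_resolvent (un _ as_)) ms).
  have d0 : 0 < (r + 1)^-1 by rewrite invr_gt0 ltr_wpDl.
  have [t [curve_at tb nt] st] := sup_adherent d0 Bsup.
  have ts : t <= s by exact: ub_le_sup.
  case: nt; apply: (monotone_below ms) => //; first exact: un.
  have : (s - t) < (r + 1)^-1 by rewrite ltrBlDr addrC -ltrBlDr.
  rewrite -/r => H; apply: le_lt_trans (_ : (r + 1)^-1 * r < 1).
    by rewrite ler_wpM2r // ltW.
  by rewrite mulrC ltr_pdivrMr ?ltr_wpDl // mul1r ltrDl.
have us := un s as_.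
have [i [j ij]] : exists i j, (resolvent_sign i j).[s] < 0.
  apply: contrapT => H; apply: nms; apply/(monotone_resolvent us) => i j.
  by rewrite -resolvent_sign_ge0 // leNgt; apply/negP => ij; apply: H; exists i, j.
have sb' : s < b by rewrite lt_neqAle sb andbT; apply: contra_notN nms => /eqP ->.
(* a negative entry of the resolvent persists slightly above [s] *)
have [e e0 eP] := poly_neg_nbhs ij.
pose t := Num.min b (s + e / 2).
have st : s < t by rewrite lt_min sb' ltrDl divr_gt0.
have tb : t <= b by rewrite ge_min lexx.
have ut : (t%:M - M) \in unitmx by apply: un; exact: le_trans as_ (ltW st).
suff Bt : B t by have := ub_le_sup Bub Bt; rewrite -/s leNgt st.
split=> //; first exact: le_trans as_ (ltW st).
move=> /(monotone_resolvent ut)/(_ i j); rewrite -resolvent_sign_ge0 // leNgt => /negP; apply.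
apply: eP; rewrite distrC gtr0_norm ?subr_gt0 // ltrBlDr addrC.
rewrite gt_min ltrD2l; apply/orP; right.
by rewrite ltr_pdivrMr // mulr_natr mulr2n ltrDl.
Qed.

(** Otherwise the resolvent at [a] is nonnegative, and applied to [(a - M) x <= 0] it
    gives [x <= 0]. *)
Theorem eigenvalue_ge a x : nonneg_col x -> x != 0 ->
  (forall i, a * x i 0 <= (M *m x) i 0) -> exists2 t, a <= t & eigenvalue M t.
Proof.
move=> x0 xn0 ax; apply: contrapT => H.
have ma : monotone_at a.
  by apply: monotone_above_eigenvalues => t at_; apply/negP => et; apply: H; exists t.
move/eqP: xn0; apply; apply/colP => i; rewrite [RHS]mxE; apply/eqP; rewrite eq_le x0 andbT.
have := ma (- x) _ i; rewrite mxE oppr_ge0; apply => j.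
by rewrite mulmxN mxE oppr_ge0 mulmxBl mul_scalar_mx [X in X <= _]mxE [X in _ + X]mxE
  [X in X + _]mxE subr_le0.
Qed.

Lemma eigenvalue_trmx t : eigenvalue M^T t = eigenvalue M t.
Proof.
rewrite !eigenvalue_root_char; congr (root _ t); rewrite /char_poly -[RHS]det_tr.
by congr (\det _); rewrite /char_poly_mx linearB /= tr_scalar_mx map_trmx.
Qed.

Lemma eigenvalue_le_bound t : eigenvalue M t -> t <= row_bound M.
Proof.
move=> et; rewrite leNgt; apply/negP => lt.
have mt : monotone_at t by move=> y; exact: dominant_monotone.
move: et; rewrite -eigenvalue_trmx => /eigenvalueP[v vE v0]; move/eqP: v0; apply.
have E : (t%:M - M) *m v^T = 0.
  by rewrite mulmxBl mul_scalar_mx -[M in M *m _]trmxK -trmx_mul vE linearZ subrr.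
have p1 : nonneg_col v^T by apply: mt => i; rewrite E mxE.
have p2 : nonneg_col (- v^T) by apply: mt => i; rewrite mulmxN E oppr0 mxE.
apply/rowP => i; rewrite [RHS]mxE; apply/eqP; rewrite eq_le.
have := p1 i; have := p2 i; rewrite !mxE oppr_ge0 => -> ->.
by [].
Qed.

(** Round down a large multiple of the absolute value of an eigenvector; the gap between
    [a] and [t] absorbs the rounding errors. *)
Lemma integral_subeigenvector a t : 0 <= a -> a < t -> eigenvalue M t ->
  exists x : 'I_n -> nat, (exists i, x i != 0%N) /\
    forall i, a * (x i)%:R <= \sum_j M i j * (x j)%:R.
Proof.
move=> a0 at_; rewrite -eigenvalue_trmx => /eigenvalueP[v vE v0].
have t0 : 0 < t by exact: le_lt_trans at_.
pose u i := `|v 0 i|.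
have uM i : t * u i <= \sum_j M i j * u j.
  have /rowP/(_ i) := vE; rewrite !mxE => E.
  rewrite /u -(gtr0_norm t0) -normrM -E; apply: le_trans (ler_norm_sum _ _ _) _.
  apply: ler_sum => j _; rewrite mxE normrM mulrC ler_wpM2r //.
  by rewrite ger0_norm.
have [i0 ui0] : exists i, u i != 0.
  apply: contrapT => H; move/eqP: v0; apply; apply/rowP => i; rewrite [RHS]mxE.
  by apply/eqP; apply: contrapT => vi; apply: H; exists i; rewrite normr_eq0; exact/negP.
pose T := \sum_i (row_bound M / (t - a) + 1) / u i * (u i != 0)%:R.
have ta : 0 < t - a by rewrite subr_gt0.
have rb : 0 <= row_bound M by apply: sumr_ge0 => i _; apply: sumr_ge0.
have c0 : 0 < row_bound M / (t - a) + 1 by rewrite ltr_wpDl // divr_ge0 // ltW.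
have term0 i : 0 <= (row_bound M / (t - a) + 1) / u i * (u i != 0)%:R.
  by rewrite mulr_ge0 // divr_ge0 ?normr_ge0 // ltW.
have Tu i : u i != 0 -> row_bound M / (t - a) + 1 <= T * u i.
  move=> ui; have up : 0 < u i by rewrite lt_neqAle eq_sym ui normr_ge0.
  rewrite -ler_pdivrMr // /T (bigD1 i) //= ui mulr1 lerDl.
  by apply: sumr_ge0.
have T0 : 0 <= T by apply: sumr_ge0.
have tr i : 0 <= T * u i by rewrite mulr_ge0 ?normr_ge0.
pose x i := Num.trunc (T * u i).
have xle i : (x i)%:R <= T * u i by rewrite /x truncn_le.
have xgt i : T * u i - 1 <= (x i)%:R by rewrite lerBlDr -[1]/(1%:R) -natrD addn1 ltW // truncnS_gt.
exists x; split.
  exists i0; rewrite -lt0n -(ltr_nat R) -[0%:R]/0; apply: contraT; rewrite -leNgt => x0.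
  have := truncnS_gt (T * u i0); rewrite -/(x i0).
  have -> : x i0 = 0%N by apply/eqP; rewrite -leqn0 -(ler_nat R).
  rewrite ltNge => /negP; case; apply: le_trans (Tu _ ui0).
  by rewrite -[1]/(1%:R) lerDr divr_ge0 // ltW.
move=> i; have [ui|ui] := eqVneq (u i) 0.
  have -> : x i = 0%N by rewrite /x ui mulr0 truncn0.
  by rewrite mulr0; apply: sumr_ge0 => j _; rewrite mulr_ge0.
apply: le_trans (_ : a * (T * u i) <= _); first by rewrite ler_wpM2l.
apply: (@le_trans _ _ (\sum_j M i j * (T * u j - 1))); last first.
  by apply: ler_sum => j _; rewrite ler_wpM2l.
have -> : \sum_j M i j * (T * u j - 1) = T * (\sum_j M i j * u j) - \sum_j M i j.
  rewrite mulr_sumr -sumrB; apply: eq_bigr => j _.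
  by rewrite mulrBr mulr1 mulrCA.
have ri : \sum_j M i j <= row_bound M.
  rewrite /row_bound [X in _ <= X](bigD1 i) //= lerDl.
  by apply: sumr_ge0 => l _; apply: sumr_ge0.
have H1 : T * (t * u i) <= T * (\sum_j M i j * u j) by rewrite ler_wpM2l.
have H2 : row_bound M <= (t - a) * (T * u i).
  have := Tu i ui; rewrite -(ler_pM2l ta) mulrDr mulr1 mulrCA divff ?mulr1; last by rewrite gt_eqF.
  by apply: le_trans; rewrite lerDl ltW.
move: H1 H2 ri; move: (\sum_j _) (\sum_j _) (row_bound M) (u i) => s1 s2 r w H1 H2 ri.
have -> : a * (T * w) = T * (t * w) - (t - a) * (T * w) by ring.
by apply: lerB => //; exact: le_trans ri H2.
Qed.
End PerronFrobenius.

(** * Growth in a based ring *)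

Section Growth.
Variables (A : comPzRingType) (C : set A) (R : realType).
Hypothesis Cb : based_ring C.
Hypothesis Cpow : forall b, C b -> exists m, (0 < m)%N /\
  exists2 y, nonneg_comb C y & b ^+ m = 1 + y.
Let CZ := based_Zbasis Cb.
Notation coord := (Defs.coord C).
Notation nonneg := (nonneg_comb C).
Implicit Types (x y c d : A) (D : {fset A}).

Lemma nonneg0 : nonneg 0. Proof. by exists [::]; rewrite ?big_nil. Qed.

Lemma nonneg1 : nonneg 1.
Proof. by exists [:: 1]; rewrite ?big_seq1 // => b /[1!inE] /eqP ->; exact: based1 Cb. Qed.

Lemma nonnegD x y : nonneg x -> nonneg y -> nonneg (x + y).
Proof.
move=> /(nonneg_coord CZ) x0 /(nonneg_coord CZ) y0; apply/(nonneg_coord CZ) => b.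
by rewrite coordD // addr_ge0.
Qed.

Lemma nonnegM x y : nonneg x -> nonneg y -> nonneg (x * y).
Proof.
move=> [s sC ->] [t tC ->]; rewrite big_distrlr /=.
elim: s sC => [|b s IH] sC; first by rewrite big_nil; exact: nonneg0.
rewrite big_cons; apply: nonnegD; last by apply: IH => c cs; apply: sC; rewrite inE cs orbT.
have Cb' : C b by apply: sC; rewrite mem_head.
elim: t tC {IH} => [|c t IHt] tC; first by rewrite big_nil; exact: nonneg0.
rewrite big_cons; apply: nonnegD; last by apply: IHt => d dt; apply: tC; rewrite inE dt orbT.
by apply: (basedM Cb) => //; apply: tC; rewrite mem_head.
Qed.

Lemma nonnegX x n : nonneg x -> nonneg (x ^+ n).
Proof.
by move=> x0; elim: n => [|n IH]; [exact: nonneg1|rewrite exprS; exact: nonnegM].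
Qed.

Lemma nonneg_sum I (r : seq I) (f : I -> A) : (forall i, nonneg (f i)) -> nonneg (\sum_(i <- r) f i).
Proof.
move=> f0; elim: r => [|i r IH]; first by rewrite big_nil; exact: nonneg0.
by rewrite big_cons; apply: nonnegD.
Qed.

Lemma nonnegMn x n : nonneg x -> nonneg (x *+ n).
Proof. by move=> x0; rewrite -[n]card_ord -sumr_const; exact: nonneg_sum. Qed.

Lemma nonneg_split x : nonneg x -> x != 0 -> exists b y, [/\ C b, nonneg y & x = b + y].
Proof.
move=> [[|b s] sC ->]; first by rewrite big_nil eqxx.
move=> _; exists b, (\sum_(c <- s) c); split; first by apply: sC; rewrite mem_head.
  by exists s => // c cs; apply: sC; rewrite inE cs orbT.
by rewrite big_cons.
Qed.

Lemma one_plus_neq0 x : nonneg x -> 1 + x != 0.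
Proof.
move=> /(nonneg_coord CZ) x0; apply/eqP => /(congr1 (coord^~ 1)).
rewrite coordD // coord0 // coord_basis ?eqxx //; last exact: based1 Cb.
by move=> E; have := x0 1; rewrite -(lerD2l 1) E addr0.
Qed.

(** By distributivity it suffices that [b c != 0] for basis elements, and [b^m c^n] has
    a positive coordinate at the unit. *)
Lemma nonneg_mul_neq0 x y : nonneg x -> nonneg y -> x != 0 -> y != 0 -> x * y != 0.
Proof.
move=> xn yn /(nonneg_split xn)[b [x' [Cb' x'0 ->]]] /(nonneg_split yn)[c [y' [Cc y'0 ->]]].
have bn : nonneg b by exists [:: b]; rewrite ?big_seq1 // => ? /[1!inE] /eqP ->.
have cn : nonneg c by exists [:: c]; rewrite ?big_seq1 // => ? /[1!inE] /eqP ->.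
have [m [m0 [u u0 bm]]] := Cpow Cb'; have [n [n0 [v v0 cm]]] := Cpow Cc.
have bc : b * c != 0.
  apply/eqP => bc0; have := one_plus_neq0 (x := u + v + u * v).
  have -> : 1 + (u + v + u * v) = b ^+ m * c ^+ n by rewrite bm cm; ring.
  rewrite -(prednK m0) -(prednK n0) !exprS mulrACA bc0 mul0r eqxx => H.
  by have := H (nonnegD (nonnegD u0 v0) (nonnegM u0 v0)).
have [e [z [Ce z0 bcE]]] := nonneg_split (nonnegM bn cn) bc.
have wn : nonneg (z + (b * y' + x' * (c + y'))).
  by do ![apply: nonnegD|apply: nonnegM|by []].
apply/eqP => E; have : e + (z + (b * y' + x' * (c + y'))) = 0 by rewrite -[RHS]E addrA -bcE; ring.
move=> /(congr1 (coord^~ e)); rewrite coordD // coord_basis // eqxx coord0 //= => E'.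
by have := proj1 (nonneg_coord CZ _) wn e; rewrite -(lerD2l 1) E' addr0.
Qed.

Definition expands (a : R) c x :=
  forall b, a * (coord x b)%:~R <= (coord (c * x) b)%:~R.

Lemma coordM x y b : (coord (x * y) b)%:~R =
  \sum_(e <- finsupp (coord x)) (coord x e)%:~R * (coord (e * y) b)%:~R :> R.
Proof.
rewrite {1}(coord_expand CZ x) mulr_suml coord_sum // rmorph_sum; apply: eq_bigr => e _.
by rewrite mulrzAl coordMz //= rmorphM mulrC.
Qed.

(** Multiplying by a nonnegative element preserves coordinatewise inequalities, so [x y]
    is expanded by both [c] and [d]. *)
Lemma expandsD a a' c d x y : nonneg x -> nonneg y -> expands a c x -> expands a' d y ->
  expands (a + a') (c + d) (x * y).
Proof.
have mul e f u v : nonneg v -> expands e f u -> expands e f (u * v).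
  move=> v0 fu b; rewrite mulrA.
  pose r := (finsupp (coord u) `|` finsupp (coord (f * u)))%fset.
  have cM w : (finsupp (coord w) `<=` r)%fset -> (coord (w * v) b)%:~R =
    \sum_(e <- r) (coord w e)%:~R * (coord (e * v) b)%:~R :> R.
    move=> wr; rewrite coordM; apply: big_fset_incl => // z _ /fsfun_dflt ->.
    by rewrite mul0r.
  rewrite !cM ?fsubsetUl ?fsubsetUr // mulr_sumr big_seq [X in _ <= X]big_seq.
  apply: ler_sum => z zr; rewrite mulrA; apply: ler_wpM2r; last exact: fu.
  rewrite ler0z; apply: (proj1 (nonneg_coord CZ _)).
  have Cz : C z by move: zr; rewrite inE => /orP[]; [case: (coord_is_coord CZ u) => H _|case: (coord_is_coord CZ (f * u)) => H _]; exact: H.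
  by apply: nonnegM => //; exists [:: z]; rewrite ?big_seq1 // => ? /[1!inE] /eqP ->.
move=> x0 y0 cx dy b; rewrite mulrDl mulrDl coordD // rmorphD /=.
by apply: lerD; [exact: mul|rewrite [x * y]mulrC; exact: mul].
Qed.

Section Truncation.
Variable D : {fset A}.
Hypothesis DC : [set` D] `<=` C.
Variable c : A.
Hypothesis c0 : nonneg c.
Notation M := (left_mul_mx C R D c).

Let Dnth (i : 'I_(size D)) : D`_i \in D. Proof. exact: mem_nth. Qed.

Let basis_nonneg b : C b -> nonneg b.
Proof. by move=> Cb'; exists [:: b]; rewrite ?big_seq1 // => ? /[1!inE] /eqP ->. Qed.

Lemma left_mul_mxE (i j : 'I_(size D)) : M i j = (coord (c * D`_j) D`_i)%:~R.
Proof. by rewrite mxE /truncated_mul (coord_truncate CZ) // Dnth. Qed.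

Lemma left_mul_mx_ge0 i j : 0 <= M i j.
Proof.
rewrite left_mul_mxE ler0z; apply: (proj1 (nonneg_coord CZ _)).
by apply: nonnegM => //; apply/basis_nonneg/DC/Dnth.
Qed.

Lemma left_mul_coord x (i : 'I_(size D)) : (forall b, coord x b != 0 -> b \in D) ->
  (coord (c * x) D`_i)%:~R = \sum_j M i j * (coord x D`_j)%:~R.
Proof.
move=> xD; rewrite {1}(coord_expand_fset CZ xD) mulr_sumr coord_sum // rmorph_sum.
rewrite (big_nth 0) big_mkord; apply: eq_bigr => j _.
by rewrite left_mul_mxE mulrzAr coordMz //= rmorphM.
Qed.

(** The coordinates of [x] form a vector with [M x >= a x] for the truncated
    multiplication matrix [M]. *)
Lemma PFdim_at_ge a x : 0 <= a -> nonneg x -> x != 0 ->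
  (forall b, coord x b != 0 -> b \in D) -> expands a c x -> a <= PFdim_at C R D c.
Proof.
move=> a0 xn x0 xD ax.
pose v : 'cV[R]_(size D) := \col_j (coord x D`_j)%:~R.
have [|||t at_ et] := @eigenvalue_ge _ _ M left_mul_mx_ge0 a v.
- by move=> i; rewrite mxE ler0z; exact: (proj1 (nonneg_coord CZ _)).
- apply: contraNneq x0 => v0; apply/eqP; apply: (coord_inj CZ) => b; rewrite coord0 //.
  have [//|xb] := eqVneq (coord x b) 0; have bD := xD b xb.
  have bs : (index b D < size D)%N by rewrite index_mem.
  have /colP/(_ (Ordinal bs)) := v0; rewrite !mxE /= nth_index // => /eqP.
  by rewrite intr_eq0 => /eqP.
- move=> i; rewrite mxE [X in _ <= X](_ : _ = (coord (c * x) D`_i)%:~R) ?ax //.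
  by rewrite mxE left_mul_coord //; apply: eq_bigr => j _; rewrite [v _ _]mxE.
have t0 := le_trans a0 at_; apply: le_trans at_ _; apply: ub_le_sup; last by split.
exists (row_bound M) => u [_]; apply: eigenvalue_le_bound; exact: left_mul_mx_ge0.
Qed.

(** The truncated matrix has integral approximate eigenvectors; coordinates of [c x]
    outside [D] are nonnegative while those of [x] vanish. *)
Lemma PFdim_at_expands a : 0 <= a -> a < PFdim_at C R D c ->
  exists x, [/\ nonneg x, x != 0, forall b, coord x b != 0 -> b \in D & expands a c x].
Proof.
move=> a0 aP.
have [t [t0 et] at_] : exists2 t, [set a | 0 <= a /\ eigenvalue M a] t & a < t.
  apply: sup_gt => //; apply: contrapT => H; move: aP; rewrite /PFdim_at /PF_eigenvalue.
  by rewrite sup_out ?ltNge ?a0 // => -[].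
have [u [[i ui] uM]] := integral_subeigenvector left_mul_mx_ge0 a0 at_ et.
pose f b : int := if (index b D < size D)%N =P true is ReflectT lt then u (Ordinal lt) else 0.
have fE (j : 'I_(size D)) : f D`_j = u j.
  rewrite /f; have ij : index D`_j D = j by rewrite index_uniq // fset_uniq.
  case: eqP => [p|]; last by rewrite ij ltn_ord.
  by congr (u _)%:Z; apply: val_inj.
pose x := \sum_(b <- D) b *~ f b.
have xE b : coord x b = if b \in D then f b else 0.
  by rewrite (coord_unique CZ (is_coord_fset f DC)) fsfun_fun.
have xD b : coord x b != 0 -> b \in D by rewrite xE; case: ifP; rewrite ?eqxx.
have xn : nonneg x.
  by apply/(nonneg_coord CZ) => b; rewrite xE; case: ifP => // _; rewrite /f; case: eqP.
exists x; split=> //.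
  apply/eqP => /(congr1 (coord^~ D`_i)); rewrite /= coord0 // xE Dnth fE => /eqP.
  by rewrite eqz_nat (negPf ui).
move=> b; have [bD|bD] := boolP (b \in D).
  have bs : (index b D < size D)%N by rewrite index_mem.
  rewrite -(nth_index 0 bD) -[index b D]/(val (Ordinal bs)) left_mul_coord // xE Dnth fE.
  apply: le_trans (uM _) _; apply: ler_sum => j _; by rewrite xE Dnth fE.
rewrite xE (negPf bD) mulr0 ler0z; apply: (proj1 (nonneg_coord CZ _)).
exact: nonnegM.
Qed.

Lemma PFdim_at_ge0 : 0 <= PFdim_at C R D c.
Proof.
rewrite /PFdim_at /PF_eigenvalue; set S := [set a | _].
have [[[a Sa] Sub]|nS] := pselect (has_sup S); last by rewrite sup_out.
by apply: le_trans (proj1 Sa) _; exact: ub_le_sup.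
Qed.
End Truncation.

Variable F : nat -> {fset A}.
Hypothesis Fg : good_filtration C F.

Let FC k : [set` F k] `<=` C.
Proof. by move=> b bF; rewrite -(filtrationU Fg); exists k. Qed.

Let Fmono k l : (k <= l)%N -> (F k `<=` F l)%fset.
Proof.
move=> /subnKC <-; elim: (l - k)%N => [|d IH]; first by rewrite addn0.
by rewrite addnS; apply: fsubset_trans IH (filtrationS Fg _).
Qed.

(** An element supported in [F k] is supported in [F k.+1]. *)
Lemma PFdim_at_mono c k : nonneg c -> PFdim_at C R (F k) c <= PFdim_at C R (F k.+1) c.
Proof.
move=> c0; rewrite leNgt; apply/negP => lt.
set p := PFdim_at C R (F k.+1) c in lt; set q := PFdim_at C R (F k) c in lt.
have p0 : 0 <= p by exact: PFdim_at_ge0.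
have a0 : 0 <= (p + q) / 2 by rewrite divr_ge0 // addr_ge0 // ltW // (le_lt_trans p0).
have aq : (p + q) / 2 < q by rewrite ltr_pdivrMr // mulr_natr mulr2n ltrD2r.
have [x [xn x0 xD cx]] := PFdim_at_expands (@FC k) c0 a0 aq.
have : (p + q) / 2 <= p.
  apply: (PFdim_at_ge (@FC k.+1) c0 a0 xn x0) => // b /xD; exact: (fsubsetP (filtrationS Fg k)).
by rewrite leNgt ltr_pdivlMr // mulr_natr mulr2n ltrD2l lt.
Qed.

Lemma PFdim_sup c : nonneg c ->
  PFdim C R F c = ereal_sup (range (fun k => (PFdim_at C R (F k) c)%:E)).
Proof.
move=> c0; apply/cvg_lim => //; apply: ereal_nondecreasing_cvgn.
apply/nondecreasing_seqP => k; rewrite lee_fin; exact: PFdim_at_mono.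
Qed.

Lemma PFdim_ge a c x : nonneg c -> 0 <= a -> nonneg x -> x != 0 -> expands a c x ->
  (a%:E <= PFdim C R F c)%E.
Proof.
move=> c0 a0 xn x0 cx; rewrite PFdim_sup //.
have [k xF] : exists k, forall b, coord x b != 0 -> b \in F k.
  suff [k kP] : exists k, forall b, b \in (finsupp (coord x) : seq A) -> b \in F k.
    by exists k => b; rewrite -mem_finsupp; exact: kP.
  have : forall b, b \in (finsupp (coord x) : seq A) -> C b.
    by case: (coord_is_coord CZ x).
  elim: (enum_fset _) => [|b s IH] sC; first by exists 0%N.
  have [|k kP] := IH; first by move=> d ds; apply: sC; rewrite inE ds orbT.
  have : C b by apply: sC; rewrite mem_head.
  rewrite -(filtrationU Fg) => -[l _ bl]; exists (maxn k l) => d; rewrite inE => /orP[/eqP ->|/kP].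
    by apply: (fsubsetP (Fmono (leq_maxr k l))).
  by apply: (fsubsetP (Fmono (leq_maxl k l))).
apply: le_trans (_ : (PFdim_at C R (F k) c)%:E <= _)%E; last by apply: ereal_sup_ubound; exists k.
by rewrite lee_fin; exact: (PFdim_at_ge (@FC k) c0 a0 xn x0 xF cx).
Qed.

Lemma one_neq0 : 1 != 0 :> A.
Proof. by have := one_plus_neq0 nonneg0; rewrite addr0. Qed.

Lemma expands0 c : nonneg c -> expands 0 c 1.
Proof.
by move=> c0 b; rewrite mul0r ler0z mulr1; exact: (proj1 (nonneg_coord CZ _)).
Qed.

(** The case [a = 0], witnessed by the unit, covers vanishing [PFdim]. *)
Lemma PFdim_expands a c : nonneg c -> 0 <= a -> (a = 0 \/ (a%:E < PFdim C R F c)%E) ->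
  exists x, [/\ nonneg x, x != 0 & expands a c x].
Proof.
move=> c0 a0 [->|].
  by exists 1; split; [exact: nonneg1|exact: one_neq0|exact: expands0].
rewrite PFdim_sup // => /ereal_sup_gt[_ [k _ <-]]; rewrite lte_fin => ak.
by have [x [xn x0 _ cx]] := PFdim_at_expands (@FC k) c0 a0 ak; exists x.
Qed.

Lemma PFdim_ge0 c : nonneg c -> (0 <= PFdim C R F c)%E.
Proof.
by move=> c0; apply: (PFdim_ge c0 (lexx 0) nonneg1 one_neq0); exact: expands0.
Qed.

Lemma PFdim_superadditive c d : nonneg c -> nonneg d ->
  (PFdim C R F c + PFdim C R F d <= PFdim C R F (c + d))%E.
Proof.
move=> c0 d0; have cd0 := nonnegD c0 d0.
have key a a' : 0 <= a -> 0 <= a' -> (a = 0 \/ (a%:E < PFdim C R F c)%E) ->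
    (a' = 0 \/ (a'%:E < PFdim C R F d)%E) -> ((a + a')%:E <= PFdim C R F (c + d))%E.
  move=> a0 a'0 ac a'd.
  have [x [xn x0 cx]] := PFdim_expands c0 a0 ac.
  have [y [yn y0 dy]] := PFdim_expands d0 a'0 a'd.
  apply: (@PFdim_ge _ _ (x * y)) => //; first exact: addr_ge0.
  - exact: nonnegM.
  - exact: nonneg_mul_neq0.
  - exact: expandsD.
have := PFdim_ge0 c0; have := PFdim_ge0 d0; have := PFdim_ge0 cd0; move: key.
move: (PFdim C R F c) (PFdim C R F d) (PFdim C R F (c + d)) => X Y [z| |] key z0 Y0 X0;
  [|by rewrite leey|by []].
have bnd (W : \bar R) : (0 <= W)%E -> (forall a, 0 <= a -> (a%:E < W)%E -> a <= z) -> W \is a fin_num.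
  case: W => [w| |] //= _ H; have z1 : 0 <= z + 1 by rewrite addr_ge0.
  by have := H _ z1 (ltry _); rewrite gerDl ler10.
have Xfin : X \is a fin_num.
  apply: bnd => // a a0 aX; have := key a 0 a0 (lexx 0) (or_intror aX) (or_introl erefl).
  by rewrite addr0 lee_fin.
have Yfin : Y \is a fin_num.
  apply: bnd => // a a0 aY; have := key 0 a (lexx 0) a0 (or_introl erefl) (or_intror aY).
  by rewrite add0r lee_fin.
move: Xfin Yfin key X0 Y0 z0; case: X => // x _; case: Y => // y _; rewrite !lee_fin => key x0 y0 z0.
(* each summand may be lowered by a third of the excess *)
rewrite leNgt; apply/negP => zxy; pose e := (x + y - z) / 3.
have e0 : 0 < e by rewrite divr_gt0 // subr_gt0.
have near w : 0 <= w -> Num.max 0 (w - e) = 0 \/ ((Num.max 0 (w - e))%:E < w%:E)%E.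
  move=> w0; rewrite lte_fin gt_max [w - e < w]gtrDl oppr_lt0 e0 andbT.
  by move: w0; rewrite le_eqVlt => /orP[/eqP <-|->]; [left; rewrite sub0r max_l // oppr_le0 ltW|right].
have := key _ _ _ _ (near x x0) (near y y0); rewrite !le_max !lexx => /(_ isT isT).
rewrite lee_fin leNgt => /negP; apply.
apply: lt_le_trans (_ : (x - e) + (y - e) <= _); last by apply: lerD; rewrite le_max lexx orbT.
have -> : z = (x - e) + (y - e) - e by rewrite /e; field.
by rewrite ltrBlDr ltrDl.
Qed.

(** Take [y = sum_i u^(n-1-i) v^i c^i x]: then [v c y - u y = v^n c^n x - u^n x]
    telescopes. *)
Lemma expands_root c n x (u v : nat) a : nonneg c -> nonneg x -> x != 0 -> (0 < v)%N ->
  (u%:R / v%:R) ^+ n.+1 <= a -> 0 <= a -> expands a (c ^+ n.+1) x ->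
  exists y, [/\ nonneg y, y != 0 & expands (u%:R / v%:R) c y].
Proof.
move=> c0 xn x0 v0 ua a0 ax.
have [u0|u0] := posnP u.
  by exists 1; rewrite u0 mul0r; split; [exact: nonneg1|exact: one_neq0|exact: expands0].
pose U : A := u%:R; pose V : A := v%:R.
have Un : nonneg U by apply: nonnegMn; exact: nonneg1.
have Vn : nonneg V by apply: nonnegMn; exact: nonneg1.
pose y := (\sum_(i < n.+1) U ^+ (n.+1.-1 - i) * (V * c) ^+ i) * x.
have yn : nonneg y.
  apply: nonnegM => //; apply: nonneg_sum => i; apply: nonnegM; apply: nonnegX => //.
  exact: nonnegM.
have tele : V * c * y - U * y = V ^+ n.+1 * (c ^+ n.+1 * x) - U ^+ n.+1 * x.
  have T := subrXX U (V * c) n.+1; rewrite /y.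
  move: (\sum_(i < _) _) T => S T.
  transitivity (- ((U - V * c) * S) * x); first by ring.
  by rewrite -T exprMn; ring.
have vR : (0 : R) < v%:R by rewrite ltr0n.
have H : nonneg (V ^+ n.+1 * (c ^+ n.+1 * x) - U ^+ n.+1 * x).
  apply/(nonneg_coord CZ) => b.
  rewrite /U /V -!natrX !mulr_natl coordD // coordN // !coordMn // -(ler0z R) rmorphB /= subr_ge0.
  rewrite !rmorphMn /= -[X in X <= _]mulr_natl -[X in _ <= X]mulr_natl !natrX.
  apply: (@le_trans _ _ (v%:R ^+ n.+1 * (a * (coord x b)%:~R))); last first.
    by rewrite ler_wpM2l ?ax // exprn_ge0 // ler0n.
  rewrite mulrA; apply: ler_wpM2r; first by rewrite ler0z; exact: (proj1 (nonneg_coord CZ _)).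
  by move: ua; rewrite expr_div_n ler_pdivrMr ?exprn_gt0 // mulrC.
exists y; split=> //.
  have yE : y = U ^+ n * x + (\sum_(i < n) U ^+ (n - (lift ord0 i)) * (V * c) ^+ (lift ord0 i)) * x.
    by rewrite /y big_ord_recl /= mulrDl expr0 mulr1 subn0.
  have Ux : nonneg (U ^+ n * x) by apply: nonnegM => //; exact: nonnegX.
  have Ux0 : U ^+ n * x != 0.
    rewrite /U -natrX mulr_natl; apply/eqP => E; move/eqP: x0; apply.
    apply: (coord_inj CZ) => b; rewrite coord0 //; have := congr1 (coord^~ b) E.
    rewrite /= coordMn // coord0 // => /eqP; rewrite mulrn_eq0 expn_eq0 => /orP[|/eqP //].
    by rewrite (gtn_eqF u0).
  have [b [w [Cb' w0 E]]] := nonneg_split Ux Ux0.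
  have rest : nonneg ((\sum_(i < n) U ^+ (n - (lift ord0 i)) * (V * c) ^+ (lift ord0 i)) * x).
    apply: nonnegM => //; apply: nonneg_sum => i; apply: nonnegM; apply: nonnegX => //.
    exact: nonnegM.
  apply/eqP => y0; have := yE; rewrite y0 E => /esym/(congr1 (coord^~ b)).
  rewrite /= !coordD // coord0 // coord_basis // eqxx => E'.
  have := proj1 (nonneg_coord CZ _) w0 b; have := proj1 (nonneg_coord CZ _) rest b.
  move=> p q; have := addr_ge0 q p; rewrite -(lerD2l 1) addr0 addrA E'.
  by [].
move=> b; have Hb : u%:R * (coord y b)%:~R <= v%:R * (coord (c * y) b)%:~R :> R.
  have := proj1 (nonneg_coord CZ _) H b; rewrite -tele.
  rewrite /U /V -mulrA !mulr_natl coordD // coordN // !coordMn // -(ler0z R) rmorphB /= subr_ge0.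
  by rewrite !rmorphMn.
by rewrite mulrAC ler_pdivrMr // [X in _ <= X]mulrC.
Qed.

(** If [PFdim c ^ n < a < PFdim (c ^ n)], a fraction between [PFdim c] and the [n]-th
    root of [a] is a factor by which [c] expands something. *)
Lemma PFdim_submultiplicative c n : nonneg c ->
  (PFdim C R F (c ^+ n) <= PFdim C R F c ^+ n)%E.
Proof.
move=> c0; case: n => [|n].
  rewrite expr0 expe0 PFdim_sup; last exact: nonneg1.
  apply: ge_ereal_sup => _ [k _ <-]; rewrite lee_fin /PFdim_at /PF_eigenvalue.
  have M1 : left_mul_mx C R (F k) 1 = 1%:M.
    apply/matrixP => i j; rewrite left_mul_mxE // mul1r mxE (coord_basis CZ); last exact/FC/mem_nth.
    by rewrite nth_uniq ?fset_uniq // eq_sym -val_eqE /=; case: (_ == _).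
  have [[hs _]|nS] := pselect (has_sup [set a | 0 <= a /\ eigenvalue (left_mul_mx C R (F k) 1) a]).
    apply: ge_sup => // a [_]; rewrite M1 => /eigenvalueP[v]; rewrite mulmx1 => vE v0.
    suff -> : a = 1 by [].
    by apply/eqP; rewrite -subr_eq0; move: vE => /eqP; rewrite eq_sym -subr_eq0 -{2}[v]scale1r -scalerBl scaler_eq0 (negPf v0) orbF.
  by rewrite sup_out.
have cn := nonnegX n.+1 c0.
have := PFdim_ge0 c0; case E : (PFdim C R F c) => [p| |] //; last first.
  move=> _; have -> : (+oo ^+ n.+1 = +oo :> \bar R)%E; last by rewrite leey.
  by elim: (n) => [|l IH]; rewrite expeS ?IH ?expe0 ?mule1 ?mulyy.
rewrite lee_fin => p0; rewrite -EFin_expe leNgt; apply/negP => lt.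
have [a pa aP] : exists2 a, p ^+ n.+1 < a & (a%:E < PFdim C R F (c ^+ n.+1))%E.
  move: lt; case: (PFdim C R F (c ^+ n.+1)) => [w| |] //.
    rewrite lte_fin => pw; exists ((p ^+ n.+1 + w) / 2); first by rewrite midf_lt.
    by rewrite lte_fin midf_lt.
  by move=> _; exists (p ^+ n.+1 + 1); rewrite ?ltry // ltrDl.
have a0 : 0 <= a by apply: le_trans (ltW pa); exact: exprn_ge0.
(* a fraction [u / v] between [p] and the root [s] of [a] *)
pose s := a `^ n.+1%:R^-1.
have s0 : 0 <= s by exact: powR_ge0.
have sE : s ^+ n.+1 = a.
  by rewrite -powR_mulrn // -powRrM mulVf ?powRr1 // pnatr_eq0.
have ps : p < s.
  by rewrite ltNge; apply/negP => sp; move: pa; rewrite -sE ltNge lerXn2r // nnegrE.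
have sp0 : 0 < s - p by rewrite subr_gt0.
pose v := (Num.trunc (s - p)^-1).+1; pose u := (Num.trunc (v%:R * p)).+1.
have v0 : 0 < v%:R :> R by rewrite ltr0n.
have vsp : 1 < v%:R * (s - p) by rewrite -ltr_pdivrMr // div1r truncnS_gt.
have pu : p < u%:R / v%:R by rewrite ltr_pdivlMr // mulrC truncnS_gt.
have us : u%:R / v%:R <= s.
  rewrite ler_pdivrMr // [s * _]mulrC /u -natr1.
  apply: le_trans (_ : v%:R * p + 1 <= _); first by rewrite lerD2r truncn_le mulr_ge0 // ltW.
  by rewrite -lerBrDl -mulrBr ltW.
have [x [xn x0 ax]] := PFdim_expands cn a0 (or_intror aP).
have uv0 : 0 <= u%:R / v%:R :> R by rewrite divr_ge0 // ler0n.
have [|y [yn y0 uvy]] := @expands_root c n x u v a c0 xn x0 isT _ a0 ax.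
  by rewrite -sE lerXn2r // nnegrE.
have := PFdim_ge c0 uv0 yn y0 uvy; rewrite E lee_fin leNgt => /negP; apply.
exact: pu.
Qed.

(** If [b^m = 1 + y] then [b x = x + y] for [x = 1 + b + ... + b^(m-1)]. *)
Lemma PFdim_basis_ge1 b : C b -> (1 <= PFdim C R F b)%E.
Proof.
move=> Cb'; have [m [m0 [y y0 bm]]] := Cpow Cb'.
have bn : nonneg b by exists [:: b]; rewrite ?big_seq1 // => ? /[1!inE] /eqP ->.
pose x := \sum_(i < m) b ^+ i.
have xn : nonneg x by apply: nonneg_sum => i; exact: nonnegX.
have x0 : x != 0.
  rewrite /x; case: (m) m0 => // l _; rewrite big_ord_recl expr0; apply: one_plus_neq0.
  by apply: nonneg_sum => i; exact: nonnegX.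
apply: (PFdim_ge bn ler01 xn x0) => e.
have -> : b * x = x + y.
  by apply/eqP; rewrite addrC -subr_eq -{2}[x]mul1r -mulrBl -subrX1 bm addrC addKr.
by rewrite mul1r ler_int coordD // lerDl; exact: (proj1 (nonneg_coord CZ _)).
Qed.

Theorem PF_filtration_good : PF_filtration C R F.
Proof.
split; [exact: PFdim_superadditive|exact: PFdim_submultiplicative|exact: PFdim_basis_ge1].
Qed.
End Growth.

(** * Automorphisms of an algebraically closed field *)

Section SubfieldType.
Variables (K : fieldType) (F : divringClosed K).

Record subfield := Subfield { subfield_val : K; subfield_valP : subfield_val \in F }.
HB.instance Definition _ := [isSub for subfield_val].
HB.instance Definition _ := Choice.copy subfield (sub_type subfield).
HB.instance Definition _ :=
  GRing.SubChoice_isSubComUnitRing.Build _ _ subfield (GRing.divringClosedP _).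
HB.instance Definition _ :=
  GRing.SubComUnitRing_isSubIntegralDomain.Build _ _ subfield.
HB.instance Definition _ :=
  GRing.SubIntegralDomain_isSubField.Build _ _ subfield (frefl _).
End SubfieldType.

Section DivisionInSubring.
Variables (S : comNzRingType) (R : subringClosed S).

Lemma monic_division (q p : {poly S}) :
  q \is monic -> q \is a polyOver R -> p \is a polyOver R ->
  exists s r, [/\ s \is a polyOver R, r \is a polyOver R,
    p = s * q + r & (size r < size q)%N].
Proof.
move=> qm qR; have [n] := ubnP (size p); elim: n p => // n IH p pn pR.
have [pq|qp] := ltnP (size p) (size q).
  by exists 0, p; rewrite mul0r add0r rpred0.
have q0 : (0 < size q)%N by rewrite size_poly_gt0 monic_neq0.
have p0 : (0 < size p)%N by apply: leq_trans qp.
pose t := lead_coef p *: 'X^(size p - size q).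
have tR : t \is a polyOver R.
  by rewrite polyOverZ // ?(polyOverP pR) // rpredX // polyOverX.
have ptR : p - t * q \is a polyOver R by rewrite rpredB // rpredM.
have pts : (size (p - t * q)%R < size p)%N.
  rewrite -[ltnRHS](prednK p0) ltnS; apply/leq_sizeP => i pi.
  rewrite coefB -scalerAl coefZ coefXnM.
  have le : (size p - size q <= i)%N.
    by rewrite (leq_trans _ pi) // -subn1 leq_sub2l.
  rewrite ltnNge le /=; have [->|ne] := eqVneq i (size p).-1.
    have -> : ((size p).-1 - (size p - size q) = (size q).-1)%N.
      by rewrite -!subn1 subnAC subKn.
    by rewrite -!lead_coefE (monicP qm) mulr1 subrr.
  have {}pi : (size p <= i)%N by rewrite -(prednK p0) ltn_neqAle eq_sym ne.
  by rewrite !nth_default ?mulr0 ?subrr // leq_subRL // subnK.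
have [|s [r [sR rR E rq]]] := IH (p - t * q) _ ptR.
  by rewrite -ltnS (leq_trans _ pn).
exists (t + s), r; split => //; first exact: rpredD.
by rewrite mulrDl -addrA -E addrC subrK.
Qed.
End DivisionInSubring.

Section PartialAutomorphisms.
Variable K : fieldType.
Implicit Types (R : subringClosed (K * K)%type) (y a : (K * K)%type).

(** The subring [R] of [K * K] is the graph of an isomorphism between subrings of [K]. *)
Definition partial_iso (R : {pred K * K}) :=
  forall a, a \in R -> (a.1 == 0) = (a.2 == 0).

Lemma partial_iso_neq0 R a : partial_iso R -> a \in R -> a != 0 ->
  a.1 != 0 /\ a.2 != 0.
Proof.
case: a => u v Ri aR; have /= E := Ri _ aR; rewrite E => a0.
suff v0 : v != 0 by [].
by apply: contraNN a0 => v0; move: E; rewrite v0 => /eqP ->; rewrite (eqP v0).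
Qed.

Lemma pairV_inv a : a.1 != 0 -> a.2 != 0 -> (a.1^-1, a.2^-1) * a = 1.
Proof. by case: a => u v /= u0 v0; congr pair; rewrite mulVf. Qed.

Definition inverse_closed (R : {pred K * K}) :=
  forall a, a \in R -> a != 0 -> (a.1^-1, a.2^-1) \in R.

Lemma monic_multiple R (q : {poly K * K}) :
  partial_iso R -> inverse_closed R -> q \is a polyOver R -> q != 0 ->
  exists c, [/\ c \in R, c *: q \is monic & size (c *: q) = size q].
Proof.
move=> Ri Rv qR q0; have lR : lead_coef q \in R by apply: (polyOverP qR).
have l0 : lead_coef q != 0 by rewrite lead_coef_eq0.
have [l1 l2] := partial_iso_neq0 Ri lR l0.
exists ((lead_coef q).1^-1, (lead_coef q).2^-1); set c := (_, _).
have E : c * lead_coef q = 1 by apply: pairV_inv.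
have S : size (c *: q) = size q.
  apply/eqP; rewrite eqn_leq size_scale_leq /= -[size q]prednK ?size_poly_gt0 //.
  rewrite ltnNge; apply/negP => /leq_sizeP/(_ _ (leqnn _)) /eqP.
  by rewrite coefZ -lead_coefE E oner_eq0.
split=> //; first exact: Rv.
by rewrite monicE lead_coefE S coefZ -lead_coefE E.
Qed.

(** The pairs [q.[y]] again form the graph of an isomorphism: modulo the minimal
    polynomial [p] of the first coordinate, a polynomial vanishing at the second
    coordinate would have a common factor with [p] of smaller degree. *)
Lemma partial_iso_adjoin R (p : {poly K * K}) y :
  partial_iso R -> inverse_closed R ->
  p \is monic -> p \is a polyOver R -> p.[y] = 0 ->
  (forall q, q \is a polyOver R -> q != 0 -> (size q < size p)%N ->
     q.[y].1 != 0) ->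
  forall q, q \is a polyOver R -> (q.[y].1 == 0) = (q.[y].2 == 0).
Proof.
move=> Ri Rv pm pR py pmin.
have small q : q \is a polyOver R -> q != 0 -> (size q < size p)%N ->
    q.[y].2 != 0.
  have [n] := ubnP (size q); elim: n q => // n IH q0 qn q0R q00 q0p.
  apply/eqP => q0y.
  have [c [cR qm sq]] := monic_multiple Ri Rv q0R q00.
  set q := c *: q0 in qm sq.
  have qR : q \is a polyOver R by rewrite polyOverZ.
  have qy : q.[y].2 = 0 by rewrite hornerZ /= q0y mulr0.
  have [s [r [sR rR E rq]]] := monic_division qm qR pR.
  have r0 : r = 0.
    apply/eqP/negPn/negP => r0.
    have /negP[] : r.[y].2 != 0.
      apply: IH => //; first by rewrite (leq_trans rq) // sq -ltnS.
      by rewrite (ltn_trans rq) // sq.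
    have -> : r = p - s * q by rewrite E addrC addKr.
    by rewrite hornerD hornerN hornerM py /= qy mulr0 subrr.
  rewrite r0 addr0 in E.
  have s0 : s != 0.
    by apply/eqP => s0; move: (monic_neq0 pm); rewrite E s0 mul0r eqxx.
  have sz : (size p = (size s + size q).-1)%N by rewrite E size_Mmonic.
  have q1 : (1 < size q)%N.
    rewrite ltn_neqAle size_poly_gt0 monic_neq0 // andbT; apply/eqP => /esym/eqP.
    case/size_poly1P => d _ dE; move/monicP: qm qy.
    by rewrite dE lead_coefC hornerC => -> /= /eqP; rewrite oner_eq0.
  have sp : (size s < size p)%N.
    by rewrite sz; move: q1; case: (size q) => [|[|m]] // _; rewrite !addnS ltnS leq_addr.
  have /(congr1 fst)/eqP := py.
  rewrite E hornerM /= mulf_eq0; apply/negP; rewrite negb_or !pmin //.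
  by rewrite monic_neq0.
  by rewrite sq.
move=> q qR; have [s [r [sR rR -> rp]]] := monic_division pm pR qR.
rewrite hornerD hornerM py mulr0 add0r.
have [->|r0] := eqVneq r 0; first by rewrite horner0 !eqxx.
by rewrite (negPf (small _ rR r0 rp)) (negPf (pmin _ rR r0 rp)).
Qed.
End PartialAutomorphisms.

Section MaximalSubfield.
Variable K : closedFieldType.
Implicit Types (F : divringClosed K) (A : set K).

Definition subfield_set A :=
  A 1 /\ forall x y, A x -> A y -> A (x - y) /\ A (x / y).

Lemma divringClosed_of A : subfield_set A ->
  exists F, forall x, (x \in F) = `[< A x >].
Proof.
move=> [A1 Acl]; pose S : {pred K} := fun x => `[< A x >].
have cl : GRing.divring_closed S.
  split; first exact/asboolP.
  - by move=> x y /asboolP Ax /asboolP Ay; apply/asboolP; case: (Acl x y Ax Ay).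
  - by move=> x y /asboolP Ax /asboolP Ay; apply/asboolP; case: (Acl x y Ax Ay).
pose F : divringClosed K := HB.pack S (GRing.isDivringClosed.Build K S cl).
by exists F.
Qed.

(** Zorn's lemma. *)
Lemma maximal_subfield F0 (c : K) : c \notin F0 ->
  exists F, [/\ {subset F0 <= F}, c \notin F &
    forall F', {subset F <= F'} -> c \notin F' -> {subset F' <= F}].
Proof.
move=> cF0.
pose good A := [/\ subfield_set A, forall x, x \in F0 -> A x & ~ A c].
pose P A := A = set0 \/ good A.
have chain (X : set (set K)) : (X `<=` P)%classic -> total_on X subset ->
    P (\bigcup_(Y in X) Y)%classic.
  move=> XP Xt; have [[Y [XY gY]]|noY] := pselect (exists Y, X Y /\ good Y).
    right; split.
    - split; first by exists Y => //; case: gY => -[].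
      move=> x y [Y1 XY1 Y1x] [Y2 XY2 Y2y].
      have [Z [XZ Zx Zy]] : exists Z, [/\ X Z, Z x & Z y].
        by case: (Xt _ _ XY1 XY2) => S;
          [exists Y2|exists Y1]; split=> //; exact: S.
      have [Z0|[[_ Zcl] _ _]] := XP _ XZ; first by rewrite Z0 in Zx.
      by have [Zxy Zxy'] := Zcl x y Zx Zy; split; exists Z.
    - by move=> x xF; exists Y => //; case: gY => _ + _; apply.
    - by case=> Z XZ Zc; have [Z0|[_ _]] := XP _ XZ; [rewrite Z0 in Zc|].
  left; apply/seteqP; split=> // x [Y XY Yx].
  have [Y0|gY] := XP _ XY; first by rewrite Y0 in Yx.
  by case: noY; exists Y.
have [A [PA Amax]] := Zorn_bigcup chain.
have gF0 : good [set` F0].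
  split=> //=; last exact/negP.
  split=> /=; first exact: rpred1.
  by move=> x y xF yF; rewrite rpredB // rpred_div.
have [A0|[Af F0A nAc]] := PA.
  exfalso; apply: (Amax [set` F0]); last by right.
  rewrite A0; split=> // /(_ 1) /=; apply; exact: rpred1.
have [F FE] := divringClosed_of Af.
exists F; split=> [x xF|| F' FF' cF' x xF'].
- by rewrite FE; apply/asboolP/F0A.
- by rewrite FE; apply/asboolP.
apply/negPn/negP => xF; apply: (Amax [set` F']).
  split; last by move=> H; move: xF; rewrite FE => /asboolP; apply; apply: H.
  by move=> z Az /=; apply: FF'; rewrite FE; apply/asboolP.
right; split=> [|z zF0 /=|]; last by move=> /= cF; rewrite cF in cF'.
  split=> /=; first exact: rpred1.
  by move=> u v uF vF; rewrite rpredB // rpred_div.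
by apply: FF'; rewrite FE; apply/asboolP/F0A.
Qed.

Definition algebraic_over F (y : K) :=
  exists p : {poly K}, [/\ p \is a polyOver F, p != 0 & root p y].

Lemma adjoin_subfield F (y : K) : exists F' : divringClosed K,
  [/\ {subset F <= F'}, y \in F' &
   forall x, x \in F' -> exists p q, [/\ p \is a polyOver F,
     q \is a polyOver F, q.[y] != 0 & x = p.[y] / q.[y]]].
Proof.
pose A x := exists p q, [/\ p \is a polyOver F,
     q \is a polyOver F, q.[y] != 0 & x = p.[y] / q.[y]].
have AC x : x \in F -> A x.
  move=> xF; exists x%:P, 1; rewrite !hornerE invr1 mulr1 oner_neq0 polyOverC.
  by split=> //; exact: rpred1.
have [|F' F'E] := @divringClosed_of A.
  split; first by apply: AC; exact: rpred1.
  move=> _ _ [p [q [pF qF q0 ->]]] [r [s [rF sF s0 ->]]]; split.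
    exists (p * s - r * q), (q * s); split; try by rewrite ?rpredB ?rpredM.
      by rewrite hornerM mulf_neq0.
    by rewrite !hornerE; field; rewrite q0 s0.
  have [r0|r0] := eqVneq r.[y] 0.
    rewrite r0 mul0r invr0 mulr0; apply: AC; exact: rpred0.
  exists (p * s), (q * r); split; try by rewrite rpredM.
    by rewrite hornerM mulf_neq0.
  by rewrite !hornerE; field; rewrite q0 s0 r0.
exists F'; split=> [x xF||x]; try by rewrite F'E; apply/asboolP; apply: AC.
  rewrite F'E; apply/asboolP; exists 'X, 1.
  by rewrite polyOverX rpred1 !hornerE oner_neq0 invr1 mulr1.
by rewrite F'E => /asboolP.
Qed.

Lemma algebraic_overP F y :
  algebraic_over F y <-> algebraicOver (\val : subfield F -> K) y.
Proof.
split=> [[p [pF p0 py]]|[p p0 py]]; last first.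
  exists (map_poly \val p); split=> //; last by rewrite map_poly_eq0.
  by apply/polyOverP => i; rewrite coef_map; exact: subfield_valP.
pose p' : {poly subfield F} := \poly_(i < size p) insubd 0 p`_i.
have E : map_poly \val p' = p.
  apply/polyP => i; rewrite coef_map coef_poly; case: ltnP => ip.
    by apply: (insubdK (0 : subfield F)); apply: (polyOverP pF).
  by rewrite nth_default.
by exists p'; rewrite ?E // -(map_poly_eq0 (\val : {rmorphism _ -> K})) E.
Qed.

(** Every proper extension of [F] contains [c], in particular [F(c^2)] does if
    [c] is transcendental, and [F(y)] does for every [y]; both relations are
    algebraic. *)
Lemma maximal_subfield_algebraic F c : c \notin F ->
  (forall F', {subset F <= F'} -> c \notin F' -> {subset F' <= F}) ->
  forall y, algebraic_over F y.
Proof.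
move=> cF Fmax.
have key y : y \in F \/ exists p q, [/\ p \is a polyOver F,
     q \is a polyOver F, q.[y] != 0 & c = p.[y] / q.[y]].
  have [F' [FF' yF' E]] := adjoin_subfield F y.
  have [yF|yF] := boolP (y \in F); [by left | right; apply: E].
  by apply/negPn/negP => cF'; move: yF; rewrite (Fmax F').
have algc : algebraic_over F c.
  have [c2|[p [q [pF qF q0 E]]]] := key (c ^+ 2).
    exists ('X^2 - (c ^+ 2)%:P); rewrite rpredB ?rpredX ?polyOverX ?polyOverC //.
    by rewrite /root !hornerE subrr eqxx -size_poly_gt0 size_XnsubC.
  (* [c] is a rational function of [c^2]: the odd part of the resulting equation does not vanish *)
  pose r := (q \Po 'X^2) * 'X - (p \Po 'X^2).
  exists r; split.
  - apply: rpredB; first by rewrite rpredM ?polyOver_comp ?rpredX ?polyOverX.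
    by rewrite polyOver_comp ?rpredX ?polyOverX.
  - have q0' : q != 0 by apply: contraNneq q0 => ->; rewrite horner0.
    have [i qi] : exists i, q`_i != 0.
      by exists (size q).-1; rewrite -lead_coefE lead_coef_eq0.
    apply: contraNneq qi => r0; have := congr1 (fun r : {poly K} => r`_(i.*2.+1)) r0.
    rewrite coefB coefMX /= !coef_comp_poly_Xn // coef0 -muln2 dvdn_mull //.
    by rewrite dvdn2 /= oddM andbF /= subr0 mulnK // => ->.
  - have pq : c * q.[c ^+ 2] = p.[c ^+ 2] by rewrite [X in X * _]E divfK.
    by rewrite /root /r !hornerE !horner_comp !hornerE -pq mulrC subrr.
have intF x : x \in F -> integralOver (\val : subfield F -> K) x.
  by move=> xF; apply: (integral_id _ (Subfield xF)).
have intc : integralOver (\val : subfield F -> K) c.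
  by apply/integral_algebraic/algebraic_overP.
move=> y; have [yF|[p [q [pF qF q0 E]]]] := key y.
  by exists ('X - y%:P); rewrite polyOverXsubC yF polyXsubC_eq0 root_XsubC.
apply/algebraic_overP/integral_algebraic.
pose r := p - c *: q.
have r0 : r != 0.
  have q0' : q != 0 by apply: contraNneq q0 => ->; rewrite horner0.
  apply/eqP => /(congr1 (fun r : {poly K} => r`_(size q).-1)) /eqP.
  rewrite coefB coefZ coef0 subr_eq0 -lead_coefE => /eqP pq.
  move: cF; rewrite -[c](mulfK (_ : lead_coef q != 0)) ?lead_coef_eq0 // -pq.
  by rewrite rpred_div ?(polyOverP pF) ?(polyOverP qF).
have l0 : lead_coef r != 0 by rewrite lead_coef_eq0.
have ir i : integralOver (\val : subfield F -> K) r`_i.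
  rewrite coefB coefZ; apply: integral_sub.
    by apply: intF; apply: (polyOverP pF).
  by apply: integral_mul => //; apply: intF; apply: (polyOverP qF).
apply: (@integral_root_monic _ _ _ _ ((lead_coef r)^-1 *: r)).
- by rewrite monicE lead_coefZ mulVf.
- have pq : c * q.[y] = p.[y] by rewrite [X in X * _]E divfK.
  by rewrite /root !hornerE pq subrr mulr0.
- move=> x /(nthP 0) [i _ <-]; rewrite coefZ; apply: integral_mul => //.
  by apply/integral_algebraic/algebraic_inv/integral_algebraic; rewrite lead_coefE.
Qed.
End MaximalSubfield.

Section FixedField.
Variable K : closedFieldType.
Hypothesis char0 : [pchar K] =i pred0.
Implicit Types (R : subringClosed (K * K)%type) (F : divringClosed K).

Lemma horner_fst (q : {poly K * K}) y : q.[y].1 = (map_poly fst q).[y.1].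
Proof. by rewrite -[y.1]/(fst y) horner_map. Qed.

Lemma horner_snd (q : {poly K * K}) y : q.[y].2 = (map_poly snd q).[y.2].
Proof. by rewrite -[y.2]/(snd y) horner_map. Qed.

(** Over an inverse-closed graph, polynomials can be made monic, so one of least degree
    divides the others. *)
Lemma minimal_annihilator R (a : K) (q : {poly K * K}) :
  partial_iso R -> inverse_closed R ->
  q \is a polyOver R -> q != 0 -> root (map_poly fst q) a ->
  exists p, [/\ p \is monic, p \is a polyOver R, root (map_poly fst p) a &
    forall q, q \is a polyOver R -> q != 0 -> (size q < size p)%N ->
      ~~ root (map_poly fst q) a].
Proof.
move=> Ri Rv qR q0 qa.
pose P n := `[< exists p : {poly K * K}, [/\ p \is a polyOver R, p != 0,
  root (map_poly fst p) a & size p = n] >].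
have exP : exists n, P n by exists (size q); apply/asboolP; exists q.
case: (ex_minnP exP) => n /asboolP[p [pR p0 pa sp]] nmin.
have [d [dR dm sd]] := monic_multiple Ri Rv pR p0.
exists (d *: p); split=> //; first by rewrite polyOverZ.
  by rewrite map_polyZ /root hornerZ (eqP pa) mulr0.
move=> r rR r0 rp; apply/negP => ra.
by move: rp; rewrite sd sp ltnNge nmin //; apply/asboolP; exists r.
Qed.

Lemma diagonal_subring F : exists R, forall x, (x \in R) = (x.1 == x.2) && (x.1 \in F).
Proof.
pose S : {pred K * K} := fun x => (x.1 == x.2) && (x.1 \in F).
have cl : GRing.subring_closed S.
  split; first by rewrite unfold_in eqxx /= rpred1.
  - move=> [x y] [z t] /andP[/eqP/= -> yF] /andP[/eqP/= -> tF].
    by rewrite unfold_in /= eqxx rpredB.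
  - move=> [x y] [z t] /andP[/eqP/= -> yF] /andP[/eqP/= -> tF].
    by rewrite unfold_in /= eqxx rpredM.
by exists (HB.pack_for (subringClosed (K * K)%type) S (GRing.isSubringClosed.Build (K * K)%type S cl)).
Qed.

Lemma other_root F (c : K) (p : {poly K}) : c \notin F -> p \is monic ->
  p \is a polyOver F -> root p c ->
  (forall q, q \is a polyOver F -> q != 0 -> (size q < size p)%N -> ~~ root q c) ->
  exists2 c', root p c' & c' != c.
Proof.
move=> cF pm pF pc pmin; have /factor_theorem[s E] := pc.
have s0 : s != 0 by apply: contraTneq pm => s0; rewrite E s0 mul0r monicE lead_coef0 eq_sym oner_eq0.
have sp : size p = (size s).+1 by rewrite E size_Mmonic ?monicXsubC // size_XsubC addn2.
have s1 : size s != 1%N.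
  apply/eqP => s1; move: cF; have p1 : p`_1 = 1 by move: pm; rewrite monicE lead_coefE sp s1 => /eqP.
  have : - p`_0 \in F by rewrite rpredN (polyOverP pF).
  suff -> : - p`_0 = c by move=> ->.
  move: pc; rewrite /root horner_coef sp s1 !big_ord_recl big_ord0 /= p1.
  by rewrite expr0 expr1 mulr1 mul1r addr0 addrC addr_eq0 => /eqP <-.
have [c' c's] := closed_rootP s s1.
exists c'; first by rewrite E rootM c's.
apply: contraTneq c's => ->.
have pd0 : p^`() != 0.
  have szp : (1 < size p)%N by rewrite sp ltnS size_poly_gt0.
  apply/eqP => /(congr1 (fun r : {poly K} => r`_(size p).-2)) /eqP.
  rewrite coef_deriv coef0 prednK -?lead_coefE ?(monicP pm); last by case: (size p) szp => [|[]].
  by rewrite (proj1 (pcharf0P _) char0) => /eqP E0; case: (size p) szp E0 => [|[]].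
have : ~~ root p^`() c.
  apply: pmin => //; last by apply: lt_size_deriv; rewrite monic_neq0.
  apply/polyOverP => i; rewrite coef_deriv rpredMn //; exact: (polyOverP pF).
by rewrite E derivM derivXsubC mulr1 rootE !hornerE subrr mulr0 add0r.
Qed.

(** Graphs of isomorphisms between subrings of [K] that fix [F] and send [c] to [c']. *)
Definition partial_automorphism F (c c' : K) (A : set (K * K)) :=
  [/\ A 1, (forall x y, A x -> A y -> A (x - y) /\ A (x * y)),
      (forall x, x \in F -> A (x, x)), A (c, c') &
      forall x, A x -> (x.1 == 0) = (x.2 == 0)].

Lemma subringClosed_of (A : set (K * K)) :
  A 1 -> (forall x y, A x -> A y -> A (x - y) /\ A (x * y)) ->
  exists R, forall x, (x \in R) = `[< A x >].
Proof.
move=> A1 Acl; pose S : {pred K * K} := fun x => `[< A x >].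
have cl : GRing.subring_closed S.
  split; first exact/asboolP.
  - by move=> x y /asboolP Ax /asboolP Ay; apply/asboolP; case: (Acl x y Ax Ay).
  - by move=> x y /asboolP Ax /asboolP Ay; apply/asboolP; case: (Acl x y Ax Ay).
by exists (HB.pack_for (subringClosed (K * K)%type) S
  (GRing.isSubringClosed.Build (K * K)%type S cl)).
Qed.

Lemma partial_automorphism_horner R F c c' y (p : {poly K * K}) :
  partial_iso R -> inverse_closed R ->
  (forall x, x \in F -> (x, x) \in R) -> 
  (c, c') \in R \/ y = (c, c') ->
  p \is monic -> p \is a polyOver R -> p.[y] = 0 ->
  (forall q, q \is a polyOver R -> q != 0 -> (size q < size p)%N ->
      ~~ root (map_poly fst q) y.1) ->
  partial_automorphism F c c' [set x | exists2 q, q \is a polyOver R & x = q.[y]].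
Proof.
move=> Ri Rv FR cR pm pR py pmin; split.
- by exists 1; rewrite ?rpred1 ?hornerC.
- move=> _ _ [q qR ->] [r rR ->]; split.
    by exists (q - r); rewrite ?rpredB // hornerD hornerN.
  by exists (q * r); rewrite ?rpredM // hornerM.
- by move=> x xF; exists (x, x)%:P; rewrite ?hornerC // polyOverC FR.
- case: cR => [cR|->]; first by exists (c, c')%:P; rewrite ?hornerC // polyOverC.
  by exists 'X; rewrite ?polyOverX ?hornerX.
- move=> _ [q qR ->]; apply: (partial_iso_adjoin Ri Rv pm pR py) => // r rR r0 rp.
  by rewrite horner_fst; exact: pmin.
Qed.

Lemma maximal_partial_automorphism F c c' A0 : partial_automorphism F c c' A0 ->
  exists2 A, partial_automorphism F c c' A &
    forall B, (A `<=` B)%classic -> partial_automorphism F c c' B -> (B `<=` A)%classic.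
Proof.
move=> gA0; pose good := partial_automorphism F c c'; pose P A := A = set0 \/ good A.
have chain (X : set (set (K * K))) : (X `<=` P)%classic -> total_on X subset ->
    P (\bigcup_(Y in X) Y)%classic.
  move=> XP Xt; have [[Y [XY [Y1 Ycl FY cY Yi]]]|noY] := pselect (exists Y, X Y /\ good Y).
    right; split; [by exists Y| |by move=> x xF; exists Y => //; apply: FY|by exists Y|].
      move=> x y [Y1' XY1 Y1x] [Y2 XY2 Y2y].
      have [Z [XZ Zx Zy]] : exists Z, [/\ X Z, Z x & Z y].
        by case: (Xt _ _ XY1 XY2) => S;
          [exists Y2|exists Y1']; split=> //; exact: S.
      have [Z0|[_ Zcl _ _ _]] := XP _ XZ; first by rewrite Z0 in Zx.
      by have [Zxy Zxy'] := Zcl x y Zx Zy; split; exists Z.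
    move=> x [Z XZ Zx]; have [Z0|[_ _ _ _]] := XP _ XZ; first by rewrite Z0 in Zx.
    exact.
  left; apply/seteqP; split=> // x [Y XY Yx].
  have [Y0|gY] := XP _ XY; first by rewrite Y0 in Yx.
  by case: noY; exists Y.
have [A [PA Amax]] := Zorn_bigcup chain.
have [A0'|gA] := PA.
  exfalso; apply: (Amax A0); last by right.
  by rewrite A0'; split=> // /(_ 1); case: gA0 => + _ _ _ _ => /[swap]; apply.
exists A => // B AB gB x Bx; apply: contrapT => nAx.
by apply: (Amax B); [split=> // /(_ _ Bx)|right].
Qed.

(** Otherwise the graph would extend to fractions. *)
Lemma maximal_inverse_closed F c c' (A : set (K * K)) :
  partial_automorphism F c c' A ->
  (forall B, (A `<=` B)%classic -> partial_automorphism F c c' B -> (B `<=` A)%classic) ->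
  forall a, A a -> a != 0 -> A (a.1^-1, a.2^-1).
Proof.
move=> gA Amax a Aa a0; have [A1 Acl FA cA Ai] := gA.
pose B : set (K * K) := [set x | exists u v, [/\ A u, A v, v.1 != 0 & x = (u.1 / v.1, u.2 / v.2)]].
have a1 : a.1 != 0.
  by apply: contraNneq a0 => a1; move: (Ai _ Aa); rewrite a1 eqxx; case: (a) a1 => ? ? /= -> /esym/eqP ->.
have v2 v : A v -> v.1 != 0 -> v.2 != 0 by move=> Av; rewrite Ai.
have AB x : A x -> B x by exists x, 1; rewrite /= oner_neq0 !divr1; split=> //; case: x {H}.
apply: (Amax B); first by move=> x; exact: AB.
  split; [exact: AB| |by move=> x xF; apply/AB/FA|exact: AB|].
  - move=> _ _ [u [v [Au Av v0 ->]]] [u' [v' [Au' Av' v0' ->]]]; split.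
      exists (u * v' - u' * v), (v * v'); split; try by [apply: (Acl _ _ _ _).2].
      + by apply: (Acl _ _ _ _).1; apply: (Acl _ _ _ _).2.
      + by rewrite /= mulf_neq0.
      + by congr pair => /=; field; rewrite ?v0 ?v0' ?v2.
    exists (u * u'), (v * v'); split; try by [apply: (Acl _ _ _ _).2].
      + by rewrite /= mulf_neq0.
      + by congr pair => /=; field; rewrite ?v0 ?v0' ?v2.
  - move=> _ [u [v [Au Av v0 ->]]] /=; rewrite !mulf_eq0 !invr_eq0 (negPf v0).
    by rewrite (negPf (v2 _ Av v0)) !orbF Ai.
by exists 1, a; rewrite /= !mul1r; split.
Qed.

(** A maximal partial automorphism of [K] over a subfield [F] with [K / F]
    algebraic has domain and range [K]: a new element of the domain would be sent
    to a root of the transported minimal polynomial, and a polynomial over [F] has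
    all its roots in the range because the images of its roots are its roots. *)
Lemma exists_automorphism F c : c \notin F -> (forall y, algebraic_over F y) ->
  exists s : {rmorphism K -> K},
    [/\ bijective s, forall x, x \in F -> s x = x & s c != c].
Proof.
move=> cF Falg; have [D DE] := diagonal_subring F.
have pair_poly (R : subringClosed (K * K)%type) (q : {poly K}) :
    (forall x, x \in F -> (x, x) \in R) -> q \is a polyOver F ->
    exists p : {poly K * K}, [/\ p \is a polyOver R, map_poly fst p = q,
      map_poly snd p = q & size p = size q].
  move=> FR qF; pose p : {poly K * K} := \poly_(i < size q) (q`_i, q`_i).
  have p1 : map_poly fst p = q.
    apply/polyP => i; rewrite coef_map coef_poly; case: ltnP => //= ?.
    by rewrite nth_default.
  have p2 : map_poly snd p = q.
    apply/polyP => i; rewrite coef_map coef_poly; case: ltnP => //= ?.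
    by rewrite nth_default.
  exists p; split=> //; first by apply/polyOver_poly => i _; apply/FR/(polyOverP qF).
  by apply/eqP; rewrite eqn_leq size_poly -{1}p1 size_poly.
have annihilator (R : subringClosed (K * K)%type) y : partial_iso R -> inverse_closed R ->
    (forall x, x \in F -> (x, x) \in R) ->
    exists p : {poly K * K}, [/\ p \is monic, p \is a polyOver R, root (map_poly fst p) y &
    forall q, q \is a polyOver R -> q != 0 -> (size q < size p)%N ->
      ~~ root (map_poly fst q) y].
  move=> Ri Rv FR; have [q [qF q0 qy]] := Falg y.
  have [p [pR p1 p2 _]] := pair_poly R q FR qF.
  apply: (minimal_annihilator Ri Rv pR); last by rewrite p1.
  by apply: contraNneq q0 => p0; rewrite -p1 p0 rmorph0.
have horner0 (p : {poly K * K}) u v : root (map_poly fst p) u ->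
    root (map_poly snd p) v -> p.[(u, v)] = 0.
  move=> /eqP pu /eqP pv; have := horner_fst p (u, v); have := horner_snd p (u, v).
  by rewrite /= pu pv; case: _.[_] => x y /= -> ->.
have [c' c'c [A gA Amax]] : exists2 c', c' != c &
    exists2 A, partial_automorphism F c c' A &
    forall B, (A `<=` B)%classic -> partial_automorphism F c c' B -> (B `<=` A)%classic.
  have Di : partial_iso D by move=> a; rewrite DE => /andP[/eqP ->].
  have Dv : inverse_closed D.
    by move=> a; rewrite !DE /= => /andP[/eqP -> aF] _; rewrite eqxx rpredV.
  have FD x : x \in F -> (x, x) \in D by rewrite DE eqxx.
  have [p [pm pD pc pmin]] := annihilator D c Di Dv FD.
  have p12 : map_poly snd p = map_poly fst p.
    by apply/polyP => i; rewrite !coef_map /=; have := polyOverP pD i; rewrite DE => /andP[/eqP ->].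
  have p1m : map_poly fst p \is monic by apply: monic_map.
  have sp : size (map_poly fst p) = size p.
    apply: size_map_poly_id0; rewrite (monicP pm) /=; exact: oner_neq0.
  have [||c' pc' c'c] := other_root cF p1m _ pc.
  - by apply/polyOverP => i; rewrite coef_map /=; have := polyOverP pD i; rewrite DE => /andP[/eqP ->].
  - move=> q qF q0; have [r [rD r1 r2 sr]] := pair_poly D q FD qF.
    rewrite -r1 r1 sp -sr => rp; rewrite -r1; apply: pmin => //.
    by apply: contraNneq q0 => r0; rewrite -r1 r0 rmorph0.
  exists c' => //; apply: maximal_partial_automorphism.
  apply: (@partial_automorphism_horner D _ _ _ (c, c') p) => //; first by right.
  by apply: horner0; rewrite ?p12.
have [A1 Acl FA cA Ai] := gA.
have [R RE] := subringClosed_of A1 Acl.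
have RA x : x \in R <-> A x by rewrite RE; split=> /asboolP.
have Ri : partial_iso R by move=> a /RA; exact: Ai.
have Rv : inverse_closed R.
  by move=> a /RA Aa a0; apply/RA; apply: (maximal_inverse_closed gA Amax).
have FR x : x \in F -> (x, x) \in R by move=> /FA Ax; apply/RA.
have dom u : exists v, (u, v) \in R.
  have [p [pm pR pu pmin]] := annihilator R u Ri Rv FR.
  have p2m : map_poly snd p \is monic by apply: monic_map.
  have [v pv] : exists v, root (map_poly snd p) v.
    apply/closed_rootP; apply: contraTneq pu => /eqP/size_poly1P [d d0 dE].
    have d1 : d = 1 by move/monicP: p2m; rewrite dE lead_coefC.
    have s1 : size p = 1%N.
      rewrite -(@size_map_poly_id0 _ _ snd); last by rewrite (monicP pm) oner_neq0.
      by rewrite dE size_polyC d0.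
    have /size_poly1P[e e0 eE] : size p == 1%N by rewrite s1.
    by move: pm; rewrite eE map_polyC rootC monicE lead_coefC => /eqP -> /=; rewrite oner_eq0.
  (* [u] gets as image a root [v] of the transported minimal polynomial *)
  exists v; apply/RA; pose B := [set x | exists2 q, q \is a polyOver R & x = q.[(u, v)]].
  apply: (Amax B); last by exists 'X; rewrite ?polyOverX ?hornerX.
    by move=> x /RA xR; exists x%:P; rewrite ?hornerC // polyOverC.
  apply: (@partial_automorphism_horner R _ _ _ (u, v) p) => //; last exact: horner0.
  by left; apply/RA.
have uniq1 u v v' : (u, v) \in R -> (u, v') \in R -> v = v'.
  move=> uv uv'; have := Ri _ (rpredB uv uv'); rewrite /= subrr eqxx.
  by move=> /esym; rewrite subr_eq0 => /eqP.
have uniq2 u u' v : (u, v) \in R -> (u', v) \in R -> u = u'.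
  move=> uv uv'; have := Ri _ (rpredB uv uv'); rewrite /= subrr eqxx.
  by rewrite subr_eq0 => /eqP.
have ran v : exists u, (u, v) \in R.
  have [q [qF q0 qv]] := Falg v.
  have [r qE] := closed_field_poly_normal q.
  have [f fR] := choice dom.
  (* the factorisation of [q] is carried by the automorphism to a factorisation of [q] *)
  pose P : {poly K * K} := (lead_coef q, lead_coef q) *: \prod_(z <- r) ('X - (z, f z)%:P).
  have P1 : map_poly fst P = q.
    rewrite map_polyZ rmorph_prod /= [RHS]qE; congr (_ *: _); apply: eq_bigr => z _.
    by rewrite rmorphB /= map_polyX map_polyC.
  have PR : P \is a polyOver R.
    rewrite polyOverZ ?FR ?(polyOverP qF) // rpred_prod // => z _.
    by rewrite polyOverXsubC.
  have P2 : map_poly snd P = q.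
    apply/polyP => i; rewrite coef_map /=; apply: (@uniq1 q`_i); last first.
      by apply/FR/(polyOverP qF).
    rewrite -{1}P1 coef_map /=; have := polyOverP PR i; by case: (P`_i).
  move: qv; rewrite -P2 map_polyZ rmorph_prod /= /root hornerZ mulf_eq0.
  rewrite lead_coef_eq0 (negPf q0) /= horner_prod prodf_seq_eq0 => /hasP[z _ /=].
  rewrite rmorphB /= map_polyX map_polyC hornerXsubC subr_eq0 => /eqP ->.
  by exists z.
have [f fR] := choice dom; have [g gR] := choice ran.
have fB : zmod_morphism f.
  by move=> x y; apply: (@uniq1 (x - y)) => //; exact: (rpredB (fR x) (fR y)).
have fM : monoid_morphism f.
  split; first by apply: (@uniq1 1) => //; exact: (rpred1 R).
  by move=> x y; apply: (@uniq1 (x * y)) => //; exact: (rpredM (fR x) (fR y)).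
pose s : {rmorphism K -> K} :=
  HB.pack_for {rmorphism K -> K} f (GRing.isZmodMorphism.Build K K f fB)
    (GRing.isMonoidMorphism.Build K K f fM).
exists s; split.
- exists g => x; first by apply: (@uniq2 _ _ (f x)).
  by apply: (@uniq1 (g x)).
- by move=> x xF; apply: (@uniq1 x) => //; apply: FR.
- by rewrite (_ : s c = c') //; apply: (@uniq1 c) => //; apply/RA.
Qed.

(** If [c] is not in [k], a subfield [F] containing [k] and maximal for excluding [c]
    makes [K] algebraic over [F], and some automorphism of [K] over [F] moves [c]. *)
Theorem fixed_field (k : fieldType) (iota : {rmorphism k -> K}) c :
  (forall s : {rmorphism K -> K}, bijective s ->
     (forall a, s (iota a) = iota a) -> s c = c) ->
  exists a, c = iota a.
Proof.
move=> fixc; have [//|nc] := pselect (exists a, c = iota a).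
have [F0 F0E] : exists F0 : divringClosed K, forall x, (x \in F0) = `[< exists a, x = iota a >].
  apply: divringClosed_of; split; first by exists 1; rewrite rmorph1.
  move=> _ _ [a ->] [b ->]; split; first by exists (a - b); rewrite rmorphB.
  by exists (a / b); rewrite fmorph_div.
have [|F [F0F cF Fmax]] := @maximal_subfield K F0 c; first by rewrite F0E; apply/asboolP.
have [s [sb sF /eqP sc]] := exists_automorphism cF (maximal_subfield_algebraic cF Fmax).
case: sc; apply: fixc => // a; apply/sF/F0F; rewrite F0E; apply/asboolP.
by exists a.
Qed.
End FixedField.

(** * Descent of linear relations *)

Section LinearSets.
Variables (F : fieldType) (n : nat).
Implicit Types S : set 'rV[F]_n.

Definition linear_set S := S 0 /\ forall a u v, S u -> S v -> S (a *: u + v).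

(** Take a subspace of largest rank contained in [S]. *)
Lemma linear_set_mx S : linear_set S -> exists A : 'M[F]_n, forall v, S v <-> (v <= A)%MS.
Proof.
move=> [S0 Slin].
pose P r := `[< exists2 A : 'M[F]_n, forall v : 'rV_n, (v <= A)%MS -> S v & \rank A = r >].
have exP : exists r, P r.
  exists 0%N; apply/asboolP; exists 0; rewrite ?mxrank0 // => v.
  by rewrite submx0 => /eqP ->.
have bP r : P r -> (r <= n)%N by move=> /asboolP[A _ <-]; exact: rank_leq_col.
case: (ex_maxnP exP bP) => r /asboolP[A AS rA] rmax.
exists A => v; split=> [Sv|/AS//].
apply/negPn/negP => vA.
suff /rmax : P (\rank (A + v)%MS).
  rewrite -rA leqNgt => /negP; apply; rewrite ltn_neqAle mxrankS ?addsmxSl // andbT.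
  apply: contra vA => rAv; have : (A + v <= A)%MS.
    by rewrite -(geq_leqif (mxrank_leqif_sup (addsmxSl A v))) (eqP rAv).
  by apply: submx_trans; exact: addsmxSr.
apply/asboolP; exists (A + v)%MS => // w /sub_addsmxP[[x y] /= ->].
have -> : y *m v = y 0 0 *: v.
  by apply/rowP => j; rewrite !mxE big_ord1.
by rewrite addrC; apply: Slin => //; apply: AS; rewrite submxMl.
Qed.
End LinearSets.

Section Descent.
Variables (k : fieldType) (K : closedFieldType) (iota : {rmorphism k -> K}).
Hypothesis char0 : [pchar K] =i pred0.

Definition over_k (s : {rmorphism K -> K}) :=
  bijective s /\ forall a, s (iota a) = iota a.

Lemma fixed_mx m n (A : 'M[K]_(m, n)) :
  (forall s, over_k s -> map_mx s A = A) -> exists B, A = map_mx iota B.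
Proof.
move=> fixA; have fix_entry i j : exists a, A i j = iota a.
  apply: (fixed_field char0) => s sb sk.
  by rewrite -[in RHS](fixA s) ?mxE //; split.
have [f fE] := choice (fun ij : 'I_m * 'I_n => fix_entry ij.1 ij.2).
by exists (\matrix_(i, j) f (i, j)); apply/matrixP => i j; rewrite !mxE -fE.
Qed.

(** A basis of the row space in which some maximal minor is the identity is
    determined by the row space, hence is fixed by every automorphism. *)
Lemma descent_mx m n (A : 'M[K]_(m, n)) :
  (forall s, over_k s -> (map_mx s A <= A)%MS) ->
  exists B : 'M[k]_(\rank A, n), (map_mx iota B :=: A)%MS.
Proof.
move=> stA; pose A0 := row_base A.
have full0 : row_full A0^T by rewrite /row_full mxrank_tr; exact: row_base_free.
pose f := fullrankfun full0.
have fu : colsub f A0 \in unitmx.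
  rewrite -unitmx_tr -row_full_unit.
  have -> : (colsub f A0)^T = rowsub f A0^T by apply/matrixP => i j; rewrite !mxE.
  exact: fullrowsub_full.
(* the reduced echelon form, whose entries are fixed by the automorphisms *)
pose C := invmx (colsub f A0) *m A0.
have CA : (C :=: A)%MS.
  apply: (eqmx_trans (eqmxMfull _ _) (eq_row_base A)).
  by rewrite row_full_unit unitmx_inv.
have Cf : colsub f C = 1%:M by rewrite -mulmx_colsub mulVmx.
have [s [sb sk]|B CB] := @fixed_mx _ _ C; last by exists B; rewrite -CB.
have /submxP[X XE] : (map_mx s C <= C)%MS.
  rewrite (submx_trans _ (_ : A <= C)%MS) ?CA //.
  by rewrite (submx_trans _ (stA s _)) // map_submx CA.
have X1 : X = 1%:M.
  have := congr1 (colsub f) XE; rewrite -mulmx_colsub Cf mulmx1 => <-.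
  rewrite -(map_mx1 s) -Cf; by apply/matrixP => i j; rewrite !mxE.
by rewrite XE X1 mul1mx.
Qed.

(** The row space of [S] has a basis with entries in [k], by [descent_mx]. *)
Lemma descent_linear_set n (S : set 'rV[K]_n) : linear_set S ->
  (forall s v, over_k s -> S v -> S (map_mx s v)) ->
  forall v, S v -> exists r (X : 'rV[K]_r) (B : 'M[k]_(r, n)),
    v = X *m map_mx iota B /\ forall i, S (map_mx iota (row i B)).
Proof.
move=> Slin Sst v Sv; have [A AE] := linear_set_mx Slin.
have [s sk|B BA] := @descent_mx _ _ A.
  apply/row_subP => i; rewrite -map_row; apply/AE/Sst => //.
  by apply/AE; exact: row_sub.
have /submxP[X XE] : (v <= map_mx iota B)%MS by rewrite BA; exact/AE.
exists _, X, B; split=> // i; apply/AE.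
by rewrite map_row -BA row_sub.
Qed.

(** Membership in a row space is a rank condition, which does not depend on the field. *)
Lemma solvable_over_k r n (B : 'M[k]_(r, n)) (v : 'rV[k]_n) (X : 'rV[K]_r) :
  map_mx iota v = X *m map_mx iota B -> exists Y, v = Y *m B.
Proof. by move=> E; apply/submxP; rewrite -(map_submx iota) E submxMl. Qed.
End Descent.

(** * Krull's intersection theorem *)

Section Noetherian.
Variable B : comNzRingType.
Implicit Types (S : subringClosed B) (p q : {poly B}).

(** The ascending chain condition, stated for the ideals generated by the initial
    segments of sequences. *)
Definition noetherian (S : {pred B}) := forall s : nat -> B, (forall n, s n \in S) ->
  exists N (c : nat -> B), (forall n, c n \in S) /\ s N = \sum_(i < N) c i * s i.

(** An ideal of the ring of polynomials with coefficients in [S]. *)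
Definition in_ideal S (l : seq {poly B}) p :=
  exists c : nat -> {poly B}, (forall i, c i \is a polyOver S) /\
    p = \sum_(i < size l) c i * l`_i.

Lemma in_idealZ S l c p : c \is a polyOver S -> in_ideal S l p -> in_ideal S l (c * p).
Proof.
move=> cS [d [dS ->]]; exists (fun i => c * d i); split=> [i|]; first exact: rpredM.
by rewrite mulr_sumr; apply: eq_bigr => i _; rewrite mulrA.
Qed.

Lemma in_idealD S l p q : in_ideal S l p -> in_ideal S l q -> in_ideal S l (p + q).
Proof.
move=> [d [dS ->]] [e [eS ->]]; exists (fun i => d i + e i); split=> [i|].
  exact: rpredD.
by rewrite -big_split; apply: eq_bigr => i _ /=; rewrite mulrDl.
Qed.

Lemma in_ideal_sum S l I (r : seq I) (P : pred I) (f : I -> {poly B}) :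
  (forall i, P i -> in_ideal S l (f i)) -> in_ideal S l (\sum_(i <- r | P i) f i).
Proof.
move=> fS; elim/big_ind: _ => //; last exact: in_idealD.
exists (fun=> 0); split=> [i|]; first exact: rpred0.
by rewrite big1 // => i _; rewrite mul0r.
Qed.

Lemma in_ideal_nth S l i : (i < size l)%N -> in_ideal S l l`_i.
Proof.
move=> il; exists (fun j => (j == i)%:R); split=> [j|]; first exact: rpred_nat.
rewrite (bigD1 (Ordinal il)) //= eqxx mul1r big1 ?addr0 // => j /negPf ji.
by rewrite (_ : (j == i :> nat) = false) ?mul0r // -ji.
Qed.

Lemma in_ideal_trans S l l' p : (forall q, q \in l -> in_ideal S l' q) ->
  in_ideal S l p -> in_ideal S l' p.
Proof.
move=> ll' [c [cS ->]]; apply: in_ideal_sum => i _; apply: in_idealZ => //.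
by apply: ll'; rewrite mem_nth.
Qed.

(** Hilbert's basis theorem: choosing successively elements of minimal degree
    outside the ideal of the previous ones, a relation between the leading
    coefficients would lower the degree of the last one. *)
Lemma hilbert_basis S : noetherian S -> forall s : nat -> {poly B},
  (forall n, s n \is a polyOver S) -> exists N, in_ideal S (mkseq s N) (s N).
Proof.
move=> nS s sS; apply: contrapT => /forallNP nos.
pose I p := exists N, in_ideal S (mkseq s N) p.
have Imon N M p : (N <= M)%N -> in_ideal S (mkseq s N) p -> in_ideal S (mkseq s M) p.
  move=> NM; apply: in_ideal_trans => q /(nthP 0)[i]; rewrite size_mkseq => iN <-.
  rewrite nth_mkseq // -(@nth_mkseq _ 0 s M) ?(leq_trans iN) //.
  by apply: in_ideal_nth; rewrite size_mkseq (leq_trans iN).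
have notfg l : (forall q, q \in l -> I q) -> exists p, I p /\ ~ in_ideal S l p.
  move=> lI; have [N lN] : exists N, forall q, q \in l -> in_ideal S (mkseq s N) q.
    elim: l lI => [|q l IH] lI; first by exists 0%N.
    have [|N lN] := IH; first by move=> r rl; apply: lI; rewrite inE rl orbT.
    have [M qM] := lI q (mem_head _ _).
    exists (maxn M N) => r; rewrite inE => /orP[/eqP ->|/lN rN].
      exact: (Imon _ _ _ (leq_maxl M N) qM).
    exact: (Imon _ _ _ (leq_maxr M N) rN).
  exists (s N); split; last by move/(in_ideal_trans lN); exact: nos.
  exists N.+1; rewrite -(@nth_mkseq _ 0 s N.+1) //.
  by apply: in_ideal_nth; rewrite size_mkseq.
have pick l : exists p, (forall q, q \in l -> I q) -> [/\ I p, ~ in_ideal S l p &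
    forall q, I q -> ~ in_ideal S l q -> (size p <= size q)%N].
  have [lI|nlI] := pselect (forall q, q \in l -> I q); last by exists 0.
  have [p [Ip pl]] := notfg l lI.
  pose P n := `[< exists p, [/\ I p, ~ in_ideal S l p & size p = n] >].
  have exP : exists n, P n by exists (size p); apply/asboolP; exists p.
  case: (ex_minnP exP) => n /asboolP[r [Ir rl rn]] nmin.
  exists r => _; split=> // q Iq ql; rewrite rn; apply: nmin; apply/asboolP.
  by exists q.
have [phi phiP] := choice pick.
pose L := fix L n := if n is m.+1 then rcons (L m) (phi (L m)) else [::].
pose q n := phi (L n).
have LE n : L n = mkseq q n.
  by elim: n => //= n IHn; rewrite mkseqS -IHn.
have LI n : forall r, r \in L n -> I r.
  elim: n => //= n IHn r; rewrite mem_rcons inE => /orP[/eqP ->|]; last exact: IHn.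
  by case: (phiP _ IHn).
have qP n : [/\ I (q n), ~ in_ideal S (L n) (q n) &
    forall r, I r -> ~ in_ideal S (L n) r -> (size (q n) <= size r)%N].
  exact: (phiP (L n) (LI n)).
have IS p : I p -> p \is a polyOver S.
  move=> [N [c [cS ->]]]; apply: rpred_sum => i _; rewrite rpredM //.
  have iN : (i < N)%N by exact: (leq_trans (ltn_ord i) (eq_leq (size_mkseq s N))).
  by rewrite nth_mkseq.
have qS n : q n \is a polyOver S by apply: IS; case: (qP n).
have qmon i j : (i <= j)%N -> (size (q i) <= size (q j))%N.
  move=> ij; case: (qP i) => _ _; apply; first by case: (qP j).
  case: (qP j) => _ + _; apply: contra_not; apply: in_ideal_trans => r.
  rewrite !LE => /(nthP 0)[m]; rewrite size_mkseq => mi <-.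
  rewrite nth_mkseq // -(@nth_mkseq _ 0 q j) ?(leq_trans mi) //.
  by apply: in_ideal_nth; rewrite size_mkseq (leq_trans mi).
have [|N [c [cS E]]] := nS (fun n => lead_coef (q n)).
  by move=> n; apply: (polyOverP (qS n)).
have [IqN qN minN] := qP N.
have q0 : q N != 0.
  by apply/eqP => q0; apply: qN; rewrite q0 -[0](mul0r (q 0%N)); 
     exists (fun=> 0); split=> [i|]; [exact: rpred0|rewrite mul0r big1 // => i _; rewrite mul0r].
pose d i := (size (q N) - size (q i))%N.
(* [h] has the same size and leading coefficient as [q N] *)
pose h := \sum_(i < N) (c i *: 'X^(d i)) * q i.
have cXS i : c i *: 'X^(d i) \is a polyOver S.
  by rewrite polyOverZ ?rpredX ?polyOverX.
have hid : in_ideal S (L N) h.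
  exists (fun i => c i *: 'X^(d i)); split=> //.
  rewrite LE size_mkseq; apply: eq_bigr => i _; by rewrite nth_mkseq.
have Ih : I h.
  have IL i : I (q i) by case: (qP i).
  rewrite /h; elim/big_ind: _ => [|x y [M xM] [M' yM]|i _].
  - by exists 0%N; exists (fun=> 0); split=> [i|]; [exact: rpred0|rewrite big_ord0].
  - exists (maxn M M'); apply: in_idealD; first exact: (Imon _ _ _ (leq_maxl _ _)).
    exact: (Imon _ _ _ (leq_maxr _ _)).
  - by have [M qM] := IL i; exists M; apply: in_idealZ.
have : (size (q N) <= size (q N - h)%R)%N.
  apply: minN.
    have [M qM] := IqN; have [M' hM] := Ih; exists (maxn M M').
    apply: in_idealD; first exact: (Imon _ _ _ (leq_maxl _ _)).
    rewrite -mulN1r; apply: in_idealZ; first by rewrite rpredN rpred1.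
    exact: (Imon _ _ _ (leq_maxr _ _)).
  by move=> qh; apply: qN; rewrite -(subrK h (q N)); apply: in_idealD.
apply/negP; rewrite -ltnNge -[ltnRHS]prednK ?size_poly_gt0 // ltnS.
apply/leq_sizeP => j Nj; rewrite coefB coef_sum.
have [jN|jN] := leqP (size (q N)) j.
  rewrite nth_default // big1 ?subrr // => i _.
  rewrite -scalerAl coefZ coefXnM ltnNge (leq_trans (leq_subr _ _) jN) /=.
  by rewrite nth_default ?mulr0 // leq_subRL ?subnK ?(leq_trans _ jN) ?leq_subr // qmon // ltnW.
have -> : j = (size (q N)).-1.
  by apply/eqP; rewrite eqn_leq Nj andbT -ltnS prednK // size_poly_gt0.
rewrite -lead_coefE E; apply/eqP; rewrite subr_eq0; apply/eqP/eq_bigr => i _.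
have qi : (size (q i) <= size (q N))%N by rewrite qmon // ltnW.
have qi0 : (0 < size (q i))%N.
  rewrite size_poly_gt0; apply/eqP => qi0; case: (qP i) => _ + _; apply.
  by rewrite qi0; exists (fun=> 0); split=> [m|]; [exact: rpred0|rewrite big1 // => m _; rewrite mul0r].
rewrite -scalerAl coefZ coefXnM lead_coefE.
have le1 : (d i <= (size (q N)).-1)%N.
  by rewrite /d -subn1 leq_sub2l.
by rewrite ltnNge le1 /d -!subn1 subnAC subKn.
Qed.

Lemma noetherian_adjoin S S' y : noetherian S ->
  (forall x, x \in S' <-> exists2 p, p \is a polyOver S & x = p.[y]) -> noetherian S'.
Proof.
move=> nS S'E s sS'.
have ex n : exists p, p \is a polyOver S /\ s n = p.[y].
  by have [p] := proj1 (S'E (s n)) (sS' n); exists p.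
have [p pP] := choice ex.
have [|N [c [cS E]]] := hilbert_basis nS (s := p); first by move=> n; case: (pP n).
exists N, (fun i => (c i).[y]); split=> [n|]; first by apply/S'E; exists (c n).
have [_ ->] := pP N; rewrite E size_mkseq horner_sum; apply: eq_bigr => i _.
by rewrite hornerM nth_mkseq //; have [_ ->] := pP i.
Qed.

Lemma adjoin_subring S y : exists S' : subringClosed B,
  forall x, x \in S' <-> exists2 p, p \is a polyOver S & x = p.[y].
Proof.
pose A : {pred B} := fun x => `[< exists2 p, p \is a polyOver S & x = p.[y] >].
have cl : GRing.subring_closed A.
  split.
  - by apply/asboolP; exists 1; rewrite ?rpred1 ?hornerC.
  - move=> _ _ /asboolP[p pS ->] /asboolP[q qS ->]; apply/asboolP.
    by exists (p - q); rewrite ?rpredB // hornerD hornerN.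
  - move=> _ _ /asboolP[p pS ->] /asboolP[q qS ->]; apply/asboolP.
    by exists (p * q); rewrite ?rpredM // hornerM.
exists (HB.pack_for (subringClosed B) A (GRing.isSubringClosed.Build B A cl)).
by move=> x; split=> /asboolP.
Qed.

(** By induction on the number of generators; the last clause is the induction principle
    of the generated algebra. *)
Lemma noetherian_fg S (l : seq B) : noetherian S ->
  exists S' : subringClosed B, [/\ noetherian S', {subset S <= S'}, {subset l <= S'} &
    forall P : B -> Prop, (forall x, x \in S -> P x) -> (forall x, x \in l -> P x) ->
      (forall x y, P x -> P y -> P (x + y)) -> (forall x y, P x -> P y -> P (x * y)) ->
      forall x, x \in S' -> P x].
Proof.
elim: l S => [|y l IH] S nS; first by exists S; split=> // P PS _ _ _ x; exact: PS.
have [S1 S1E] := adjoin_subring S y.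
have SS1 x : x \in S -> x \in S1.
  by move=> xS; apply/S1E; exists x%:P; rewrite ?polyOverC ?hornerC.
have [S' [nS' S1S' lS' S'P]] := IH S1 (noetherian_adjoin nS S1E).
exists S'; split=> // [x /SS1 /S1S' //|x|P PS Pl PD PM].
  rewrite inE => /orP[/eqP ->|/lS' //]; apply/S1S'/S1E.
  by exists 'X; rewrite ?polyOverX ?hornerX.
apply: S'P => // [x /S1E[p pS ->]|x xl]; last by apply: Pl; rewrite inE xl orbT.
have Py : P y by apply: Pl; rewrite mem_head.
elim/poly_ind: p pS => [|p c IHp] pS; first by rewrite horner0; apply/PS/rpred0.
rewrite hornerMXaddC; apply: PD; last first.
  by have := polyOverP pS 0%N; rewrite coefD coefMX coefC /= add0r; exact: PS.
apply: PM => //; apply: IHp; apply/polyOverP => i.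
by have := polyOverP pS i.+1; rewrite coefD coefMX coefC /= addr0.
Qed.
End Noetherian.

Section Krull.
Variables (K : fieldType) (T : pointedType) (y z : seq (T -> K)) (t0 : T).

(** The algebra generated by the functions [y], and the powers of its ideal
    generated by the functions [z]. *)
Inductive algebra_gen : (T -> K) -> Prop :=
| algebra_const c : algebra_gen (fun=> c)
| algebra_mem f : f \in y -> algebra_gen f
| algebra_add f g : algebra_gen f -> algebra_gen g -> algebra_gen (f \+ g)
| algebra_mul f g : algebra_gen f -> algebra_gen g -> algebra_gen (f \* g).

Inductive ideal_power : nat -> (T -> K) -> Prop :=
| ideal_power0 f : algebra_gen f -> ideal_power 0 f
| ideal_power_zero n : ideal_power n.+1 (fun=> 0)
| ideal_power_add n f g :
    ideal_power n.+1 f -> ideal_power n.+1 g -> ideal_power n.+1 (f \+ g)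
| ideal_powerS n f g : f \in z -> ideal_power n g -> ideal_power n.+1 (f \* g).

Lemma algebra_sum I (r : seq I) (F : I -> T -> K) :
  (forall i, algebra_gen (F i)) -> algebra_gen (fun t => \sum_(i <- r) F i t).
Proof.
move=> FA; elim: r => [|i r IH].
  rewrite (_ : (fun _ => _) = (fun=> 0)); first exact: algebra_const.
  by apply/funext => t; rewrite big_nil.
rewrite (_ : (fun _ => _) = F i \+ (fun t => \sum_(j <- r) F j t)).
  exact: algebra_add.
by apply/funext => t; rewrite big_cons.
Qed.

(** Krull's intersection theorem.  In the Rees algebra, generated by [y] and by
    the functions ['X * f] for [f] in [z], the ideal generated by all the
    [q * 'X^n] is finitely generated. *)
Theorem krull_intersection (q : T -> K) :
  {in z, forall f, algebra_gen f /\ f t0 = 0} ->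
  (forall n, ideal_power n q) ->
  exists a, [/\ algebra_gen a, a t0 = 0 & forall t, q t = a t * q t].
Proof.
move=> zA qz; pose B : comNzRingType := T -> {poly K}.
pose S0 : {pred B} := fun f => `[< exists c : K, f = (fun=> c%:P) >].
have cl : GRing.subring_closed S0.
  split; first by apply/asboolP; exists 1.
  - move=> _ _ /asboolP[c ->] /asboolP[d ->]; apply/asboolP; exists (c - d).
    by apply/funext => t; rewrite /= polyCB.
  - move=> _ _ /asboolP[c ->] /asboolP[d ->]; apply/asboolP; exists (c * d).
    by apply/funext => t; rewrite polyCM.
pose S : subringClosed B := HB.pack_for (subringClosed B) S0
  (GRing.isSubringClosed.Build B S0 cl).
have SE f : (f \in S) = `[< exists c : K, f = (fun=> c%:P) >] by [].
have nS : noetherian S.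
  move=> s sS; have [s0|s0] := eqVneq (s 0%N) 0.
    exists 0%N, (fun=> 0); split=> [n|]; first exact: rpred0.
    by rewrite big_ord0.
  have : s 0%N \in S by [].
  rewrite SE => /asboolP[c sc]; have : s 1%N \in S by [].
  rewrite SE => /asboolP[d sd].
  have c0 : c != 0 by apply: contra_neq s0 => c0; rewrite sc c0.
  exists 1%N, (fun=> (fun=> (d / c)%:P)); split=> [n|].
    by rewrite SE; apply/asboolP; exists (d / c).
  rewrite big_ord1 sc sd; apply/funext => t.
  by rewrite -[RHS]/((d / c)%:P * c%:P) -polyCM divfK.
pose cst f : B := fun t : T => (f t)%:P.
pose shift f : B := fun t : T => f t *: 'X.
have [S' [nS' SS' gS' S'P]] := noetherian_fg (map cst y ++ map shift z) nS.
have algS f : algebra_gen f -> cst f \in S'.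
  elim=> [c|g gy|g h _ gS _ hS|g h _ gS _ hS].
  - by apply: SS'; rewrite SE; apply/asboolP; exists c.
  - by apply: gS'; rewrite mem_cat map_f.
  - rewrite (_ : cst _ = cst g + cst h) ?rpredD //.
    by apply/funext => t; rewrite /cst /= polyCD.
  - rewrite (_ : cst _ = cst g * cst h) ?rpredM //.
    by apply/funext => t; rewrite /cst /= polyCM.
have reesS n f : ideal_power n f -> (fun t => f t *: 'X^n : {poly K}) \in S'.
  elim=> [g /algS gS|m|m g h _ gS _ hS|m g h gz _ hS].
  - by rewrite (_ : (fun _ => _) = cst g) //; apply/funext => t; rewrite alg_polyC.
  - rewrite (_ : (fun _ => _) = (0 : B)) ?rpred0 //.
    by apply/funext => t; rewrite scale0r.
  - rewrite -[X in X \in _]/(fun t => (g t + h t) *: 'X^(m.+1) : {poly K}).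
    rewrite (_ : (fun _ => _) = ((fun t => g t *: 'X^(m.+1)) : B) + (fun t => h t *: 'X^(m.+1))).
      exact: rpredD.
    by apply/funext => t; rewrite scalerDl.
  - rewrite (_ : (fun _ => _) = shift g * ((fun t => h t *: 'X^m) : B)).
      by apply: rpredM => //; apply: gS'; rewrite mem_cat orbC map_f.
    apply/funext => t; rewrite -[RHS]/(g t *: 'X * (h t *: 'X^m)) /=.
    by rewrite -scalerAl -scalerAr scalerA -exprS.
have [N [c [cS E]]] := nS' (fun n => fun t => q t *: 'X^n) (fun n => reesS n q (qz n)).
pose P (f : B) := (exists d : K, f t0 = d%:P) /\ forall i, algebra_gen (fun t => (f t)`_i).
have Pc f : f \in S' -> P f.
  apply: S'P.
  - move=> g; rewrite SE => /asboolP[d ->]; split; first by exists d.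
    move=> i; rewrite (_ : (fun _ => _) = (fun=> (d%:P)`_i)) //; exact: algebra_const.
  - move=> g; rewrite mem_cat => /orP[/mapP[h hy ->]|/mapP[h hz ->]].
      split; first by exists (h t0).
      case=> [|i]; rewrite /cst.
        rewrite (_ : (fun _ => _) = h); first exact: algebra_mem.
        by apply/funext => t; rewrite coefC.
      rewrite (_ : (fun _ => _) = (fun=> 0)); first exact: algebra_const.
      by apply/funext => t; rewrite coefC.
    have [hA h0] := zA h hz; split; first by exists 0; rewrite /shift h0 scale0r.
    move=> i; rewrite (_ : (fun _ => _) = h \* (fun=> (i == 1%N)%:R)).
      by apply: algebra_mul => //; exact: algebra_const.
    by apply/funext => t; rewrite /shift coefZ coefX.
  - move=> f1 f2 [[d1 e1] A1] [[d2 e2] A2]; split.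
      by exists (d1 + d2); rewrite -[LHS]/(f1 t0 + f2 t0) e1 e2 polyCD.
    move=> i; rewrite (_ : (fun _ => _) = (fun t => (f1 t)`_i) \+ (fun t => (f2 t)`_i)).
      exact: algebra_add.
    by apply/funext => t; rewrite -[LHS]/((f1 t + f2 t)`_i) coefD.
  - move=> f1 f2 [[d1 e1] A1] [[d2 e2] A2]; split.
      by exists (d1 * d2); rewrite -[LHS]/(f1 t0 * f2 t0) e1 e2 polyCM.
    move=> i; pose F (j : 'I_i.+1) t := (f1 t)`_j * (f2 t)`_(i - j).
    rewrite (_ : (fun _ => _) = (fun t => \sum_j F j t)).
      by apply: algebra_sum => j; apply: algebra_mul.
    by apply/funext => t; rewrite -[LHS]/((f1 t * f2 t)`_i) coefM.
(* compare the coefficients of ['X^N] in the relation [q 'X^N = sum_(i < N) c_i q 'X^i] *)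
exists (fun t => \sum_(i < N) (c i t)`_(N - i)); split.
- by apply: algebra_sum => i; case: (Pc (c i) (cS i)).
- rewrite big1 // => i _; have [[d ->] _] := Pc _ (cS i); rewrite coefC.
  by rewrite subn_eq0 leqNgt ltn_ord.
- move=> t; have := congr1 (fun f : B => (f t)`_N) E.
  rewrite coefZ coefXn eqxx mulr1 => qE; rewrite [LHS]qE.
  rewrite (_ : (\sum_(i < N) _) t = \sum_(i < N) c i t * (q t *: 'X^i)); last first.
    by rewrite fct_sumE.
  rewrite coef_sum mulr_suml; apply: eq_bigr => i _.
  by rewrite -scalerAr coefZ coefMXn ltnNge (ltnW (ltn_ord i)) /= mulrC.
Qed.
End Krull.

(** * Nilpotent matrices and Engel's theorem *)

Section Nilpotent.
Variable K : closedFieldType.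

Lemma eigenvalue_nilpotent n (x : 'M[K]_n) m a : x ^+ m = 0 -> eigenvalue x a -> a = 0.
Proof.
move=> xm /eigenvalueP[v vx v0].
have E i : v *m x ^+ i = a ^+ i *: v.
  elim: i => [|i IH]; first by rewrite !expr0 scale1r mulmx1.
  by rewrite !exprSr [x ^+ i * x]/(_ *m _) mulmxA IH -scalemxAl vx scalerA.
have := E m; rewrite xm mulmx0 => /esym/eqP; rewrite scaler_eq0 (negPf v0) orbF.
by rewrite expf_eq0 => /andP[_ /eqP].
Qed.

Lemma char_poly_eigen n (x : 'M[K]_n) (s : seq K) :
  char_poly x = \prod_(z <- s) ('X - z%:P) -> forall a, (a \in s) = eigenvalue x a.
Proof. by move=> E a; rewrite eigenvalue_root_char E root_prod_XsubC. Qed.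

Lemma char_poly_split n (x : 'M[K]_n) : exists s, char_poly x = \prod_(z <- s) ('X - z%:P) /\ size s = n.
Proof.
have [s] := closed_field_poly_normal (char_poly x).
rewrite (monicP (char_poly_monic x)) scale1r => E; exists s; split=> //.
by apply: succn_inj; rewrite -(size_char_poly x) E size_prod_XsubC.
Qed.

Lemma char_poly_nilpotent n (x : 'M[K]_n) : (forall a, eigenvalue x a -> a = 0) ->
  char_poly x = 'X^n.
Proof.
move=> ev0; have [s [E sn]] := char_poly_split x.
have -> : char_poly x = \prod_(z <- s) 'X.
  rewrite E; apply: eq_big_seq => z zs.
  by rewrite (ev0 z) ?subr0 // -(char_poly_eigen E).
by rewrite big_const_seq count_predT sn -Monoid.iteropE.
Qed.

Lemma nilpotentP n (x : 'M[K]_n) : (exists m, x ^+ m = 0) <-> (forall a, eigenvalue x a -> a = 0).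
Proof.
split=> [[m xm] a|ev0]; first exact: eigenvalue_nilpotent xm.
exists n; case: n x ev0 => [|n] x /char_poly_nilpotent E.
  by apply/matrixP => -[].
have := Cayley_Hamilton x; rewrite E rmorphXn /= horner_mx_X; exact.
Qed.

Lemma nilpotent_trace n (x : 'M[K]_n) m : x ^+ m = 0 -> \tr x = 0.
Proof.
case: n x => [|n] x xm; first by rewrite /mxtrace big_ord0.
apply/eqP; rewrite -oppr_eq0 -char_poly_trace // char_poly_nilpotent.
  by rewrite coefXn ltn_eqF.
by move=> a; exact: eigenvalue_nilpotent xm.
Qed.
End Nilpotent.

Lemma unitmx_add_nilpotent (K : fieldType) n (x : 'M[K]_n) m :
  x ^+ m = 0 -> 1%:M + x \in unitmx.
Proof.
move=> xm; have := subrX1 (- x) m.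
have -> : (- x) ^+ m = 0 by rewrite exprNn xm mulr0.
rewrite sub0r => /(congr1 -%R); rewrite opprK -mulNr opprD !opprK addrC => /esym.
by case/mulmx1_unit.
Qed.

Section Subquotient.
Variable K : fieldType.

(** Coordinates on the quotient of [U2] by [U1]: the rows of [B] lift a basis, and
    [B'] sends a row of [U2] to its coordinates. *)
Definition subquotient n m (U1 U2 : 'M[K]_n) (B : 'M_(m, n)) (B' : 'M_(n, m)) :=
  [/\ B *m B' = 1%:M, U1 *m B' = 0, (B <= U2)%MS &
      forall p (v : 'M_(p, n)), (v <= U2)%MS -> (v - v *m B' *m B <= U1)%MS].

Lemma exists_subquotient n (U1 U2 : 'M[K]_n) : (U1 <= U2)%MS ->
  exists m (B : 'M_(m, n)) (B' : 'M_(n, m)), subquotient U1 U2 B B' /\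
    (m + \rank U1 = \rank U2)%N.
Proof.
move=> U12; pose C := (U2 :\: U1)%MS; pose B := row_base C.
have C0 : (C :&: U1)%MS = 0 by exact: capmx_diff.
have E : (U2 :&: U1 :=: U1)%MS by apply/capmx_idPr.
have U2E : (U2 <= C + U1)%MS by rewrite -(addsmx_diff_cap_eq U2 U1) addsmxS ?E.
have BC : (B <= C)%MS by rewrite eq_row_base.
exists _, B, (proj_mx C U1 *m pinvmx B); split; last first.
  by rewrite addnC -(mxrank_cap_compl U2 U1) E.
split.
- by rewrite mulmxA proj_mx_id // mulmxVp // row_base_free.
- by rewrite mulmxA proj_mx_0 // mul0mx.
- by rewrite eq_row_base diffmxSl.
- move=> p v vU2; rewrite mulmxA mulmxKpV; last by rewrite eq_row_base proj_mx_sub.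
  by apply: proj_mx_compl_sub; apply: submx_trans U2E.
Qed.

Section SubquotientTheory.
Variables (n m : nat) (U1 U2 : 'M[K]_n) (B : 'M[K]_(m, n)) (B' : 'M[K]_(n, m)).
Hypothesis sq : subquotient U1 U2 B B'.

Definition stable (x : 'M[K]_n) := (U1 *m x <= U1)%MS /\ (U2 *m x <= U2)%MS.

Definition subq (x : 'M[K]_n) : 'M_m := B *m x *m B'.

Lemma subqM x y : stable x -> stable y -> subq (x *m y) = subq x *m subq y.
Proof.
case: sq => BB U1B BU2 comp [x1 x2] [y1 y2]; rewrite /subq.
apply/eqP; rewrite -subr_eq0 !mulmxA -mulmxBl -mulmxBl.
have /submxP[D ->] : (B *m x - B *m x *m B' *m B <= U1)%MS.
  by apply: comp; rewrite (submx_trans (submxMr _ BU2)).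
by rewrite -!mulmxA (mulmxA U1); case/submxP: y1 => D' ->; rewrite -!mulmxA U1B !mulmx0.
Qed.

Lemma subq_linear a x y : subq (a *: x + y) = a *: subq x + subq y.
Proof. by rewrite /subq mulmxDr mulmxDl -scalemxAr -scalemxAl. Qed.

Lemma subqB x y : subq (x - y) = subq x - subq y.
Proof. by rewrite /subq mulmxBr mulmxBl. Qed.

Lemma subq1 : subq 1%:M = 1%:M.
Proof. by case: sq => BB _ _ _; rewrite /subq mulmx1. Qed.

Lemma stableM x y : stable x -> stable y -> stable (x *m y).
Proof.
move=> [x1 x2] [y1 y2]; split; rewrite mulmxA.
  exact: submx_trans (submxMr _ x1) y1.
exact: submx_trans (submxMr _ x2) y2.
Qed.

Lemma stable1 : stable 1%:M. Proof. by split; rewrite mulmx1. Qed.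

Lemma stableX x k : stable x -> stable (x ^+ k).
Proof.
move=> xs; elim: k => [|k IH]; first exact: stable1.
by rewrite exprS; exact: stableM.
Qed.

Lemma subqX x k : stable x -> subq (x ^+ k) = subq x ^+ k.
Proof.
move=> xs; elim: k => [|k IH]; first exact: subq1.
by rewrite !exprS -[RHS]/(subq x *m _) -IH -subqM //; exact: stableX.
Qed.

Lemma subq_nilpotent x k : stable x -> x ^+ k = 0 -> subq x ^+ k = 0.
Proof. by move=> xs xk; rewrite -subqX // xk /subq mulmx0 mul0mx. Qed.

Lemma subq_row p (v : 'M_(p, m)) : (v *m B <= U2)%MS.
Proof. by case: sq => _ _ BU2 _; rewrite (submx_trans (submxMl _ _)). Qed.

Lemma subq_eq0 x : stable x -> subq x = 0 <-> (U2 *m x <= U1)%MS.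
Proof.
case: sq => BB U1B BU2 comp [x1 x2]; split=> [x0|x0].
  have U2E : (U2 <= U1 + B)%MS.
    rewrite -[U2 in X in (X <= _)%MS](subrK (U2 *m B' *m B)) addmx_sub_adds //.
      exact: comp.
    exact: submxMl.
  apply: submx_trans (submxMr x U2E) _.
  rewrite addsmxMr addsmx_sub x1 /=.
  have : (B *m x - B *m x *m B' *m B <= U1)%MS.
    by apply: comp; rewrite (submx_trans (submxMr _ BU2)).
  by rewrite -/(subq x) x0 mul0mx subr0.
have /submxP[D] : (B *m x <= U1)%MS by rewrite (submx_trans (submxMr _ BU2)).
by rewrite /subq => ->; rewrite -mulmxA U1B mulmx0.
Qed.

Lemma subq_faithful p (v : 'M_(p, n)) : (v <= U2)%MS -> v *m B' = 0 -> (v <= U1)%MS.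
Proof. by case: sq => _ _ _ comp /comp + v0; rewrite v0 mul0mx subr0. Qed.
End SubquotientTheory.
End Subquotient.

Section LieSets.
Variable K : closedFieldType.

Definition lie_linear n (L : set 'M[K]_n) :=
  L 0 /\ forall a u v, L u -> L v -> L (a *: u + v).

Lemma lie_linear_mx n (L : set 'M[K]_n) : lie_linear L ->
  exists A : 'M[K]_(n * n), forall u, L u <-> (mxvec u <= A)%MS.
Proof.
move=> [L0 Ll].
have [|A AE] := @linear_set_mx _ _ [set v | L (vec_mx v)].
  by split=> [|a u v Lu Lv] /=; rewrite ?linear0 // linearP; exact: Ll.
by exists A => u; rewrite -AE /= mxvecK.
Qed.

Definition bracket n (x y : 'M[K]_n) := x *m y - y *m x.

Definition lmulx n (x : 'M[K]_n) : 'M[K]_(n * n) := lin_mx (mulmx x).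
Definition rmulx n (x : 'M[K]_n) : 'M[K]_(n * n) := lin_mx (mulmxr x).
Definition admx n (x : 'M[K]_n) : 'M[K]_(n * n) := lmulx x - rmulx x.

Lemma mul_lmulx n (x b : 'M[K]_n) : mxvec b *m lmulx x = mxvec (x *m b).
Proof. by rewrite mul_vec_lin. Qed.

Lemma mul_rmulx n (x b : 'M[K]_n) : mxvec b *m rmulx x = mxvec (b *m x).
Proof. by rewrite mul_vec_lin. Qed.

Lemma mul_admx n (x b : 'M[K]_n) : mxvec b *m admx x = mxvec (bracket x b).
Proof. by rewrite mulmxBr mul_lmulx mul_rmulx -linearB. Qed.

Lemma mxvec_ext p n (A B : 'M[K]_(n * n, p)) :
  (forall b : 'M[K]_n, mxvec b *m A = mxvec b *m B) -> A = B.
Proof.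
by move=> E; apply/row_matrixP => i; rewrite !rowE -[delta_mx 0 i]vec_mxK E.
Qed.

Lemma comm_lr n (x y : 'M[K]_n) : lmulx x *m rmulx y = rmulx y *m lmulx x.
Proof.
by apply: mxvec_ext => b; rewrite !mulmxA !(mul_lmulx, mul_rmulx) mulmxA.
Qed.

Lemma lmulxX n (x b : 'M[K]_n) k : mxvec b *m lmulx x ^+ k = mxvec (x ^+ k *m b).
Proof.
elim: k => [|k IH]; first by rewrite !expr0 mulmx1 mul1mx.
rewrite exprSr [X in _ *m X]/(_ *m _) mulmxA IH mul_lmulx mulmxA.
by rewrite -[x *m x ^+ k]/(x * _) -exprS.
Qed.

Lemma rmulxX n (x b : 'M[K]_n) k : mxvec b *m rmulx x ^+ k = mxvec (b *m x ^+ k).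
Proof.
elim: k => [|k IH]; first by rewrite !expr0 !mulmx1.
rewrite exprSr [X in _ *m X]/(_ *m _) mulmxA IH mul_rmulx -mulmxA.
by rewrite -[x ^+ k *m x]/(_ * x) -exprSr.
Qed.

(** Left and right multiplications commute, so each term of the binomial expansion
    contains a high power of one of the two factors. *)
Lemma lr_nilpotent n (x y b : 'M[K]_n) k : x ^+ k *m b = 0 -> b *m y ^+ k = 0 ->
  mxvec b *m (lmulx x - rmulx y) ^+ (k + k) = 0.
Proof.
move=> xb by0; have LR : GRing.comm (lmulx x) (rmulx y) by exact: comm_lr.
have bL : mxvec b *m lmulx x ^+ k = 0 by rewrite lmulxX xb linear0.
have bR : mxvec b *m rmulx y ^+ k = 0 by rewrite rmulxX by0 linear0.
have kill (A C : 'M[K]_(n * n)) : mxvec b *m A ^+ k = 0 ->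
    forall j, (k <= j)%N -> mxvec b *m (A ^+ j * C) = 0.
  move=> bA j kj; rewrite -(subnKC kj) exprD -mulrA.
  by rewrite -[_ * _]/(A ^+ k *m _) mulmxA bA mul0mx.
rewrite exprBn_comm // mulmx_sumr big1 // => i _.
rewrite -[_ *+ _]scaler_nat -scalemxAr; apply/eqP; rewrite scaler_eq0; apply/orP; right.
have [ki|ik] := leqP k i.
  have -> : (-1) ^+ i * lmulx x ^+ (k + k - i) * rmulx y ^+ i =
     rmulx y ^+ i * ((-1) ^+ i * lmulx x ^+ (k + k - i)).
    apply: commr_sym; apply: commrM; first exact: commr_sign.
    by apply/commr_sym/commrX/commr_sym/commrX.
  by rewrite kill.
rewrite -(commr_sign (lmulx x ^+ _) i) -mulrA kill //.
by rewrite -addnBA ?leq_addr // ltnW.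
Qed.

Lemma admx_nilpotent n (x : 'M[K]_n) k : x ^+ k = 0 -> admx x ^+ (k + k) = 0.
Proof.
move=> xk; apply: mxvec_ext => b; rewrite mulmx0.
by apply: lr_nilpotent; rewrite xk ?mul0mx ?mulmx0.
Qed.

Definition lie_closed n (L : set 'M[K]_n) := forall u v, L u -> L v -> L (bracket u v).

(** Engel's theorem.  Some [y] outside a maximal proper subalgebra [H] satisfies
    [[H, y] <= H], by induction applied to the action of [H] on [L / H]. *)
Theorem engel n (L : set 'M[K]_n) : (0 < n)%N -> lie_linear L -> lie_closed L ->
  (forall x, L x -> exists k, x ^+ k = 0) ->
  exists2 v : 'rV[K]_n, v != 0 & forall x, L x -> v *m x = 0.
Proof.
move=> n0 Ll; have [A AE] := lie_linear_mx Ll.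
have [d] := ubnP (\rank A); elim: d n n0 L Ll A AE => // d IH n n0 L Ll A AE rA Lb Lnil.
pose P (r : nat) := `[< exists (H : set 'M[K]_n) (C : 'M[K]_(n * n)), [/\ forall u, H u <-> (mxvec u <= C)%MS, lie_linear H, lie_closed H & H `<=` L]
  /\ (\rank C < \rank A)%N /\ \rank C = r >].
have [A0|A0] := eqVneq A 0.
  exists (const_mx 1); last first.
    by move=> x /AE; rewrite A0 submx0 mxvec_eq0 => /eqP ->; rewrite mulmx0.
  by apply/eqP => /rowP/(_ (Ordinal n0)) /eqP; rewrite !mxE oner_eq0.
have exP : exists r, P r.
  exists 0%N; apply/asboolP; exists [set 0], 0; rewrite mxrank0 lt0n mxrank_eq0; split=> //; split=> //.
  - by move=> u; rewrite submx0 mxvec_eq0; split=> [->|/eqP].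
  - by split=> // a u v -> ->; rewrite scaler0 addr0.
  - by move=> u v -> ->; rewrite /bracket mul0mx subrr.
  - by move=> u ->; case: Ll.
have Pb r : P r -> (r <= n * n)%N by move=> /asboolP[H [C [_ [_ <-]]]]; exact: rank_leq_col.
case: (ex_maxnP exP Pb) => r /asboolP[H [C [[CE Hl Hb HL] [rC rE]]]] rmax.
have CA : (C <= A)%MS.
  by apply/row_subP => i; rewrite -[row i C]vec_mxK; apply/AE/HL/CE; rewrite vec_mxK row_sub.
have [m [B [B' [sq mE]]]] := exists_subquotient CA.
have m0 : (0 < m)%N by rewrite -(ltn_add2r (\rank C)) mE add0n.
have st h : H h -> stable C A (admx h).
  move=> Hh; split; apply/row_subP => i; rewrite row_mul.
    rewrite -[row i C]vec_mxK mul_admx; apply/CE/Hb => //.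
    by apply/CE; rewrite vec_mxK row_sub.
  rewrite -[row i A]vec_mxK mul_admx; apply/AE/Lb; first exact: HL.
  by apply/AE; rewrite vec_mxK row_sub.
(* [H], of maximal rank among the proper subalgebras, acts on [L / H] *)
pose L' : set 'M[K]_m := [set z | exists2 h, H h & z = subq B B' (admx h)].
have ad_linear a u v : admx (a *: u + v) = a *: admx u + admx v.
  apply: mxvec_ext => b; rewrite [LHS]mul_admx [RHS]mulmxDr -scalemxAr !mul_admx.
  transitivity (mxvec (a *: bracket u b + bracket v b)); last by rewrite linearP.
  congr mxvec; rewrite /bracket mulmxDl mulmxDr -scalemxAl -scalemxAr.
  by rewrite scalerBr opprD addrACA.
have ad0 : admx 0 = 0 :> 'M_(n * n).
  apply: mxvec_ext => b; rewrite mul_admx mulmx0 /bracket mul0mx mulmx0 subrr.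
  by rewrite linear0.
have ad_bracket u v : admx (bracket u v) = bracket (admx v) (admx u).
  apply: mxvec_ext => b; rewrite [LHS]mul_admx {2}/bracket [RHS]mulmxBr !mulmxA !mul_admx.
  transitivity (mxvec (bracket u (bracket v b) - bracket v (bracket u b))); last by rewrite linearB.
  congr mxvec; rewrite /bracket.
  rewrite !(mulmxBr, mulmxBl) !mulmxA.
  move: (u *m v *m b) (v *m u *m b) (b *m u *m v) (b *m v *m u) (u *m b *m v) (v *m b *m u).
  by move=> *; apply/matrixP => i j; rewrite !mxE; ring.
have L'l : lie_linear L'.
  split; first by exists 0; [case: Hl|rewrite ad0 /subq mulmx0 mul0mx].
  move=> a _ _ [h Hh ->] [h' Hh' ->]; exists (a *: h + h'); first by case: Hl => _; apply.
  by rewrite ad_linear subq_linear.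
have L'b : lie_closed L'.
  move=> _ _ [h Hh ->] [h' Hh' ->]; exists (bracket h' h); first exact: Hb.
  have sthh : stable C A (admx h *m admx h') by apply: stableM; exact: st.
  rewrite ad_bracket /bracket -(subqM sq (st _ Hh) (st _ Hh')) -(subqM sq (st _ Hh') (st _ Hh)).
  by rewrite subqB.
have L'nil z : L' z -> exists k, z ^+ k = 0.
  move=> [h Hh ->]; have [k hk] := Lnil h (HL _ Hh); exists (k + k)%N.
  by apply: (subq_nilpotent sq (st _ Hh)); exact: admx_nilpotent.
have [A' A'E] := lie_linear_mx L'l.
have rA' : (\rank A' < d)%N.
  apply: (@leq_ltn_trans (\rank C)); last by rewrite (leq_trans rC) // -ltnS.
  pose F (u : 'rV_(n * n)) : 'rV_(m * m) := mxvec (subq B B' (admx (vec_mx u))).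
  have Flin : linear F.
    move=> a u v; rewrite /F (linearP vec_mx) ad_linear subq_linear.
    by rewrite (linearP mxvec).
  pose Fl : {linear 'rV_(n * n) -> 'rV_(m * m)} :=
    HB.pack_for {linear 'rV_(n * n) -> 'rV_(m * m)} F (GRing.isLinear.Build _ _ _ _ F Flin).
  apply: (@leq_trans (\rank (C *m lin1_mx Fl))); last exact: mxrankM_maxl.
  apply: mxrankS; apply/row_subP => i.
  have [h Hh E] : L' (vec_mx (row i A')) by apply/A'E; rewrite vec_mxK row_sub.
  rewrite -[row i A']vec_mxK E (_ : mxvec _ = mxvec h *m lin1_mx Fl); last first.
    by rewrite mul_rV_lin1 /= /F mxvecK.
  by apply: submxMr; apply/CE.
have [w w0 wL'] := IH m m0 L' L'l A' A'E rA' L'b L'nil.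
pose y : 'M_n := vec_mx (w *m B).
have Ly : L y by apply/AE; rewrite vec_mxK; exact: (subq_row sq).
have Hy : ~ H y.
  move=> /CE; rewrite vec_mxK => /submxP[D E]; move/eqP: w0; apply.
  have [BB U1B _ _] := sq.
  by rewrite -[w]mulmx1 -BB mulmxA E -mulmxA U1B mulmx0.
have bHy h : H h -> H (bracket h y).
  move=> Hh; apply/CE; rewrite -mul_admx vec_mxK.
  apply: (subq_faithful sq); last by rewrite -!mulmxA (mulmxA B) wL' //; exists h.
  by have [_] := st _ Hh; apply: submx_trans; apply: submxMr; exact: (subq_row sq).
have [H0 Hlin] := Hl.
have HD u v : H u -> H v -> H (u + v) by move=> Hu Hv; rewrite -[u]scale1r; apply: Hlin.
have HZ a u : H u -> H (a *: u) by move=> Hu; rewrite -[_ *: _]addr0; apply: Hlin.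
have HN u : H u -> H (- u) by move=> Hu; rewrite -scaleN1r; apply: HZ.
pose H' : set 'M_n := [set z | exists a h, H h /\ z = a *: y + h].
have H'L : H' `<=` L by move=> _ [a [h [/HL Lh ->]]]; case: Ll => _; apply.
have H'E u : H' u <-> (mxvec u <= C + mxvec y)%MS.
  split=> [[a [h [/CE hC ->]]]|/sub_addsmxP[[p q] /= E]].
    rewrite linearP /= addrC addmx_sub_adds // scalemx_sub //.
  exists (q 0 0), (vec_mx (p *m C)); split; first by apply/CE; rewrite vec_mxK submxMl.
  apply: (can_inj mxvecK); rewrite E linearP /= vec_mxK addrC; congr (_ + _).
  by apply/rowP => j; rewrite !mxE big_ord1.
have H'l : lie_linear H'.
  split; first by exists 0, 0; rewrite scale0r addr0.
  move=> a _ _ [b [h [Hh ->]]] [b' [h' [Hh' ->]]]; exists (a * b + b'), (a *: h + h').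
  by split; [exact: Hlin|rewrite scalerDr scalerA scalerDl addrACA].
have H'b : lie_closed H'.
  move=> _ _ [b [h [Hh ->]]] [b' [h' [Hh' ->]]]; exists 0, (b' *: bracket h y - b *: bracket h' y + bracket h h').
  split.
    exact: HD _ _ (HD _ _ (HZ _ _ (bHy _ Hh)) (HN _ (HZ _ _ (bHy _ Hh')))) (Hb _ _ Hh Hh').
  rewrite scale0r add0r /bracket !(mulmxDl, mulmxDr) -!scalemxAl -!scalemxAr.
  move: (y *m y) (h *m y) (y *m h) (h' *m y) (y *m h') (h *m h') (h' *m h).
  by move=> *; apply/matrixP => i j; rewrite !mxE; ring.
have rC' : (\rank C < \rank (C + mxvec y)%MS)%N.
  rewrite ltn_neqAle mxrankS ?addsmxSl // andbT; apply/negP => E; apply: Hy.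
  apply/CE; apply: (submx_trans (addsmxSr C (mxvec y))).
  by rewrite -(geq_leqif (mxrank_leqif_sup (addsmxSl C (mxvec y)))) (eqP E).
have LH' u : L u -> H' u.
  move=> Lu; apply/H'E; have C'A : (C + mxvec y <= A)%MS by rewrite addsmx_sub CA; apply/AE.
  have : (mxvec u <= A)%MS by apply/AE.
  move=> uA; apply: submx_trans uA _.
  rewrite -(geq_leqif (mxrank_leqif_sup C'A)) leqNgt; apply/negP => rC'A.
  have /rmax : P (\rank (C + mxvec y)%MS) by apply/asboolP; exists H', (C + mxvec y)%MS.
  by rewrite -rE leqNgt rC'.
have [|z z0 zH] := IH n n0 H Hl C CE _ Hb (fun x Hx => Lnil x (HL x Hx)).
  by rewrite (leq_trans rC) // -ltnS.
(* the vectors killed by [H] are stable under [y] *)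
have zyH j h : H h -> z *m y ^+ j *m h = 0.
  elim: j h => [|j IHj] h Hh; first by rewrite expr0 mulmx1 zH.
  have -> : z *m y ^+ j.+1 *m h = z *m y ^+ j *m h *m y - z *m y ^+ j *m bracket h y.
    rewrite /bracket mulmxBr !mulmxA opprB addrC subrK.
    by rewrite exprSr -[y ^+ j * y]/(_ *m _) mulmxA.
  by rewrite (IHj _ Hh) (IHj _ (bHy _ Hh)) mul0mx subrr.
have [k yk] := Lnil y Ly.
have exj : exists j, z *m y ^+ j == 0 by exists k; rewrite yk mulmx0.
case: (ex_minnP exj) => -[|j] /eqP zj jmin.
  by move: z0; rewrite -[z]mulmx1 -[1%:M]/(1 : 'M_n) -(expr0 y) zj eqxx.
exists (z *m y ^+ j); first by apply/negP => /jmin; rewrite ltnn.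
move=> x /LH' [a [h [Hh ->]]]; rewrite mulmxDr (zyH _ _ Hh) addr0 -scalemxAr.
by rewrite -mulmxA -[y ^+ j *m y]/(_ * y) -exprSr zj scaler0.
Qed.
End LieSets.

(** * Cartan's criterion *)

Section RationalFunctional.
Variable K : fieldType.
Hypothesis char0 : [pchar K] =i pred0.

Lemma intr_eq0_char0 (n : int) : ((n%:~R : K) == 0) = (n == 0).
Proof.
have nE m : ((m%:R : K) == 0) = (m == 0%N) by rewrite (proj1 (pcharf0P _) char0).
by case: n => n; rewrite ?NegzE ?rmorphN ?oppr_eq0 /= nE.
Qed.

Lemma mulrz_eq0_char0 (a : K) n : (a *~ n == 0) = (a == 0) || (n == 0).
Proof. by rewrite -mulrzr mulf_eq0 intr_eq0_char0. Qed.

(** A subgroup maximal among those that contain no nonzero multiple of [a] is the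
    kernel of a map to the rationals. *)
Lemma rational_functional (a : K) : a != 0 ->
  exists f : K -> rat, f a != 0 /\ (forall u v, f (u - v) = f u - f v).
Proof.
move=> a0.
pose good (H : set K) := (H 0 /\ forall u v, H u -> H v -> H (u - v)) /\
  forall n : int, H (a *~ n) -> n = 0.
pose P (H : set K) := H = set0 \/ good H.
have chain (X : set (set K)) : (X `<=` P)%classic -> total_on X subset ->
    P (\bigcup_(Y in X) Y)%classic.
  move=> XP Xt; have [[Y [XY [[Y0 Yl] Ya]]]|noY] := pselect (exists Y, X Y /\ good Y).
    right; split; [split; first by exists Y|].
      move=> u v [Y1 XY1 Y1u] [Y2 XY2 Y2v].
      have [Z [XZ Zu Zv]] : exists Z, [/\ X Z, Z u & Z v].
        by case: (Xt _ _ XY1 XY2) => S; [exists Y2|exists Y1]; split=> //; exact: S.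
      have [Z0|[[_ Zl] _]] := XP _ XZ; first by rewrite Z0 in Zu.
      by exists Z => //; apply: Zl.
    move=> n [Z XZ Zn]; have [Z0|[_ Za]] := XP _ XZ; first by rewrite Z0 in Zn.
    exact: Za.
  left; apply/seteqP; split=> // x [Y XY Yx].
  have [Y0|gY] := XP _ XY; first by rewrite Y0 in Yx.
  by case: noY; exists Y.
have [H [PH Hmax]] := Zorn_bigcup chain.
have [H0|[[H0 Hl] Ha]] := PH.
  exfalso; apply: (Hmax [set 0]); last first.
    right; split; first by split=> // u v -> ->; rewrite subrr.
    by move=> n /eqP; rewrite mulrz_eq0_char0 (negPf a0) => /eqP.
  by rewrite H0; split=> // /(_ 0); apply.
have HN u : H u -> H (- u) by move=> Hu; rewrite -sub0r; apply: Hl.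
have HD u v : H u -> H v -> H (u + v) by move=> Hu Hv; rewrite -[v]opprK; apply: Hl => //; apply: HN.
have HMn u n : H u -> H (u *+ n).
  by move=> Hu; elim: n => [|n IH]; rewrite ?mulr0n // mulrS; apply: (HD _ _ Hu IH).
have HM u (n : int) : H u -> H (u *~ n).
  move=> Hu; case: n => n; first exact: HMn.
  by rewrite NegzE mulrNz; exact/HN/HMn.
have ex v : exists n m : int, n != 0 /\ H (v *~ n - a *~ m).
  apply: contrapT => nov.
  pose H' : set K := [set z | exists (i : int) h, H h /\ z = h + v *~ i].
  have : P H'.
    right; split; [split|].
    - by exists 0, 0; rewrite mulr0z addr0.
    - move=> _ _ [i [h [Hh ->]]] [j [h' [Hh' ->]]]; exists (i - j), (h - h').
      by split; [exact: Hl|rewrite mulrzBr opprD addrACA].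
    - move=> n [i [h [Hh E]]]; have [i0|i0] := eqVneq i 0.
        by apply: Ha; rewrite E i0 mulr0z addr0.
      exfalso; apply: nov; exists i, n; split=> //.
      by rewrite E opprD addrC subrK; apply: HN.
  apply: Hmax; split; first by move=> h Hh; exists 0, h; rewrite mulr0z addr0.
  move=> /(_ v) Hv; apply: nov; exists 1, 0; split=> //.
  by rewrite mulr0z subr0; apply: Hv; exists 1, 0; rewrite add0r.
have [f fP] := choice (fun v => let: ex_intro n (ex_intro m p) := ex v in
  ex_intro (fun nm : int * int => nm.1 != 0 /\ H (v *~ nm.1 - a *~ nm.2)) (n, m) p).
have uniq v n m : n != 0 -> H (v *~ n - a *~ m) ->
    (f v).2%:~R / (f v).1%:~R = m%:~R / n%:~R :> rat.
  move=> n0 Hnm; have [f0 Hf] := fP v.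
  have /Ha : H (a *~ ((f v).2 * n - m * (f v).1)).
    have -> : a *~ ((f v).2 * n - m * (f v).1) =
        (v *~ n - a *~ m) *~ (f v).1 - (v *~ (f v).1 - a *~ (f v).2) *~ n.
      rewrite mulrzBr !mulrzBl -!mulrzA [(f v).1 * n]mulrC.
      by rewrite opprB [RHS]addrC addrA subrK.
    exact: Hl _ _ (HM _ _ Hnm) (HM _ _ Hf).
  move/eqP; rewrite subr_eq0 => /eqP E; apply/eqP.
  by rewrite eqr_div ?intr_eq0 // -!intrM E.
exists (fun v => (f v).2%:~R / (f v).1%:~R); split.
  rewrite (@uniq a 1 1) ?divr1 ?oner_eq0 //; last by rewrite subrr.
move=> u v; have [u0 Hu] := fP u; have [v0 Hv] := fP v.
rewrite (@uniq (u - v) ((f u).1 * (f v).1) ((f u).2 * (f v).1 - (f v).2 * (f u).1)).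
- by rewrite rmorphB !rmorphM /=; field; rewrite !intr_eq0 u0 v0.
- by rewrite mulf_neq0.
- have -> : (u - v) *~ ((f u).1 * (f v).1) - a *~ ((f u).2 * (f v).1 - (f v).2 * (f u).1) =
      (u *~ (f u).1 - a *~ (f u).2) *~ (f v).1 - (v *~ (f v).1 - a *~ (f v).2) *~ (f u).1.
    rewrite mulrzBr !mulrzBl -!mulrzA [(f v).1 * (f u).1]mulrC !opprB.
    by rewrite -[LHS]addrA -[RHS]addrA; congr (_ + _); rewrite addrCA [RHS]addrCA; congr (_ + _); rewrite addrC.
  exact: Hl _ _ (HM _ _ Hu) (HM _ _ Hv).
Qed.
End RationalFunctional.

Section ChineseRemainder.
Variable K : fieldType.
Implicit Types (r : seq K) (P Q : {poly K}).

Lemma coprime_prod_Xsub (a : K) r e : a \notin r ->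
  coprimep (\prod_(b <- r) ('X - b%:P) ^+ e) (('X - a%:P) ^+ e).
Proof.
move=> ar; apply: coprimep_expr; rewrite coprimep_XsubC /root horner_prod.
rewrite prodf_seq_neq0; apply/allP => b br /=.
rewrite hornerE !hornerE expf_eq0 negb_and; apply/orP; right.
by rewrite subr_eq0; apply: contraNneq ar => ->.
Qed.

Lemma dvdp_prod_Xsub r e P : uniq r ->
  (forall a, a \in r -> ('X - a%:P) ^+ e %| P) -> \prod_(b <- r) ('X - b%:P) ^+ e %| P.
Proof.
elim: r => [|a r IH] /=; first by rewrite big_nil dvd1p.
move=> /andP[ar ur] rP; rewrite big_cons Gauss_dvdp; last first.
  by rewrite coprimep_sym coprime_prod_Xsub.
by rewrite rP ?mem_head // IH // => b br; apply: rP; rewrite inE br orbT.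
Qed.

(** By induction on [r], Bezout coefficients for [('X - a)^e] and the product of the
    other factors correct the value at [a]. *)
Lemma chinese_remainder r e (c : K -> K) : uniq r ->
  exists Q, forall a, a \in r -> ('X - a%:P) ^+ e %| Q - (c a)%:P.
Proof.
elim: r => [|a r IH] /=; first by exists 0.
move=> /andP[ar /IH[Q QP]].
have /Bezout_eq1_coprimepP[[u v] /= uv] := coprime_prod_Xsub e ar.
set P := \prod_(b <- r) _ in uv.
exists (Q + ((c a)%:P - Q) * (u * P)) => b; rewrite inE => /orP[/eqP ->|br].
  have -> : Q + ((c a)%:P - Q) * (u * P) - (c a)%:P = (Q - (c a)%:P) * (v * ('X - a%:P) ^+ e).
    by rewrite -[u * P](addrK (v * ('X - a%:P) ^+ e)) uv; ring.
  by rewrite mulrA dvdp_mull.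
rewrite addrAC dvdp_add ?QP // mulrA dvdp_mull //.
by rewrite /P (big_rem _ br) /= dvdp_mulr.
Qed.
End ChineseRemainder.

Section Idempotents.
Variable F : fieldType.

(** Write [e] as a product of a column base and a row base, which are inverse on the
    image. *)
Lemma idempotent_trace n (e : 'M[F]_n) : e *m e = e -> \tr e = (\rank e)%:R.
Proof.
move=> ee; have E : row_base e *m col_base e = 1%:M.
  have H : col_base e *m (row_base e *m col_base e) *m row_base e = col_base e *m 1%:M *m row_base e.
    by rewrite mulmx1 mulmx_base mulmxA mulmx_base -mulmxA mulmx_base ee.
  apply: (row_full_inj (col_base_full e)); exact: (row_free_inj (row_base_free e) H).
by rewrite -{1}(mulmx_base e) mxtrace_mulC E mxtrace1.
Qed.
End Idempotents.

Section Cartan.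
Variable K : closedFieldType.
Hypothesis char0 : [pchar K] =i pred0.

Lemma bracketN n (u v : 'M[K]_n) : bracket u v = - bracket v u.
Proof. by rewrite /bracket opprB. Qed.

Lemma trace_bracket n (u v z : 'M[K]_n) :
  \tr (u *m bracket v z) = \tr (bracket u v *m z).
Proof.
rewrite /bracket mulmxBl mulmxBr !linearB /=; congr (_ - _); first by rewrite mulmxA.
by rewrite mulmxA mxtrace_mulC mulmxA.
Qed.

Section Spectral.
Variables (n' : nat) (x : 'M[K]_n'.+1).
Notation n := n'.+1.

(** Evaluate at [x] polynomials that are [1] modulo one power [('X - a)^n] and [0]
    modulo the others. *)
Lemma exists_spectral_idempotents : exists (r : seq K) (e : K -> 'M[K]_n),
  [/\ uniq r, forall a, (a \in r) = eigenvalue x a &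
   [/\ \sum_(a <- r) e a = 1, forall a, a \in r -> e a * e a = e a,
     {in r &, forall a b, a != b -> e a * e b = 0},
     forall a, a \in r -> (x - a%:M) ^+ n * e a = 0 &
     forall a, x * e a = e a * x]].
Proof.
have [s [sE sn]] := char_poly_split x; pose r := undup s.
have ur : uniq r by exact: undup_uniq.
have kill P : (forall a, a \in r -> ('X - a%:P) ^+ n %| P) -> horner_mx x P = 0.
  move=> rP; have cP : char_poly x %| P.
    apply: dvdp_trans (dvdp_prod_Xsub ur rP).
    rewrite sE -prodr_undup_exp_count -/r.
    have : forall a, (count_mem a s <= n)%N by move=> a; rewrite -sn count_size.
    elim: r {ur rP} => [|a r' IH] cn; first by rewrite !big_nil dvd1p.
    by rewrite !big_cons dvdp_mul ?IH // dvdp_exp2l.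
  by have /dvdpP[Q ->] := cP; rewrite rmorphM /= Cayley_Hamilton mulr0.
have [E EP] := choice (fun a => chinese_remainder n (fun b => (a == b)%:R) ur).
have E1 a : a \in r -> ('X - a%:P) ^+ n %| E a - 1.
  by move=> ar; have := EP a a ar; rewrite eqxx.
have E0 a b : b \in r -> a != b -> ('X - b%:P) ^+ n %| E a.
  by move=> br /negPf ab; have := EP a b br; rewrite ab subr0.
exists r, (fun a => horner_mx x (E a)); split=> //.
  by move=> a; rewrite mem_undup (char_poly_eigen sE).
split.
- apply/eqP; rewrite -subr_eq0 -raddf_sum -(rmorph1 (horner_mx x)) -rmorphB /=.
  rewrite kill // => a ar; rewrite (bigD1_seq a) //= addrAC dvdp_add ?E1 //.
  by elim/big_ind: _ => [|P Q|b ba]; [exact: dvdp0|exact: dvdp_add|exact: E0].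
- move=> a ar; apply/eqP; rewrite -subr_eq0 -rmorphM -rmorphB /= kill // => b br.
  rewrite -{3}[E a]mulr1 -mulrBr; have [<-|ab] := eqVneq a b.
    by rewrite dvdp_mull // E1.
  by rewrite dvdp_mulr // E0.
- move=> a b ar br ab; rewrite -rmorphM /= kill // => c cr.
  have [ac|ac] := eqVneq a c; last by rewrite dvdp_mulr // E0.
  by rewrite dvdp_mull // E0 // -ac eq_sym.
- move=> a ar; have -> : x - a%:M = horner_mx x ('X - a%:P).
    by rewrite rmorphB /= horner_mx_X horner_mx_C.
  rewrite -rmorphXn -rmorphM /= kill // => b br; have [<-|ab] := eqVneq a b.
    by rewrite dvdp_mulr.
  by rewrite dvdp_mull // E0.
- by move=> a; rewrite -{1 4}(horner_mx_X x) -!rmorphM mulrC.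
Qed.
End Spectral.

(** Cartan's criterion.  With [y] acting on the generalised eigenspaces of [x] by
    rational multiples of the eigenvalues, [ad y] is a polynomial in [ad x] without
    constant and linear terms, so that [tr (x y)] is a combination of traces of
    products of elements of [a]; but it is a combination of the eigenvalues of [x],
    whose image under a rational functional is a sum of squares. *)
Theorem cartan_nilpotent n (L a : set 'M[K]_n) I (s : seq I) (p q : I -> 'M[K]_n) :
  lie_linear L -> a `<=` L -> (forall u v, L u -> a v -> a (bracket u v)) ->
  (forall u v, a u -> a v -> \tr (u *m v) = 0) ->
  (forall i, L (p i) /\ L (q i)) -> a (\sum_(i <- s) bracket (p i) (q i)) ->
  (forall u, a u -> a (- u)) ->
  exists k, (\sum_(i <- s) bracket (p i) (q i)) ^+ k = 0.
Proof.
case: n L a p q => [|n'] L a p q Ll aL La aa pqL ax aN.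
  by exists 0%N; apply/matrixP => -[].
set x := \sum_(i <- s) _ in ax *; apply/nilpotentP => l0 ev0.
apply/eqP; apply: contraT => l00.
have [r [e [ur rE [e1 ee eo ne ce]]]] := exists_spectral_idempotents x.
have [f0 [f0l f0B]] := rational_functional char0 l00.
(* a common denominator makes the functional integral on the eigenvalues *)
pose D := \prod_(b <- r) (denq (f0 b))%:~R : rat.
have D0 : D != 0 by rewrite /D prodf_seq_neq0; apply/allP => b _; rewrite /= intr_eq0 denq_neq0.
pose f v := D * f0 v.
have fB u v : f (u - v) = f u - f v by rewrite /f f0B mulrBr.
have f00 : f 0 = 0 by rewrite -(subrr 0) fB subrr.
have fN u : f (- u) = - f u by rewrite -sub0r fB f00 sub0r.
have fD u v : f (u + v) = f u + f v by rewrite -[v]opprK fB fN !opprK.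
have fint b : b \in r -> exists w : int, f b = w%:~R.
  move=> br; exists ((\prod_(y <- rem b r) denq (f0 y)) * numq (f0 b)).
  rewrite /f /D (big_rem _ br) /= rmorphM rmorph_prod /= numqE; ring.
pose w v := numq (f v).
have wE v : (exists m : int, f v = m%:~R) -> (w v)%:~R = f v.
  by move=> [m fm]; rewrite /w fm numq_int.
have wr b : b \in r -> (w b)%:~R = f b by move/fint/wE.
have wB b c : b \in r -> c \in r -> w (b - c) = w b - w c.
  move=> br cr; apply: (@intr_inj rat); rewrite rmorphB /= (wr b br) (wr c cr) -fB wE //.
  by rewrite fB -(wr b br) -(wr c cr); exists (w b - w c); rewrite rmorphB.
have w0 : w 0 = 0 by rewrite /w f00.
pose dl := undup [seq b - c | b <- r, c <- r].
(* [Q] interpolates the functional at the differences of eigenvalues, the eigenvalues of [ad x] *)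
have [Q QP] := chinese_remainder (n'.+1 + n'.+1) (fun v => (w v)%:~R : K) (undup_uniq _ : uniq dl).
have dlP b c : b \in r -> c \in r -> b - c \in dl.
  by move=> br cr; rewrite mem_undup; apply/allpairsP; exists (b, c).
have l0r : l0 \in r by rewrite rE.
(* the difference 0 occurs, where [Q] vanishes to high order *)
have [Q2 QE] : exists Q2, Q = Q2 * 'X^2.
  apply/dvdpP; have := QP 0; rewrite -(subrr l0) dlP // subrr w0 mulr0z !subr0 => /(_ isT).
  apply: dvdp_trans; have -> : (n'.+1 + n'.+1 = n' + n' + 2)%N by rewrite addn2 addSn addnS.
  by rewrite exprD dvdp_mulIr.
pose y := \sum_(b <- r) (w b)%:~R *: e b.
have ey b : b \in r -> y * e b = (w b)%:~R *: e b.
  move=> br; rewrite /y mulr_suml (bigD1_seq b) //= big1_seq => [|c /andP[cb cr]].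
    by rewrite addr0 -scalerAl ee.
  by rewrite -scalerAl eo // scaler0.
have ye b : b \in r -> e b * y = (w b)%:~R *: e b.
  move=> br; rewrite /y mulr_sumr (bigD1_seq b) //= big1_seq => [|c /andP[cb cr]].
    by rewrite addr0 -scalerAr ee.
  by rewrite -scalerAr eo // ?scaler0 // eq_sym.
have adY b : mxvec (bracket y b) = mxvec b *m horner_mx (admx x) Q.
  have -> : b = \sum_(c <- r) \sum_(d <- r) e c * b * e d.
    rewrite -{1}[b]mulr1 -{1}[b]mul1r -e1 mulr_suml mulr_suml; apply: eq_bigr => c _.
    by rewrite mulr_sumr.
  have brD : {morph (fun u => mxvec (bracket y u)) : u v / u + v}.
    by move=> u v /=; rewrite -linearD /=; congr mxvec; rewrite /bracket mulmxDl mulmxDr opprD addrACA.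
  have br0 : mxvec (bracket y 0) = 0 by rewrite /bracket mulmx0 mul0mx subrr linear0.
  rewrite (big_morph _ brD br0) linear_sum mulmx_suml; apply: eq_big_seq => c cr.
  rewrite (big_morph _ brD br0) linear_sum mulmx_suml; apply: eq_big_seq => d dr.
  set z := e c * b * e d.
  have -> : bracket y z = (w (c - d))%:~R *: z.
    have yz : y * z = (w c)%:~R *: z by rewrite /z !mulrA ey // -!scalerAl.
    have zy : z * y = (w d)%:~R *: z by rewrite /z -mulrA ye // -scalerAr.
    by rewrite /bracket -[y *m z]/(y * z) -[z *m y]/(z * y) yz zy -scalerBl wB // rmorphB.
  have /dvdpP[R RE] := QP _ (dlP c d cr dr).
  have -> : Q = (w (c - d))%:~R%:P + ('X - (c - d)%:P) ^+ (n'.+1 + n'.+1) * R.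
    by rewrite mulrC -RE addrC subrK.
  rewrite rmorphD rmorphM rmorphXn rmorphB /= horner_mx_X !horner_mx_C mulmxDr.
  have -> : admx x - (c - d)%:M = lmulx (x - c%:M) - rmulx (x - d%:M).
    apply: mxvec_ext => u; rewrite [LHS]mulmxBr mul_admx [RHS]mulmxBr mul_lmulx mul_rmulx.
    rewrite mul_mx_scalar -linearZ -!linearB /=; congr mxvec.
    rewrite /bracket mulmxBl mulmxBr mul_scalar_mx mul_mx_scalar scalerBl.
    move: (x *m u) (u *m x) (c *: u) (d *: u) => *; apply/matrixP => i j; rewrite !mxE; ring.
  rewrite -[X in _ = _ + X]/(mxvec z *m (_ *m _)) mulmxA lr_nilpotent ?mul0mx ?addr0.
  - by rewrite mul_mx_scalar linearZ.
  - by rewrite -[_ *m z]/(_ * z) /z !mulrA ne // !mul0r.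
  - have cm : GRing.comm (e d) (x - d%:M).
      by apply: commrB; [exact/commr_sym/ce|exact: comm_mx_scalar].
    by rewrite -[z *m _]/(z * _) /z -mulrA (commrX _ cm) ne // mulr0.
have [A AE] := lie_linear_mx Ll.
have Lx : L x by exact: aL.
have stA : stablemx A (admx x).
  apply/row_subP => i; rewrite row_mul -[row i A]vec_mxK mul_admx; apply/AE/aL.
  rewrite -[bracket _ _]opprK; apply: aN; rewrite /bracket opprB.
  by apply: La => //; apply/AE; rewrite vec_mxK row_sub.
have xy0 : \tr (x *m y) = 0.
  rewrite mulmx_suml linear_sum big1 // => i _ /=.
  have [Lp Lq] := pqL i.
  have -> : \tr (bracket (p i) (q i) *m y) = - \tr (p i *m bracket y (q i)).
    by rewrite -trace_bracket (bracketN (q i)) mulmxN linearN.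
  pose T : 'M[K]_(n'.+1 * n'.+1) := horner_mx (admx x) Q2.
  pose c' : 'M_n'.+1 := vec_mx (mxvec (q i) *m T).
  have Lc' : L c'.
    apply/AE; rewrite vec_mxK; apply: submx_trans (horner_mx_stable Q2 stA).
    by apply: submxMr; apply/AE.
  have -> : bracket y (q i) = bracket x (bracket x c').
    apply: (can_inj mxvecK); rewrite adY QE rmorphM rmorphXn /= horner_mx_X.
    by rewrite -!mul_admx vec_mxK expr2 -!mulmxA.
  set c := bracket x c'.
  have ac : a c by rewrite /c bracketN; exact: aN _ (La _ _ Lc' ax).
  have apx : a (bracket (p i) x) by exact: La _ _ Lp ax.
  by rewrite trace_bracket aa ?oppr0.
have tre b : b \in r -> \tr (x *m e b) = b * (\rank (e b))%:R.
  move=> br; rewrite -(idempotent_trace (ee b br)).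
  have cm : GRing.comm (x - b%:M) (e b).
    by apply/commr_sym/commrB; [exact/commr_sym/ce|exact: comm_mx_scalar].
  have : \tr ((x - b%:M) *m e b) = 0.
    apply: (@nilpotent_trace _ _ _ n'.+1); rewrite -[_ *m e b]/(_ * e b) exprMn_comm //.
    have eX k : e b ^+ k.+1 = e b by elim: k => [|k IH]; rewrite ?expr1 // exprS IH ee.
    by rewrite eX; exact: ne.
  by rewrite mulmxBl linearB /= mul_scalar_mx mxtraceZ => /eqP; rewrite subr_eq0 => /eqP.
have sum0 : \sum_(b <- r) b *~ (w b * (\rank (e b))%:Z) = 0.
  apply: etrans xy0; rewrite /y mulmx_sumr linear_sum /=; apply: eq_big_seq => b br.
  by rewrite -scalemxAr mxtraceZ tre // -mulrzr rmorphM /= mulrCA.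
have fz m v : f (v *~ m) = f v *~ m.
  have fn k : f (v *+ k) = f v *+ k by elim: k => [|k IH]; rewrite ?mulr0n // !mulrS fD IH.
  by case: m => m; rewrite ?NegzE ?mulrNz ?fN -!pmulrn fn.
(* the functional applied to the trace of [x y] is a sum of squares *)
have : \sum_(b <- r) f b * f b * (\rank (e b))%:R = 0.
  have := congr1 f sum0; rewrite (big_morph f fD f00) f00 => H; apply: etrans H.
  apply: eq_big_seq => b br.
  by rewrite fz -mulrzr rmorphM /= wr // mulrA.
move/eqP; rewrite psumr_eq0 => [|b _]; last by rewrite mulr_ge0 // -expr2 sqr_ge0.
move=> /allP/(_ l0 l0r)/implyP/(_ isT); rewrite !mulf_eq0 orbb pnatr_eq0 mxrank_eq0.
rewrite (negPf D0) (negPf f0l) /=.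
move=> /eqP el0.
have /eigenvalueP[v vx v0] := ev0.
move: v0; rewrite -[v]mulmx1 -[1%:M]/(1 : 'M_n'.+1) -e1 mulmx_sumr.
rewrite big1_seq ?eqxx // => b /andP[_ br].
have [->|bl] := eqVneq b l0; first by rewrite el0 mulmx0.
have vE k : v *m (x - b%:M) ^+ k = (l0 - b) ^+ k *: v.
  elim: k => [|k IH]; first by rewrite !expr0 mulmx1 scale1r.
  rewrite !exprSr -[X in v *m X]/(_ *m _) mulmxA IH -scalemxAl mulmxBr vx mul_mx_scalar.
  by rewrite -scalerBl scalerA.
have : v *m ((x - b%:M) ^+ n'.+1 *m e b) = 0 by rewrite -[X in v *m X]/(_ * _) ne // mulmx0.
rewrite mulmxA vE -scalemxAl => /eqP; rewrite scaler_eq0 expf_eq0 /= subr_eq0.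
by rewrite eq_sym (negPf bl) => /eqP.
Qed.
End Cartan.

(** * Regular functions and invariant derivations *)

Section RegularTerms.
Variables (K : closedFieldType) (N : nat).

(** Regular functions are represented by terms in order to differentiate them. *)
Inductive rterm : Type :=
| RConst of K
| RCoord of 'I_N & 'I_N
| RInvDet
| RAdd of rterm & rterm
| RMul of rterm & rterm.

Fixpoint reval (S : comUnitRingType) (phi : K -> S) (f : rterm) (g : 'M[S]_N) : S :=
  match f with
  | RConst a => phi a
  | RCoord i j => g i j
  | RInvDet => (\det g)^-1
  | RAdd f h => reval phi f g + reval phi h g
  | RMul f h => reval phi f g * reval phi h g
  end.

Notation ev := (reval (@idfun K)).

Definition rsum I (r : seq I) (F : I -> rterm) := foldr (fun i f => RAdd (F i) f) (RConst 0) r.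

Lemma reval_sum (S : comUnitRingType) (phi : {rmorphism K -> S}) I (r : seq I) F g :
  reval phi (rsum r F) g = \sum_(i <- r) reval phi (F i) g.
Proof.
by elim: r => [|i r IH] /=; rewrite ?big_nil ?big_cons ?rmorph0 // IH.
Qed.

Lemma ev_sum I (r : seq I) F g : ev (rsum r F) g = \sum_(i <- r) ev (F i) g.
Proof. exact: (reval_sum idfun). Qed.

(** The left-invariant derivation in the direction [x]. *)
Fixpoint rderiv (x : 'M[K]_N) (f : rterm) : rterm :=
  match f with
  | RConst a => RConst 0
  | RCoord i j => rsum (index_enum 'I_N) (fun l => RMul (RCoord i l) (RConst (x l j)))
  | RInvDet => RMul (RConst (- \tr x)) RInvDet
  | RAdd f h => RAdd (rderiv x f) (rderiv x h)
  | RMul f h => RAdd (RMul (rderiv x f) h) (RMul f (rderiv x h))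
  end.

Lemma reval_rderiv_coord (S : comUnitRingType) (phi : {rmorphism K -> S}) x i j g :
  reval phi (rderiv x (RCoord i j)) g = (g *m map_mx phi x) i j.
Proof. by rewrite reval_sum mxE; apply: eq_bigr => l _; rewrite mxE. Qed.

Lemma ev_rderiv_coord x i j g : ev (rderiv x (RCoord i j)) g = (g *m x) i j.
Proof. by rewrite (reval_rderiv_coord idfun) map_mx_id. Qed.

Lemma rderiv_rsum x I (r : seq I) F g :
  ev (rderiv x (rsum r F)) g = \sum_(i <- r) ev (rderiv x (F i)) g.
Proof. by elim: r => [|i r IH] /=; rewrite ?big_nil ?big_cons // IH. Qed.

Lemma rderiv_linear a x y f g :
  ev (rderiv (a *: x + y) f) g = a * ev (rderiv x f) g + ev (rderiv y f) g.
Proof.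
elim: f => [b|i j||f IHf h IHh|f IHf h IHh].
- by rewrite /= mulr0 addr0.
- by rewrite !ev_rderiv_coord mulmxDr -scalemxAr !mxE.
- by rewrite /= mxtraceD mxtraceZ; ring.
- by rewrite /= IHf IHh; ring.
- by rewrite /= IHf IHh; ring.
Qed.

(** Both sides are derivations, so it suffices to compare them on coordinates. *)
Lemma rderiv_bracket x y f g :
  ev (rderiv (x *m y - y *m x) f) g =
  ev (rderiv x (rderiv y f)) g - ev (rderiv y (rderiv x f)) g.
Proof.
have E u v i j : ev (rderiv u (rderiv v (RCoord i j))) g = (g *m (u *m v)) i j.
  rewrite [rderiv v _]/= rderiv_rsum mulmxA mxE; apply: eq_bigr => l _.
  by rewrite -ev_rderiv_coord [LHS]/= mulr0 addr0.
elim: f => [b|i j||f IHf h IHh|f IHf h IHh].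
- by rewrite /= subrr.
- by rewrite !E ev_rderiv_coord mulmxBr !mxE.
- by rewrite /= linearB /= mxtrace_mulC; ring.
- by rewrite /= IHf IHh; ring.
- by rewrite /= IHf IHh; ring.
Qed.

Section Substitution.
Variables (P : 'I_N -> 'I_N -> rterm) (V : rterm).

Fixpoint rsubst (f : rterm) : rterm :=
  match f with
  | RConst a => RConst a
  | RCoord i j => P i j
  | RInvDet => V
  | RAdd f h => RAdd (rsubst f) (rsubst h)
  | RMul f h => RMul (rsubst f) (rsubst h)
  end.

Definition subst_mx g : 'M[K]_N := \matrix_(i, j) ev (P i j) g.

Lemma ev_rsubst f g : ev V g = (\det (subst_mx g))^-1 -> ev (rsubst f) g = ev f (subst_mx g).
Proof.
move=> Vg; elim: f => [b|i j||f IHf h IHh|f IHf h IHh] //=.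
- by rewrite mxE.
- by rewrite IHf IHh.
- by rewrite IHf IHh.
Qed.

(** The chain rule, for a map whose differential sends [x] to [y]. *)
Lemma rderiv_rsubst x y f g : ev V g = (\det (subst_mx g))^-1 ->
  ev (rderiv x V) g = - \tr y * ev V g ->
  (forall i j, ev (rderiv x (P i j)) g = (subst_mx g *m y) i j) ->
  ev (rderiv x (rsubst f)) g = ev (rderiv y f) (subst_mx g).
Proof.
move=> Vg dV dP; elim: f => [b|i j||f IHf h IHh|f IHf h IHh].
- by [].
- by rewrite ev_rderiv_coord -dP.
- by rewrite /= dV Vg.
- by rewrite /= IHf IHh.
- by rewrite /= IHf IHh !ev_rsubst.
Qed.
End Substitution.

Definition rtranslate (h : 'M[K]_N) : rterm -> rterm :=
  rsubst (fun i j => rsum (index_enum 'I_N) (fun l => RMul (RConst (h i l)) (RCoord l j)))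
    (RMul (RConst (\det h)^-1) RInvDet).

Lemma ev_coord_translate (h g : 'M[K]_N) i j :
  ev (rsum (index_enum 'I_N) (fun l => RMul (RConst (h i l)) (RCoord l j))) g = (h *m g) i j.
Proof. by rewrite ev_sum mxE. Qed.

Lemma subst_translate (h g : 'M[K]_N) :
  subst_mx (fun i j => rsum (index_enum 'I_N) (fun l => RMul (RConst (h i l)) (RCoord l j))) g =
  h *m g.
Proof. by apply/matrixP => i j; rewrite mxE ev_coord_translate. Qed.

Lemma ev_rtranslate h f g : ev (rtranslate h f) g = ev f (h *m g).
Proof. by rewrite ev_rsubst subst_translate // det_mulmx invfM. Qed.

Lemma rderiv_rtranslate h x f g :
  ev (rderiv x (rtranslate h f)) g = ev (rderiv x f) (h *m g).
Proof.
rewrite (@rderiv_rsubst _ _ x x) ?subst_translate //=.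
- by rewrite det_mulmx invfM.
- by ring.
- move=> i j; rewrite rderiv_rsum -mulmxA mxE; apply: eq_bigr => l _.
  by rewrite -ev_rderiv_coord [LHS]/= mul0r add0r.
Qed.

Lemma det_conj (h g : 'M[K]_N) : h \in unitmx -> \det (h *m g *m invmx h) = \det g.
Proof.
by move=> hu; rewrite !det_mulmx mulrAC -det_mulmx mulmxV // det1 mul1r.
Qed.

Lemma trace_conj (h g : 'M[K]_N) : h \in unitmx -> \tr (h *m g *m invmx h) = \tr g.
Proof. by move=> hu; rewrite mxtrace_mulC mulmxA mulVmx // mul1mx. Qed.

Definition rconj (h : 'M[K]_N) : rterm -> rterm :=
  rsubst (fun i j => rsum (index_enum 'I_N) (fun l => RMul (RConst (h i l))
    (rsum (index_enum 'I_N) (fun m => RMul (RCoord l m) (RConst (invmx h m j))))))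
    RInvDet.

Lemma subst_conj (h g : 'M[K]_N) :
  subst_mx (fun i j => rsum (index_enum 'I_N) (fun l => RMul (RConst (h i l))
    (rsum (index_enum 'I_N) (fun m => RMul (RCoord l m) (RConst (invmx h m j)))))) g =
  h *m g *m invmx h.
Proof.
apply/matrixP => i j; rewrite mxE ev_sum -mulmxA mxE; apply: eq_bigr => l _ /=.
by rewrite ev_sum mxE.
Qed.

Lemma ev_rconj h f g : h \in unitmx -> ev (rconj h f) g = ev f (h *m g *m invmx h).
Proof. by move=> hu; rewrite ev_rsubst subst_conj //= det_conj. Qed.

Lemma rderiv_rconj h x f g : h \in unitmx ->
  ev (rderiv x (rconj h f)) g = ev (rderiv (h *m x *m invmx h) f) (h *m g *m invmx h).
Proof.
move=> hu; rewrite (@rderiv_rsubst _ _ x (h *m x *m invmx h)) ?subst_conj //=.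
- by rewrite det_conj.
- by rewrite trace_conj.
- move=> i j; rewrite rderiv_rsum.
  have -> : h *m g *m invmx h *m (h *m x *m invmx h) = h *m (g *m x *m invmx h).
    by rewrite !mulmxA mulmxKV.
  rewrite mxE; apply: eq_bigr => l _; rewrite [LHS]/= mul0r add0r; congr (_ * _).
  rewrite rderiv_rsum mxE; apply: eq_bigr => m _.
  by rewrite -ev_rderiv_coord [LHS]/= mulr0 addr0.
Qed.
End RegularTerms.

Local Notation ev := (reval (@idfun _)).

(** * The tangent Lie algebra of a linear group *)

Section Tangent.
Variables (K : closedFieldType) (N : nat) (G : set 'M[K]_N).
Hypothesis Ggrp : is_subgroup G.

Lemma regularP (h : 'M[K]_N -> K) : regular idfun h <-> exists f, h = ev f.
Proof.
split=> [|[f ->]].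
  elim=> [a|i j||f1 f2 _ [t1 ->] _ [t2 ->]|f1 f2 _ [t1 ->] _ [t2 ->]].
  - by exists (RConst _ a).
  - by exists (RCoord _ i j).
  - by exists (RInvDet _ _).
  - by exists (RAdd t1 t2).
  - by exists (RMul t1 t2).
elim: f => [a|i j||f IHf f' IHf'|f IHf f' IHf'].
- exact: (@regular_const _ _ idfun).
- exact: regular_coord.
- exact: regular_inv_det.
- exact: regular_add.
- exact: regular_mul.
Qed.

Lemma closedP (Z : set 'M[K]_N) : zariski_closed idfun Z <->
  exists P : set (rterm K N),
    Z = [set g | g \in unitmx /\ forall f, P f -> ev f g = 0].
Proof.
split=> [[F Freg ->]|[P ->]].
  exists [set f | F (ev f)]; apply/seteqP; split=> g /= [gu gF]; split=> // f Ff.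
    exact: gF.
  by have /regularP[t ft] := Freg _ Ff; rewrite ft; apply: gF; rewrite /= -ft.
exists [set h | exists2 f, P f & h = ev f].
  by move=> h [f _ ->]; apply/regularP; exists f.
apply/seteqP; split=> g /= [gu gP]; split=> //.
  by move=> _ [f Pf ->]; exact: gP.
by move=> f Pf; apply: gP; exists f.
Qed.

Definition vanishing (f : rterm K N) := forall g, G g -> ev f g = 0.

Definition tangent : set 'M[K]_N :=
  [set x | forall f, vanishing f -> ev (rderiv x f) 1%:M = 0].

Lemma G_unit g : G g -> g \in unitmx. Proof. exact: (subgroup_unit Ggrp). Qed.

(** The derivation is left-invariant, so its value at [g] is the value at the identity
    of the derivative of a translate. *)
Lemma tangent_vanishing x f : tangent x -> vanishing f -> vanishing (rderiv x f).
Proof.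
move=> xt f0 g Gg; rewrite -[g]mulmx1 -rderiv_rtranslate; apply: xt => h Gh.
by rewrite ev_rtranslate; apply/f0/(subgroupM Ggrp).
Qed.

Lemma tangent_ext x f f' : tangent x -> (forall g, G g -> ev f g = ev f' g) ->
  forall g, G g -> ev (rderiv x f) g = ev (rderiv x f') g.
Proof.
move=> xt E g Gg; apply/eqP; rewrite -subr_eq0.
have := @tangent_vanishing x (RAdd f (RMul (RConst N (-1)) f')) xt _ g Gg.
rewrite /= mul0r add0r mulN1r => ->//.
by move=> h Gh /=; rewrite E // mulN1r subrr.
Qed.

Lemma tangent0 : tangent 0.
Proof.
move=> f f0; have := rderiv_linear 0 0 0 f 1%:M; rewrite scale0r add0r mul0r add0r.
have := rderiv_linear 1 0 0 f 1%:M; rewrite scale1r add0r mul1r => /eqP.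
by rewrite -subr_eq subrr eq_sym => /eqP.
Qed.

Lemma tangent_linear a x y : tangent x -> tangent y -> tangent (a *: x + y).
Proof. by move=> xt yt f f0; rewrite rderiv_linear xt // yt // mulr0 addr0. Qed.

Lemma tangent_bracket x y : tangent x -> tangent y -> tangent (x *m y - y *m x).
Proof.
move=> xt yt f f0; rewrite rderiv_bracket xt ?yt ?subrr //; exact: tangent_vanishing.
Qed.

Lemma tangent_conj h x : G h -> tangent x -> tangent (h *m x *m invmx h).
Proof.
move=> Gh xt f f0; have hu := G_unit Gh.
have := rderiv_rconj x f 1%:M hu; rewrite mulmx1 mulmxV // => <-.
apply: xt => g Gg; rewrite ev_rconj // f0 //.
by apply: (subgroupM Ggrp); [exact: (subgroupM Ggrp)|exact: (subgroupV Ggrp)].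
Qed.

(** ** Polynomial curves *)
Definition curve_at (t : K) (E : 'M[{poly K}]_N) : 'M[K]_N := map_mx (horner_eval t) E.

Lemma det_at t (E : 'M[{poly K}]_N) : \det (curve_at t E) = (\det E).[t].
Proof. by rewrite /curve_at (det_map_mx (horner_eval t)). Qed.

Lemma det_at1 t (E : 'M[{poly K}]_N) : \det E = 1 -> \det (curve_at t E) = 1.
Proof. by move=> dE; rewrite det_at dE -polyC1 hornerC. Qed.

Lemma horner_reval (E : 'M[{poly K}]_N) f t : \det E = 1 ->
  (reval (@polyC K) f E).[t] = ev f (curve_at t E).
Proof.
move=> dE; elim: f => [a|i j||f IHf h IHh|f IHf h IHh] /=.
- by rewrite hornerC.
- by rewrite mxE.
- by rewrite dE det_at1 // !invr1 -polyC1 hornerC.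
- by rewrite hornerD IHf IHh.
- by rewrite hornerM IHf IHh.
Qed.

Lemma curve_in_closed (E : 'M[{poly K}]_N) : zariski_closed idfun G -> \det E = 1 ->
  (forall f, vanishing f -> reval (@polyC K) f E = 0) -> forall t, G (curve_at t E).
Proof.
move=> /closedP[P GE] dE E0 t; rewrite GE /=; split.
  by rewrite unitmxE det_at1 ?unitr1.
move=> f Pf; rewrite -horner_reval // E0 ?horner0 // => g.
by rewrite GE => -[_]; apply.
Qed.

(** The determinant is a polynomial without zeros. *)
Lemma det_curve (E : 'M[{poly K}]_N) : curve_at 0 E = 1%:M ->
  (forall t, curve_at t E \in unitmx) -> \det E = 1.
Proof.
move=> E0 Eu; have /size_poly1P[c c0 dE] : size (\det E) == 1%N.
  apply: contraT => /closed_rootP[t]; rewrite /root -det_at => /eqP d0.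
  by have := Eu t; rewrite unitmxE d0 unitr0.
by have := det_at 0 E; rewrite E0 det1 dE hornerC => <-.
Qed.

Lemma deriv_reval (E : 'M[{poly K}]_N) x f : \det E = 1 -> \tr x = 0 ->
  map_mx (@deriv K) E = E *m map_mx (@polyC K) x ->
  (reval (@polyC K) f E)^`() = reval (@polyC K) (rderiv x f) E.
Proof.
move=> dE tx Ex; elim: f => [a|i j||f IHf h IHh|f IHf h IHh].
- by rewrite /= derivC.
- by rewrite reval_rderiv_coord -Ex mxE.
- by rewrite /= dE tx oppr0 mul0r invr1 derivC.
- by rewrite /= derivD IHf IHh.
- by rewrite /= derivM IHf IHh.
Qed.

Hypothesis char0 : [pchar K] =i pred0.

Lemma poly_eq0_derivs (p : {poly K}) : (forall n, p^`(n).[0] = 0) -> p = 0.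
Proof.
move=> p0; apply/polyP => i; have := p0 i.
rewrite horner_coef0 coef_derivn addn0 ffactnn coef0 => /eqP.
by rewrite -mulr_natr mulf_eq0 (proj1 (pcharf0P _) char0) -leqn0 leqNgt fact_gt0 orbF => /eqP.
Qed.

(** The Taylor coefficients at [t = 0] of a function along [exp (t x)] are its
    iterated derivatives in the direction [x] at the identity. *)
Lemma integral_curve_vanishing (E : 'M[{poly K}]_N) x : tangent x -> \tr x = 0 ->
  \det E = 1 -> curve_at 0 E = 1%:M ->
  map_mx (@deriv K) E = E *m map_mx (@polyC K) x ->
  forall f, vanishing f -> reval (@polyC K) f E = 0.
Proof.
move=> xt tx dE E0 Ex f f0; apply: poly_eq0_derivs => n.
have [h [h0 hE]] : exists h, vanishing h /\ (reval (@polyC K) f E)^`(n) = reval (@polyC K) h E.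
  elim: n => [|n [h [h0 IH]]]; first by exists f.
  exists (rderiv x h); split; first exact: tangent_vanishing.
  by rewrite derivnS IH (deriv_reval _ dE tx Ex).
by rewrite hE horner_reval // E0 h0 //; exact: (subgroup1 Ggrp).
Qed.

Definition exp_curve (x : 'M[K]_N) M : 'M[{poly K}]_N :=
  \sum_(i < M) ('X^i * ((i`!)%:R^-1)%:P) *: map_mx (@polyC K) (x ^+ i).

Lemma at_exp x M t : curve_at t (exp_curve x M) = \sum_(i < M) (t ^+ i / (i`!)%:R) *: x ^+ i.
Proof.
rewrite /curve_at /exp_curve map_mx_sum; apply: eq_bigr => i _.
by apply/matrixP => a b; rewrite !mxE /= /horner_eval !hornerE.
Qed.

Lemma exp_curve_nilpotent x M t : x ^+ M = 0 ->
  exists y, curve_at t (exp_curve x M) = 1%:M + x *m y /\ (x *m y) ^+ M = 0.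
Proof.
case: M => [x0|M xM].
  have e0 (y : 'M[K]_N) : y = 0 by rewrite -[y]mul1mx -[1%:M]/(1 : 'M[K]_N) -(expr0 x) x0 mul0mx.
  by exists 0; split; [rewrite [LHS]e0 [RHS]e0|exact: e0].
pose y := \sum_(i < M) (t ^+ i.+1 / (i.+1`!)%:R) *: x ^+ i.
have xy : GRing.comm x y.
  apply: commr_sum => i _; rewrite /GRing.comm -[LHS]/(x *m _) -[RHS]/(_ *m x).
  by rewrite -scalemxAl -scalemxAr -[x *m _]/(x * _) -[_ *m x]/(_ * x) -exprS -exprSr.
exists y; split; last by rewrite -[x *m y]/(x * y) exprMn_comm // xM mul0r.
rewrite at_exp big_ord_recl !expr0 fact0 divr1 scale1r; congr (_ + _).
rewrite mulmx_sumr; apply: eq_bigr => i _.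
by rewrite -scalemxAr -[x *m _]/(x * _) -exprS.
Qed.

Lemma at0_exp x M : x ^+ M = 0 -> curve_at 0 (exp_curve x M) = 1%:M.
Proof.
move=> xM; have [y] := exp_curve_nilpotent 0 xM; rewrite at_exp.
case: M xM => [|M] xM; last first.
  move=> _; rewrite big_ord_recl big1 ?addr0 => [|i _].
    by rewrite !expr0 fact0 divr1 scale1r.
  by rewrite /= expr0n mul0r scale0r.
by move=> _; rewrite big_ord0 -[1%:M]/(1 : 'M[K]_N) -(expr0 x) xM.
Qed.

Lemma deriv_exp x M : x ^+ M = 0 ->
  map_mx (@deriv K) (exp_curve x M) = exp_curve x M *m map_mx (@polyC K) x.
Proof.
case: M => [x0|M xM].
  rewrite /exp_curve !big_ord0 mul0mx; apply/matrixP => i j; by rewrite !mxE deriv0.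
rewrite /exp_curve mulmx_suml [RHS]big_ord_recr /= -scalemxAl -map_mxM -[_ *m x]/(_ * x).
rewrite -exprSr xM map_mx0 scaler0 addr0 big_ord_recl.
have D (F : 'I_M -> 'M[{poly K}]_N) : map_mx (@deriv K) (\sum_i F i) = \sum_i map_mx (@deriv K) (F i).
  apply/matrixP => i j; rewrite !mxE !summxE (raddf_sum (@deriv K)).
  by apply: eq_bigr => l _; rewrite mxE.
rewrite map_mxD D (_ : map_mx _ _ = 0) ?add0r; last first.
  by apply/matrixP => i j; rewrite [X in X *: _]mul1r !mxE -polyCM /= derivC.
apply: eq_bigr => i _; rewrite -scalemxAl -map_mxM -[x ^+ i *m x]/(x ^+ i * x) -exprSr.
apply/matrixP => a b; rewrite !mxE /= /bump /= add1n -mulrA -polyCM -mulrA -polyCM derivM derivC mulr0 addr0.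
rewrite derivXn /= mulrnAl -mulrnAr -polyCMn; congr (_ * _%:P).
rewrite -mulrnAl; congr (_ * _); rewrite -mulr_natr factS natrM invfM mulrAC mulVf ?mul1r //.
by rewrite (proj1 (pcharf0P _) char0).
Qed.

(** A regular function vanishing on [G] is a polynomial in [t] along [exp(t x)], all of
    whose Taylor coefficients at [0] vanish. *)
Theorem exp_in_group x M : zariski_closed idfun G -> tangent x -> x ^+ M = 0 ->
  forall t, G (curve_at t (exp_curve x M)).
Proof.
move=> Gcl xt xM; have tx := nilpotent_trace xM.
have E0 := at0_exp xM.
have dE : \det (exp_curve x M) = 1.
  apply: det_curve => // t; have [y [-> xy]] := exp_curve_nilpotent t xM.
  exact: unitmx_add_nilpotent xy.
apply: curve_in_closed => //; apply: integral_curve_vanishing xt tx dE E0 _.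
exact: deriv_exp.
Qed.
End Tangent.

(** * Functions with zero derivatives *)

Section IdealPower.
Variables (K : fieldType) (T : pointedType) (y z : seq (T -> K)).
Notation J := (ideal_power y z).
Hypothesis zy : {in z, forall f, algebra_gen y f}.

Lemma ideal_power_algebra n f : J n f -> algebra_gen y f.
Proof.
elim=> [//|m|m g h _ gA _ hA|m g h gz _ hA].
- exact: algebra_const.
- exact: algebra_add.
- by apply: algebra_mul => //; exact: zy.
Qed.

Lemma idealD n f g : J n f -> J n g -> J n (f \+ g).
Proof.
case: n => [Jf Jg|n]; last exact: ideal_power_add.
by apply/ideal_power0/algebra_add; apply: ideal_power_algebra; [exact: Jf|exact: Jg].
Qed.

Lemma idealM n a f : algebra_gen y a -> J n f -> J n (a \* f).
Proof.
move=> aA; elim=> [g gA|m|m g h _ gJ _ hJ|m g h gz _ hJ].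
- exact/ideal_power0/algebra_mul.
- rewrite (_ : _ \* _ = fun=> 0); first exact: ideal_power_zero.
  by apply/funext => t /=; rewrite mulr0.
- rewrite (_ : a \* _ = (a \* g) \+ (a \* h)); first exact: ideal_power_add.
  by apply/funext => t /=; rewrite mulrDr.
- rewrite (_ : a \* _ = g \* (a \* h)); first exact: ideal_powerS.
  by apply/funext => t /=; rewrite mulrCA.
Qed.

Lemma ideal_mul m n f g : J m f -> J n g -> J (m + n) (f \* g).
Proof.
move=> fJ gJ; elim: fJ => [h hA|i|i h k _ hJ _ kJ|i h k hz _ kJ].
- exact: idealM.
- rewrite (_ : _ \* _ = fun=> 0); first exact: ideal_power_zero.
  by apply/funext => t /=; rewrite mul0r.
- rewrite (_ : (h \+ k) \* g = (h \* g) \+ (k \* g)); first exact: ideal_power_add.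
  by apply/funext => t /=; rewrite mulrDl.
- rewrite (_ : (h \* k) \* g = h \* (k \* g)); first exact: ideal_powerS.
  by apply/funext => t /=; rewrite mulrA.
Qed.

Lemma idealZ n c f : J n f -> J n (fun t => c * f t).
Proof. by move=> fJ; apply: idealM => //; exact: algebra_const. Qed.

Lemma ideal0 n : J n (fun=> 0).
Proof. by case: n => [|n]; [exact/ideal_power0/algebra_const|exact: ideal_power_zero]. Qed.

Lemma ideal_sum n I (r : seq I) (F : I -> T -> K) :
  (forall i, J n (F i)) -> J n (fun t => \sum_(i <- r) F i t).
Proof.
move=> FJ; elim: r => [|i r IH].
  by rewrite (_ : (fun _ => _) = (fun=> 0)); [exact: ideal0|apply/funext => t; rewrite big_nil].
rewrite (_ : (fun _ => _) = F i \+ (fun t => \sum_(j <- r) F j t)); first exact: idealD.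
by apply/funext => t; rewrite big_cons.
Qed.

Lemma ideal_gen f : f \in z -> J 1 f.
Proof.
move=> fz; rewrite (_ : f = f \* (fun=> 1)).
  by apply: ideal_powerS => //; exact/ideal_power0/algebra_const.
by apply/funext => t /=; rewrite mulr1.
Qed.

Lemma ideal_ext n f g : (forall t, f t = g t) -> J n f -> J n g.
Proof. by move=> /funext ->. Qed.
End IdealPower.

Section Taylor.
Variables (K : closedFieldType) (N : nat) (G : set 'M[K]_N).
Hypothesis Ggrp : is_subgroup G.
Variables (T : pointedType) (e : T -> 'M[K]_N).
Hypothesis eG : forall t, G (e t).

Definition fn (f : rterm K N) : T -> K := fun t => ev f (e t).

Definition shifted_coord ij : rterm K N :=
  RAdd (RCoord K ij.1 ij.2) (RConst N (- (ij.1 == ij.2)%:R)).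

Definition coords : seq (T -> K) :=
  fn (RInvDet K N) :: [seq fn (RCoord K ij.1 ij.2) | ij <- index_enum ('I_N * 'I_N)%type].

Definition shifted : seq (T -> K) :=
  [seq fn (shifted_coord ij) | ij <- index_enum ('I_N * 'I_N)%type].

Notation J := (ideal_power coords shifted).

Lemma fn_algebra f : algebra_gen coords (fn f).
Proof.
elim: f => [a|i j||f IHf h IHh|f IHf h IHh].
- exact: algebra_const.
- apply: algebra_mem; rewrite inE; apply/orP; right.
  by apply/mapP; exists (i, j); rewrite ?mem_index_enum.
- by apply: algebra_mem; rewrite mem_head.
- exact: algebra_add.
- exact: algebra_mul.
Qed.

Lemma algebra_fn h : algebra_gen coords h -> exists f, h = fn f.
Proof.
elim=> [c|f|f g _ [f' ->] _ [g' ->]|f g _ [f' ->] _ [g' ->]].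
- by exists (RConst N c).
- rewrite inE => /orP[/eqP ->|/mapP[ij _ ->]]; first by exists (RInvDet K N).
  by exists (RCoord K ij.1 ij.2).
- by exists (RAdd f' g').
- by exists (RMul f' g').
Qed.

Lemma shifted_algebra : {in shifted, forall f, algebra_gen coords f}.
Proof. by move=> _ /mapP[ij _ ->]; exact: fn_algebra. Qed.

Let zy := shifted_algebra.

Lemma shifted1 ij : J 1 (fn (shifted_coord ij)).
Proof. by apply: ideal_gen; apply/map_f; rewrite mem_index_enum. Qed.

Lemma fn_shifted i j t : fn (shifted_coord (i, j)) t = e t i j - (i == j)%:R.
Proof. by []. Qed.

Definition linear_part (c : 'M[K]_N) : T -> K :=
  fun t => \sum_i \sum_j c i j * (e t i j - (i == j)%:R).

Lemma linear_part1 c : J 1 (linear_part c).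
Proof.
apply: ideal_sum => // i; apply: ideal_sum => // j.
by apply: idealZ => //; exact: (shifted1 (i, j)).
Qed.

(** [h] equals [a] plus the linear form [c], to first order at the identity. *)
Definition first_order h a c := algebra_gen coords h /\
  J 2 (fun t => h t - a - linear_part c t).

Lemma first_orderD h1 h2 a1 a2 c1 c2 : first_order h1 a1 c1 -> first_order h2 a2 c2 ->
  first_order (h1 \+ h2) (a1 + a2) (c1 + c2).
Proof.
move=> [A1 J1] [A2 J2]; split; first exact: algebra_add.
apply: ideal_ext (idealD zy J1 J2) => t /=.
have -> : linear_part (c1 + c2) t = linear_part c1 t + linear_part c2 t.
  rewrite -big_split; apply: eq_bigr => i _; rewrite -big_split; apply: eq_bigr => j _ /=.
  by rewrite mxE mulrDl.
by ring.
Qed.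

Lemma linear_partZ a c t : linear_part (a *: c) t = a * linear_part c t.
Proof.
rewrite mulr_sumr; apply: eq_bigr => i _; rewrite mulr_sumr; apply: eq_bigr => j _ /=.
by rewrite mxE mulrA.
Qed.

Lemma linear_partD c d t : linear_part (c + d) t = linear_part c t + linear_part d t.
Proof.
rewrite -big_split; apply: eq_bigr => i _; rewrite -big_split; apply: eq_bigr => j _ /=.
by rewrite mxE mulrDl.
Qed.

Lemma first_orderM h1 h2 a1 a2 c1 c2 : first_order h1 a1 c1 -> first_order h2 a2 c2 ->
  first_order (h1 \* h2) (a1 * a2) (a2 *: c1 + a1 *: c2).
Proof.
move=> [A1 J1] [A2 J2]; split; first exact: algebra_mul.
have P1 := idealM A2 J1.
have P2 := idealM (algebra_const _ a1) J2.
have P3 : J 2 (linear_part c1 \* linear_part c2).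
  exact: (ideal_mul (linear_part1 c1) (linear_part1 c2)).
have lA c : algebra_gen coords (linear_part c).
  exact: (ideal_power_algebra zy (linear_part1 c)).
have P4 := idealM (lA c1) J2.
have P5 := idealD zy (idealD zy P1 P2) (idealD zy P3 P4).
apply: ideal_ext P5 => t /=; rewrite linear_partD !linear_partZ.
by ring.
Qed.

Lemma first_order_const a : first_order (fun=> a) a 0.
Proof.
split; first exact: algebra_const.
apply: ideal_ext (ideal0 _ _ 2) => t.
by rewrite -(scale0r 0) linear_partZ mul0r subr0 subrr.
Qed.

Lemma first_order_coord i j :
  first_order (fn (RCoord K i j)) (i == j)%:R (delta_mx i j).
Proof.
split; first exact: fn_algebra.
apply: ideal_ext (ideal0 _ _ 2) => t.
rewrite /linear_part (bigD1 i) //= (bigD1 j) //= mxE !eqxx mul1r.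
rewrite big1 => [|l /negPf li]; last by rewrite mxE li andbF mul0r.
rewrite big1 => [|l /negPf li]; last by rewrite big1 // => m _; rewrite mxE li mul0r.
by rewrite !addr0 subrr.
Qed.

(** The differential of the determinant at the identity is the trace. *)
Lemma first_order_det : first_order (fun t => \det (e t)) 1 1%:M.
Proof.
pose F i j := fn (RCoord K i j).
have A (s : {perm 'I_N}) (r : seq 'I_N) : algebra_gen coords (fun t => \prod_(i <- r) F i (s i) t).
  elim: r => [|i r IH].
    rewrite (_ : (fun _ => _) = fun=> 1); first exact: algebra_const.
    by apply/funext => t; rewrite big_nil.
  rewrite (_ : (fun _ => _) = F i (s i) \* (fun t => \prod_(j <- r) F j (s j) t)).
    by apply: algebra_mul => //; exact: fn_algebra.
  by apply/funext => t; rewrite big_cons.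
have diag (r : seq 'I_N) : first_order (fun t => \prod_(i <- r) F i i t) 1
    (\sum_(i <- r) delta_mx i i).
  elim: r => [|i r IH].
    rewrite big_nil (_ : (fun _ => _) = fun=> 1); first exact: first_order_const.
    by apply/funext => t; rewrite big_nil.
  have := first_orderM (first_order_coord i i) IH.
  rewrite eqxx mulr1 !scale1r big_cons.
  rewrite (_ : (fun t => \prod_(j <- i :: r) _) = F i i \* (fun t => \prod_(j <- r) F j j t)) //.
  by apply/funext => t; rewrite big_cons.
have offdiag (s : {perm 'I_N}) : s != 1%g -> J 2 (fun t => \prod_i F i (s i) t).
  move=> s1; have [i si] : exists i, s i != i.
    apply/existsP; rewrite -negb_forall; apply: contra s1 => /forallP sid.
    by apply/eqP/permP => i; rewrite perm1; exact/eqP.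
  have sij : s (s i) != s i by rewrite (inj_eq perm_inj).
  have AP (P : pred 'I_N) : algebra_gen coords (fun t => \prod_(j | P j) F j (s j) t).
    rewrite (_ : (fun _ => _) = fun t => \prod_(j <- [seq j <- index_enum 'I_N | P j]) F j (s j) t).
      exact: A.
    by apply/funext => t; rewrite big_filter.
  have Jo k : s k != k -> J 1 (F k (s k)).
    move=> /negPf sk; apply: ideal_ext (shifted1 (k, s k)) => t.
    by rewrite fn_shifted eq_sym sk subr0.
  have := ideal_mul (Jo i si) (idealM (AP [pred j | (j != i) && (j != s i)]) (Jo (s i) sij)).
  apply: ideal_ext => t /=.
  rewrite [RHS](bigD1 i) //= [X in _ = _ * X](bigD1 (s i)) //=; congr (_ * _); exact: mulrC.
split.
  rewrite (_ : (fun _ => _) = fun t => \sum_(s : {perm 'I_N}) (-1) ^+ s * \prod_i F i (s i) t) //.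
  by apply: algebra_sum => s; apply: (algebra_mul (algebra_const _ _)); exact: A.
have [_ J1] := diag (index_enum 'I_N).
have J2 : J 2 (fun t => \sum_(s <- [seq s : {perm 'I_N} <- index_enum {perm 'I_N} | s != 1%g])
    (-1) ^+ s * \prod_i F i (s i) t).
  have Js (s : {perm 'I_N}) : s != 1%g -> J 2 (fun t => (-1) ^+ s * \prod_i F i (s i) t).
    by move=> s1; apply: idealZ => //; exact: offdiag.
  elim: (index_enum _) => [|s r IH] /=.
    by apply: ideal_ext (ideal0 _ _ 2) => t; rewrite big_nil.
  case: ifP => // s1; apply: ideal_ext (idealD zy (Js s s1) IH) => t /=.
  by rewrite big_cons.
apply: ideal_ext (idealD zy J1 J2) => t /=.
rewrite big_filter [in RHS]/determinant [X in _ = X - _ - _](bigD1 (1%g : {perm 'I_N})) //=.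
rewrite odd_perm1 expr0 mul1r (_ : \sum_i delta_mx i i = 1%:M); last first.
  apply/matrixP => a b; rewrite summxE !mxE (bigD1 a) //= mxE eqxx big1 ?addr0 1?eq_sym //.
  by move=> c /negPf ca; rewrite mxE eq_sym ca.
under [in RHS]eq_bigr do rewrite perm1.
by rewrite -!addrA; congr (_ + _); rewrite addrA addrC.
Qed.
End Taylor.

Section FirstOrder.
Variables (K : closedFieldType) (N : nat) (G : set 'M[K]_N).
Hypothesis Ggrp : is_subgroup G.
Variables (T : pointedType) (e : T -> 'M[K]_N).
Hypotheses (eG : forall t, G (e t)) (esurj : forall g, G g -> exists t, e t = g).
Hypothesis char0 : [pchar K] =i pred0.
Notation J := (ideal_power (coords e) (shifted e)).
Let zy := shifted_algebra (e := e).

Definition differential (f : rterm K N) : 'M[K]_N :=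
  \matrix_(i, j) ev (rderiv (delta_mx i j) f) 1%:M.

Definition pairing (x c : 'M[K]_N) : K := \sum_i \sum_j x i j * c i j.

Lemma rderiv0 f (g : 'M[K]_N) : ev (rderiv 0 f) g = 0 :> K.
Proof.
have /eqP := rderiv_linear 1 (0 : 'M[K]_N) 0 f g.
by rewrite scaler0 addr0 mul1r -subr_eq subrr eq_sym => /eqP.
Qed.

Lemma rderivD x y f (g : 'M[K]_N) : ev (rderiv (x + y) f) g = ev (rderiv x f) g + ev (rderiv y f) g :> K.
Proof. by have := rderiv_linear 1 x y f g; rewrite scale1r mul1r. Qed.

Lemma rderivZ a x f (g : 'M[K]_N) : ev (rderiv (a *: x) f) g = a * ev (rderiv x f) g :> K.
Proof. by have := rderiv_linear a x 0 f g; rewrite addr0 rderiv0 addr0. Qed.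

Lemma rderiv_sum I (r : seq I) (x : I -> 'M[K]_N) f g :
  ev (rderiv (\sum_(i <- r) x i) f) g = \sum_(i <- r) ev (rderiv (x i) f) g.
Proof.
elim: r => [|i r IH]; first by rewrite !big_nil rderiv0.
by rewrite !big_cons rderivD IH.
Qed.

Lemma rderiv_pairing x f : ev (rderiv x f) 1%:M = pairing x (differential f).
Proof.
rewrite {1}(matrix_sum_delta x) rderiv_sum; apply: eq_bigr => i _.
by rewrite rderiv_sum; apply: eq_bigr => j _; rewrite rderivZ mxE.
Qed.

Lemma differential_add f h : differential (RAdd f h) = differential f + differential h.
Proof. by apply/matrixP => i j; rewrite !mxE. Qed.

Lemma differential_mul f h : differential (RMul f h) =
  ev h 1%:M *: differential f + ev f 1%:M *: differential h.
Proof. by apply/matrixP => i j; rewrite !mxE /= mulrC. Qed.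

Lemma differential_coord i j : differential (RCoord K i j) = delta_mx i j.
Proof.
by apply/matrixP => a b; rewrite mxE ev_rderiv_coord mul1mx !mxE eq_sym (eq_sym j).
Qed.

Lemma differential_invdet : differential (RInvDet K N) = - 1%:M.
Proof.
apply/matrixP => a b; rewrite !mxE /= det1 invr1 mulr1; congr (- _).
rewrite /mxtrace (bigD1 a) //= mxE eqxx /= big1 ?addr0 1?eq_sym // => c /negPf ca.
by rewrite mxE ca.
Qed.

(** By induction on the term; for the inverse determinant, multiply its expansion by
    that of the determinant. *)
Theorem first_order_fn f : first_order e (fn e f) (ev f 1%:M) (differential f).
Proof.
elim: f => [a|i j||f IHf h IHh|f IHf h IHh].
- rewrite (_ : differential _ = 0); first exact: first_order_const.
  by apply/matrixP => i j; rewrite !mxE.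
- by rewrite differential_coord /= mxE; exact: first_order_coord.
- split; first exact: fn_algebra.
  have [Ad Jd] := first_order_det e.
  rewrite differential_invdet /= det1 invr1.
  pose s := linear_part e 1%:M; have Js : J 1 s := linear_part1 e 1%:M.
  have As := ideal_power_algebra zy Js.
  have AV : algebra_gen (coords e) (fn e (RInvDet K N)) by exact: fn_algebra.
  have J1 := idealZ (-1) Jd.
  have J2 := ideal_mul Js Js.
  have J3 := idealM As Jd.
  apply: ideal_ext (idealM AV (idealD zy (idealD zy J1 J2) J3)) => t /=.
  rewrite -[- 1%:M]scaleN1r linear_partZ mulN1r -/s /fn /=.
  have d0 : \det (e t) != 0.
    by rewrite -unitfE -unitmxE; exact: (G_unit Ggrp).
  by field.
- rewrite differential_add; exact: first_orderD.
- rewrite differential_mul; exact: first_orderM.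
Qed.

(** Its differential annihilates the tangent space, so it is the differential of a
    function vanishing on the group; subtract that function. *)
Lemma second_order f : ev f 1%:M = 0 -> (forall x, tangent G x -> ev (rderiv x f) 1%:M = 0) ->
  J 2 (fn e f).
Proof.
move=> f1 fx.
pose Om : set 'rV[K]_(N * N) := [set v | exists h, vanishing G h /\ v = mxvec (differential h)].
have Omlin : linear_set Om.
  split.
    exists (RConst N 0); split=> [//|]; rewrite (_ : differential _ = 0) ?linear0 //.
    by apply/matrixP => i j; rewrite !mxE.
  move=> a _ _ [h [h0 ->]] [l [l0 ->]]; exists (RAdd (RMul (RConst N a) h) l); split.
    by move=> g Gg /=; rewrite h0 // l0 // mulr0 addr0.
  rewrite differential_add differential_mul linearD /= -linearZ /=.
  rewrite (_ : differential (RConst N a) = 0) ?scaler0 ?add0r //.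
  by apply/matrixP => i j; rewrite !mxE.
have [A AE] := linear_set_mx Omlin.
have : Om (mxvec (differential f)).
  apply/AE; rewrite submxE; apply/eqP/rowP => j; rewrite [RHS]mxE.
  pose c := col j (cokermx A); pose x : 'M[K]_N := vec_mx c^T.
  have xE h : pairing x (differential h) = (mxvec (differential h) *m cokermx A) 0 j.
    rewrite mxE (reindex _ (curry_mxvec_bij _ _)) /= /pairing pair_bigA /=.
    by apply: eq_bigr => -[a b] _ /=; rewrite mxvecE !mxE mulrC.
  rewrite -xE -rderiv_pairing; apply: fx => h h0; rewrite rderiv_pairing xE.
  have : (mxvec (differential h) <= A)%MS by apply/AE; exists h.
  by rewrite submxE => /eqP ->; rewrite mxE.
move=> [h [h0 /(can_inj mxvecK) dE]].
have [_ Jf] := first_order_fn f; have [_ Jh] := first_order_fn h.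
apply: ideal_ext (idealD zy Jf (idealZ (-1) Jh)) => t /=.
rewrite f1 dE /fn h0 //; have := h0 1%:M (subgroup1 Ggrp); move=> ->.
by ring.
Qed.

(** A basis of the tangent space, with linear forms on matrices extending the dual
    basis. *)
Lemma exists_dual_basis : exists r (x : 'I_r -> 'M[K]_N) (tau : 'I_r -> 'M[K]_N),
  (forall k, tangent G (x k)) /\
  forall u, tangent G u -> u = \sum_k pairing (tau k) u *: x k.
Proof.
pose S : set 'rV[K]_(N * N) := [set v | tangent G (vec_mx v)].
have Slin : linear_set S.
  split; first by rewrite /S /= linear0; exact: tangent0.
  by move=> a u v Su Sv; rewrite /S /= linearP; exact: tangent_linear.
have [A AE] := linear_set_mx Slin.
exists _, (fun k => vec_mx (row k A)), (fun k => vec_mx (col k (pinvmx A))^T).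
split=> [k|u ut]; first by apply/AE; rewrite row_sub.
have uA : (mxvec u <= A)%MS by apply/AE; rewrite /S /= mxvecK.
rewrite -{1}[u]mxvecK -{1}(mulmxKpV uA) mulmx_sum_row linear_sum; apply: eq_bigr => k _.
rewrite linearZ /=; congr (_ *: _).
rewrite mxE (reindex _ (curry_mxvec_bij _ _)) /= /pairing pair_bigA /=.
by apply: eq_bigr => -[a b] _ /=; rewrite mxvecE !mxE mulrC.
Qed.

Definition linear_coord (tau : 'M[K]_N) : rterm K N :=
  rsum (index_enum ('I_N * 'I_N)%type) (fun ij =>
    RMul (RConst N (tau ij.1 ij.2)) (shifted_coord K ij)).

Lemma ev_linear_coord tau g : ev (linear_coord tau) g = pairing tau (g - 1%:M).
Proof.
rewrite ev_sum /pairing pair_bigA; apply: eq_bigr => -[i j] _ /=.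
by rewrite !mxE.
Qed.

Lemma rderiv_linear_coord tau x : ev (rderiv x (linear_coord tau)) 1%:M = pairing tau x.
Proof.
rewrite rderiv_rsum /pairing pair_bigA; apply: eq_bigr => -[i j] _.
rewrite [LHS]/= mul0r add0r addr0; congr (_ * _).
by have := ev_rderiv_coord x i j 1%:M; rewrite mul1mx => <-.
Qed.

(** Euler's formula: the vector field [sum_k t_k x_k] multiplies functions
    vanishing to order [n] by [n], up to higher order. *)
Lemma euler_formula r (x tau : 'I_r -> 'M[K]_N) :
  (forall k, tangent G (x k)) ->
  (forall u, tangent G u -> u = \sum_k pairing (tau k) u *: x k) ->
  forall n h, J n h -> forall f, h = fn e f ->
  J n.+1 (fun t => \sum_k ev (linear_coord (tau k)) (e t) * ev (rderiv (x k) f) (e t)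
     - n%:R * ev f (e t)).
Proof.
move=> xt dual; pose Eu f t := \sum_k ev (linear_coord (tau k)) (e t) * ev (rderiv (x k) f) (e t).
have Euext f f' : fn e f = fn e f' -> forall t, Eu f t = Eu f' t.
  move=> E t; apply: eq_bigr => k _; congr (_ * _).
  apply: (tangent_ext Ggrp (xt k)) => // g Gg; have [s <-] := esurj Gg.
  exact: (congr1 (fun F => F s) E).
have AE f : algebra_gen (coords e) (Eu f).
  apply: algebra_sum => k; apply: algebra_mul; first exact: (fn_algebra e (linear_coord _)).
  exact: (fn_algebra e (rderiv (x k) f)).
have J1t k : J 1 (fn e (linear_coord (tau k))).
  apply: ideal_ext (linear_part1 e (tau k)) => t; rewrite /fn ev_linear_coord.
  by apply: eq_bigr => i _; apply: eq_bigr => j _; rewrite !mxE.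
have JE f : J 1 (Eu f).
  apply: ideal_sum => // k; rewrite (_ : (fun _ => _) = fn e (rderiv (x k) f) \* fn e (linear_coord (tau k))).
    by apply: idealM => //; exact: fn_algebra.
  by apply/funext => t; rewrite /= mulrC.
have EM f f' t : Eu (RMul f f') t = Eu f t * ev f' (e t) + ev f (e t) * Eu f' t.
  rewrite mulr_suml mulr_sumr -big_split; apply: eq_bigr => k _ /=; ring.
have Ecoord ij : J 2 (fun t => Eu (shifted_coord K ij) t - ev (shifted_coord K ij) (e t)).
  case: ij => i j.
  have P1 : J 2 (fn e (RAdd (shifted_coord K (i, j)) (RMul (RConst N (-1))
      (rsum (index_enum 'I_r) (fun k => RMul (RConst N (x k i j)) (linear_coord (tau k))))))).
    apply: second_order.
      rewrite /= !mxE ev_sum big1 ?mulr0 ?addr0 ?subrr // => k _ /=.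
      rewrite ev_linear_coord subrr /pairing big1 ?mulr0 // => a _.
      by rewrite big1 // => b _; rewrite mxE mulr0.
    move=> u ut; rewrite [LHS]/= mul0r add0r addr0 rderiv_rsum mulN1r.
    have -> : ev (rsum (index_enum 'I_N) (fun l => RMul (RCoord K i l) (RConst N (u l j)))) 1%:M = u i j.
      by have := ev_rderiv_coord u i j 1%:M; rewrite mul1mx => <-.
    rewrite {1}(dual u ut) summxE -sumrB big1 // => k _ /=.
    by rewrite mul0r add0r rderiv_linear_coord mxE mulrC subrr.
  have P2 k : J 2 (fun t => ev (linear_coord (tau k)) (e t) * ((e t *m x k) i j - x k i j)).
    have -> : (fun t => ev (linear_coord (tau k)) (e t) * ((e t *m x k) i j - x k i j)) =
      fn e (linear_coord (tau k)) \* linear_part e (\matrix_(a, b) ((i == a)%:R * x k b j)).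
      apply/funext => t; rewrite /fn /=; congr (_ * _).
      rewrite /linear_part (bigD1 i) //= [X in _ = _ + X]big1 ?addr0 => [|a /negPf ai]; last first.
        by rewrite big1 // => b _; rewrite !mxE eq_sym ai mul0r mul0r.
      have xk : x k i j = \sum_b (i == b)%:R * x k b j.
        by rewrite -{1}[x k]mul1mx mxE; apply: eq_bigr => b _; rewrite mxE.
      rewrite mxE xk -sumrB; apply: eq_bigr => b _; rewrite !mxE eqxx mul1r; ring.
    exact: (ideal_mul (J1t k) (linear_part1 e _)).
  have P3 : J 2 (fun t => \sum_k ev (linear_coord (tau k)) (e t) * ((e t *m x k) i j - x k i j)).
    exact: ideal_sum.
  apply: ideal_ext (idealD zy (idealZ (-1) P1) P3) => t /=.
  rewrite /fn /= ev_sum /Eu.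
  have -> : \sum_k ev (linear_coord (tau k)) (e t) * ev (rderiv (x k) (shifted_coord K (i, j))) (e t)
     = \sum_k ev (linear_coord (tau k)) (e t) * (e t *m x k) i j.
    apply: eq_bigr => k _; congr (_ * _); rewrite [LHS]/= addr0.
    exact: (ev_rderiv_coord (x k) i j).
  under [X in _ + X = _]eq_bigr do rewrite mulrBr.
  rewrite sumrB /=; under eq_bigr do rewrite mulrC.
  by ring.
move=> n h; elim=> [f _ f' _|m f fE|m f g fJ IHf gJ IHg h' hE|m f g fz gJ IHg h' hE].
- by apply: ideal_ext (JE f') => t; rewrite mul0r subr0.
- apply: ideal_ext (ideal0 _ _ _) => t; have ft0 : ev f (e t) = 0.
    by have := congr1 (fun F => F t) fE; rewrite /fn => <-.
  have := Euext f (RConst N 0) _ t; rewrite /Eu => -> /=.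
    by rewrite ft0 mulr0 subr0 big1 // => k _; rewrite mulr0.
  by rewrite -fE.
- have [f' fE] := algebra_fn (ideal_power_algebra zy fJ).
  have [g' gE] := algebra_fn (ideal_power_algebra zy gJ).
  apply: ideal_ext (idealD zy (IHf f' fE) (IHg g' gE)) => t.
  have hE' : fn e h' = fn e (RAdd f' g') by rewrite -hE fE gE.
  have := congr1 (fun F => F t) hE'; rewrite /fn /= => ->.
  have := Euext _ _ hE' t; rewrite /Eu => -> /=.
  under [in RHS]eq_bigr do rewrite mulrDr.
  rewrite big_split /=; ring.
- move/mapP: fz => [ij _ fE]; have [g' gE] := algebra_fn (ideal_power_algebra zy gJ).
  have hE' : fn e h' = fn e (RMul (shifted_coord K ij) g') by rewrite -hE fE gE.
  have Jij : J 1 (fn e (shifted_coord K ij)) by exact: shifted1.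
  have J1 := ideal_mul (Ecoord ij) gJ.
  have J2 := ideal_mul Jij (IHg g' gE).
  apply: ideal_ext (idealD zy J1 J2) => t.
  have := Euext _ _ hE' t; rewrite /Eu => ->; have := congr1 (fun F => F t) hE'.
  rewrite {1 2}/fn => ->; have := EM (shifted_coord K ij) g' t; rewrite /Eu => ->.
  rewrite gE [ev (RMul _ _) _]/=; rewrite -natr1 /fn /=; ring.
Qed.
End FirstOrder.

Section TangentConstant.
Variables (K : closedFieldType) (N : nat) (G : set 'M[K]_N).
Hypothesis Ggrp : is_subgroup G.
Hypothesis char0 : [pchar K] =i pred0.

Definition tangent_null (q : rterm K N) :=
  forall x, tangent G x -> forall g, G g -> ev (rderiv x q) g = 0.

(** Its derivatives vanish, so Euler's formula shows that [q - q(1)] vanishes at the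
    identity to infinite order, and Krull's theorem makes it vanish after
    multiplication by a function [b] with [b(1) = 1]. *)
Lemma tangent_null_local q : tangent_null q ->
  exists b, ev b 1%:M = 1 /\
    forall g, G g -> ev b g * (ev q g - ev q 1%:M) = 0.
Proof.
move=> qnull.
pose T0 := {g : 'M[K]_N | `[< G g >]}.
have G1 : `[< G 1%:M >] by apply/asboolP; exact: (subgroup1 Ggrp).
pose T : pointedType := HB.pack_for pointedType T0 (isPointed.Build T0 (exist _ 1%:M G1)).
pose e (t : T) : 'M[K]_N := sval (t : T0).
have eG t : G (e t) by apply/asboolP; exact: (svalP (t : T0)).
have esurj g : G g -> exists t, e t = g.
  by move=> Gg; exists (exist _ g (introT (asboolP _) Gg) : T0).
pose zy := shifted_algebra (e := e).
pose Q := RAdd q (RConst N (- ev q 1%:M)).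
have Qnull x g : tangent G x -> G g -> ev (rderiv x Q) g = 0.
  by move=> xt Gg; rewrite /= qnull // addr0.
have [r [x [tau [xt dual]]]] := exists_dual_basis G.
have J1 : ideal_power (coords e) (shifted e) 1 (fn e Q).
  have [_ J2] := first_order_fn Ggrp eG Q.
  have J1 : ideal_power (coords e) (shifted e) 1 (fun t => fn e Q t - ev Q 1%:M - linear_part e (differential Q) t).
    move: J2; move: (fun t => _) => h J2; have : exists2 m, m = 2%N & ideal_power (coords e) (shifted e) m h by exists 2%N.
    case=> m m2 Jm; have {m2} : (1 <= m)%N by rewrite m2.
    elim: Jm => [//|n _|n f g _ IHf _ IHg n0|n f g fz gJ _ _].
    - exact: ideal0.
    - by apply: idealD => //; [exact: IHf|exact: IHg].
    - rewrite (_ : f \* g = g \* f); last by apply/funext => t /=; rewrite mulrC.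
      apply: idealM; first exact: (ideal_power_algebra zy gJ).
      exact: ideal_gen.
  apply: ideal_ext (idealD zy J1 (linear_part1 e (differential Q))) => t /=.
  by rewrite subrr subr0 subrK.
have Jn n : ideal_power (coords e) (shifted e) n (fn e Q).
  case: n => [|n]; first exact/ideal_power0/fn_algebra.
  elim: n => // n IH.
  have := euler_formula Ggrp eG esurj xt dual IH (erefl (fn e Q)).
  move/(idealZ (- (n.+1%:R)^-1)); apply: ideal_ext => t.
  rewrite big1 => [|k _]; last by rewrite Qnull ?mulr0.
  by rewrite sub0r mulrNN mulKf // (proj1 (pcharf0P _) char0).
have zA : {in shifted e, forall f, algebra_gen (coords e) f /\ f (exist _ 1%:M G1 : T0) = 0}.
  move=> f fz; split; first exact: zy.
  by case/mapP: fz => -[i j] _ ->; rewrite fn_shifted mxE subrr.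
have [a [/algebra_fn[a' ->] a0 qa]] := krull_intersection zA Jn.
exists (RAdd (RConst N 1) (RMul (RConst N (-1)) a')); split.
  by move: a0; rewrite /fn /e /= => ->; rewrite mulr0 addr0.
move=> g Gg; have [t <-] := esurj g Gg.
have := qa t; rewrite /fn /= => qt.
by rewrite mulN1r mulrBl mul1r -qt subrr.
Qed.

Lemma tangent_null_translate q h : G h -> tangent_null q -> tangent_null (rtranslate h q).
Proof.
move=> Gh qnull x xt g Gg; rewrite rderiv_rtranslate; apply: qnull => //.
exact: (subgroupM Ggrp).
Qed.

Lemma closed_subset (P : set (rterm K N)) : zariski_closed idfun G ->
  zariski_closed idfun [set g | G g /\ forall f, P f -> ev f g = 0].
Proof.
move=> /closedP[P' GE]; apply/closedP; exists (P' `|` P); apply/seteqP; split=> g /=.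
  by rewrite {1}GE => -[[gu gP'] gP]; split=> // f [/gP'|/gP].
move=> [gu gP]; split; last by move=> f Pf; apply: gP; right.
by rewrite GE; split=> // f Pf; apply: gP; left.
Qed.

(** By translation, each point of [G] has a neighbourhood where [q] is constant; so the
    level set of [q(1)] and its complement are both closed. *)
Theorem tangent_null_constant q : zariski_closed idfun G -> zariski_connected G ->
  tangent_null q -> forall g, G g -> ev q g = ev q 1%:M.
Proof.
move=> Gcl Gcon qnull.
have loc p : G p -> exists b, ev b p = 1 /\
    forall g, G g -> ev b g * (ev q g - ev q p) = 0.
  move=> Gp; have [b [b1 bq]] := tangent_null_local (tangent_null_translate Gp qnull).
  have pu := G_unit Ggrp Gp.
  exists (rtranslate (invmx p) b); split; first by rewrite ev_rtranslate mulVmx.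
  move=> g Gg; have := bq (invmx p *m g) (subgroupM Ggrp (subgroupV Ggrp Gp) Gg).
  by rewrite !ev_rtranslate mulmxA mulmxV // mul1mx mulmx1.
pose A := [set g | G g /\ forall f, [set RAdd q (RConst N (- ev q 1%:M))] f -> ev f g = 0].
pose B := [set g | G g /\ forall f, [set b | exists p, [/\ G p, ev q p = ev q 1%:M &
  forall g, G g -> ev b g * (ev q g - ev q p) = 0]] f -> ev f g = 0].
have AE g : G g -> A g <-> ev q g = ev q 1%:M.
  move=> Gg; split=> [[_ /(_ _ erefl) /= /eqP]|E].
    by rewrite subr_eq0 => /eqP.
  by split=> // f -> /=; rewrite E subrr.
have BE g : G g -> B g <-> ev q g != ev q 1%:M.
  move=> Gg; split=> [[_ gB]|gq].
    apply/eqP => gq; have [b [b1 bq]] := loc g Gg.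
    have : ev b g = 0 by apply: gB; exists g.
    by rewrite b1 => /eqP; rewrite oner_eq0.
  split=> // b [p [Gp pq bq]]; have /eqP := bq g Gg.
  by rewrite mulf_eq0 pq subr_eq0 (negPf gq) orbF => /eqP.
have [||||A0|B0] := Gcon A B; first exact: closed_subset.
- exact: closed_subset.
- apply/seteqP; split=> g; first by case=> -[].
  move=> Gg; have [gq|gq] := eqVneq (ev q g) (ev q 1%:M).
    by left; apply/AE.
  by right; apply/BE.
- apply/seteqP; split=> // g [Ag Bg]; have Gg : G g by case: Ag.
  by move/(AE g Gg): Ag => E; move/(BE g Gg): Bg; rewrite E eqxx.
- by have : A 1%:M; [apply/AE => //; exact: (subgroup1 Ggrp)|rewrite A0].
- move=> g Gg; apply/eqP; apply: contraT => gq.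
  by have : B g; [apply/BE|rewrite B0].
Qed.
End TangentConstant.

(** * Differentials of representations *)

Section MatrixTerms.
Variables (K : closedFieldType) (N : nat).
Notation rt := (rterm K N).

Definition mxterm m n := 'I_m -> 'I_n -> rt.

Definition mev m n (M : mxterm m n) (g : 'M[K]_N) : 'M[K]_(m, n) := \matrix_(i, j) ev (M i j) g.

Definition mder m n (x : 'M[K]_N) (M : mxterm m n) : mxterm m n := fun i j => rderiv x (M i j).

Definition mconst m n (C : 'M[K]_(m, n)) : mxterm m n := fun i j => RConst N (C i j).

Definition mmul m n p (M : mxterm m n) (M' : mxterm n p) : mxterm m p :=
  fun i j => rsum (index_enum 'I_n) (fun l => RMul (M i l) (M' l j)).

Definition mstd : mxterm N N := fun i j => RCoord K i j.

Lemma mev_const m n (C : 'M[K]_(m, n)) g : mev (mconst C) g = C.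
Proof. by apply/matrixP => i j; rewrite mxE. Qed.

Lemma mev_mul m n p (M : mxterm m n) (M' : mxterm n p) g :
  mev (mmul M M') g = mev M g *m mev M' g.
Proof.
by apply/matrixP => i j; rewrite !mxE ev_sum; apply: eq_bigr => l _; rewrite !mxE.
Qed.

Lemma mev_std g : mev mstd g = g.
Proof. by apply/matrixP => i j; rewrite mxE. Qed.

Lemma mder_const m n (C : 'M[K]_(m, n)) x g : mev (mder x (mconst C)) g = 0.
Proof. by apply/matrixP => i j; rewrite !mxE. Qed.

Lemma mder_mul m n p (M : mxterm m n) (M' : mxterm n p) x g :
  mev (mder x (mmul M M')) g =
  mev (mder x M) g *m mev M' g + mev M g *m mev (mder x M') g.
Proof.
apply/matrixP => i j; rewrite !mxE rderiv_rsum -big_split; apply: eq_bigr => l _.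
by rewrite !mxE.
Qed.

Lemma mder_std x g : mev (mder x mstd) g = g *m x.
Proof. by apply/matrixP => i j; rewrite mxE ev_rderiv_coord. Qed.

Lemma mder_linear m n (M : mxterm m n) a x y g :
  mev (mder (a *: x + y) M) g = a *: mev (mder x M) g + mev (mder y M) g.
Proof. by apply/matrixP => i j; rewrite !mxE rderiv_linear. Qed.

(** The inverse is regular, by Cramer's rule. *)
Definition rdet n (M : mxterm n n) : rt :=
  rsum (index_enum {perm 'I_n}) (fun s => RMul (RConst N ((-1) ^+ s))
    (foldr (fun i f => RMul (M i (s i)) f) (RConst N 1) (index_enum 'I_n))).

Lemma ev_rdet n (M : mxterm n n) g : ev (rdet M) g = \det (mev M g).
Proof.
rewrite ev_sum; apply: eq_bigr => s _ /=; congr (_ * _).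
elim: (index_enum _) => [|i r IH] /=; first by rewrite big_nil.
by rewrite big_cons IH mxE.
Qed.

Definition minv : mxterm N N := fun i j =>
  RMul (RInvDet K N) (RMul (RConst N ((-1) ^+ (j + i)))
    (rdet (fun a b => RCoord K (lift j a) (lift i b)))).

Lemma mev_inv g : g \in unitmx -> mev minv g = invmx g.
Proof.
move=> gu; apply/matrixP => i j; rewrite /invmx gu !mxE /= ev_rdet; congr (_ * (_ * _)).
by congr (\det _); apply/matrixP => a b; rewrite !mxE.
Qed.

Definition mcomp_inv m n (M : mxterm m n) : mxterm m n :=
  fun i j => rsubst minv (rdet mstd) (M i j).

Lemma mev_comp_inv m n (M : mxterm m n) g : g \in unitmx ->
  mev (mcomp_inv M) g = mev M (invmx g).
Proof.
move=> gu; have E : subst_mx minv g = invmx g by exact: mev_inv.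
by apply/matrixP => i j; rewrite !mxE ev_rsubst E // ev_rdet mev_std det_inv invrK.
Qed.
End MatrixTerms.

Section Representations.
Variables (K : closedFieldType) (N : nat) (G : set 'M[K]_N).
Hypothesis Ggrp : is_subgroup G.
Notation mxterm := (mxterm K N).

Lemma mder_ext m n (M M' : mxterm m n) x : tangent G x ->
  (forall g, G g -> mev M g = mev M' g) ->
  forall g, G g -> mev (mder x M) g = mev (mder x M') g.
Proof.
move=> xt E g Gg; apply/matrixP => i j; rewrite !mxE.
by apply: (tangent_ext Ggrp xt) => // h Gh; have /matrixP/(_ i j) := E h Gh; rewrite !mxE.
Qed.

Lemma mder_vanishing m n (M : mxterm m n) C x : tangent G x ->
  (forall g, G g -> mev M g = C) -> forall g, G g -> mev (mder x M) g = 0.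
Proof.
move=> xt E g Gg; rewrite (mder_ext xt (M' := mconst N C)) ?mder_const //.
by move=> h Gh; rewrite mev_const E.
Qed.

Definition is_rep n (F : mxterm n n) := mev F 1%:M = 1%:M /\
  forall g h, G g -> G h -> mev F (g *m h) = mev F g *m mev F h.

Definition drep n (F : mxterm n n) x : 'M[K]_n := mev (mder x F) 1%:M.

Let G1 := subgroup1 Ggrp.

Section Rep.
Variables (n : nat) (F : mxterm n n).
Hypothesis Frep : is_rep F.

Lemma repV g : G g -> mev F g *m mev F (invmx g) = 1%:M.
Proof.
move=> Gg; rewrite -(proj2 Frep) ?mulmxV ?(proj1 Frep) //; first exact: (G_unit Ggrp).
exact: (subgroupV Ggrp).
Qed.

Lemma repVl g : G g -> mev F (invmx g) *m mev F g = 1%:M.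
Proof.
move=> Gg; rewrite -(proj2 Frep) ?mulVmx ?(proj1 Frep) //; first exact: (G_unit Ggrp).
exact: (subgroupV Ggrp).
Qed.

Lemma mev_inv_rep g : G g -> mev (mcomp_inv F) g = mev F (invmx g).
Proof. by move=> Gg; rewrite mev_comp_inv //; exact: (G_unit Ggrp). Qed.

(** Left translation by [g] multiplies the representation by a constant matrix. *)
Lemma mder_rep x g : tangent G x -> G g -> mev (mder x F) g = mev F g *m drep F x.
Proof.
move=> xt Gg; pose T : mxterm n n := fun i j => rtranslate g (F i j).
have -> : mev (mder x F) g = mev (mder x T) 1%:M.
  by apply/matrixP => i j; rewrite !mxE rderiv_rtranslate mulmx1.
rewrite (mder_ext xt (M' := mmul (mconst N (mev F g)) F)) // => [|h Gh].
  by rewrite mder_mul mder_const mul0mx add0r mev_const.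
rewrite mev_mul mev_const -(proj2 Frep) //.
by apply/matrixP => i j; rewrite !mxE ev_rtranslate.
Qed.

Lemma mder_inv_rep x g : tangent G x -> G g ->
  mev (mder x (mcomp_inv F)) g = - (drep F x *m mev F (invmx g)).
Proof.
move=> xt Gg.
have := mder_vanishing (M := mmul F (mcomp_inv F)) (C := 1%:M) xt _ Gg.
rewrite mder_mul mder_rep // mev_inv_rep // => H.
have /(congr1 (mulmx (mev F (invmx g)))) : mev F g *m drep F x *m mev F (invmx g) +
    mev F g *m mev (mder x (mcomp_inv F)) g = 0.
  by apply: H => h Gh; rewrite mev_mul mev_inv_rep // repV.
rewrite mulmx0 mulmxDr !mulmxA repVl // !mul1mx => /eqP.
by rewrite addrC addr_eq0 => /eqP.
Qed.

Lemma drep_linear a x y : drep F (a *: x + y) = a *: drep F x + drep F y.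
Proof. exact: mder_linear. Qed.

(** Evaluate the commutator of two invariant derivations on the representation. *)
Lemma drep_bracket x y : tangent G x -> tangent G y ->
  drep F (bracket x y) = bracket (drep F x) (drep F y).
Proof.
move=> xt yt.
have E u v : tangent G u -> tangent G v -> mev (mder u (mder v F)) 1%:M = drep F u *m drep F v.
  move=> ut vt; rewrite (mder_ext ut (M' := mmul F (mconst N (drep F v)))) //.
    by rewrite mder_mul mder_const mulmx0 addr0 mev_const.
  by move=> g Gg; rewrite mev_mul mev_const mder_rep.
rewrite {2}/bracket -!E //; apply/matrixP => i j; rewrite !mxE.
exact: rderiv_bracket.
Qed.

Lemma drep_conj x h : G h -> tangent G x ->
  drep F (h *m x *m invmx h) = mev F h *m drep F x *m mev F (invmx h).
Proof.
move=> Gh xt; have hu := G_unit Ggrp Gh.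
pose T : mxterm n n := fun i j => rconj h (F i j).
have -> : drep F (h *m x *m invmx h) = mev (mder x T) 1%:M.
  by apply/matrixP => i j; rewrite !mxE rderiv_rconj // mulmx1 mulmxV.
rewrite (mder_ext xt (M' := mmul (mmul (mconst N (mev F h)) F) (mconst N (mev F (invmx h))))) // => [|g Gg].
  by rewrite mder_mul mder_const mulmx0 addr0 mder_mul mder_const mul0mx add0r !mev_const.
rewrite !mev_mul !mev_const -!(proj2 Frep) //; last exact: (subgroupV Ggrp).
  by apply/matrixP => i j; rewrite !mxE ev_rconj.
exact: (subgroupM Ggrp).
Qed.

Lemma mev_drep h x : G h -> tangent G x ->
  mev F h *m drep F x = drep F (h *m x *m invmx h) *m mev F h.
Proof. by move=> Gh xt; rewrite drep_conj // -!mulmxA repVl // mulmx1. Qed.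

Lemma drep_const m p (A : 'M[K]_(m, n)) (B : 'M[K]_(n, p)) C x : tangent G x ->
  (forall g, G g -> A *m mev F g *m B = C) -> A *m drep F x *m B = 0.
Proof.
move=> xt E; have := mder_vanishing (M := mmul (mmul (mconst N A) F) (mconst N B)) (C := C) xt _ G1.
rewrite mder_mul mder_const mulmx0 addr0 mder_mul mder_const mul0mx add0r !mev_const.
by apply=> g Gg; rewrite !mev_mul !mev_const E.
Qed.

Lemma drep_stable x (U1 U2 : 'M[K]_n) : tangent G x ->
  (forall g, G g -> (U1 *m mev F g <= U2)%MS) -> (U1 *m drep F x <= U2)%MS.
Proof.
move=> xt U12; rewrite submxE; apply/eqP; apply: (drep_const (C := 0)) => // g Gg.
by apply/eqP; rewrite -submxE U12.
Qed.

Lemma drep_sub1 x (U1 U2 : 'M[K]_n) : tangent G x ->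
  (forall g, G g -> (U1 *m (mev F g - 1%:M) <= U2)%MS) -> (U1 *m drep F x <= U2)%MS.
Proof.
move=> xt U12; rewrite submxE; apply/eqP; apply: (drep_const (C := U1 *m cokermx U2)) => // g Gg.
have := U12 g Gg; rewrite submxE mulmxBr mulmx1 mulmxBl subr_eq0 => /eqP.
by [].
Qed.

Hypothesis char0 : [pchar K] =i pred0.
Hypothesis Gcl : zariski_closed idfun G.
Hypothesis Gcon : zariski_connected G.

(** If [y] commutes with the differential, the function [F(g) y F(g)^-1] has zero
    derivatives, hence is constant. *)
Lemma commute_drep y : (forall x, tangent G x -> drep F x *m y = y *m drep F x) ->
  forall g, G g -> mev F g *m y = y *m mev F g.
Proof.
move=> cy g Gg; pose M := mmul (mmul F (mconst N y)) (mcomp_inv F).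
have Mc : mev M g = mev M 1%:M.
  apply/matrixP => i j; rewrite [LHS]mxE [RHS]mxE.
  apply: (tangent_null_constant Ggrp char0 Gcl Gcon) => // x xt h Gh.
  have -> : ev (rderiv x (M i j)) h = mev (mder x M) h i j by rewrite mxE.
  rewrite mder_mul mder_mul mder_const mulmx0 addr0 mder_inv_rep // mder_rep //.
  rewrite !mev_mul mev_const mev_inv_rep // mulmxN !mulmxA.
  by rewrite -[mev F h *m drep F x *m y]mulmxA cy // mulmxA subrr mxE.
move: Mc; rewrite !mev_mul !mev_const !mev_inv_rep // !(proj1 Frep) mul1mx.
rewrite invmx1 (proj1 Frep) mulmx1 => E.
by rewrite -{2}E -!mulmxA repVl // mulmx1.
Qed.
End Rep.
End Representations.

(** * Simple subquotients *)

Section SimpleSubquotients.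
Variables (K : closedFieldType) (N : nat) (G : set 'M[K]_N).
Hypothesis Ggrp : is_subgroup G.
Notation mxterm := (mxterm K N).

Definition gstable n (F : mxterm n n) (U : 'M[K]_n) :=
  forall g, G g -> (U *m mev F g <= U)%MS.

Definition simple_rep n (F : mxterm n n) :=
  (0 < n)%N /\ forall U : 'M[K]_n, gstable F U -> U = 0 \/ row_full U.

(** That is, [U2 / U1] is a simple representation. *)
Definition simple_between n (F : mxterm n n) (U1 U2 : 'M[K]_n) :=
  [/\ gstable F U1, gstable F U2, (U1 <= U2)%MS, ~~ (U2 <= U1)%MS &
    forall U, gstable F U -> (U1 <= U)%MS -> (U <= U2)%MS -> (U <= U1)%MS \/ (U2 <= U)%MS].

Definition subrep n m (F : mxterm n n) (B : 'M[K]_(m, n)) (B' : 'M[K]_(n, m)) : mxterm m m :=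
  mmul (mmul (mconst N B) F) (mconst N B').

Section Subrep.
Variables (n : nat) (F : mxterm n n).
Hypothesis Frep : is_rep G F.

Lemma gstable0 : gstable F 0. Proof. by move=> g _; rewrite mul0mx. Qed.

Lemma gstable_full : gstable F 1%:M. Proof. by move=> g _; rewrite submx1. Qed.

Lemma gstable_cap U V : gstable F U -> gstable F V -> gstable F (U :&: V)%MS.
Proof.
move=> Us Vs g Gg; rewrite sub_capmx.
by rewrite (submx_trans (submxMr _ (capmxSl U V)) (Us g Gg))
  (submx_trans (submxMr _ (capmxSr U V)) (Vs g Gg)).
Qed.

(** A proper stable subspace of largest rank. *)
Lemma exists_simple_between U : gstable F U -> U != 0 -> exists U1, simple_between F U1 U.
Proof.
move=> Us U0.
pose P (r : nat) := `[< exists V : 'M[K]_n, [/\ gstable F V, (V <= U)%MS, ~~ (U <= V)%MS & \rank V = r] >].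
have exP : exists r, P r.
  exists 0%N; apply/asboolP; exists 0; rewrite mxrank0 sub0mx submx0.
  by split=> //; exact: gstable0.
have Pb r : P r -> (r <= n)%N by move=> /asboolP[V [_ _ _ <-]]; exact: rank_leq_col.
case: (ex_maxnP exP Pb) => r /asboolP[U1 [U1s U1U UU1 rE]] rmax.
exists U1; split=> // V Vs U1V VU.
have [UV|UV] := boolP (U <= V)%MS; first by right.
left; rewrite -(geq_leqif (mxrank_leqif_sup U1V)) rE; apply: rmax.
by apply/asboolP; exists V.
Qed.

Section OfSubquotient.
Variables (m : nat) (U1 U2 : 'M[K]_n) (B : 'M[K]_(m, n)) (B' : 'M[K]_(n, m)).
Hypotheses (sq : subquotient U1 U2 B B') (U1s : gstable F U1) (U2s : gstable F U2).

Lemma stable_mev g : G g -> stable U1 U2 (mev F g).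
Proof. by move=> Gg; split; [exact: U1s|exact: U2s]. Qed.

Lemma stable_drep x : tangent G x -> stable U1 U2 (drep F x).
Proof.
by move=> xt; split; apply: (drep_stable Ggrp xt) => g Gg; [exact: U1s|exact: U2s].
Qed.

Lemma mev_subrep g : mev (subrep F B B') g = subq B B' (mev F g).
Proof. by rewrite !mev_mul !mev_const. Qed.

Lemma drep_subrep x : drep (subrep F B B') x = subq B B' (drep F x).
Proof.
by rewrite /drep !mder_mul !mder_const mulmx0 addr0 mul0mx add0r !mev_const.
Qed.

Lemma is_rep_subrep : is_rep G (subrep F B B').
Proof.
split; first by rewrite mev_subrep (proj1 Frep) (subq1 sq).
move=> g h Gg Gh; rewrite !mev_subrep (proj2 Frep) //.
by apply: (subqM sq); exact: stable_mev.
Qed.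

Lemma simple_subrep : simple_between F U1 U2 -> simple_rep (subrep F B B').
Proof.
case: (sq) => BB U1B BU2 comp [_ _ U12 U21 sb]; split.
  rewrite lt0n; apply: contra U21 => /eqP m0; apply: (subq_faithful sq (submx_refl _)).
  apply/matrixP => i j; have := ltn_ord j; by rewrite [X in (_ < X)%N]m0.
move=> U Us; pose V := (U1 + U *m B)%MS.
have UB2 : (U *m B <= U2)%MS by exact: (subq_row sq).
have Vs : gstable F V.
  move=> g Gg; rewrite addsmxMr addsmx_sub (submx_trans (U1s Gg)) ?addsmxSl //=.
  have := comp _ (U *m B *m mev F g) (submx_trans (submxMr _ UB2) (U2s Gg)).
  rewrite -[X in (X <= V)%MS](subrK (U *m B *m mev F g *m B' *m B)) => H.
  apply: addmx_sub_adds => //; apply: submxMr.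
  by have := Us g Gg; rewrite mev_subrep /subq !mulmxA.
have [||VU1|U2V] := sb V Vs; first exact: addsmxSl.
- by rewrite addsmx_sub U12.
- left; have /submxP[D E] : (U *m B <= U1)%MS by rewrite (submx_trans (addsmxSr U1 _)).
  by rewrite -[U]mulmx1 -BB mulmxA E -mulmxA U1B mulmx0.
- right; have /sub_addsmxP[[D D'] /= E] : (B <= U1 + U *m B)%MS by rewrite (submx_trans BU2).
  apply/row_fullP; exists D'; rewrite -BB [in RHS]E mulmxDl -mulmxA U1B mulmx0 add0r.
  by rewrite -!mulmxA BB mulmx1.
Qed.
End OfSubquotient.
End Subrep.

Lemma drep0 n (F : mxterm n n) : drep F 0 = 0.
Proof. by apply/matrixP => i j; rewrite !mxE rderiv0. Qed.

Section Schur.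
Variables (n : nat) (F : mxterm n n).
Hypotheses (Frep : is_rep G F) (Fsimple : simple_rep F).

(** An eigenspace of [y] is stable. *)
Lemma schur y : (forall g, G g -> mev F g *m y = y *m mev F g) -> exists c, y = c%:M.
Proof.
case: Fsimple => n0 Fs cy.
have [c ec] : exists c, eigenvalue y c.
  have [c] : exists c, root (char_poly y) c.
    by apply/closed_rootP; rewrite size_char_poly eqSS -lt0n.
  by rewrite -eigenvalue_root_char; exists c.
have yE : eigenspace y c *m y = c *: eigenspace y c by exact/eigenspaceP.
exists c; have [|E0|] := Fs (eigenspace y c).
- move=> g Gg; apply/eigenspaceP; rewrite -mulmxA cy // mulmxA.
  by rewrite yE -scalemxAl.
- by move: ec; rewrite /eigenvalue E0 eqxx.
- move=> /row_fullP[D E]; rewrite -[LHS]mul1mx -E -mulmxA.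
  by rewrite yE -scalemxAr E scalemx1.
Qed.

Definition conj_stable (S : set 'M[K]_N) := forall h x, G h -> S x -> S (h *m x *m invmx h).

(** A stable Lie algebra acting by nilpotent matrices acts by zero, as its null
    space is nonzero and stable. *)
Lemma nilpotent_acts_zero (S : set 'M[K]_N) : S `<=` tangent G -> lie_linear S ->
  lie_closed S -> conj_stable S -> (forall x, S x -> exists k, drep F x ^+ k = 0) ->
  forall x, S x -> drep F x = 0.
Proof.
move=> St [S0 Sl] Sb Sc Snil; case: Fsimple => n0 Fs.
pose L : set 'M[K]_n := [set y | exists2 x, S x & y = drep F x].
have [|||v v0 vL] := @engel _ n L n0.
- split; first by exists 0; rewrite ?drep0.
  move=> a _ _ [x Sx ->] [y Sy ->]; exists (a *: x + y); first exact: Sl.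
  by rewrite drep_linear.
- move=> _ _ [x Sx ->] [y Sy ->]; exists (bracket x y); first exact: Sb.
  by rewrite (drep_bracket Ggrp Frep) //; exact: St.
- by move=> _ [x Sx ->]; exact: Snil.
have [W WE] : exists W : 'M[K]_n, forall w : 'rV_n, (forall x, S x -> w *m drep F x = 0) <-> (w <= W)%MS.
  apply: (@linear_set_mx _ _ [set w | forall x, S x -> w *m drep F x = 0]).
  split=> [x _|a u w uS wS x Sx]; first by rewrite mul0mx.
  by rewrite mulmxDl -scalemxAl uS // wS // scaler0 addr0.
have [g Gg|W0|Wfull] := Fs W.
- apply/row_subP => i; rewrite row_mul; apply/WE => x Sx.
  rewrite -mulmxA (mev_drep Ggrp Frep Gg (St _ Sx)) mulmxA.
  suff -> : row i W *m drep F (g *m x *m invmx g) = 0 by rewrite mul0mx.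
  by apply: (proj2 (WE _) (row_sub i W)); exact: Sc.
- have : (v <= W)%MS by apply/WE => x Sx; apply: vL; exists x.
  by rewrite W0 submx0 (negPf v0).
- move=> x Sx; apply/row_matrixP => i; rewrite rowE row0.
  by apply: (proj2 (WE _)) => //; exact: submx_full.
Qed.
End Schur.

(** The tangent space acts on a stable subspace by the derivative of conjugation, which
    is the bracket. *)
Lemma conj_stable_ideal (S : set 'M[K]_N) : lie_linear S -> conj_stable S ->
  forall y x, tangent G y -> S x -> S (bracket y x).
Proof.
move=> Sl Sc y x yt Sx; have [A AE] := lie_linear_mx Sl.
pose M : mxterm N N := mmul (mmul (@mstd K N) (mconst N x)) (mcomp_inv (@mstd K N)).
have stdrep : is_rep G (@mstd K N) by split=> [|g h _ _]; rewrite !mev_std.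
have Mg g : G g -> mev M g = g *m x *m invmx g.
  by move=> Gg; rewrite !mev_mul mev_std mev_const (mev_inv_rep Ggrp) // mev_std.
have dM : mev (mder y M) 1%:M = bracket y x.
  rewrite mder_mul mder_mul mder_const mulmx0 addr0 mder_std mul1mx.
  rewrite (mder_inv_rep Ggrp stdrep) //; last exact: (subgroup1 Ggrp).
  rewrite mev_mul mev_const mev_std (mev_inv_rep Ggrp) //; last exact: (subgroup1 Ggrp).
  rewrite invmx1 !mev_std mulmx1 mulmx1 mul1mx.
  have -> : drep (@mstd K N) y = y by rewrite /drep mder_std mul1mx.
  by rewrite mulmxN.
apply/AE; rewrite -dM submxE; apply/eqP/rowP => j; rewrite [RHS]mxE.
pose C := cokermx A.
pose f : rterm K N := rsum (index_enum ('I_N * 'I_N)%type) (fun ab =>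
  RMul (M ab.1 ab.2) (RConst N (C (mxvec_index ab.1 ab.2) j))).
have fE g : ev f g = (mxvec (mev M g) *m C) 0 j.
  rewrite ev_sum mxE (reindex _ (curry_mxvec_bij _ _)) /=.
  by apply: eq_bigr => -[a b] _ /=; rewrite mxvecE [mev M g a b]mxE.
have <- : ev (rderiv y f) 1%:M = (mxvec (mev (mder y M) 1%:M) *m C) 0 j.
  rewrite rderiv_rsum mxE (reindex _ (curry_mxvec_bij _ _)) /=.
  apply: eq_bigr => -[a b] _; rewrite /= mxvecE [mev (mder y M) 1%:M a b]mxE.
  by rewrite mulr0 addr0.
apply: yt => g Gg; rewrite fE Mg //.
have : (mxvec (g *m x *m invmx g) <= A)%MS by apply/AE/Sc.
by rewrite submxE => /eqP ->; rewrite mxE.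
Qed.
End SimpleSubquotients.

(** * The unipotent radical *)

Section UnipotentCurve.
Variables (K : closedFieldType) (N : nat).
Hypothesis char0 : [pchar K] =i pred0.

Definition binomial_poly i : {poly K} :=
  (\prod_(j < i) ('X - j%:R%:P)) * ((i`!)%:R^-1)%:P.

Lemma binomial_poly_nat i m : (binomial_poly i).[m%:R] = 'C(m, i)%:R.
Proof.
have i0 : ((i`!)%:R : K) != 0.
  by rewrite (proj1 (pcharf0P _) char0) -lt0n fact_gt0.
apply: (mulIf i0); rewrite -natrM bin_ffact /binomial_poly hornerM hornerC divfK //.
elim: i {i0} => [|i IH]; first by rewrite big_ord0 hornerE ffactn0.
rewrite big_ord_recr /= hornerM IH hornerXsubC ffactnSr natrM.
have [im|mi] := leqP i m; first by rewrite natrB.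
by rewrite ffact_small // !mul0r.
Qed.

(** The binomial series of [(1 + y)^t], for nilpotent [y]. *)
Definition power_curve (y : 'M[K]_N) M : 'M[{poly K}]_N :=
  \sum_(i < M) binomial_poly i *: map_mx (@polyC K) (y ^+ i).

Lemma at_power y M t : curve_at t (power_curve y M) = \sum_(i < M) (binomial_poly i).[t] *: y ^+ i.
Proof.
rewrite /curve_at /power_curve map_mx_sum; apply: eq_bigr => i _.
by apply/matrixP => a b; rewrite !mxE /= /horner_eval hornerM hornerC.
Qed.

Lemma at_power_nat y M m : y ^+ M = 0 -> curve_at m%:R (power_curve y M) = (1 + y) ^+ m.
Proof.
move=> yM; rewrite at_power addrC exprD1n.
have vanish i : (M <= i)%N -> y ^+ i = 0.
  by move=> Mi; rewrite -(subnKC Mi) exprD yM mul0r.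
pose F i := 'C(m, i)%:R *: y ^+ i.
rewrite (eq_bigr (fun i : 'I_M => F i)); last by move=> i _; rewrite binomial_poly_nat.
rewrite [RHS](eq_bigr (fun i : 'I_m.+1 => F i)); last by move=> i _; rewrite /F scaler_nat.
rewrite -!(big_mkord xpredT F) .
have [le|lt] := leqP M m.+1.
  rewrite [RHS](@big_cat_nat _ _ _ M 0 m.+1) //= [X in _ = _ + X]big_nat.
  rewrite [X in _ = _ + X]big1 ?addr0 // => i /andP[Mi _].
  by rewrite /F vanish // scaler0.
rewrite (@big_cat_nat _ _ _ m.+1 0 M) ?(ltnW lt) //= [X in _ + X]big_nat.
rewrite [X in _ + X]big1 ?addr0 // => i /andP[mi _].
by rewrite /F bin_small // scale0r.
Qed.

Lemma det_power_curve y M : y ^+ M = 0 -> \det (power_curve y M) = 1.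
Proof.
move=> yM; apply: det_curve => [|t]; first by rewrite -[0]/(0%:R) at_power_nat // expr0.
case: M yM => [|M] yM.
  have e0 (z : 'M[K]_N) : z = 0 by rewrite -[z]mul1mx -[1%:M]/(1 : 'M[K]_N) -(expr0 y) yM mul0mx.
  by rewrite [X in X \in _](e0 _) -[0](e0 1%:M) unitmx1.
rewrite at_power big_ord_recl expr0.
have -> : (binomial_poly 0).[t] *: (1 : 'M[K]_N) = 1%:M.
  by rewrite /binomial_poly big_ord0 mul1r hornerC fact0 invr1 scale1r.
pose z := \sum_(i < M) (binomial_poly i.+1).[t] *: y ^+ i.
have -> : \sum_(i < M) (binomial_poly (lift ord0 i)).[t] *: y ^+ (lift ord0 i) = y * z.
  rewrite -[y * z]/(y *m z) mulmx_sumr; apply: eq_bigr => i _.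
  by rewrite -scalemxAr -[y *m _]/(y * _) -exprS.
apply: (@unitmx_add_nilpotent _ _ _ M.+1); rewrite exprMn_comm ?yM ?mul0r //.
apply: commr_sum => i _; rewrite /GRing.comm -[LHS]/(y *m _) -[RHS]/(_ *m y).
by rewrite -scalemxAl -scalemxAr -[y *m _]/(y * _) -[_ *m y]/(_ * y) -exprS -exprSr.
Qed.

Lemma poly_eq0_nat (p : {poly K}) : (forall m, p.[m%:R] = 0) -> p = 0.
Proof.
move=> p0; apply/eqP; apply: contraT => pn0.
have u : uniq [seq (m%:R : K) | m <- iota 0 (size p)].
  rewrite map_inj_uniq ?iota_uniq // => a b; wlog ab : a b / (a <= b)%N.
    by move=> H E; case: (leqP a b) => [/H|/ltnW/H]; [apply|move=> ->].
  move/eqP; rewrite eq_sym -subr_eq0 -natrB // (proj1 (pcharf0P _) char0) subn_eq0 => ba.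
  by apply/eqP; rewrite eqn_leq ab.
have /(max_poly_roots pn0) : all (root p) [seq (m%:R : K) | m <- iota 0 (size p)].
  by apply/allP => _ /mapP[m _ ->]; rewrite /root p0.
by rewrite u size_map size_iota ltnn => /(_ isT).
Qed.

(** Each element [u] is joined to the identity by the curve [u^t], which lies in the
    group because it does for all natural [t].  Along it, a product of two
    polynomials vanishes without either of them vanishing at both ends. *)
Lemma unipotent_connected (U : set 'M[K]_N) : zariski_closed idfun U -> is_subgroup U ->
  (forall u, U u -> exists M, (u - 1) ^+ M = 0) -> zariski_connected U.
Proof.
move=> Ucl Ugrp Unil A B Acl Bcl AB AB0.
wlog A1 : A B Acl Bcl AB AB0 / A 1%:M.
  move=> H; have [A1|B1] : (A `|` B) 1%:M by rewrite AB; exact: (subgroup1 Ugrp).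
    exact: H.
  have [||B0|A0] := H B A Bcl Acl _ _ B1; rewrite 1?setUC 1?setIC //; first by right.
  by left.
right; apply/seteqP; split=> // b Bb.
have Ub : U b by rewrite -AB; right.
have [M bM] := Unil b Ub.
pose E := power_curve (b - 1) M; have dE : \det E = 1 by exact: det_power_curve.
have Em m : curve_at m%:R E = b ^+ m by rewrite at_power_nat // addrC subrK.
have Et t : U (curve_at t E).
  apply: curve_in_closed => // f f0; apply: poly_eq0_nat => m; rewrite horner_reval // Em.
  apply: f0; elim: m => [|m IH]; first exact: (subgroup1 Ugrp).
  by rewrite exprS; apply: (subgroupM Ugrp).
have /closedP[PA AE] := Acl; have /closedP[PB BE] := Bcl.
have Ab : ~ A b by move=> Ab; have : (A `&` B) b by []; rewrite AB0.
have B1 : ~ B 1%:M by move=> B1; have : (A `&` B) 1%:M by []; rewrite AB0.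
have [f Pf fb] : exists2 f, PA f & ev f b != 0.
  apply: contrapT => nof; apply: Ab; rewrite AE /=; split; first exact: (subgroup_unit Ugrp).
  by move=> f Pf; apply/eqP; apply: contraT => fb; case: nof; exists f.
have [h Ph h1] : exists2 h, PB h & ev h 1%:M != 0.
  apply: contrapT => noh; apply: B1; rewrite BE /=; split; first exact: unitmx1.
  by move=> h Ph; apply/eqP; apply: contraT => h1; case: noh; exists h.
have : reval (@polyC K) f E * reval (@polyC K) h E = 0.
  apply: poly_eq0_nat => m; rewrite hornerM !horner_reval //.
  have : (A `|` B) (curve_at m%:R E) by rewrite AB.
  rewrite AE BE => -[[_ /(_ f Pf) ->]|[_ /(_ h Ph) ->]]; rewrite ?mul0r ?mulr0 //.
move/eqP; rewrite mulf_eq0 => /orP[|] /eqP p0.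
  have := horner_reval f 1%:R dE; rewrite p0 horner0 Em expr1 => /esym/eqP.
  by rewrite (negPf fb).
have := horner_reval h 0%:R dE; rewrite p0 horner0 Em expr0 => /esym/eqP.
by rewrite (negPf h1).
Qed.
End UnipotentCurve.

Section Radical.
Variables (K : closedFieldType) (N : nat) (G : set 'M[K]_N).
Hypothesis Ggrp : is_subgroup G.
Hypothesis char0 : [pchar K] =i pred0.
Hypothesis Gcl : zariski_closed idfun G.
Hypothesis Gred : forall U : set 'M[K]_N,
  zariski_closed idfun U -> zariski_connected U -> normal_subgroup U G ->
  (forall u, U u -> unipotent u) -> U = [set 1%:M].
Notation std := (@mstd K N).

Lemma std_rep : is_rep G std. Proof. by split=> [|g h _ _]; rewrite !mev_std. Qed.

Lemma drep_std x : drep std x = x. Proof. by rewrite /drep mder_std mul1mx. Qed.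

(** The unipotent radical: a unipotent normal subgroup acts trivially on simple
    representations. *)
Definition unipotent_part : set 'M[K]_N :=
  [set u | G u /\ forall U1 U2, simple_between G std U1 U2 -> (U2 *m (u - 1%:M) <= U1)%MS].

Lemma unipotent_part_closed : zariski_closed idfun unipotent_part.
Proof.
pose F (U1 U2 : 'M[K]_N) i j : rterm K N :=
  RAdd (mmul (mmul (mconst N U2) std) (mconst N (cokermx U1)) i j)
    (RConst N (- (U2 *m cokermx U1) i j)).
have FE U1 U2 g i j : ev (F U1 U2 i j) g = (U2 *m (g - 1%:M) *m cokermx U1) i j.
  have /matrixP/(_ i j) : mev (mmul (mmul (mconst N U2) std) (mconst N (cokermx U1))) g =
     U2 *m g *m cokermx U1 by rewrite !mev_mul !mev_const mev_std.
  rewrite mxE => E; rewrite [LHS]/= E mulmxBr mulmx1 mulmxBl [RHS]mxE.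
  by rewrite [X in _ = _ + X]mxE.
rewrite (_ : unipotent_part = [set g | G g /\ forall f, [set f | exists U1 U2 i j,
    simple_between G std U1 U2 /\ f = F U1 U2 i j] f -> ev f g = 0]).
  exact: closed_subset.
apply/seteqP; split=> u /= [Gu uP]; split=> //.
  move=> _ [U1 [U2 [i [j [sb ->]]]]]; rewrite FE.
  by have := uP U1 U2 sb; rewrite submxE => /eqP ->; rewrite mxE.
move=> U1 U2 sb; rewrite submxE; apply/eqP/matrixP => i j.
by rewrite -FE [RHS]mxE; apply: uP; exists U1, U2, i, j.
Qed.

Lemma sub_std U : gstable G std U -> forall g, G g -> (U *m g <= U)%MS.
Proof. by move=> Us g Gg; have := Us g Gg; rewrite mev_std. Qed.

Lemma unipotent_part_normal : normal_subgroup unipotent_part G.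
Proof.
split; last first.
- move=> g h Gg [Gh hP]; split.
    by apply: (subgroupM Ggrp); [exact: (subgroupM Ggrp)|exact: (subgroupV Ggrp)].
  move=> U1 U2 sb; have [U1s U2s _ _ _] := sb.
  have -> : g *m h *m invmx g - 1%:M = g *m (h - 1%:M) *m invmx g.
    by rewrite mulmxBr mulmx1 mulmxBl mulmxV // (G_unit Ggrp).
  rewrite !mulmxA; apply: submx_trans (sub_std U1s (subgroupV Ggrp Gg)).
  apply: submxMr; apply: submx_trans (hP U1 U2 sb).
  by apply: submxMr; exact: sub_std.
- by move=> u [].
split.
- by move=> u [/(G_unit Ggrp)].
- by split=> [|U1 U2 _]; [exact: (subgroup1 Ggrp)|rewrite subrr mulmx0 sub0mx].
- move=> g h [Gg gP] [Gh hP]; split; first exact: (subgroupM Ggrp).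
  move=> U1 U2 sb; have [U1s _ _ _ _] := sb.
  have -> : g *m h - 1%:M = (g - 1%:M) *m h + (h - 1%:M).
    by rewrite mulmxBl mul1mx addrA subrK.
  rewrite mulmxDr addmx_sub ?hP // mulmxA.
  by apply: submx_trans (sub_std U1s Gh); apply: submxMr; exact: gP.
- move=> g [Gg gP]; split; first exact: (subgroupV Ggrp).
  move=> U1 U2 sb; have [_ U2s _ _ _] := sb.
  have -> : invmx g - 1%:M = - (invmx g *m (g - 1%:M)).
    by rewrite mulmxBr mulmx1 mulVmx ?opprB // (G_unit Ggrp).
  rewrite mulmxN eqmx_opp mulmxA; apply: submx_trans (gP U1 U2 sb).
  by apply: submxMr; exact: (sub_std U2s (subgroupV Ggrp Gg)).
Qed.

(** Filter [K^N] by simple subquotients. *)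
Lemma unipotent_part_unipotent u : unipotent_part u -> (u - 1%:M) ^+ N = 0.
Proof.
move=> [Gu uP].
suff H d (U : 'M[K]_N) : gstable G std U -> (\rank U <= d)%N -> U *m (u - 1%:M) ^+ d = 0.
  by have := H N 1%:M (@gstable_full _ _ _ _ _) (rank_leq_row _); rewrite mul1mx.
elim: d U => [|d IH] U Us rU.
  by move: rU; rewrite leqn0 mxrank_eq0 => /eqP ->; rewrite mul0mx.
have [->|U0] := eqVneq U 0; first by rewrite mul0mx.
have [U1 sb] := exists_simple_between Us U0.
have [U1s _ U1U UU1 _] := sb.
rewrite exprS -[_ * _]/(_ *m _) mulmxA.
have /submxP[D ->] := uP U1 U sb.
rewrite -mulmxA IH ?mulmx0 // -ltnS (leq_trans _ rU) //.
by rewrite ltn_neqAle mxrankS // andbT; apply: contra UU1 => /eqP E;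
   rewrite -(geq_leqif (mxrank_leqif_sup U1U)) E.
Qed.

Lemma iter_mulmx (y : 'M[K]_N) m : iter m (mulmx y) 1%:M = y ^+ m.
Proof. by elim: m => [|m IH] //=; rewrite IH exprS. Qed.

Lemma unipotent_part_trivial : unipotent_part = [set 1%:M].
Proof.
apply: Gred; first exact: unipotent_part_closed.
- apply: unipotent_connected => //; first exact: unipotent_part_closed.
    by case: unipotent_part_normal.
  by move=> u /unipotent_part_unipotent uN; exists N.
- exact: unipotent_part_normal.
- by move=> u /unipotent_part_unipotent uN; rewrite /unipotent iter_mulmx.
Qed.

Definition derived : set 'M[K]_N := [set x | exists s : seq ('M[K]_N * 'M[K]_N),
  (forall pq, pq \in s -> tangent G pq.1 /\ tangent G pq.2) /\
  x = \sum_(pq <- s) bracket pq.1 pq.2].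

(** The exponential of [x] lies in the unipotent radical, so it is the identity; then
    [x = 0] by comparing the terms of lowest degree. *)
Lemma std_trivial x : tangent G x ->
  (forall U1 U2, simple_between G std U1 U2 -> (U2 *m x <= U1)%MS) ->
  (exists k, x ^+ k = 0) -> x = 0.
Proof.
move=> xt xP xnil; have {}xnil : exists k, x ^+ k == 0.
  by have [k /eqP] := xnil; exists k.
(* for the least [k] with [x^k = 0], the product [x^(k-2) (exp x - 1)] is [x^(k-1)] *)
case: (ex_minnP xnil) => k /eqP xk kmin0 {xnil}.
have kmin m : x ^+ m = 0 -> (k <= m)%N by move=> /eqP; exact: kmin0.
clear kmin0.
have e1 : curve_at 1 (exp_curve x k) = 1%:M.
  suff : unipotent_part (curve_at 1 (exp_curve x k)) by rewrite unipotent_part_trivial.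
  split; first exact: exp_in_group.
  move=> U1 U2 sb; have [U1s U2s _ _ _] := sb.
  rewrite at_exp; case: (k) xk => [|m] xm.
    rewrite big_ord0 sub0r mulmxN eqmx_opp mulmx1 -[U2]mulmx1.
    by rewrite -[1%:M]/(1 : 'M[K]_N) -(expr0 x) xm mulmx0 sub0mx.
  rewrite big_ord_recl !expr0 fact0 divr1 scale1r addrC addKr mulmx_sumr.
  apply: summx_sub => i _; rewrite -scalemxAr scalemx_sub //.
  rewrite lift0; elim: (i : nat) => [|j IH]; first by rewrite expr1 xP.
  rewrite exprSr -[_ * x]/(_ *m x) mulmxA (submx_trans (submxMr _ IH)) //.
  have := drep_stable Ggrp xt (F := std) (U1 := U1) (U2 := U1).
  by rewrite drep_std; apply.
case: k xk kmin e1 => [|[|m]] xk kmin e1.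
- by rewrite -[x]mulmx1 -[1%:M]/(1 : 'M[K]_N) -(expr0 x) xk mulmx0.
- by rewrite -(expr1 x).
have /kmin : x ^+ m.+1 = 0; last by rewrite ltnn.
have /eqP : x ^+ m *m (curve_at 1 (exp_curve x m.+2) - 1%:M) = 0 by rewrite e1 subrr mulmx0.
rewrite at_exp 2!big_ord_recl !expr0 fact0 divr1 scale1r addrC addKr mulmxDr mulmx_sumr.
rewrite big1 ?addr0 => [|i _]; first by rewrite lift0 !expr1 scale1r -[_ *m _]/(_ * _) -exprSr => /eqP.
rewrite -scalemxAr -[_ *m _]/(_ * _) -exprD !lift0 !addnS -addSn -addSn exprD xk mul0r scaler0 //.
Qed.

(** Cartan's criterion for the differential, where the ambient Lie algebra is the image
    of the tangent algebra. *)
Lemma trace_null_nilpotent n (F : mxterm K N n n) (S : set 'M[K]_N) : is_rep G F ->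
  S `<=` tangent G -> lie_linear S -> conj_stable G S -> S `<=` derived ->
  (forall x y, S x -> S y -> \tr (drep F x *m drep F y) = 0) ->
  forall x, S x -> exists k, drep F x ^+ k = 0.
Proof.
move=> Frep St Sl Sc Sd tr0 x Sx; have [s [st xE]] := Sd x Sx.
have Sid := conj_stable_ideal Ggrp Sl Sc.
have lin := drep_linear F.
pose p i := drep F (tnth (in_tuple s) i).1; pose q i := drep F (tnth (in_tuple s) i).2.
have ps i : tangent G (tnth (in_tuple s) i).1 /\ tangent G (tnth (in_tuple s) i).2.
  exact/st/mem_tnth.
have xE' : drep F x = \sum_(i <- index_enum 'I_(size s)) bracket (p i) (q i).
  rewrite xE big_tnth.
  have dsum (I : Type) (r : seq I) (f : I -> 'M[K]_N) : drep F (\sum_(i <- r) f i) = \sum_(i <- r) drep F (f i).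
    elim: r => [|i r IH]; first by rewrite !big_nil drep0.
    by rewrite !big_cons -[f i]scale1r lin IH !scale1r.
  rewrite dsum; apply: eq_bigr => i _; rewrite (drep_bracket Ggrp Frep) //; by case: (ps i).
rewrite xE'; apply: (@cartan_nilpotent _ _ n [set drep F y | y in tangent G] [set drep F y | y in S]) => //.
- split; first by exists 0; [exact: tangent0|exact: drep0].
  move=> a _ _ [u ut <-] [v vt <-]; exists (a *: u + v); last exact: lin.
  exact: tangent_linear.
- by move=> _ [y Sy <-]; exists y => //; exact: St.
- move=> _ _ [u ut <-] [v Sv <-]; exists (bracket u v); first exact: Sid.
  by rewrite (drep_bracket Ggrp Frep) //; exact: St.
- by move=> _ _ [u Su <-] [v Sv <-]; exact: tr0.
- by move=> i; split; [exists (tnth (in_tuple s) i).1|exists (tnth (in_tuple s) i).2] => //; case: (ps i).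
- by rewrite -xE'; exists x.
- move=> _ [y Sy <-]; have [S0 Sl'] := Sl; exists (- y).
    by have := Sl' (-1) y 0 Sy S0; rewrite addr0 scaleN1r.
  by have := lin (-1) y 0; rewrite addr0 drep0 !scaleN1r addr0.
Qed.

(** Nilpotency on [K^N] gives triviality on its simple subquotients, then [std_trivial]
    applies. *)
Lemma trace_null_trivial (S : set 'M[K]_N) :
  S `<=` tangent G -> lie_linear S -> conj_stable G S -> S `<=` derived ->
  (forall x y, S x -> S y -> \tr (x *m y) = 0) -> forall x, S x -> x = 0.
Proof.
move=> St Sl Sc Sd tr0 x Sx.
have Snil y : S y -> exists k, y ^+ k = 0.
  move=> Sy; rewrite -(drep_std y); apply: (trace_null_nilpotent std_rep St Sl Sc Sd) => //.
  by move=> a b Sa Sb; rewrite !drep_std tr0.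
apply: std_trivial; [exact: St| |exact: Snil].
move=> U1 U2 sb; have [U1s U2s U12 _ _] := sb.
have [m [B [B' [sq _]]]] := exists_subquotient U12.
have st y : tangent G y -> stable U1 U2 (drep std y) by exact: stable_drep.
have := st x (St _ Sx); rewrite drep_std => stx; apply/(subq_eq0 sq stx).
rewrite -{1}(drep_std x) -drep_subrep.
apply: (nilpotent_acts_zero Ggrp (is_rep_subrep std_rep sq U1s U2s)
  (simple_subrep sq U1s U2s sb) St Sl) => // [u v Su Sv|y Sy].
  by apply: (conj_stable_ideal Ggrp Sl Sc) => //; exact: St.
have [k yk] := Snil y Sy; exists k; rewrite drep_subrep drep_std.
by apply: (subq_nilpotent sq) => //; rewrite -(drep_std y); apply/st/St.
Qed.

Lemma trace_null_acts_zero n (F : mxterm K N n n) (S : set 'M[K]_N) : is_rep G F -> simple_rep G F ->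
  S `<=` tangent G -> lie_linear S -> conj_stable G S -> S `<=` derived ->
  (forall x y, S x -> S y -> \tr (drep F x *m drep F y) = 0) ->
  forall x, S x -> drep F x = 0.
Proof.
move=> Frep Fs St Sl Sc Sd tr0 x Sx.
apply: (nilpotent_acts_zero Ggrp Frep Fs St Sl) => // [u v Su Sv|y Sy].
  by apply: (conj_stable_ideal Ggrp Sl Sc) => //; exact: St.
exact: (trace_null_nilpotent Frep St Sl Sc Sd).
Qed.
End Radical.

(** * Casimir elements *)

Section DualBasis.
Variables (K : closedFieldType) (n : nat) (beta : 'M[K]_n -> 'M[K]_n -> K).
Hypotheses (betaC : forall x y, beta x y = beta y x)
  (betaD : forall a x y z, beta (a *: x + y) z = a * beta x z + beta y z).

Let beta0 z : beta 0 z = 0.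
Proof. by have := betaD (-1) 0 0 z; rewrite scaler0 addr0 mulN1r addNr. Qed.

Lemma form_sum I (r : seq I) (a : I -> K) b z :
  beta (\sum_(i <- r) a i *: b i) z = \sum_(i <- r) a i * beta (b i) z.
Proof.
elim: r => [|i r IH]; first by rewrite !big_nil beta0.
by rewrite !big_cons betaD IH.
Qed.

(** Invert the Gram matrix of a basis. *)
Lemma dual_basis (S : set 'M[K]_n) : lie_linear S ->
  (forall x, S x -> (forall y, S y -> beta x y = 0) -> x = 0) ->
  exists d (b c : 'I_d -> 'M[K]_n),
  [/\ forall i, S (b i), forall i, S (c i), forall i j, beta (b i) (c j) = (i == j)%:R,
      forall x, S x -> x = \sum_i beta x (c i) *: b i &
      forall x, S x -> x = \sum_i beta x (b i) *: c i].
Proof.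
move=> Sl nd; have [S0 SD] := Sl; have [A AE] := lie_linear_mx Sl.
have Ssum I (r : seq I) (a : I -> K) b : (forall i, S (b i)) -> S (\sum_(i <- r) a i *: b i).
  by move=> bS; elim: r => [|i r IH]; rewrite ?big_nil // big_cons; apply: SD.
pose d := \rank A; pose b (i : 'I_d) := vec_mx (row i (row_base A)).
have bS i : S (b i) by apply/AE; rewrite vec_mxK (submx_trans (row_sub _ _)) ?eq_row_base.
have comb (X : 'rV[K]_d) : mxvec (\sum_i X 0 i *: b i) = X *m row_base A.
  rewrite mulmx_sum_row linear_sum; apply: eq_bigr => i _.
  by rewrite linearZ /= vec_mxK.
have bgen x : S x -> exists X : 'rV[K]_d, x = \sum_i X 0 i *: b i.
  move=> /AE; rewrite -(eq_row_base A) => /submxP[X E]; exists X.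
  by apply: (can_inj mxvecK); rewrite comb.
pose g := \matrix_(i, j) beta (b i) (b j).
have gu : g \in unitmx.
  rewrite -row_free_unit; apply/row_freeP; apply/row_freeP/inj_row_free => X Xg.
  have : \sum_i X 0 i *: b i = 0.
    apply: nd; first exact: Ssum.
    move=> y /bgen[Y ->]; rewrite betaC form_sum big1 // => j _.
    rewrite betaC form_sum; have /rowP/(_ j) := Xg; rewrite !mxE => E.
    by rewrite (eq_bigr (fun i => X 0 i * g i j)) ?E ?mulr0 // => i _; rewrite mxE.
  move/(congr1 mxvec); rewrite comb linear0 => /eqP.
  by rewrite mulmx_free_eq0 ?row_base_free // => /eqP.
pose c j := \sum_l invmx g l j *: b l.
have cS i : S (c i) by exact: Ssum.
have bc i j : beta (b i) (c j) = (i == j)%:R.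
  have /matrixP/(_ i j) := mulmxV gu; rewrite !mxE => <-.
  rewrite betaC form_sum; apply: eq_bigr => l _.
  by rewrite betaC mxE mulrC.
have E1 x : S x -> x = \sum_i beta x (c i) *: b i.
  move=> /bgen[X ->]; apply: eq_bigr => i _; congr (_ *: _).
  rewrite form_sum (bigD1 i) //= bc eqxx mulr1 big1 ?addr0 // => j ji.
  by rewrite bc (negPf ji) mulr0.
exists d, b, c; split=> // x Sx; apply/eqP; rewrite -subr_eq0; apply/eqP.
pose y := \sum_i beta x (b i) *: c i.
have Sy : S y by exact: Ssum.
have Sxy : S (x - y) by rewrite addrC -scaleN1r; exact: SD.
apply: nd Sxy _ => z Sz; rewrite [z]E1 // betaC form_sum big1 // => j _.
rewrite [X in _ * X]betaC (_ : x - y = (-1) *: y + x); last by rewrite scaleN1r addrC.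
rewrite betaD form_sum (bigD1 j) //= (betaC (c j)) bc eqxx mulr1.
rewrite big1 => [|i ij]; first by rewrite addr0 mulN1r addNr mulr0.
by rewrite [X in _ * X]betaC bc eq_sym (negPf ij) mulr0.
Qed.
End DualBasis.

Section Casimir.
Variables (K : closedFieldType) (N : nat) (G : set 'M[K]_N).
Hypothesis Ggrp : is_subgroup G.
Hypothesis char0 : [pchar K] =i pred0.
Hypothesis Gcl : zariski_closed idfun G.
Hypothesis Gred : forall U : set 'M[K]_N,
  zariski_closed idfun U -> zariski_connected U -> normal_subgroup U G ->
  (forall u, U u -> unipotent u) -> U = [set 1%:M].
Notation derived := (derived G).

Lemma derived_linear : lie_linear derived.
Proof.
split; first by exists [::]; rewrite big_nil.
move=> a _ _ [s [sP ->]] [t [tP ->]].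
exists ([seq (a *: pq.1, pq.2) | pq <- s] ++ t); split.
  move=> pq; rewrite mem_cat => /orP[/mapP[pq' /sP[p q] ->]|/tP //] /=; split=> //.
  by rewrite -[_ *: _]addr0; apply: tangent_linear => //; exact: tangent0.
rewrite big_cat big_map /= scaler_sumr; congr (_ + _); apply: eq_bigr => pq _.
by rewrite /bracket -scalemxAl -scalemxAr scalerBr.
Qed.

Lemma derived_tangent : derived `<=` tangent G.
Proof.
move=> _ [s [sP ->]]; elim: s sP => [|pq s IH] sP; first by rewrite big_nil; exact: tangent0.
rewrite big_cons -[bracket _ _]scale1r; apply: tangent_linear; last first.
  by apply: IH => pq' pq's; apply: sP; rewrite inE pq's orbT.
by case: (sP pq); rewrite ?mem_head // => p q; exact: tangent_bracket.
Qed.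

Lemma derived_conj : conj_stable G derived.
Proof.
move=> h _ Gh [s [sP ->]].
exists [seq (h *m pq.1 *m invmx h, h *m pq.2 *m invmx h) | pq <- s]; split.
  by move=> _ /mapP[pq /sP[p q] ->] /=; split; exact: tangent_conj.
rewrite big_map mulmx_sumr mulmx_suml; apply: eq_bigr => pq _ /=.
have hu := G_unit Ggrp Gh.
rewrite /bracket mulmxBr mulmxBl !mulmxA; congr (_ - _).
  by rewrite mulmxKV.
by rewrite mulmxKV.
Qed.

Let Gi := subgroupV Ggrp.
Let conjV h x : G h -> h *m (invmx h *m x *m h) *m invmx h = x.
Proof.
by move=> /(G_unit Ggrp) hu; rewrite !mulmxA mulmxV // mul1mx mulmxK.
Qed.

Lemma conj_stableV S h x : conj_stable G S -> G h -> S x -> S (invmx h *m x *m h).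
Proof.
by move=> Sc Gh Sx; rewrite -{2}[h]invmxK; apply: Sc => //; exact: Gi.
Qed.

Definition orthogonal_in (beta : 'M[K]_N -> 'M[K]_N -> K) (S T : set 'M[K]_N) : set 'M[K]_N :=
  [set x | S x /\ forall y, T y -> beta x y = 0].

Definition invariant_form (beta : 'M[K]_N -> 'M[K]_N -> K) := forall h x y, G h ->
  tangent G x -> tangent G y ->
  beta (h *m x *m invmx h) (h *m y *m invmx h) = beta x y.

Definition trace_form n (F : mxterm K N n n) x y := \tr (drep F x *m drep F y).

Lemma trace_formC n (F : mxterm K N n n) x y : trace_form F x y = trace_form F y x.
Proof. exact: mxtrace_mulC. Qed.

Lemma trace_formD n (F : mxterm K N n n) a x y z :
  trace_form F (a *: x + y) z = a * trace_form F x z + trace_form F y z.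
Proof. by rewrite /trace_form drep_linear mulmxDl -scalemxAl mxtraceD mxtraceZ. Qed.

Lemma trace_form_inv n (F : mxterm K N n n) : is_rep G F -> invariant_form (trace_form F).
Proof.
move=> Frep h x y Gh xt yt; rewrite /trace_form !(drep_conj Ggrp Frep) //.
rewrite mxtrace_mulC !mulmxA -(mulmxA (_ *m drep F y)) (repVl Ggrp Frep Gh) mulmx1.
by rewrite mxtrace_mulC !mulmxA (repVl Ggrp Frep Gh) mul1mx mxtrace_mulC.
Qed.

Lemma orthogonal_linear beta S T :
  (forall a x y z, beta (a *: x + y) z = a * beta x z + beta y z) ->
  lie_linear S -> lie_linear (orthogonal_in beta S T).
Proof.
move=> bD [S0 SD]; split.
  split=> // y _; have := bD (-1) 0 0 y; rewrite scaler0 addr0 mulN1r addNr => -> //.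
move=> a u v [Su uT] [Sv vT]; split; first exact: SD.
by move=> y Ty; rewrite bD uT // vT // mulr0 addr0.
Qed.

Lemma orthogonal_conj beta S T : invariant_form beta -> S `<=` tangent G -> T `<=` tangent G ->
  conj_stable G S -> conj_stable G T -> conj_stable G (orthogonal_in beta S T).
Proof.
move=> bi St Tt Sc Tc h x Gh [Sx xT]; split; first exact: Sc.
move=> y Ty; have Ty' := conj_stableV Tc Gh Ty.
by rewrite -(conjV y Gh) bi ?xT //; [exact: St|exact: Tt].
Qed.

Section OnSimple.
Variables (m : nat) (F : mxterm K N m m).
Hypotheses (Frep : is_rep G F) (Fs : simple_rep G F).

Let r : set 'M[K]_N := [set x | derived x /\ drep F x = 0].
Let kappa := trace_form (@mstd K N).
Let g2 := orthogonal_in kappa derived r.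

Let kappaE x y : kappa x y = \tr (x *m y).
Proof. by rewrite /kappa /trace_form !drep_std. Qed.

Let r_linear : lie_linear r.
Proof.
have [d0 dD] := derived_linear; split; first by split=> //; exact: drep0.
by move=> a u v [du u0] [dv v0]; split; [exact: dD|rewrite drep_linear u0 v0 scaler0 addr0].
Qed.

Let r_conj : conj_stable G r.
Proof.
move=> h x Gh [dx x0]; split; first exact: derived_conj.
by rewrite (drep_conj Ggrp Frep) ?x0 ?mulmx0 ?mul0mx //; exact: derived_tangent.
Qed.

Let r_t : r `<=` tangent G. Proof. by move=> x [/derived_tangent]. Qed.

Let r_nondeg x : r x -> (forall y, r y -> kappa x y = 0) -> x = 0.
Proof.
move=> rx xr.
apply: (trace_null_trivial Ggrp char0 Gcl Gred (S := orthogonal_in kappa r r)) => //.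
- by move=> y [/r_t].
- by apply: orthogonal_linear => //; exact: trace_formD.
- by apply: orthogonal_conj => //; apply: trace_form_inv; exact: std_rep.
- by move=> y [[]].
- by move=> y z [ry yr] [rz _]; rewrite -kappaE; exact: yr.
Qed.

Let g2_t : g2 `<=` tangent G. Proof. by move=> x [/derived_tangent]. Qed.

Let g2_linear : lie_linear g2.
Proof. by apply: orthogonal_linear; [exact: trace_formD|exact: derived_linear]. Qed.

Let g2_conj : conj_stable G g2.
Proof.
apply: orthogonal_conj => //; [|exact: derived_tangent|exact: derived_conj].
by apply: trace_form_inv; exact: std_rep.
Qed.

Let derived_split x : derived x -> exists2 y, g2 y & drep F y = drep F x.
Proof.
move=> dx; have [d [b [c [br cr bc E1 E2]]]] :=
  dual_basis (@trace_formC _ _) (@trace_formD _ _) r_linear r_nondeg.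
pose x' := \sum_i kappa x (c i) *: b i.
have [d0 dD] := derived_linear.
have Rsum (a : 'I_d -> K) (s : seq 'I_d) : r (\sum_(i <- s) a i *: b i).
  have [r0 rD] := r_linear.
  by elim: s => [|i s IH]; rewrite ?big_nil // big_cons; apply: rD.
have [dx' x'0] : r x' by exact: Rsum.
exists (-1 *: x' + x); last by rewrite drep_linear x'0 scaler0 add0r.
split; first exact: dD.
move=> y ry; rewrite /kappa trace_formD /x' (form_sum (@trace_formD _ _)) mulN1r addrC.
apply/eqP; rewrite subr_eq0; apply/eqP; rewrite [in LHS](E2 y ry) trace_formC.
rewrite (form_sum (@trace_formD _ _)); apply: eq_bigr => i _.
by rewrite mulrC trace_formC; congr (_ * _); exact: trace_formC.
Qed.

Let g2_nondeg x : g2 x -> (forall y, g2 y -> trace_form F x y = 0) -> x = 0.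
Proof.
move=> g2x xg2.
pose S := orthogonal_in (trace_form F) g2 g2.
have Sc : conj_stable G S by apply: orthogonal_conj => //; exact: trace_form_inv.
have Sl : lie_linear S by apply: orthogonal_linear => //; exact: trace_formD.
have St : S `<=` tangent G by move=> y [/g2_t].
have Sr y : S y -> drep F y = 0.
  apply: (trace_null_acts_zero Ggrp char0 Frep Fs St Sl Sc); first by move=> z [[]].
  by move=> z w [g2z zg] [g2w _]; exact: zg.
apply: r_nondeg; first by case: (g2x) => dx _; split=> //; apply: Sr.
by move=> y ry; apply: (proj2 g2x).
Qed.

(** On the derived algebra, the kernel [r] of the action has an orthogonal complement
    [g2] for the trace form of [K^N], and the trace form of [F] is nondegenerate on
    [g2], both by Cartan's criterion.  The sum of the products of dual bases of [g2]
    has trace [dim g2], and it is invariant because [g2] and its form are. *)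
Lemma exists_casimir : (exists2 x, derived x & drep F x != 0) ->
  exists d (b c : 'I_d -> 'M[K]_N),
  [/\ (0 < d)%N, forall i, tangent G (b i) /\ tangent G (c i),
      \tr (\sum_i drep F (b i) *m drep F (c i)) = d%:R &
      forall n (F' : mxterm K N n n), is_rep G F' -> forall g, G g ->
       mev F' g *m (\sum_i drep F' (b i) *m drep F' (c i)) =
       (\sum_i drep F' (b i) *m drep F' (c i)) *m mev F' g].
Proof.
move=> [x0 dx0 Fx0].
have [d [b [c [bg cg bc E1 E2]]]] :=
  dual_basis (@trace_formC _ F) (@trace_formD _ F) g2_linear g2_nondeg.
have bt i : tangent G (b i) by exact: g2_t.
have ct i : tangent G (c i) by exact: g2_t.
exists d, b, c; split=> //.
- have [y g2y yE] := derived_split dx0; rewrite lt0n; apply: contra Fx0 => /eqP d0.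
  rewrite -yE (E1 y g2y) big1 ?drep0 // => i.
  by have := ltn_ord i; rewrite [X in (_ < X)%N]d0.
- rewrite raddf_sum (eq_bigr (fun=> 1)); first by rewrite sumr_const card_ord.
  by move=> i _; have := bc i i; rewrite eqxx.
move=> n F' F'rep g Gg.
pose cj x := g *m x *m invmx g; pose cjV x := invmx g *m x *m g.
rewrite mulmx_sumr mulmx_suml.
transitivity (\sum_i drep F' (cj (b i)) *m drep F' (cj (c i)) *m mev F' g).
  apply: eq_bigr => i _; rewrite mulmxA (mev_drep Ggrp F'rep) // -/(cj (b i)) -[LHS]mulmxA.
  by rewrite (mev_drep Ggrp F'rep) // -/(cj (c i)) mulmxA.
rewrite -!mulmx_suml; congr (_ *m _).
have drepS m' (F'' : mxterm K N m' m') I (s : seq I) (a : I -> K) (u : I -> 'M[K]_N) :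
  drep F'' (\sum_(i <- s) a i *: u i) = \sum_(i <- s) a i *: drep F'' (u i).
  elim: s => [|i s IH]; first by rewrite !big_nil drep0.
  by rewrite !big_cons drep_linear IH.
have cjS (I : Type) (s : seq I) (a : I -> K) (u : I -> 'M[K]_N) :
  cj (\sum_(i <- s) a i *: u i) = \sum_(i <- s) a i *: cj (u i).
  rewrite /cj mulmx_sumr mulmx_suml; apply: eq_bigr => i _.
  by rewrite -scalemxAr -scalemxAl.
transitivity (\sum_i \sum_j trace_form F (cj (b i)) (c j) *: (drep F' (b j) *m drep F' (cj (c i)))).
  apply: eq_bigr => i _; rewrite {1}(E1 (cj (b i))); last exact: g2_conj.
  by rewrite drepS mulmx_suml; apply: eq_bigr => j _; rewrite -scalemxAl.
rewrite exchange_big; apply: eq_bigr => j _ /=.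
transitivity (drep F' (b j) *m drep F' (cj (cjV (c j)))); last by rewrite /cj /cjV conjV.
rewrite (E2 (cjV (c j))); last exact: conj_stableV.
rewrite cjS drepS mulmx_sumr; apply: eq_bigr => i _; rewrite -scalemxAr; congr (_ *: _).
rewrite -[RHS](trace_form_inv Frep Gg) //; last first.
  by apply: g2_t; apply: conj_stableV.
by rewrite trace_formC /cjV conjV.
Qed.
End OnSimple.
End Casimir.

(** * Lifting fixed vectors *)

Section FixedVectors.
Variables (K : closedFieldType) (N : nat) (G : set 'M[K]_N).
Hypothesis Ggrp : is_subgroup G.
Hypothesis char0 : [pchar K] =i pred0.
Hypothesis Gcl : zariski_closed idfun G.
Hypothesis Gcon : zariski_connected G.
Hypothesis Gred : forall U : set 'M[K]_N,
  zariski_closed idfun U -> zariski_connected U -> normal_subgroup U G ->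
  (forall u, U u -> unipotent u) -> U = [set 1%:M].
Hypothesis Gperfect : forall H : set 'M[K]_N, zariski_closed idfun H -> is_subgroup H ->
  H `<=` G -> (forall g h, G g -> G h -> H (g *m h *m invmx g *m invmx h)) -> H = G.

(** If commutators of [G] act trivially on [E2 / E1], the elements acting trivially form
    a closed subgroup containing the commutators of [G]. *)
Lemma trivial_between n (F : mxterm K N n n) (E1 E2 : 'M[K]_n) : is_rep G F ->
  gstable G F E1 -> gstable G F E2 ->
  (forall g h, G g -> G h -> (E2 *m (mev F g *m mev F h - mev F h *m mev F g) <= E1)%MS) ->
  forall g, G g -> (E2 *m (mev F g - 1%:M) <= E1)%MS.
Proof.
move=> Frep E1s E2s com g Gg.
pose H := [set g | G g /\ (E2 *m (mev F g - 1%:M) <= E1)%MS].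
suff HG : H = G by have [] : H g by rewrite HG.
apply: Gperfect.
- pose T i j : rterm K N := RAdd (mmul (mmul (mconst N E2) F) (mconst N (cokermx E1)) i j)
      (RConst N (- (E2 *m cokermx E1) i j)).
  have TE h i j : ev (T i j) h = (E2 *m (mev F h - 1%:M) *m cokermx E1) i j.
    have /matrixP/(_ i j) : mev (mmul (mmul (mconst N E2) F) (mconst N (cokermx E1))) h =
       E2 *m mev F h *m cokermx E1 by rewrite !mev_mul !mev_const.
    rewrite mxE => E; rewrite [LHS]/= E mulmxBr mulmx1 mulmxBl [RHS]mxE.
    by rewrite [X in _ = _ + X]mxE.
  rewrite (_ : H = [set g | G g /\ forall f, [set f | exists i j, f = T i j] f -> ev f g = 0]).
    exact: closed_subset.
  apply/seteqP; split=> u /= [Gu uP]; split=> //.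
    by move=> _ [i [j ->]]; rewrite TE; move: uP; rewrite submxE => /eqP ->; rewrite mxE.
  rewrite submxE; apply/eqP/matrixP => i j.
  by rewrite -TE [RHS]mxE; apply: uP; exists i, j.
- have F1 := proj1 Frep; have FM := proj2 Frep; split.
  + by move=> u [/(G_unit Ggrp)].
  + by split; [exact: (subgroup1 Ggrp)|rewrite F1 subrr mulmx0 sub0mx].
  + move=> a b [Ga aP] [Gb bP]; split; first exact: (subgroupM Ggrp).
    have -> : mev F (a *m b) - 1%:M = (mev F a - 1%:M) *m mev F b + (mev F b - 1%:M).
      by rewrite FM // mulmxBl mul1mx addrA subrK.
    rewrite mulmxDr addmx_sub ?bP // mulmxA.
    exact: submx_trans (submxMr _ aP) (E1s b Gb).
  + move=> a [Ga aP]; have Gi := subgroupV Ggrp Ga; split=> //.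
    have -> : mev F (invmx a) - 1%:M = - (mev F (invmx a) *m (mev F a - 1%:M)).
      by rewrite mulmxBr mulmx1 (repVl Ggrp Frep Ga) opprB.
    rewrite mulmxN eqmx_opp mulmxA; apply: submx_trans aP.
    by apply: submxMr; exact: E2s.
- by move=> u [].
move=> a b Ga Gb.
have Gi := subgroupV Ggrp Ga; have Gj := subgroupV Ggrp Gb; have FM := proj2 Frep.
have Gab := subgroupM Ggrp Ga Gb; have Gabi := subgroupM Ggrp Gab Gi.
split; first exact: (subgroupM Ggrp).
have -> : mev F (a *m b *m invmx a *m invmx b) - 1%:M =
   (mev F a *m mev F b - mev F b *m mev F a) *m mev F (invmx a) *m mev F (invmx b).
  rewrite !FM // !mulmxBl; congr (_ - _).
  by rewrite -(mulmxA (mev F b)) (repV Ggrp Frep Ga) mulmx1 (repV Ggrp Frep Gb).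
rewrite !mulmxA; apply: submx_trans (E1s _ Gj); apply: submxMr.
by apply: submx_trans (E1s _ Gi); apply: submxMr; exact: com.
Qed.

(** The tangents act by commuting matrices, which are scalars by Schur's lemma; then all
    of [G] acts by commuting matrices, and it is perfect. *)
Lemma derived_acts n (F : mxterm K N n n) : is_rep G F -> simple_rep G F ->
  (forall x, derived G x -> drep F x = 0) -> forall g, G g -> mev F g = 1%:M.
Proof.
move=> Frep Fs d0.
have scal x : tangent G x -> exists c, drep F x = c%:M.
  move=> xt; apply: (schur Fs); apply: (commute_drep Ggrp Frep char0 Gcl Gcon) => y yt.
  have : drep F (bracket y x) = 0.
    by apply: d0; exists [:: (y, x)]; split; [move=> pq /[1!inE] /eqP ->|rewrite big_seq1].
  by rewrite (drep_bracket Ggrp Frep) // => /eqP; rewrite subr_eq0 => /eqP.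
have com g h : G g -> G h -> mev F g *m mev F h = mev F h *m mev F g.
  move=> Gg Gh; apply: (commute_drep Ggrp Frep char0 Gcl Gcon) => // x /scal[c ->].
  by rewrite scalar_mxC.
move=> g Gg; apply/eqP; rewrite -subr_eq0 -submx0 -[X in (X <= _)%MS]mul1mx.
apply: (trivial_between Frep) => // [||a b Ga Gb]; [exact: gstable0|exact: gstable_full|].
by rewrite com // subrr mulmx0 sub0mx.
Qed.

(** Write the polynomial ['X * char_poly z] as ['X^a * q] with [q(0) != 0].  By Bezout,
    the identity is the sum of a matrix with values in the image of [z] and a matrix
    with values in the kernel of [z^a]. *)
Lemma fitting n (z E E0 : 'M[K]_n) : (E *m z <= E)%MS -> (E *m z <= E0)%MS -> ~~ (E <= E0)%MS ->
  exists a, ~~ (E :&: kermx (z ^+ a) <= E0)%MS.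
Proof.
case: n z E E0 => [|n] z E E0 Ez Ez0 EE0.
  by case/negP: EE0; rewrite [E]flatmx0 sub0mx.
have p0 : 'X * char_poly z != 0.
  by rewrite mulf_neq0 ?polyX_eq0 ?monic_neq0 ?char_poly_monic.
have [a [q q0 pE]] := multiplicity_XsubC ('X * char_poly z) 0.
rewrite p0 subr0 /= in q0 pE.
have a0 : (0 < a)%N.
  rewrite lt0n; apply: contra q0 => /eqP a0; move: pE; rewrite a0 expr0 mulr1 => <-.
  by rewrite /root hornerM hornerX mul0r.
have : coprimep ('X^a) q by rewrite coprimep_expl // coprimep_sym; have := coprimep_XsubC q 0; rewrite subr0 => ->.
move=> /Bezout_eq1_coprimepP[[u v] /= uv].
exists a; apply: contra EE0 => H.
have := congr1 (horner_mx z) uv; rewrite rmorphD !rmorphM rmorphXn /= horner_mx_X rmorph1 => E1.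
have Est p : (E *m horner_mx z p <= E)%MS by exact: horner_mx_stable.
have Es1 : (E *m z ^+ a.-1 <= E)%MS.
  elim: a.-1 => [|j IH]; first by rewrite expr0 mulmx1.
  by rewrite exprSr -[_ * z]/(_ *m z) mulmxA (submx_trans (submxMr _ IH)).
rewrite -[E]mulmx1 -[1%:M]/(1 : 'M[K]_(n.+1)) -E1 mulmxDr addmx_sub //.
  rewrite -[_ * _]/(_ *m _) mulmxA (submx_trans (submxMr _ (Est u))) //.
  rewrite -(prednK a0) exprSr -[_ * z]/(_ *m z) mulmxA.
  exact: submx_trans (submxMr _ Es1) Ez0.
apply: submx_trans H; rewrite sub_capmx; apply/andP; split.
  by rewrite -rmorphM /= Est.
apply/sub_kermxP; rewrite -mulmxA.
have -> : horner_mx z v * horner_mx z q *m z ^+ a = horner_mx z (v * ('X * char_poly z)).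
  by rewrite pE !rmorphM rmorphXn /= horner_mx_X mulrA.
by rewrite !rmorphM /= Cayley_Hamilton !mulr0 mulmx0.
Qed.

(** Induction on the rank of [E].  Let [E0'] be the intersection of [E] and [E0], with
    simple quotient [E0' / E1].  If [G] acts trivially on that quotient, it acts
    trivially on [E / E1] by perfectness, and a line over [E1] replaces [E].
    Otherwise a Casimir element [z] sends [E] to [E0'] and is not nilpotent on
    [E0' / E1], so the part of [E] killed by a power of [z] is smaller than [E] and
    still not contained in [E0]. *)
Theorem fixed_vector_lifts n (F : mxterm K N n n) (E0 E : 'M[K]_n) : is_rep G F ->
  gstable G F E0 -> gstable G F E -> (forall g, G g -> (E *m (mev F g - 1%:M) <= E0)%MS) ->
  ~~ (E <= E0)%MS -> exists v : 'rV_n, [/\ (v <= E)%MS, ~~ (v <= E0)%MS &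
    forall g, G g -> v *m mev F g = v].
Proof.
move=> Frep E0s.
have [d] := ubnP (\rank E); elim: d E => // d IH E; rewrite ltnS => rE Es Efix EE0.
have lift E' : gstable G F E' -> (E' <= E)%MS -> ~~ (E' <= E0)%MS -> (\rank E' < \rank E)%N ->
  exists v : 'rV_n, [/\ (v <= E)%MS, ~~ (v <= E0)%MS & forall g, G g -> v *m mev F g = v].
  move=> E's E'E E'E0 rE'; have [||||v [vE' vE0 vG]] := IH E' => //.
  - exact: leq_trans rE' rE.
  - by move=> g Gg; apply: submx_trans (Efix g Gg); exact: submxMr.
  by exists v; split=> //; exact: submx_trans vE' E'E.
pose E0' := (E :&: E0)%MS; have E0's : gstable G F E0' by exact: gstable_cap.
have EE0' : ~~ (E <= E0')%MS by apply: contra EE0 => H; exact: submx_trans H (capmxSr _ _).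
have Efix' g : G g -> (E *m (mev F g - 1%:M) <= E0')%MS.
  by move=> Gg; rewrite sub_capmx Efix // mulmxBr mulmx1 addmx_sub ?eqmx_opp ?Es.
have rE0' : (\rank E0' < \rank E)%N.
  rewrite ltn_neqAle mxrankS ?capmxSl // andbT; apply: contra EE0' => /eqP rEE.
  by rewrite -(geq_leqif (mxrank_leqif_sup (capmxSl E E0))) rEE.
have [i vE0] : exists i, ~~ (row i E <= E0)%MS.
  by apply/existsP; rewrite -negb_forall; apply: contra EE0 => /forallP H; apply/row_subP.
pose v := row i E; have vE : (v <= E)%MS by exact: row_sub.
have [E00|E00] := eqVneq E0' 0.
  exists v; split=> // g Gg; apply/eqP; rewrite -subr_eq0 -submx0 -E00.
  by rewrite -[X in _ - X]mulmx1 -mulmxBr; apply: submx_trans (Efix' g Gg); exact: submxMr.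
have [E1 sb] := exists_simple_between E0's E00.
have [E1s _ E1E0 E0E1 _] := sb.
have [m [B [B' [sq _]]]] := exists_subquotient E1E0.
pose FM := subrep F B B'.
have FMrep : is_rep G FM by exact: (is_rep_subrep Frep sq E1s E0's).
have FMs : simple_rep G FM by exact: (simple_subrep sq E1s E0's sb).
have [act|triv] := pselect (exists2 x, derived G x & drep FM x != 0); last first.
  have {}triv x : derived G x -> drep FM x = 0.
    by move=> dx; apply/eqP; apply: contraT => Fx; case: triv; exists x.
  have E0fix g : G g -> (E0' *m (mev F g - 1%:M) <= E1)%MS.
    move=> Gg; have st := stable_mev E1s E0's Gg.
    apply/(subq_eq0 sq).
      by split; rewrite mulmxBr mulmx1 addmx_sub ?eqmx_opp //; [exact: (proj1 st)|exact: (proj2 st)].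
    by rewrite subqB (subq1 sq) -mev_subrep (derived_acts FMrep FMs triv) // subrr.
  have EE1 g : G g -> (E *m (mev F g - 1%:M) <= E1)%MS.
    apply: (trivial_between Frep E1s Es) => a b Ga Gb.
    have step u w : G u -> G w -> (E *m ((mev F u - 1%:M) *m (mev F w - 1%:M)) <= E1)%MS.
      move=> Gu Gw; rewrite mulmxA; apply: submx_trans (E0fix w Gw).
      by apply: submxMr; exact: Efix'.
    have -> : mev F a *m mev F b - mev F b *m mev F a =
      (mev F a - 1%:M) *m (mev F b - 1%:M) - (mev F b - 1%:M) *m (mev F a - 1%:M).
      rewrite !(mulmxBl, mulmxBr) !(mulmx1, mul1mx).
      move: (mev F a *m _) (mev F b *m _) => P Q; apply/matrixP => r s; rewrite !mxE; ring.
    by rewrite mulmxBr addmx_sub ?eqmx_opp ?step.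
  apply: (lift (E1 + v)%MS).
  - move=> g Gg; rewrite addsmxMr addsmx_sub (submx_trans (E1s g Gg)) ?addsmxSl //=.
    have -> : v *m mev F g = v *m (mev F g - 1%:M) + v by rewrite mulmxBr mulmx1 subrK.
    rewrite addmx_sub ?addsmxSr // (submx_trans _ (addsmxSl _ _)) //.
    by apply: submx_trans (EE1 g Gg); exact: submxMr.
  - by rewrite addsmx_sub vE (submx_trans E1E0) ?capmxSl.
  - by apply: contra vE0 => H; exact: submx_trans (addsmxSr _ _) H.
  apply: leq_ltn_trans rE0'; apply: leq_trans (mxrank_adds_leqif _ _).1 _.
  have r1 : (\rank v <= 1)%N by exact: rank_leq_row.
  apply: leq_trans (leq_add (leqnn _) r1) _; rewrite addn1 ltn_neqAle mxrankS // andbT.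
  by apply: contra E0E1 => /eqP rEE; rewrite -(geq_leqif (mxrank_leqif_sup E1E0)) rEE.
have [d' [b [c [d0 bct trd zcom]]]] := exists_casimir Ggrp char0 Gcl Gred FMrep FMs act.
pose z := \sum_i drep F (b i) *m drep F (c i).
have zst U : gstable G F U -> (U *m z <= U)%MS.
  move=> Us; rewrite mulmx_sumr; apply: summx_sub => j _; rewrite mulmxA.
  have [bt ct] := bct j.
  by apply: submx_trans (drep_stable Ggrp ct Us); apply: submxMr; exact: (drep_stable Ggrp bt).
have Ez : (E *m z <= E0')%MS.
  rewrite mulmx_sumr; apply: summx_sub => j _; rewrite mulmxA.
  have [bt ct] := bct j.
  apply: submx_trans (drep_stable Ggrp ct E0's).
  by apply: submxMr; exact: (drep_sub1 Ggrp bt).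
have Es' : stable E1 E0' z by split; exact: zst.
have zM : subq B B' z = \sum_i drep FM (b i) *m drep FM (c i).
  rewrite /subq mulmx_sumr mulmx_suml; apply: eq_bigr => j _.
  have [bt ct] := bct j.
  rewrite -/(subq B B' _) (subqM sq) ?drep_subrep //.
    exact: (stable_drep Ggrp E1s E0's bt).
  exact: (stable_drep Ggrp E1s E0's ct).
have [a Ea] : exists a, ~~ (E :&: kermx (z ^+ a) <= E0)%MS.
  apply: fitting => //; first exact: zst.
  exact: submx_trans Ez (capmxSr _ _).
have zaG g : G g -> mev F g *m z ^+ a = z ^+ a *m mev F g.
  move=> Gg; elim: (a) => [|j IHj]; first by rewrite expr0 mulmx1 mul1mx.
  rewrite exprS -[z * _]/(z *m _) mulmxA (zcom _ _ Frep _ Gg) -/z -!mulmxA.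
  by rewrite IHj.
have [Ek|Ek] := boolP (E <= kermx (z ^+ a))%MS; last first.
  apply: (lift (E :&: kermx (z ^+ a))%MS) => //; first 1 last.
  - exact: capmxSl.
  - rewrite ltn_neqAle mxrankS ?capmxSl // andbT; apply: contra Ek => /eqP rEE.
    apply: submx_trans (capmxSr E _).
    by rewrite -(geq_leqif (mxrank_leqif_sup (capmxSl E _))) rEE.
  apply: gstable_cap => // g Gg; apply/sub_kermxP; rewrite -mulmxA zaG // mulmxA.
  by rewrite mulmx_ker mul0mx.
have za0 : subq B B' (z ^+ a) = 0.
  apply/(subq_eq0 sq); first exact: stableX.
  have -> : E0' *m z ^+ a = 0; last exact: sub0mx.
  by apply/sub_kermxP; apply: submx_trans Ek; exact: capmxSl.
move: za0; rewrite (subqX sq) // zM => /nilpotent_trace; rewrite trd => /eqP.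
by rewrite (proj1 (pcharf0P _) char0) => /eqP d'0; move: d0; rewrite d'0.
Qed.
End FixedVectors.

(** * Perfectness of simple groups *)

Section Closure.
Variables (K : closedFieldType) (N : nat).
Implicit Types D Z : set 'M[K]_N.
Notation std := (@mstd K N).

Definition zariski_closure D : set 'M[K]_N :=
  [set g | g \in unitmx /\ forall f, (forall d, D d -> ev f d = 0) -> ev f g = 0].

Lemma sub_closure D : D `<=` [set g | g \in unitmx] -> D `<=` zariski_closure D.
Proof. by move=> Du d Dd; split; [exact: Du|move=> f; apply]. Qed.

Lemma closure_min D Z : zariski_closed idfun Z -> D `<=` Z -> zariski_closure D `<=` Z.
Proof.
move=> /closedP[P ->] DZ g [gu gD]; split=> // f Pf; apply: gD => d /DZ[_]; exact.
Qed.

(** A function vanishing on [D'] pulls back along a regular map to a function vanishing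
    on [D]. *)
Lemma closure_map (M : mxterm K N N N) (V : rterm K N) D D' :
  (forall g, g \in unitmx -> mev M g \in unitmx /\ ev V g = (\det (mev M g))^-1) ->
  (forall d, D d -> d \in unitmx /\ zariski_closure D' (mev M d)) ->
  forall g, zariski_closure D g -> zariski_closure D' (mev M g).
Proof.
move=> MV MD g [gu gD]; have [Mu Vg] := MV g gu; split=> // f f0.
rewrite -[mev M g]/(subst_mx M g) -(@ev_rsubst _ _ M V) //; apply: gD => d Dd.
have [du [_ dD']] := MD d Dd; have [_ Vd] := MV d du.
by rewrite (@ev_rsubst _ _ M V) //; apply: dD'.
Qed.

Lemma closure_mull h D D' : h \in unitmx -> (forall d, D d -> d \in unitmx /\ zariski_closure D' (h *m d)) ->
  forall g, zariski_closure D g -> zariski_closure D' (h *m g).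
Proof.
move=> hu HD g Dg; pose M := mmul (mconst N h) std.
have ME x : mev M x = h *m x by rewrite mev_mul mev_const mev_std.
rewrite -ME; apply: (closure_map (V := RMul (RConst N (\det h)^-1) (RInvDet K N))) Dg.
  by move=> x xu; rewrite ME unitmx_mul hu xu /= det_mulmx invfM.
by move=> d /HD; rewrite ME.
Qed.

Lemma closure_mulr h D D' : h \in unitmx -> (forall d, D d -> d \in unitmx /\ zariski_closure D' (d *m h)) ->
  forall g, zariski_closure D g -> zariski_closure D' (g *m h).
Proof.
move=> hu HD g Dg; pose M := mmul std (mconst N h).
have ME x : mev M x = x *m h by rewrite mev_mul mev_const mev_std.
rewrite -ME; apply: (closure_map (V := RMul (RConst N (\det h)^-1) (RInvDet K N))) Dg.
  by move=> x xu; rewrite ME unitmx_mul hu xu /= det_mulmx invfM mulrC.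
by move=> d /HD; rewrite ME.
Qed.

(** Translate first by elements of [D], then by elements of the closure. *)
Lemma closure_subgroup D : is_subgroup D -> is_subgroup (zariski_closure D).
Proof.
move=> Dgrp; have sub := sub_closure (subgroup_unit Dgrp).
have Du d : D d -> d \in unitmx by move/(subgroup_unit Dgrp).
split.
- by move=> g [].
- exact/sub/(subgroup1 Dgrp).
- move=> g h Dg Dh; apply: (@closure_mulr h D) Dg; first by case: Dh.
  move=> d Dd; split; first exact: Du.
  apply: (@closure_mull d D) Dh; first exact: Du.
  by move=> d' Dd'; split; [exact: Du|exact/sub/(subgroupM Dgrp)].
- move=> g Dg; rewrite -mev_inv; last by case: Dg.
  apply: (closure_map (V := rdet std)) Dg.
    by move=> x xu; rewrite mev_inv // unitmx_inv xu ev_rdet mev_std det_inv invrK.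
  move=> d Dd; have du := Du d Dd; rewrite mev_inv //; split=> //.
  exact/sub/(subgroupV Dgrp).
Qed.
End Closure.

Lemma invmx_mul (K : fieldType) n (x y : 'M[K]_n) : x \in unitmx -> y \in unitmx ->
  invmx (x *m y) = invmx y *m invmx x.
Proof.
move=> xu yu; have xyu : x *m y \in unitmx by rewrite unitmx_mul xu.
apply: (row_free_inj (A := x *m y)); first by rewrite row_free_unit.
by rewrite mulVmx // mulmxA mulmxKV // mulVmx.
Qed.

Section Commutators.
Variables (K : closedFieldType) (N : nat) (G : set 'M[K]_N).
Hypothesis Ggrp : is_subgroup G.

(** The commutator subgroup: the inverse of [[a, b]] is [[b, a]]. *)
Inductive commutator_product : 'M[K]_N -> Prop :=
| commutator1 : commutator_product 1%:M
| commutatorM w a b : commutator_product w -> G a -> G b ->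
    commutator_product (w *m (a *m b *m invmx a *m invmx b)).

Let GM := subgroupM Ggrp.
Let GV := subgroupV Ggrp.
Let Gu := G_unit Ggrp.

Lemma commutator_sub w : commutator_product w -> G w.
Proof.
elim=> [|u a b _ Gu' Ga Gb]; first exact: (subgroup1 Ggrp).
by do !apply: GM => //; exact: GV.
Qed.

Lemma commutator_subgroup : is_subgroup commutator_product.
Proof.
have CM u w : commutator_product u -> commutator_product w -> commutator_product (u *m w).
  move=> Cu; elim=> [|w' a b _ IH Ga Gb]; first by rewrite mulmx1.
  by rewrite mulmxA; apply: commutatorM.
split=> //.
- by move=> w /commutator_sub/Gu.
- exact: commutator1.
move=> w; elim=> [|u a b Cu IH Ga Gb]; first by rewrite invmx1; exact: commutator1.
have uu := Gu (commutator_sub Cu); have au := Gu Ga; have bu := Gu Gb.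
rewrite invmx_mul // ?unitmx_mul ?unitmx_inv ?au ?bu //; apply: (CM) => //.
have := commutatorM commutator1 Gb Ga.
by rewrite !invmx_mul ?unitmx_mul ?unitmx_inv ?au ?bu // !invmxK mul1mx !mulmxA.
Qed.

Lemma commutator_conj g w : G g -> commutator_product w -> commutator_product (g *m w *m invmx g).
Proof.
move=> Gg; elim=> [|u a b Cu IH Ga Gb].
  by rewrite mulmx1 mulmxV ?Gu //; exact: commutator1.
have gu := Gu Gg.
pose c x := g *m x *m invmx g.
have cM x y : c x *m c y = c (x *m y) by rewrite /c -!mulmxA (mulmxA (invmx g)) mulVmx // mul1mx.
have cG x : G x -> G (c x) by move=> Gx; do !apply: GM => //; exact: GV.
have cV x : G x -> invmx (c x) = c (invmx x).
  move=> Gx; have xu := Gu (cG _ Gx).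
  apply: (row_free_inj (A := c x)); first by rewrite row_free_unit.
  by rewrite mulVmx // cM mulVmx ?Gu // /c mulmx1 mulmxV.
rewrite -/(c _) -!cM -!cV //; exact: commutatorM IH (cG _ Ga) (cG _ Gb).
Qed.

(** In a product of commutators, the first entry of the last commutator can be moved to
    the identity within the connected group [G], so each product is connected to a
    shorter one. *)
Lemma commutator_closure_connected : zariski_closed idfun G -> zariski_connected G ->
  zariski_connected (zariski_closure commutator_product).
Proof.
move=> Gcl Gcon A B Acl Bcl AB AB0.
have Cu : commutator_product `<=` [set g | g \in unitmx].
  by move=> w /commutator_sub/Gu.
wlog A1 : A B Acl Bcl AB AB0 / A 1%:M.
  move=> H; have [A1|B1] : (A `|` B) 1%:M by rewrite AB; apply: sub_closure => //; exact: commutator1.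
    exact: H.
  have [||B0|A0] := H B A Bcl Acl _ _ B1; rewrite 1?setUC 1?setIC //; first by right.
  by left.
suff CA : commutator_product `<=` A.
  right; apply/seteqP; split=> // b Bb.
  have Ab : A b by apply: (closure_min Acl CA); rewrite -AB; right.
  by rewrite -AB0.
have /closedP[PA AE] := Acl; have /closedP[PB BE] := Bcl.
move=> w; elim=> // u a b Cu' Au Ga Gb.
have uu : u \in unitmx by exact: Cu. have bu := Gu Gb.
pose M := mmul (mmul (mmul (mconst N u) (@mstd K N)) (mconst N b)) (mmul (@minv K N) (mconst N (invmx b))).
have ME x : G x -> mev M x = u *m (x *m b *m invmx x *m invmx b).
  by move=> /Gu xu; rewrite !mev_mul !mev_const mev_std mev_inv // !mulmxA.
pose V := RConst N (\det u)^-1.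
have ME' f x : G x -> ev (rsubst M V f) x = ev f (u *m (x *m b *m invmx x *m invmx b)).
  move=> Gx; have xu := Gu Gx; have E : subst_mx M x = _ := ME x Gx.
  rewrite ev_rsubst E // !det_mulmx !det_inv /=.
  rewrite (mulrC (\det x)) mulfK; last by rewrite -unitfE -unitmxE.
  by rewrite divff ?mulr1 // -unitfE -unitmxE.
have Cx x : G x -> commutator_product (u *m (x *m b *m invmx x *m invmx b)) by move=> Gx; exact: commutatorM.
pose A' := [set g | G g /\ forall f, [set f | exists2 h, PA h & f = rsubst M V h] f -> ev f g = 0].
pose B' := [set g | G g /\ forall f, [set f | exists2 h, PB h & f = rsubst M V h] f -> ev f g = 0].
have A'E x : G x -> A' x <-> A (u *m (x *m b *m invmx x *m invmx b)).
  move=> Gx; rewrite AE; split=> [[_ H]|[_ H]].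
    split; first exact/Cu/Cx.
    by move=> f Pf; rewrite -ME' //; apply: H; exists f.
  by split=> // _ [h Ph ->]; rewrite ME' // H.
have B'E x : G x -> B' x <-> B (u *m (x *m b *m invmx x *m invmx b)).
  move=> Gx; rewrite BE; split=> [[_ H]|[_ H]].
    split; first exact/Cu/Cx.
    by move=> f Pf; rewrite -ME' //; apply: H; exists f.
  by split=> // _ [h Ph ->]; rewrite ME' // H.
have G1 := subgroup1 Ggrp.
have [||||A0|B0] := Gcon A' B'.
- exact: closed_subset.
- exact: closed_subset.
- apply/seteqP; split=> x; first by case=> -[].
  move=> Gx; have : (A `|` B) (u *m (x *m b *m invmx x *m invmx b)).
    by rewrite AB; apply: sub_closure => //; exact: Cx.
  by case=> [/(A'E x Gx)|/(B'E x Gx)]; [left|right].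
- apply/seteqP; split=> // x [A'x B'x]; have Gx : G x by case: A'x.
  have : (A `&` B) (u *m (x *m b *m invmx x *m invmx b)) by split; [exact/A'E|exact/B'E].
  by rewrite AB0.
- have : A' 1%:M by apply/A'E => //; rewrite mul1mx invmx1 mulmx1 mulmxV // mulmx1.
  by rewrite A0.
apply: contrapT => nA; have : B' a; last by rewrite B0.
apply/B'E => //; have : (A `|` B) (u *m (a *m b *m invmx a *m invmx b)).
  by rewrite AB; apply: sub_closure => //; exact: Cx.
by case.
Qed.
End Commutators.

Section OverK.
Variables (k : fieldType) (K : closedFieldType) (iota : {rmorphism k -> K}).
Hypothesis char0 : [pchar K] =i pred0.
Variable (N : nat).

Lemma regular_over_k (s : {rmorphism K -> K}) f (g : 'M[K]_N) : over_k iota s -> regular iota f ->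
  f (map_mx s g) = s (f g) :> K.
Proof.
move=> [_ sk]; elim=> [a|i j||f1 f2 _ IH1 _ IH2|f1 f2 _ IH1 _ IH2].
- by rewrite sk.
- by rewrite mxE.
- by rewrite det_map_mx fmorphV.
- by rewrite IH1 IH2 rmorphD.
- by rewrite IH1 IH2 rmorphM.
Qed.

Lemma map_unitmx_over (s : {rmorphism K -> K}) (g : 'M[K]_N) :
  (map_mx s g \in unitmx) = (g \in unitmx).
Proof. by rewrite !unitmxE det_map_mx !unitfE fmorph_eq0. Qed.

Lemma closed_over_k (Z : set 'M[K]_N) s : over_k iota s -> zariski_closed iota Z ->
  forall g, Z g -> Z (map_mx s g).
Proof.
move=> sk [P Preg ->] g [gu gP]; split; first by rewrite map_unitmx_over.
by move=> f Pf; rewrite (regular_over_k _ sk) ?gP ?rmorph0 //; exact: Preg.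
Qed.

Lemma zariski_closedW (Z : set 'M[K]_N) : zariski_closed iota Z -> zariski_closed idfun Z.
Proof.
move=> [P Preg ->]; exists P => // f /Preg.
elim=> [a|i j||f1 f2 _ IH1 _ IH2|f1 f2 _ IH1 _ IH2].
- exact: (@regular_const K K idfun N (iota a)).
- exact: regular_coord.
- exact: regular_inv_det.
- exact: regular_add.
- exact: regular_mul.
Qed.

Lemma regular_span (f : rterm K N) : exists (I : finType) (a : I -> K) (m : I -> 'M[K]_N -> K),
  (forall i, regular iota (m i)) /\ forall g, ev f g = \sum_i a i * m i g.
Proof.
have one : regular (N := N) iota (fun=> 1) by rewrite -(rmorph1 iota); exact: regular_const.
elim: f => [c|i j||f1 [I1 [a1 [m1 [r1 E1]]]] f2 [I2 [a2 [m2 [r2 E2]]]]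
               |f1 [I1 [a1 [m1 [r1 E1]]]] f2 [I2 [a2 [m2 [r2 E2]]]]].
- exists unit, (fun=> c), (fun _ _ => 1); split=> // g.
  by rewrite (big_pred1 tt) ?mulr1 // => -[].
- exists unit, (fun=> 1), (fun _ g => g i j); split=> [_|g]; first exact: regular_coord.
  by rewrite (big_pred1 tt) ?mul1r // => -[].
- exists unit, (fun=> 1), (fun _ g => (\det g)^-1); split=> [_|g]; first exact: regular_inv_det.
  by rewrite (big_pred1 tt) ?mul1r // => -[].
- exists (I1 + I2)%type, (fun i => match i with inl i => a1 i | inr i => a2 i end),
    (fun i => match i with inl i => m1 i | inr i => m2 i end); split; first by case.
  by move=> g /=; rewrite big_sumType /= E1 E2.
- exists (I1 * I2)%type, (fun i => a1 i.1 * a2 i.2), (fun i g => m1 i.1 g * m2 i.2 g).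
  split=> [i|g]; first exact: regular_mul.
  rewrite /= E1 E2 big_distrlr /= pair_big /=; apply: eq_bigr => -[i j] _ /=.
  by rewrite mulrACA.
Qed.

(** The functions vanishing on the set, written in terms of finitely many functions over
    [k], have coefficients in a space stable under automorphisms, which is spanned
    by vectors over [k]. *)
Lemma closure_over_k (D : set 'M[K]_N) :
  (forall s g, over_k iota s -> D g -> D (map_mx s g)) ->
  zariski_closed iota (zariski_closure D).
Proof.
move=> Ds; exists [set f | regular iota f /\ forall d, D d -> f d = 0]; first by move=> f [].
apply/seteqP; split=> g [gu gD]; split=> //.
  move=> f [fr f0].
  have /regularP[t tE] : regular idfun f.
    elim: fr => [a|i j||f1 f2 _ IH1 _ IH2|f1 f2 _ IH1 _ IH2].
    - exact: (@regular_const K K idfun N (iota a)).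
    - exact: regular_coord.
    - exact: regular_inv_det.
    - exact: regular_add.
    - exact: regular_mul.
  by rewrite tE; apply: gD => d /f0; rewrite tE.
move=> f f0; have [I [a [m [mr fE]]]] := regular_span f.
pose S : set 'rV[K]_#|I| := [set v | forall d, D d -> \sum_i v 0 (enum_rank i) * m i d = 0].
have Sl : linear_set S.
  split=> [d _|c u v uS vS d Dd]; first by rewrite big1 // => i _; rewrite mxE mul0r.
  rewrite (eq_bigr (fun i => c * (u 0 (enum_rank i) * m i d) + v 0 (enum_rank i) * m i d)).
    by rewrite big_split -mulr_sumr /= uS // vS // mulr0 addr0.
  by move=> i _; rewrite !mxE mulrDl mulrA.
pose v : 'rV[K]_#|I| := \row_j a (enum_val j).
have vE i : v 0 (enum_rank i) = a i by rewrite mxE enum_rankK.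
have Sv : S v by move=> d /f0; rewrite fE => E; rewrite -[RHS]E; apply: eq_bigr => i _; rewrite vE.
have Sst s u : over_k iota s -> S u -> S (map_mx s u).
  move=> sk Su d Dd; have [[s' sK s'K] sk'] := sk.
  have bs' : bijective s' by exists s.
  pose t : {rmorphism K -> K} := HB.pack_for (GRing.RMorphism.type K K) s'
    (GRing.isZmodMorphism.Build _ _ s' (can2_zmod_morphism sK s'K))
    (GRing.isMonoidMorphism.Build _ _ s' (can2_monoid_morphism sK s'K)).
  have tk : over_k iota t by split=> // c; rewrite -[in LHS](sk' c); exact: sK.
  have := Su _ (Ds t d tk Dd) => /(congr1 s); rewrite rmorph0 rmorph_sum => E; rewrite -[RHS]E.
  by apply: eq_bigr => i _; rewrite rmorphM (regular_over_k _ tk) // mxE; congr (_ * _); rewrite -[LHS]s'K.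
have [r [X [B [vB SB]]]] := descent_linear_set char0 Sl Sst Sv.
pose h j g := \sum_i map_mx iota (row j B) 0 (enum_rank i) * m i g.
have hr j : regular iota (h j).
  rewrite /h; elim: (index_enum I) => [|i l IH].
    under eq_fun do rewrite big_nil.
    by rewrite -(rmorph0 iota); exact: regular_const.
  under eq_fun do rewrite big_cons.
  apply: regular_add => //; apply: regular_mul => //.
  by rewrite mxE; exact: regular_const.
rewrite fE (eq_bigr (fun i => \sum_j X 0 j * (map_mx iota (row j B) 0 (enum_rank i) * m i g))).
  rewrite exchange_big big1 // => j _; rewrite -mulr_sumr -/(h j g) gD ?mulr0 //.
  by split=> // d Dd; exact: SB.
move=> i _; rewrite -vE vB mxE mulr_suml; apply: eq_bigr => j _.
by rewrite !mxE mulrA.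
Qed.

Variable (G : set 'M[K]_N).
Hypotheses (Gcl : zariski_closed iota G) (Ggrp : is_subgroup G) (Gcon : zariski_connected G).
Hypothesis Gnoncom : exists g h, [/\ G g, G h & g *m h <> h *m g].
Hypothesis Gsimple : forall H : set 'M[K]_N,
    zariski_closed iota H -> zariski_connected H -> normal_subgroup H G ->
    H = [set 1%:M] \/ H = G.

(** The closure of the commutator subgroup is connected, normal and defined over [k],
    and it is not trivial, so it is [G]. *)
Theorem simple_perfect (H : set 'M[K]_N) : zariski_closed idfun H -> is_subgroup H -> H `<=` G ->
  (forall g h, G g -> G h -> H (g *m h *m invmx g *m invmx h)) -> H = G.
Proof.
move=> Hcl Hgrp HG com; apply/seteqP; split=> // g Gg.
pose D := commutator_product G; have Dgrp := commutator_subgroup Ggrp.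
have DH : D `<=` H.
  move=> w; elim=> [|u a b _ IH Ga Gb]; first exact: (subgroup1 Hgrp).
  by apply: (subgroupM Hgrp) => //; exact: com.
have DG : D `<=` G by move=> w /DH/HG.
have Gcl' := zariski_closedW Gcl.
apply: (closure_min Hcl DH).
suff -> : zariski_closure D = G by [].
have Du := subgroup_unit Dgrp.
have [||| D1|//] := Gsimple (H := zariski_closure D).
- apply: closure_over_k => s w sk; have sG := closed_over_k sk Gcl.
  elim=> [|u a b _ IH Ga Gb]; first by rewrite map_mx1; exact: commutator1.
  by rewrite !map_mxM !map_invmx; apply: commutatorM => //; exact: sG.
- exact: commutator_closure_connected.
- split; first exact: closure_subgroup.
    exact: closure_min.
  move=> a h Ga Dh; have au := G_unit Ggrp Ga.
  apply: (@closure_mulr _ _ (invmx a) [set a *m d | d in D]).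
  + by rewrite unitmx_inv.
  + move=> _ [d Dd <-]; split; first by rewrite unitmx_mul au Du.
    by apply: sub_closure => //; exact: commutator_conj.
  + apply: (@closure_mull _ _ a D) Dh => // d Dd; split; first exact: Du.
    apply: sub_closure; last by exists d.
    by move=> _ [d' Dd' <-] /=; rewrite unitmx_mul au; exact: Du.
have [a [b [Ga Gb ab]]] := Gnoncom; case: ab.
have : zariski_closure D (1%:M *m (a *m b *m invmx a *m invmx b)).
  by apply: sub_closure => //; apply: commutatorM => //; exact: commutator1.
rewrite D1 /= mul1mx => E; have au := G_unit Ggrp Ga; have bu := G_unit Ggrp Gb.
by rewrite -[RHS]mul1mx -E mulmxA mulmxKV // mulmxKV.
Qed.
End OverK.

(** * Representations over the base field *)

Section RepsOverK.
Variables (k : fieldType) (K : closedFieldType) (iota : {rmorphism k -> K}).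
Variable (G : algebraic_group iota).
Hypothesis char0k : [pchar k] =i pred0.
Hypothesis Gred : reductive G.
Hypothesis Gsimple : simple G.
Notation GK := (gpoints G).
Notation N := (gdim G).
Notation "A ^i" := (map_mx iota A) (at level 2, format "A ^i").

Let char0 : [pchar K] =i pred0.
Proof. by move=> p; rewrite (fmorph_pchar iota) char0k. Qed.

Let Ggrp : is_subgroup GK := gpoints_subgroup G.
Let Gcl : zariski_closed idfun GK := zariski_closedW (gpoints_closed G).
Let Gcon : zariski_connected GK := proj1 Gred.

Lemma group_perfect (H : set 'M[K]_N) : zariski_closed idfun H -> is_subgroup H ->
  H `<=` GK -> (forall g h, GK g -> GK h -> H (g *m h *m invmx g *m invmx h)) -> H = GK.
Proof.
exact: (simple_perfect char0 (gpoints_closed G) Ggrp Gcon (proj1 Gsimple) (proj2 Gsimple)).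
Qed.

Lemma regular_term f : regular iota f -> exists t : rterm K N, f = ev t.
Proof.
move=> fr; apply/regularP; elim: fr => [a|i j||f1 f2 _ IH1 _ IH2|f1 f2 _ IH1 _ IH2].
- exact: (@regular_const K K idfun N (iota a)).
- exact: regular_coord.
- exact: regular_inv_det.
- exact: regular_add.
- exact: regular_mul.
Qed.

Lemma regular_mx_term m (r : 'M[K]_N -> 'M[K]_m) : regular_mx r ->
  exists F : mxterm K N m m, forall g, GK g -> mev F g = r g.
Proof.
move=> rr.
have H (ij : 'I_m * 'I_m) : exists t : rterm K N, forall g, GK g -> r g ij.1 ij.2 = ev t g.
  by have [f /regular_term[t ->] fE] := rr ij.1 ij.2; exists t.
have [F FE] := choice H; exists (fun i j => F (i, j)) => g Gg.
by apply/matrixP => i j; rewrite mxE -FE.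
Qed.

Lemma rep_term (V : rep G) : exists F : mxterm K N (rdim V) (rdim V),
  is_rep GK F /\ forall g, GK g -> mev F g = V g.
Proof.
have [F FE] := regular_mx_term (@rmap_regular _ _ _ _ V); exists F; split=> //.
have G1 := subgroup1 Ggrp; split; first by rewrite FE // rmap1.
by move=> g h Gg Gh; rewrite !FE ?rmapM //; exact: (subgroupM Ggrp).
Qed.

Lemma rep_inv (V : rep G) g : GK g -> V (invmx g) *m V g = 1%:M.
Proof.
move=> Gg; rewrite -rmapM ?mulVmx ?rmap1 //; first exact: (G_unit Ggrp).
exact: (subgroupV Ggrp).
Qed.

Section MatrixAction.
Variables (m n : nat) (F1 : mxterm K N m m) (F2 : mxterm K N n n).
Hypotheses (F1rep : is_rep GK F1) (F2rep : is_rep GK F2).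

Let dec (b : 'I_(m * n)) := enum_val (cast_ord (esym (mxvec_cast m n)) b).
Let decK i j : dec (mxvec_index i j) = (i, j).
Proof. by rewrite /dec /mxvec_index cast_ordK enum_rankK. Qed.

(** The action [C |-> F1(g)^-1 C F2(g)] on matrices. *)
Let hom_term : mxterm K N (m * n) (m * n) := fun a b =>
  RMul (mcomp_inv F1 (dec b).1 (dec a).1) (F2 (dec a).2 (dec b).2).

Let mev_hom g (C : 'M[K]_(m, n)) : GK g ->
  mxvec C *m mev hom_term g = mxvec (mev F1 (invmx g) *m C *m mev F2 g).
Proof.
move=> Gg; apply/rowP => b; case/mxvec_indexP: b => i' j'.
rewrite mxvecE !mxE (reindex _ (curry_mxvec_bij _ _)) /=.
rewrite (eq_bigr (fun p => mev F1 (invmx g) i' p.1 * C p.1 p.2 * mev F2 g p.2 j')).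
  rewrite -(pair_big xpredT xpredT (fun i j => mev F1 (invmx g) i' i * C i j * mev F2 g j j')) /=.
  by rewrite exchange_big; apply: eq_bigr => j _ /=; rewrite [(_ *m _) _ _]mxE mulr_suml.
move=> [i j] _ /=; rewrite mxvecE mxE /hom_term !decK /= -(mev_inv_rep Ggrp) // [mev _ g i' i]mxE.
by rewrite [mev F2 g j j']mxE; ring.
Qed.

Let hom_rep : is_rep GK hom_term.
Proof.
have GM := subgroupM Ggrp; have GV := subgroupV Ggrp; have G1 := subgroup1 Ggrp.
have row_ext (A B : 'M[K]_(m * n)) : (forall C : 'M[K]_(m, n), mxvec C *m A = mxvec C *m B) -> A = B.
  by move=> E; apply/row_matrixP => i; rewrite !rowE -[delta_mx 0 i]vec_mxK E.
split=> [|g h Gg Gh]; apply: row_ext => C.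
  by rewrite mev_hom // invmx1 (proj1 F1rep) (proj1 F2rep) mul1mx !mulmx1.
rewrite mulmxA (mev_hom _ (GM _ _ Gg Gh)) !mev_hom //.
rewrite (invmx_mul (G_unit Ggrp Gg) (G_unit Ggrp Gh)).
rewrite (proj2 F1rep _ _ (GV _ Gh) (GV _ Gg)) (proj2 F2rep _ _ Gg Gh).
by rewrite !mulmxA.
Qed.

(** The lifting of fixed vectors for the space of matrices: a matrix fixed by this
    action intertwines [F1] and [F2]. *)
Lemma fixed_matrix_lifts (E0 E : set 'M[K]_(m, n)) :
  E0 0 -> (forall a u v, E0 u -> E0 v -> E0 (a *: u + v)) ->
  E 0 -> (forall a u v, E u -> E v -> E (a *: u + v)) ->
  (forall g C, GK g -> E0 C -> E0 (mev F1 (invmx g) *m C *m mev F2 g)) ->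
  (forall g C, GK g -> E C -> E (mev F1 (invmx g) *m C *m mev F2 g)) ->
  (forall g C, GK g -> E C -> E0 (mev F1 (invmx g) *m C *m mev F2 g - C)) ->
  (exists2 C, E C & ~ E0 C) ->
  exists C, [/\ E C, ~ E0 C & forall g, GK g -> mev F1 g *m C = C *m mev F2 g].
Proof.
move=> E00 E0D E_0 ED E0s Es Efix [C EC E0C].
have mxset (S : set 'M[K]_(m, n)) : S 0 -> (forall a u v, S u -> S v -> S (a *: u + v)) ->
    exists A : 'M[K]_(m * n), forall C, S C <-> (mxvec C <= A)%MS.
  move=> S0 SD; have [A AE] := @linear_set_mx _ _ [set v | S (vec_mx v)]
    (conj (eq_ind_r S S0 (linear0 _)) (fun a u v Su Sv => eq_ind_r S (SD a _ _ Su Sv) (linearP _ a u v))).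
  by exists A => D; rewrite -AE /= mxvecK.
have [A0 A0E] := mxset E0 E00 E0D; have [A AE] := mxset E E_0 ED.
have rowP' (A' A'' : 'M[K]_(m * n)) (f : 'M[K]_(m * n)) :
  (forall D, (mxvec D <= A')%MS -> (mxvec D *m f <= A'')%MS) -> (A' *m f <= A'')%MS.
  move=> H; apply/row_subP => i; rewrite row_mul -[row i A']vec_mxK; apply: H.
  by rewrite vec_mxK row_sub.
have [||||v [vA vA0 vG]] := fixed_vector_lifts Ggrp char0 Gcl Gcon (proj2 Gred) group_perfect hom_rep (E0 := A0) (E := A).
- by move=> g Gg; apply: rowP' => D /A0E ED0; rewrite mev_hom //; apply/A0E/E0s.
- by move=> g Gg; apply: rowP' => D /AE ED0; rewrite mev_hom //; apply/AE/Es.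
- move=> g Gg; apply: rowP' => D /AE ED0; rewrite mulmxBr mulmx1 mev_hom // -linearB.
  by apply/A0E/Efix.
- by apply/negP => AA0; apply: E0C; apply/A0E; apply: submx_trans AA0; exact/AE.
exists (vec_mx v); split; first by apply/AE; rewrite vec_mxK.
  by move=> /A0E; rewrite vec_mxK (negPf vA0).
move=> g Gg; have := vG g Gg; rewrite -{1}[v]vec_mxK mev_hom // => /(congr1 vec_mx).
rewrite mxvecK => E'; rewrite -[in LHS]E' !mulmxA.
by rewrite (repV Ggrp F1rep Gg) mul1mx.
Qed.
End MatrixAction.
End RepsOverK.

Section Homs.
Variables (k : fieldType) (K : closedFieldType) (iota : {rmorphism k -> K}).
Variable (G : algebraic_group iota).
Hypothesis char0k : [pchar k] =i pred0.
Hypothesis Gred : reductive G.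
Hypothesis Gsimple : simple G.
Notation GK := (gpoints G).
Notation N := (gdim G).
Notation "A ^i" := (map_mx iota A) (at level 2, format "A ^i").
Implicit Types V W U S : rep G.

Let char0 : [pchar K] =i pred0.
Proof. by move=> p; rewrite (fmorph_pchar iota) char0k. Qed.

Definition rep_hom V W (P : 'M[k]_(rdim V, rdim W)) :=
  forall g, GK g -> V g *m P^i = P^i *m W g.

Arguments rep_hom : clear implicits.

Definition rep_homK V W (P : 'M[K]_(rdim V, rdim W)) :=
  forall g, GK g -> V g *m P = P *m W g.

Arguments rep_homK : clear implicits.

Lemma rep_hom1 V : rep_hom V V 1%:M.
Proof. by move=> g _; rewrite map_mx1 mulmx1 mul1mx. Qed.

Lemma rep_homM V W U P Q : rep_hom V W P -> rep_hom W U Q ->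
  rep_hom V U (P *m Q).
Proof. by move=> hP hQ g Gg; rewrite map_mxM mulmxA hP // -!mulmxA hQ. Qed.

Lemma rep_hom_lin V W a P Q : rep_hom V W P -> rep_hom V W Q ->
  rep_hom V W (a *: P + Q).
Proof.
move=> hP hQ g Gg; rewrite map_mxD map_mxZ mulmxDr mulmxDl -scalemxAr -scalemxAl.
by rewrite hP // hQ.
Qed.

Lemma rep_hom0 V W : rep_hom V W 0.
Proof. by move=> g _; rewrite map_mx0 mulmx0 mul0mx. Qed.

Lemma rep_hom_sum V W I (r : seq I) (a : I -> k) (P : I -> 'M[k]_(rdim V, rdim W)) :
  (forall i, rep_hom V W (P i)) -> rep_hom V W (\sum_(i <- r) a i *: P i).
Proof.
move=> hP; elim: r => [|i r IH]; first by rewrite big_nil; exact: rep_hom0.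
by rewrite big_cons; exact: rep_hom_lin.
Qed.

Lemma rep_over V s g : over_k iota s -> GK g -> V (map_mx s g) = map_mx s (V g).
Proof.
move=> sk Gg; apply/matrixP => i j; rewrite [RHS]mxE.
have [f fr fE] := @rmap_regular _ _ _ _ V i j.
rewrite !fE ?(regular_over_k _ sk) //.
exact: (closed_over_k sk (gpoints_closed G)).
Qed.

Lemma over_kV (s : {rmorphism K -> K}) : over_k iota s ->
  exists2 t : {rmorphism K -> K}, over_k iota t & cancel t s.
Proof.
move=> [[s' sK s'K] sk].
have bs' : bijective s' by exists s.
pose t : {rmorphism K -> K} := HB.pack_for (GRing.RMorphism.type K K) s'
  (GRing.isZmodMorphism.Build _ _ s' (can2_zmod_morphism sK s'K))
  (GRing.isMonoidMorphism.Build _ _ s' (can2_monoid_morphism sK s'K)).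
exists t => //; split=> // c; rewrite -[in LHS](sk c); exact: sK.
Qed.

(** Equivariance is preserved by the automorphisms of [K] over [k], so descent applies. *)
Lemma rep_homK_span V W P : rep_homK V W P ->
  exists r (x : 'rV[K]_r) (B : 'I_r -> 'M[k]_(rdim V, rdim W)),
  (forall i, rep_hom V W (B i)) /\ P = \sum_i x 0 i *: (B i)^i.
Proof.
move=> hP.
pose S : set 'rV[K]_(rdim V * rdim W) := [set v | rep_homK V W (vec_mx v)].
have Sl : linear_set S.
  split=> [g _|a u v uS vS g Gg]; first by rewrite linear0 mulmx0 mul0mx.
  by rewrite linearP mulmxDr mulmxDl -scalemxAr -scalemxAl uS // vS.
have Ss s v : over_k iota s -> S v -> S (map_mx s v).
  move=> sk Sv g Gg; have [t tk tsK] := over_kV sk.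
  have Gt := closed_over_k tk (gpoints_closed G) Gg.
  have -> : g = map_mx s (map_mx t g) by apply/matrixP => i j; rewrite !mxE tsK.
  by rewrite !(rep_over _ sk) // -map_vec_mx -!map_mxM Sv.
have SP : S (mxvec P) by move=> g Gg; rewrite mxvecK hP.
have [r [x [B [E hB]]]] := descent_linear_set char0 Sl Ss SP.
exists r, x, (fun i => vec_mx (row i B)); split.
  by move=> i g Gg; have := hB i g Gg; rewrite map_vec_mx.
apply: (can_inj mxvecK); rewrite E mulmx_sum_row linear_sum; apply: eq_bigr => i _.
by rewrite linearZ /= -map_mxvec vec_mxK map_row.
Qed.

(** Let [G] act on the matrices [C] with [P C P] a multiple of [P]; the multiple is
    invariant, and it is nonzero for the pseudo-inverse of [P].  So there is an
    equivariant [C] over [K] with [P C P = P], and this linear system can then be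
    solved over [k]. *)
Theorem rep_hom_split V W P : rep_hom V W P ->
  exists2 Q, rep_hom W V Q & P *m Q *m P = P.
Proof.
move=> hP; have [->|P0] := eqVneq P 0.
  by exists 0; [exact: rep_hom0|rewrite mulmx0].
have [F [Frep FV]] := rep_term V; have [H [Hrep HW]] := rep_term W.
pose E0 : set 'M[K]_(rdim W, rdim V) := [set C | P^i *m C *m P^i = 0].
pose E : set 'M[K]_(rdim W, rdim V) := [set C | exists c, P^i *m C *m P^i = c *: P^i].
have Gi g : GK g -> GK (invmx g) by exact: (subgroupV (gpoints_subgroup G)).
have act g C : GK g -> P^i *m (mev H (invmx g) *m C *m mev F g) *m P^i =
    V (invmx g) *m (P^i *m C *m P^i) *m W g.
  move=> Gg; rewrite FV // HW ?mulmxA; last exact: Gi.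
  by rewrite -hP; [rewrite -!mulmxA hP|exact: Gi].
have actE g c : GK g -> V (invmx g) *m (c *: P^i) *m W g = c *: P^i.
  move=> Gg; rewrite -scalemxAr -scalemxAl hP; last exact: Gi.
  by rewrite -mulmxA rep_inv // mulmx1.
have [||||||||C [[c cE] C0 CG]] := fixed_matrix_lifts char0k Gred Gsimple Hrep Frep (E0 := E0) (E := E).
- by rewrite /E0 /= mulmx0 mul0mx.
- by move=> a u v u0 v0; rewrite /E0 /= mulmxDr mulmxDl -scalemxAr -scalemxAl u0 v0 scaler0 addr0.
- by exists 0; rewrite mulmx0 mul0mx scale0r.
- move=> a u v [c uc] [d vd]; exists (a * c + d).
  by rewrite mulmxDr mulmxDl -scalemxAr -scalemxAl uc vd scalerA scalerDl.
- by move=> g C Gg C0; rewrite /E0 /= act // C0 mulmx0 mul0mx.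
- by move=> g C Gg [c cE]; exists c; rewrite act // cE actE.
- by move=> g C Gg [c cE]; rewrite /E0 /= mulmxBr mulmxBl act // cE actE // subrr.
- have PpP : P^i *m pinvmx P^i *m P^i = P^i by rewrite mulmxKpV.
  exists (pinvmx P^i); first by exists 1; rewrite PpP scale1r.
  by rewrite /E0 /= PpP => /eqP; rewrite map_mx_eq0 (negPf P0).
have c0 : c != 0 by apply: contra_notN C0 => /eqP c0; rewrite /E0 /= cE c0 scale0r.
have hC : rep_homK W V C by move=> g Gg; rewrite -FV // -HW // CG.
have [r [x [B [hB CE]]]] := rep_homK_span hC.
pose Bm : 'M[k]_(r, _) := \matrix_i mxvec (P *m B i *m P).
have [|Y YE] := @solvable_over_k _ _ iota _ _ Bm (mxvec P) (c^-1 *: x).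
  rewrite -scalemxAl mulmx_sum_row; apply: (scalerI c0).
  rewrite scalerA divff // scale1r map_mxvec -linearZ -cE CE.
  rewrite mulmx_sumr mulmx_suml linear_sum; apply: eq_bigr => i _ /=.
  by rewrite -scalemxAr -scalemxAl linearZ /= -map_row rowK map_mxvec !map_mxM.
exists (\sum_i Y 0 i *: B i); first exact: rep_hom_sum.
apply: (can_inj mxvecK); rewrite [RHS]YE mulmx_sum_row mulmx_sumr mulmx_suml linear_sum.
by apply: eq_bigr => i _; rewrite -scalemxAr -scalemxAl linearZ /= rowK.
Qed.

Section Retract.
Variables (V : rep G) (n : nat) (A : 'M[k]_(n, rdim V)) (B : 'M[k]_(rdim V, n)).
Hypotheses (AB : A *m B = 1%:M) (BA : rep_hom V V (B *m A)).

Lemma retract_regular : regular_mx (G := G) (fun g => A^i *m V g *m B^i).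
Proof.
move=> i j.
have H (ab : 'I_(rdim V) * 'I_(rdim V)) : exists f, regular iota f /\
    forall g, GK g -> V g ab.1 ab.2 = f g.
  by have [f fr fE] := @rmap_regular _ _ _ _ V ab.1 ab.2; exists f.
have [f fP] := choice H.
exists (fun g => \sum_b \sum_a iota (A i a) * f (a, b) g * iota (B b j)).
  have rsum' (I : Type) (r : seq I) (h : I -> 'M[K]_N -> K) : (forall a, regular iota (h a)) ->
      regular iota (fun g => \sum_(a <- r) h a g).
    move=> hr; elim: r => [|a r IH].
      under eq_fun do rewrite big_nil.
      by rewrite -(rmorph0 iota); exact: regular_const.
    under eq_fun do rewrite big_cons.
    exact: regular_add.
  apply: (rsum') => b; apply: (rsum') => a; apply: regular_mul; last exact: regular_const.
  by apply: regular_mul; [exact: regular_const|case: (fP (a, b))].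
move=> g Gg; rewrite mxE; apply: eq_bigr => b _; rewrite mxE mulr_suml.
by apply: eq_bigr => a _; rewrite !mxE; case: (fP (a, b)) => _ <-.
Qed.

Lemma retract1 : A^i *m V 1%:M *m B^i = 1%:M.
Proof. by rewrite rmap1 mulmx1 -map_mxM AB map_mx1. Qed.

Lemma retractM g h : GK g -> GK h ->
  A^i *m V (g *m h) *m B^i = (A^i *m V g *m B^i) *m (A^i *m V h *m B^i).
Proof.
move=> Gg Gh; rewrite rmapM // -!mulmxA; congr (_ *m _).
have := BA Gh; rewrite map_mxM => E.
rewrite !(mulmxA B^i) (mulmxA (B^i *m A^i)) -E -!mulmxA; congr (_ *m (_ *m _)).
by rewrite -[in RHS]map_mxM AB map_mx1 mulmx1.
Qed.

Definition retract : rep G := Rep retract_regular retract1 retractM.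

Lemma retract_out : rep_hom V retract B.
Proof.
move=> g Gg; rewrite /= !mulmxA; have := BA Gg; rewrite map_mxM => <-.
by rewrite -!mulmxA -map_mxM AB map_mx1 mulmx1.
Qed.
End Retract.

Lemma idempotent_factor n (e : 'M[k]_n) : e *m e = e ->
  exists (A : 'M[k]_(\rank e, n)) (B : 'M[k]_(n, \rank e)), A *m B = 1%:M /\ B *m A = e.
Proof.
move=> ee; exists (row_base e), (col_base e); split; last exact: mulmx_base.
apply: (row_free_inj (row_base_free e)) => /=; apply: (row_full_inj (col_base_full e)).
by rewrite mul1mx mulmx_base -mulmxA mulmx_base mulmxA mulmx_base.
Qed.

Lemma rep_homB V W P Q : rep_hom V W P -> rep_hom V W Q ->
  rep_hom V W (P - Q).
Proof. by move=> hP hQ; rewrite addrC -scaleN1r; exact: rep_hom_lin. Qed.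

Lemma retract_split V n m (A : 'M[k]_(n, rdim V)) (B : 'M[k]_(rdim V, n))
  (C : 'M[k]_(m, rdim V)) (D : 'M[k]_(rdim V, m))
  (AB : A *m B = 1%:M) (BA : rep_hom V V (B *m A))
  (CD : C *m D = 1%:M) (DC : rep_hom V V (D *m C)) :
  B *m A + D *m C = 1%:M -> rep_iso V (rep_sum (retract AB BA) (retract CD DC)).
Proof.
move=> E1.
have AD : A *m D = 0.
  have : A *m (B *m A + D *m C) *m D = A *m D by rewrite E1 mulmx1.
  rewrite mulmxDr mulmxDl !mulmxA AB mul1mx -(mulmxA _ C) CD mulmx1 => /eqP.
  by rewrite -subr_eq0 addrK => /eqP.
have CB : C *m B = 0.
  have : C *m (B *m A + D *m C) *m B = C *m B by rewrite E1 mulmx1.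
  rewrite mulmxDr mulmxDl !mulmxA CD mul1mx -(mulmxA _ A) AB mulmx1 => /eqP.
  by rewrite -subr_eq0 addrK => /eqP.
exists (row_mx B D), (col_mx A C); split.
- by rewrite mul_row_col.
- by rewrite mul_col_row AB CD AD CB -scalar_mx_block.
move=> g Gg; rewrite /= map_row_mx mul_mx_row mul_row_block !mulmx0 addr0 add0r.
by rewrite (retract_out AB BA Gg) (retract_out CD DC Gg).
Qed.

Lemma rep_iso_dim V W : rep_iso V W -> rdim V = rdim W.
Proof.
move=> [P [Q [PQ QP _]]]; apply/eqP; rewrite eqn_leq; apply/andP; split.
  by rewrite -{1}(mxrank1 k (rdim V)) -PQ (leq_trans (mxrankM_maxr _ _)) ?rank_leq_row.
by rewrite -{1}(mxrank1 k (rdim W)) -QP (leq_trans (mxrankM_maxr _ _)) ?rank_leq_row.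
Qed.

(** An idempotent splits the representation into its image and its kernel. *)
Lemma indecomposable_idempotent V e : indecomposable V -> rep_hom V V e ->
  e *m e = e -> e = 0 \/ e = 1%:M.
Proof.
move=> [V0 Vi] he ee; have [A [B [AB BA]]] := idempotent_factor ee.
have ff : (1%:M - e) *m (1%:M - e) = 1%:M - e.
  by rewrite mulmxBr mulmx1 mulmxBl mul1mx ee subrr subr0.
have [C [D [CD DC]]] := idempotent_factor ff.
have hBA : rep_hom V V (B *m A) by rewrite BA.
have hDC : rep_hom V V (D *m C) by rewrite DC; apply: rep_homB => //; exact: rep_hom1.
have [|/eqP|/eqP] := Vi (retract AB hBA) (retract CD hDC).
- by apply: retract_split; rewrite BA DC addrC subrK.
- by rewrite mxrank_eq0 => /eqP; left.
- by rewrite mxrank_eq0 subr_eq0 => /eqP; right.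
Qed.

(** If [P Q P = P], then [P Q] and [Q P] are nonzero idempotents, hence identities. *)
Lemma indecomposable_hom V W P : indecomposable V -> indecomposable W ->
  rep_hom V W P -> P != 0 -> rep_iso V W.
Proof.
move=> Vi Wi hP P0; have [Q hQ PQP] := rep_hom_split hP.
exists P, Q; split=> //.
- have [|||//] := indecomposable_idempotent (e := P *m Q) Vi.
  + exact: rep_homM hP hQ.
  + by rewrite mulmxA PQP.
  + by move=> E; move: PQP P0; rewrite E mul0mx => <-; rewrite eqxx.
- have [|||//] := indecomposable_idempotent (e := Q *m P) Wi.
  + exact: rep_homM hQ hP.
  + by rewrite -mulmxA (mulmxA P) PQP.
  + by move=> E; move: PQP P0; rewrite -mulmxA E mulmx0 => <-; rewrite eqxx.
Qed.

(** If [P R P = P], then [R P] is a nonzero idempotent of [S], hence the identity, so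
    [P R] is an idempotent with image isomorphic to [S]. *)
Lemma indecomposable_summand Q S P : indecomposable S -> rep_hom Q S P -> P != 0 ->
  exists U, rep_iso Q (rep_sum S U).
Proof.
move=> Si hP P0; have [R hR PRP] := rep_hom_split hP.
have RP : R *m P = 1%:M.
  have [|||//] := indecomposable_idempotent (e := R *m P) Si.
  + exact: rep_homM hR hP.
  + by rewrite -mulmxA (mulmxA P) PRP.
  + by move=> E; move: PRP P0; rewrite -mulmxA E mulmx0 => <-; rewrite eqxx.
have hPR : rep_hom Q Q (P *m R) by exact: rep_homM hP hR.
have ee : P *m R *m (P *m R) = P *m R by rewrite mulmxA PRP.
have ff : (1%:M - P *m R) *m (1%:M - P *m R) = 1%:M - P *m R.
  by rewrite mulmxBr mulmx1 mulmxBl mul1mx ee subrr subr0.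
have [C [D [CD DC]]] := idempotent_factor ff.
have hDC : rep_hom Q Q (D *m C) by rewrite DC; apply: rep_homB => //; exact: rep_hom1.
exists (retract CD hDC); apply: rep_iso_trans (retract_split RP hPR CD hDC _) _.
  by rewrite DC addrC subrK.
apply: rep_sum_iso; last exact: rep_iso_refl.
exists 1%:M, 1%:M; rewrite mulmx1; split=> // g Gg; rewrite map_mx1 mulmx1 mul1mx /=.
by rewrite -mulmxA hP // mulmxA -map_mxM RP map_mx1 mul1mx.
Qed.
End Homs.

Arguments rep_hom {k K iota G} V W P.
Arguments rep_homK {k K iota G} V W P.

(** * The Grothendieck ring of representations *)

Section RepRing.
Variables (k : fieldType) (K : closedFieldType) (iota : {rmorphism k -> K}).
Variable (G : algebraic_group iota).
Hypothesis char0k : [pchar k] =i pred0.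
Hypothesis Gred : reductive G.
Hypothesis Gsimple : simple G.
Notation GK := (gpoints G).
Notation N := (gdim G).
Notation "A ^i" := (map_mx iota A) (at level 2, format "A ^i").
Implicit Types V W U S : rep G.
Notation cls := (@rep_ring_class k K iota G).
Notation basis := [set cls V | V in [set V | indecomposable V]].

Let char0 : [pchar K] =i pred0.
Proof. by move=> p; rewrite (fmorph_pchar iota) char0k. Qed.

Lemma cls_iso V W : rep_iso V W -> cls V = cls W.
Proof. by move=> VW; rewrite /rep_ring_class; congr (Defs.diff (_, _)); apply/iso_classP. Qed.

Lemma cls_sum V W : cls (rep_sum V W) = cls V + cls W.
Proof.
rewrite /rep_ring_class -class_addE.
by rewrite [RHS](grothendieck_addE (iso_class V, 0) (iso_class W, 0)) /diff_add /= addr0.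
Qed.

Lemma cls_tensor V W : cls (rep_tensor V W) = cls V * cls W.
Proof.
rewrite /rep_ring_class -class_mulE.
rewrite [RHS](grothendieck_mulE (iso_class V, 0) (iso_class W, 0)) /diff_mul /=.
by rewrite !mulr0 mul0r !addr0.
Qed.

Lemma cls_rep1 : cls (rep1 G) = 1. Proof. by []. Qed.

Lemma cls_rep0 : cls (rep0 G) = 0. Proof. by []. Qed.

Lemma rep_dim0_iso V : rdim V = 0%N -> rep_iso V (rep0 G).
Proof.
move=> V0.
have e0 m (A B : 'M[k]_(rdim V, m)) : A = B.
  by apply/matrixP => i; have := ltn_ord i; rewrite [X in (_ < X)%N]V0.
have e0K m (A B : 'M[K]_(rdim V, m)) : A = B.
  by apply/matrixP => i; have := ltn_ord i; rewrite [X in (_ < X)%N]V0.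
exists 0, 0; split=> [||g _]; [exact: e0| |exact: e0K].
by apply/matrixP => -[].
Qed.

Lemma nonneg_combD (A : pzRingType) (C : set A) x y :
  nonneg_comb C x -> nonneg_comb C y -> nonneg_comb C (x + y).
Proof.
move=> [s sC ->] [t tC ->]; exists (s ++ t); last by rewrite big_cat.
by move=> b; rewrite mem_cat => /orP[/sC|/tC].
Qed.

(** Induction on the dimension. *)
Lemma cls_decompose V : nonneg_comb basis (cls V).
Proof.
have [d] := ubnP (rdim V); elim: d V => // d IH V; rewrite ltnS => Vd.
have [V0|V0] := posnP (rdim V).
  by exists [::]; rewrite // big_nil (cls_iso (rep_dim0_iso V0)) cls_rep0.
have [Vi|nVi] := pselect (indecomposable V).
  by exists [:: cls V]; [move=> _ /[1!inE] /eqP ->; exists V|rewrite big_seq1].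
have [W [U [iso W0 U0]]] : exists W U, [/\ rep_iso V (rep_sum W U), (0 < rdim W)%N & (0 < rdim U)%N].
  apply: contrapT => H; apply: nVi; split=> // W U iso.
  have [->|W0] := posnP (rdim W); first by left.
  have [->|U0] := posnP (rdim U); first by right.
  by case: H; exists W, U.
have dE : (rdim W + rdim U = rdim V)%N by rewrite (rep_iso_dim iso).
rewrite (cls_iso iso) cls_sum; apply: nonneg_combD; apply: IH; apply: leq_trans Vd.
  by rewrite -dE -[X in (X < _)%N]addn0 ltn_add2l.
by rewrite -dE -[X in (X < _)%N]add0n ltn_add2r.
Qed.

Section HomDim.
Variable S : rep G.

Lemma exists_hom_mx V : exists A : 'M[k]_(rdim S * rdim V),
  forall P : 'M[k]_(rdim S, rdim V), (mxvec P <= A)%MS <-> rep_hom S V P.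
Proof.
have [A AE] := @linear_set_mx _ _ [set v : 'rV[k]_(rdim S * rdim V) | rep_hom S V (vec_mx v)]
  (conj (eq_ind_r _ (@rep_hom0 _ _ _ _ S V) (linear0 _))
    (fun a u v Su Sv => eq_ind_r _ (@rep_hom_lin _ _ _ _ S V a _ _ Su Sv) (linearP _ a u v))).
by exists A => P; rewrite -AE /= mxvecK.
Qed.

Definition hom_mx V := sval (cid (exists_hom_mx V)).

Lemma hom_mxP V (P : 'M[k]_(rdim S, rdim V)) :
  (mxvec P <= hom_mx V)%MS <-> rep_hom S V P.
Proof. by rewrite /hom_mx; case: cid. Qed.

Definition hom_dim V := \rank (hom_mx V).

Lemma mxvec_subP m n p (A : 'M[k]_(m * n)) (B : 'M[k]_(p, m * n)) :
  (forall P : 'M[k]_(m, n), (mxvec P <= B)%MS -> (mxvec P <= A)%MS) -> (B <= A)%MS.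
Proof.
by move=> H; apply/row_subP => i; rewrite -[row i B]vec_mxK; apply: H; rewrite vec_mxK row_sub.
Qed.

Definition post V W (Q : 'M[k]_(rdim V, rdim W)) : 'M[k]_(rdim S * rdim V, rdim S * rdim W) :=
  lin_mx (mulmxr Q).

Arguments post : clear implicits.

Lemma mul_post V W Q (P : 'M[k]_(rdim S, rdim V)) : mxvec P *m post V W Q = mxvec (P *m Q).
Proof. by rewrite mul_vec_lin. Qed.

Lemma post_hom V W Q : rep_hom V W Q -> (hom_mx V *m post V W Q <= hom_mx W)%MS.
Proof.
move=> hQ; apply/row_subP => i; rewrite row_mul -[row i _]vec_mxK mul_post.
by apply/hom_mxP; apply: rep_homM hQ; apply/hom_mxP; rewrite vec_mxK row_sub.
Qed.

Lemma postM V W U Q R : post V W Q *m post W U R = post V U (Q *m R).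
Proof.
apply/row_matrixP => i; rewrite !rowE -[delta_mx 0 i]vec_mxK mulmxA !mul_post.
by rewrite mulmxA.
Qed.

Lemma post1 V : post V V 1%:M = 1%:M.
Proof.
by apply/row_matrixP => i; rewrite !rowE -[delta_mx 0 i]vec_mxK mul_post !mulmx1.
Qed.

Lemma hom_dim_iso V W : rep_iso V W -> hom_dim V = hom_dim W.
Proof.
have half V' W' : rep_iso V' W' -> (hom_dim V' <= hom_dim W')%N.
  move=> [P [Q [PQ _ hP]]].
  rewrite /hom_dim -{1}[hom_mx V']mulmx1 -post1 -PQ -(@postM V' W' V') mulmxA.
  apply: leq_trans (mxrankM_maxl _ _) _; apply: mxrankS; exact: post_hom.
by move=> VW; apply/eqP; rewrite eqn_leq !half //; exact: rep_iso_sym.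
Qed.

(** The injections and projections of the direct sum identify [Hom(S, V + W)] with the
    direct sum of [Hom(S, V)] and [Hom(S, W)]. *)
Lemma hom_dim_sum V W : hom_dim (rep_sum V W) = (hom_dim V + hom_dim W)%N.
Proof.
pose i1 : 'M[k]_(rdim V, rdim (rep_sum V W)) := row_mx 1%:M 0.
pose i2 : 'M[k]_(rdim W, rdim (rep_sum V W)) := row_mx 0 1%:M.
pose p1 : 'M[k]_(rdim (rep_sum V W), rdim V) := col_mx 1%:M 0.
pose p2 : 'M[k]_(rdim (rep_sum V W), rdim W) := col_mx 0 1%:M.
have hi1 : rep_hom V (rep_sum V W) i1.
  by move=> g _; rewrite /= !map_row_mx map_mx1 map_mx0 mul_mx_row mul_row_block !(mulmx1, mulmx0, mul1mx, mul0mx, addr0, add0r).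
have hi2 : rep_hom W (rep_sum V W) i2.
  by move=> g _; rewrite /= !map_row_mx map_mx1 map_mx0 mul_mx_row mul_row_block !(mulmx1, mulmx0, mul1mx, mul0mx, addr0, add0r).
have hp1 : rep_hom (rep_sum V W) V p1.
  by move=> g _; rewrite /= !map_col_mx map_mx1 map_mx0 mul_block_col mul_col_mx !(mulmx1, mulmx0, mul1mx, mul0mx, addr0, add0r).
have hp2 : rep_hom (rep_sum V W) W p2.
  by move=> g _; rewrite /= !map_col_mx map_mx1 map_mx0 mul_block_col mul_col_mx !(mulmx1, mulmx0, mul1mx, mul0mx, addr0, add0r).
have i1p1 : i1 *m p1 = 1%:M by rewrite mul_row_col mulmx1 mulmx0 addr0.
have i2p2 : i2 *m p2 = 1%:M by rewrite mul_row_col mulmx1 mulmx0 add0r.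
have i2p1 : i2 *m p1 = 0 by rewrite mul_row_col mulmx1 mulmx0 addr0.
have i1p2 : i1 *m p2 = 0 by rewrite mul_row_col mulmx1 mulmx0 add0r.
have pi1 : p1 *m i1 + p2 *m i2 = 1%:M.
  rewrite !mul_col_row !(mulmx0, mul0mx, mulmx1) add_block_mx !(addr0, add0r).
  by rewrite -scalar_mx_block.
have eqs : (hom_mx (rep_sum V W) == hom_mx V *m post V (rep_sum V W) i1 +
            hom_mx W *m post W (rep_sum V W) i2)%MS.
  apply/andP; split; last by rewrite addsmx_sub !post_hom.
  apply: mxvec_subP => P /hom_mxP hP.
  rewrite -[P]mulmx1 -pi1 mulmxDr !mulmxA linearD /=.
  apply: addmx_sub_adds.
    rewrite -(@mul_post V (rep_sum V W) i1); apply: submxMr.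
    by apply/hom_mxP; exact: rep_homM hP hp1.
  rewrite -(@mul_post W (rep_sum V W) i2); apply: submxMr.
  by apply/hom_mxP; exact: rep_homM hP hp2.
rewrite /hom_dim (eqmx_rank eqs) mxrank_disjoint_sum.
  congr (_ + _)%N; rewrite mxrankMfree //; apply/row_freeP.
    by exists (post (rep_sum V W) V p1); rewrite postM i1p1 post1.
  by exists (post (rep_sum V W) W p2); rewrite postM i2p2 post1.
apply/eqP; rewrite -submx0; apply: mxvec_subP => P.
rewrite sub_capmx => /andP[/submxP[D1 E1] /submxP[D2 E2]].
set q1 := post V (rep_sum V W) i1 in E1 *.
set q2 := post W (rep_sum V W) i2 in E2 *.
pose q3 := post (rep_sum V W) V p1.
have q13 : q1 *m q3 = 1%:M by rewrite /q1 /q3 postM i1p1 post1.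
have q23 : q2 *m q3 = 0.
  rewrite /q2 /q3 postM i2p1.
  by apply/row_matrixP => i; rewrite !rowE -[delta_mx 0 i]vec_mxK mul_post !mulmx0 linear0.
have : mxvec P *m q3 *m q1 = mxvec P.
  by rewrite E1 -!mulmxA (mulmxA q1) q13 mul1mx.
by rewrite {1}E2 -!mulmxA (mulmxA q2) q23 mul0mx !mulmx0 => <-; exact: sub0mx.
Qed.

Definition class_dim (x : rep_class G) : int := hom_dim (repr x).

Lemma class_dimE V : class_dim (iso_class V) = hom_dim V.
Proof. by congr Posz; apply/hom_dim_iso/iso_classP/iso_class_repr. Qed.

Lemma class_dimD x y : class_dim (x + y) = class_dim x + class_dim y.
Proof.
rewrite -(iso_class_repr x) -(iso_class_repr y) [_ + _]class_addE !class_dimE.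
by rewrite hom_dim_sum PoszD.
Qed.

(** The dimension of [Hom(S, -)], extended to formal differences. *)
Definition hom_index (a : rep_ring G) : int := class_dim (repr a).1 - class_dim (repr a).2.

Lemma hom_indexE x : hom_index (Defs.diff x) = class_dim x.1 - class_dim x.2.
Proof.
have /Defs.diffP[u] := Defs.diff_repr (Defs.diff x); move/(congr1 class_dim); rewrite !class_dimD /hom_index.
set a := class_dim (repr _).1; set b := class_dim (repr _).2 => E.
by apply/eqP; rewrite subr_eq addrAC eq_sym subr_eq -(inj_eq (addIr (class_dim u))) E.
Qed.

Lemma hom_indexD a b : hom_index (a + b) = hom_index a + hom_index b.
Proof.
rewrite -(Defs.diff_repr a) -(Defs.diff_repr b) [_ + _]grothendieck_addE !hom_indexE /= !class_dimD.
by ring.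
Qed.

Lemma hom_index_cls V : hom_index (cls V) = hom_dim V.
Proof.
rewrite /rep_ring_class hom_indexE /= class_dimE.
have := class_dimD 0 0; rewrite addr0 -[X in X = _]addr0 => /addrI <-.
by rewrite subr0.
Qed.

Lemma hom_dim_gt0 V P : rep_hom S V P -> P != 0 -> (0 < hom_dim V)%N.
Proof.
move=> hP P0; rewrite lt0n mxrank_eq0; apply: contra P0 => /eqP A0.
have /hom_mxP := hP; rewrite A0 submx0 => /eqP E.
by rewrite -[P]mxvecK E linear0.
Qed.

Lemma hom_dim_self : indecomposable S -> (0 < hom_dim S)%N.
Proof.
move=> [S0 _]; apply: (hom_dim_gt0 (@rep_hom1 _ _ _ _ S)).
by apply: contraTneq S0 => /(congr1 mxrank); rewrite mxrank1 mxrank0 => ->.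
Qed.

Lemma hom_dim_indecomposable V : indecomposable S -> indecomposable V ->
  cls V <> cls S -> hom_dim V = 0%N.
Proof.
move=> Si Vi VS; apply/eqP; rewrite mxrank_eq0 -submx0; apply: mxvec_subP => P /hom_mxP hP.
have [->|P0] := eqVneq P 0; first by rewrite linear0 sub0mx.
by case: VS; apply/esym/cls_iso; exact: (indecomposable_hom char0k Gred Gsimple Si Vi hP P0).
Qed.
End HomDim.

Lemma rep1_indecomposable : indecomposable (rep1 G).
Proof.
split=> // W U /rep_iso_dim /= E.
by case: (rdim W) E => [|[|w]] E; [left|right|]; case: (rdim U) E => //= u; rewrite ?addn0 ?addnS.
Qed.

Lemma basisM b c : basis b -> basis c -> nonneg_comb basis (b * c).
Proof. by move=> [V _ <-] [W _ <-]; rewrite -cls_tensor; exact: cls_decompose. Qed.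

Lemma basis_span (x : rep_ring G) : exists y z, [/\ nonneg_comb basis y, nonneg_comb basis z & x = y - z].
Proof.
rewrite -(Defs.diff_repr x); case: (repr x) => u v.
exists (cls (repr u)), (cls (repr v)); split; [exact: cls_decompose|exact: cls_decompose|].
rewrite /rep_ring_class !iso_class_repr; apply/eqP; rewrite eq_sym subr_eq; apply/eqP.
by rewrite [RHS](grothendieck_addE (u, v) (v, 0)) /diff_add /= addr0; apply/Defs.diffP; exists 0; rewrite /= !addr0.
Qed.
End RepRing.

(** * Matrix coefficients *)

Lemma mxtrace_tens (R : comPzRingType) m n (A : 'M[R]_m) (B : 'M[R]_n) :
  \tr (tensmx A B) = \tr A * \tr B.
Proof.
rewrite /mxtrace big_distrlr /= pair_big /= (reindex (@mxtens_index m n)) /=.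
  by apply: eq_bigr => -[i j] _; rewrite tensmxE.
exists (@mxtens_unindex m n) => x _; [exact: mxtens_indexK|exact: mxtens_unindexK].
Qed.

Section Coefficients.
Variables (k : fieldType) (K : closedFieldType) (iota : {rmorphism k -> K}).
Variable (G : algebraic_group iota).
Hypothesis char0k : [pchar k] =i pred0.
Hypothesis Gred : reductive G.
Hypothesis Gsimple : simple G.
Notation GK := (gpoints G).
Notation N := (gdim G).
Notation "A ^i" := (map_mx iota A) (at level 2, format "A ^i").
Implicit Types V W U S Q : rep G.
Notation cls := (@rep_ring_class k K iota G).
Notation basis := [set cls V | V in [set V | indecomposable V]].
Let Ggrp : is_subgroup GK := gpoints_subgroup G.

Definition coefficient Q (f : 'M[K]_N -> K) :=
  exists C : 'M[K]_(rdim Q), forall g, GK g -> f g = \tr (Q g *m C).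

Lemma coefficientD Q f h : coefficient Q f -> coefficient Q h -> coefficient Q (fun g => f g + h g).
Proof.
move=> [C CE] [D DE]; exists (C + D) => g Gg.
by rewrite mulmxDr mxtraceD CE ?DE.
Qed.

Lemma coefficientZ Q a f : coefficient Q f -> coefficient Q (fun g => a * f g).
Proof. by move=> [C CE]; exists (a *: C) => g Gg; rewrite -scalemxAr mxtraceZ CE. Qed.

Lemma coefficient_ext Q f h : (forall g, GK g -> h g = f g) -> coefficient Q f -> coefficient Q h.
Proof. by move=> E [C CE]; exists C => g Gg; rewrite E ?CE. Qed.

Lemma coefficient_sum Q I (r : seq I) (f : I -> 'M[K]_N -> K) :
  (forall i, coefficient Q (f i)) -> coefficient Q (fun g => \sum_(i <- r) f i g).
Proof.
move=> fc; elim: r => [|i r IH].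
  by exists 0 => g _; rewrite big_nil mulmx0 mxtrace0.
by apply: (coefficient_ext (f := fun g => f i g + \sum_(i <- r) f i g));
   [move=> g _; rewrite big_cons|exact: coefficientD].
Qed.

Lemma trace_delta n (A : 'M[K]_n) i j : \tr (A *m delta_mx j i) = A i j.
Proof.
rewrite /mxtrace (bigD1 i) //= mxE (bigD1 j) //= mxE !eqxx mulr1 big1 => [|l lj].
  rewrite addr0 big1 ?addr0 // => l li; rewrite mxE big1 // => p _.
  by rewrite mxE (negPf li) andbF mulr0.
by rewrite mxE (negPf lj) mulr0.
Qed.

(** The trace of a tensor product is the product of the traces. *)
Lemma coefficient_entry V Q i j f : coefficient Q f ->
  coefficient (rep_tensor V Q) (fun g => V g i j * f g).
Proof.
move=> [C CE]; exists (tensmx (delta_mx j i) C) => g Gg.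
by rewrite tensmx_mul mxtrace_tens trace_delta CE.
Qed.

Section FirstRow.
Variables (Q S : rep G).
Let q := rdim Q.
Let dec (b : 'I_(q * q)) := enum_val (cast_ord (esym (mxvec_cast q q)) b).
Let decK i j : dec (mxvec_index i j) = (i, j).
Proof. by rewrite /dec /mxvec_index cast_ordK enum_rankK. Qed.

(** Matrices [C] correspond to linear maps [f] from [M_q] to row vectors.  Let [G] act
    on those for which [f(Q(h))] is a multiple of the row of [S(h)]: the multiple is
    invariant and nonzero for some map by hypothesis.  A fixed map restricts on each
    row of [M_q] to a homomorphism from [Q] to [S]. *)
Lemma coefficient_hom i0 : (forall j, coefficient Q (fun g => S g i0 j)) ->
  exists2 P, rep_hom Q S P & P != 0.
Proof.
move=> /choice[C0 CE].
have [FQ [FQrep FQE]] := rep_term Q; have [FS [FSrep FSE]] := rep_term S.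
have GM := subgroupM Ggrp; have GV := subgroupV Ggrp; have G1 := subgroup1 Ggrp.
pose F1 : mxterm K N (q * q) (q * q) := fun a b =>
  if (dec a).1 == (dec b).1 then FQ (dec a).2 (dec b).2 else RConst N 0.
have F1E g (A : 'M[K]_q) : GK g -> mxvec A *m mev F1 g = mxvec (A *m Q g).
  move=> Gg; apply/rowP => b; case/mxvec_indexP: b => i j; rewrite mxvecE !mxE.
  rewrite (reindex _ (curry_mxvec_bij _ _)) /=.
  rewrite (eq_bigr (fun p => if p.1 == i then A p.1 p.2 * Q g p.2 j else 0)).
    rewrite -(pair_big xpredT xpredT (fun p1 p2 => if p1 == i then A p1 p2 * Q g p2 j else 0)) /=.
    rewrite (bigD1 i) //= [X in _ + X]big1 ?addr0 => [|l li]; first by apply: eq_bigr => l _; rewrite eqxx.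
    by rewrite big1 // => p _; rewrite (negPf li).
  move=> [a b] _ /=; rewrite mxvecE mxE /F1 !decK /=; case: ifP => _; last by rewrite /= mulr0.
  by rewrite -FQE // mxE.
have row_ext p (A B : 'M[K]_(q * q, p)) : (forall D : 'M[K]_q, mxvec D *m A = mxvec D *m B) -> A = B.
  by move=> E; apply/row_matrixP => i; rewrite !rowE -[delta_mx 0 i]vec_mxK E.
have F1rep : is_rep GK F1.
  split=> [|g h Gg Gh]; apply: row_ext => D; first by rewrite F1E // rmap1 !mulmx1.
  by rewrite mulmxA (F1E _ _ (GM _ _ Gg Gh)) !F1E // rmapM // mulmxA.
pose E : set 'M[K]_(q * q, rdim S) := [set C | exists c, forall h, GK h ->
  mxvec (Q h) *m C = c *: row i0 (S h)].
pose E0 : set 'M[K]_(q * q, rdim S) := [set C | forall h, GK h -> mxvec (Q h) *m C = 0].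
have act g h C : GK g -> GK h ->
    mxvec (Q h) *m (mev F1 (invmx g) *m C *m mev FS g) = mxvec (Q (h *m invmx g)) *m C *m S g.
  move=> Gg Gh; have Gi := GV _ Gg.
  by rewrite !mulmxA F1E // FSE // rmapM.
have EC c g C : GK g -> (forall h, GK h -> mxvec (Q h) *m C = c *: row i0 (S h)) ->
    forall h, GK h -> mxvec (Q h) *m (mev F1 (invmx g) *m C *m mev FS g) = c *: row i0 (S h).
  move=> Gg cE h Gh; have Gi := GV _ Gg; rewrite act // cE; last exact: GM.
  rewrite -scalemxAl -row_mul -rmapM //; last exact: GM.
  by rewrite mulmxKV // (G_unit Ggrp).
have [||||||||C [[c cE] nC0 CG]] := fixed_matrix_lifts char0k Gred Gsimple F1rep FSrep (E0 := E0) (E := E).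
- by move=> h _; rewrite mulmx0.
- by move=> a u v u0 v0 h Gh; rewrite mulmxDr -scalemxAr u0 // v0 // scaler0 addr0.
- by exists 0 => h _; rewrite mulmx0 scale0r.
- move=> a u v [c uc] [d vd]; exists (a * c + d) => h Gh.
  by rewrite mulmxDr -scalemxAr uc // vd // scalerA scalerDl.
- by move=> g C Gg C0' h Gh; rewrite act // C0' ?mul0mx //; apply: GM => //; exact: GV.
- by move=> g C Gg [c cE]; exists c; exact: EC.
- by move=> g C Gg [c cE] h Gh; rewrite mulmxBr (EC c) // cE // subrr.
- pose C := (\matrix_j mxvec (C0 j)^T)^T.
  have CP h : GK h -> mxvec (Q h) *m C = row i0 (S h).
    move=> Gh; apply/rowP => j; rewrite [RHS]mxE CE // mxE.
    rewrite (reindex _ (curry_mxvec_bij _ _)) /=.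
    rewrite (eq_bigr (fun p => Q h p.1 p.2 * C0 j p.2 p.1)).
      rewrite -(pair_big xpredT xpredT (fun p1 p2 => Q h p1 p2 * C0 j p2 p1)) /=.
      by apply: eq_bigr => p1 _; rewrite mxE.
    by move=> [p1 p2] _ /=; rewrite mxvecE !mxE mxvecE mxE.
  exists C; first by exists 1 => h Gh; rewrite CP // scale1r.
  move=> /(_ 1%:M G1); rewrite CP // rmap1 => /rowP/(_ i0); rewrite !mxE eqxx => /eqP.
  by rewrite oner_eq0.
pose P p : 'M[K]_(q, rdim S) := \matrix_b (mxvec (delta_mx p b : 'M[K]_q) *m C).
have PK p : rep_homK Q S (P p).
  move=> g Gg; apply/row_matrixP => b; rewrite !row_mul rowK -mulmxA.
  rewrite -FSE // -CG // mulmxA F1E // mulmx_sum_row.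
  under eq_bigr do rewrite rowK.
  under eq_bigr do rewrite scalemxAl -linearZ.
  rewrite -mulmx_suml -linear_sum; congr (mxvec _ *m _).
  apply/matrixP => i j; rewrite summxE mxE (bigD1 j) //= !mxE eqxx andbT.
  rewrite big1 => [|l lj]; last by rewrite !mxE [j == l]eq_sym (negPf lj) andbF mulr0.
  rewrite addr0 (bigD1 b) //= big1 => [|l lb]; last by rewrite mxE (negPf lb) andbF mul0r.
  by rewrite addr0 mxE eqxx andbT mulrC.
have [p Pp0] : exists p, P p != 0.
  apply: contrapT => H; apply: nC0 => h Gh.
  suff -> : C = 0 by rewrite mulmx0.
  have {}H p : P p = 0 by apply/eqP; apply: contraT => Pp; case: H; exists p.
  apply: row_ext => D; rewrite mulmx0 [D]matrix_sum_delta linear_sum mulmx_suml big1 // => i _.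
  rewrite linear_sum mulmx_suml big1 // => j _; rewrite linearZ -scalemxAl /=.
  have /row_matrixP/(_ j) := H i; rewrite rowK row0 => ->; exact: scaler0.
have [r [x [B [hB PE]]]] := rep_homK_span char0k (PK p).
have [i Bi0] : exists i, B i != 0.
  apply: contrapT => H; move: Pp0; rewrite PE big1 ?eqxx // => i _.
  have -> : B i = 0 by apply/eqP; apply: contraT => Bi; case: H; exists i.
  by rewrite map_mx0 scaler0.
by exists (B i).
Qed.
End FirstRow.

Fixpoint tensor_power U a : rep G :=
  if a is a'.+1 then rep_tensor U (tensor_power U a') else rep1 G.

Lemma cls_tensor_power U a : cls (tensor_power U a) = cls U ^+ a.
Proof. by elim: a => [|a IH] //=; rewrite cls_tensor IH exprS. Qed.

Lemma coefficient_const a : coefficient (rep1 G) (fun=> a).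
Proof. by exists a%:M => g _; rewrite mulmx1 || rewrite mul1mx mxtrace_scalar. Qed.

Lemma coefficient_prod U (r : seq ('I_(rdim U) * 'I_(rdim U))) :
  coefficient (tensor_power U (size r)) (fun g => \prod_(p <- r) U g p.1 p.2).
Proof.
elim: r => [|p r IH] /=.
  by apply: (coefficient_ext _ (coefficient_const 1)) => g _; rewrite big_nil.
by apply: (coefficient_ext _ (coefficient_entry p.1 p.2 IH)) => g _; rewrite big_cons.
Qed.

(** The determinant is a homomorphism to a commutative group. *)
Lemma rep_det1 V g : GK g -> \det (V g) = 1.
Proof.
move=> Gg; have [F [Frep FE]] := rep_term V.
pose H := [set g | GK g /\ \det (V g) = 1].
have GM := subgroupM Ggrp; have GV := subgroupV Ggrp; have G1 := subgroup1 Ggrp.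
suff HG : H = GK by have [] : H g by rewrite HG.
have detM x y : GK x -> GK y -> \det (V (x *m y)) = \det (V x) * \det (V y).
  by move=> Gx Gy; rewrite rmapM // det_mulmx.
have detV x : GK x -> \det (V x) * \det (V (invmx x)) = 1.
  by move=> Gx; rewrite -detM ?mulmxV ?rmap1 ?det1 ?(G_unit Ggrp) //; exact: GV.
apply: (group_perfect char0k Gred Gsimple).
- rewrite (_ : H = [set g | GK g /\ forall f, [set RAdd (rdet F) (RConst N (-1))] f -> ev f g = 0]).
    by apply: closed_subset; apply: zariski_closedW (gpoints_closed G).
  apply/seteqP; split=> x /= [Gx xP]; split=> //.
    by move=> _ ->; rewrite /= ev_rdet FE // xP subrr.
  by have := xP _ erefl; rewrite /= ev_rdet FE // => /eqP; rewrite subr_eq0 => /eqP.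
- split.
  + by move=> x [/(G_unit Ggrp)].
  + by split=> //; rewrite rmap1 det1.
  + by move=> x y [Gx x1] [Gy y1]; split; [exact: GM|rewrite detM // x1 y1 mulr1].
  + move=> x [Gx x1]; split; first exact: GV.
    by have := detV x Gx; rewrite x1 mul1r.
- by move=> x [].
move=> x y Gx Gy; have Gxy := GM _ _ Gx Gy; have Gx' := GV _ Gx; have Gy' := GV _ Gy.
have Gxyx := GM _ _ Gxy Gx'; split; first exact: GM.
by rewrite !detM // mulrAC -(mulrA (\det (V x))) detV // mulr1 detV.
Qed.

(** The determinant of [V] is a matrix coefficient of the tensor power of exponent
    [dim V], and it is constant; so that power maps onto the unit. *)
Lemma power_contains_unit V : indecomposable V -> exists m, (0 < m)%N /\
  exists2 y, nonneg_comb basis y & cls V ^+ m = 1 + y.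
Proof.
move=> [V0 _]; exists (rdim V); split=> //.
have det_coef : coefficient (tensor_power V (rdim V)) (fun g => \det (V g)).
  apply: coefficient_sum => s; apply: coefficientZ.
  pose r := [seq (i, s i) | i <- enum 'I_(rdim V)].
  have rE : size r = rdim V by rewrite size_map size_enum_ord.
  have := @coefficient_prod V r; rewrite rE.
  apply: coefficient_ext => g _; rewrite big_map -[LHS]big_enum.
  by [].
have [j|P hP P0] := @coefficient_hom (tensor_power V (rdim V)) (rep1 G) 0.
  apply: coefficient_ext det_coef => g Gg; rewrite rep_det1 //=.
  by rewrite [j]ord1 mxE eqxx.
have [U iso] := indecomposable_summand char0k Gred Gsimple (@rep1_indecomposable _ _ _ G) hP P0.
exists (cls U); first exact: cls_decompose.
by rewrite -cls_tensor_power (cls_iso iso) cls_sum cls_rep1.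
Qed.

Lemma std_regular : regular_mx (G := G) (fun g => g).
Proof. by move=> i j; exists (fun g => g i j) => //; exact: regular_coord. Qed.

Definition std_k : rep G := @Rep _ _ _ G N (fun g => g) std_regular erefl (fun _ _ _ _ => erefl).

Lemma det_inv_regular : regular_mx (G := G) (fun g => ((\det g)^-1)%:M : 'M[K]_1).
Proof.
move=> i j; exists (fun g => (\det g)^-1); first exact: regular_inv_det.
by move=> g _; rewrite [i]ord1 [j]ord1 mxE eqxx.
Qed.

Lemma det_inv1 : ((\det (1%:M : 'M[K]_N))^-1)%:M = 1%:M :> 'M[K]_1.
Proof. by rewrite det1 invr1. Qed.

Lemma det_invM g h : GK g -> GK h ->
  ((\det (g *m h))^-1)%:M = ((\det g)^-1)%:M *m ((\det h)^-1)%:M :> 'M[K]_1.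
Proof. by move=> _ _; rewrite -scalar_mxM det_mulmx invfM. Qed.

Definition det_inv : rep G := Rep det_inv_regular det_inv1 det_invM.

(** Its entries are the coordinates, the inverse of the determinant and the constant
    [1], which makes the spaces of coefficients of its tensor powers increase. *)
Definition generating_rep : rep G := rep_sum (rep1 G) (rep_sum std_k det_inv).

Lemma coefficient_widen a b f : (a <= b)%N ->
  coefficient (tensor_power generating_rep a) f -> coefficient (tensor_power generating_rep b) f.
Proof.
move=> /subnKC <-; elim: (b - a)%N => [|d IH] fa; first by rewrite addn0.
rewrite addnS /=; apply: (coefficient_ext _ (coefficient_entry (V := generating_rep) (lshift _ 0) (lshift _ 0) (IH fa))).
by move=> g _; rewrite /= block_mxEul mxE eqxx mul1r.
Qed.

(** The extra factor [h] makes the induction pass through products. *)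
Lemma regular_coefficient f : regular iota f -> forall a h,
  coefficient (tensor_power generating_rep a) h ->
  exists b, coefficient (tensor_power generating_rep b) (fun g => f g * h g).
Proof.
elim=> [c|i j||f1 f2 _ IH1 _ IH2|f1 f2 _ IH1 _ IH2] a h ha.
- by exists a; exact: coefficientZ.
- exists a.+1; apply: (coefficient_ext _ (coefficient_entry (V := generating_rep) (rshift _ (lshift _ i)) (rshift _ (lshift _ j)) ha)).
  by move=> g _; rewrite /= block_mxEdr block_mxEul.
- exists a.+1; apply: (coefficient_ext _ (coefficient_entry (V := generating_rep) (rshift _ (rshift _ 0)) (rshift _ (rshift _ 0)) ha)).
  by move=> g _; rewrite /= !block_mxEdr mxE eqxx.
- have [b1 c1] := IH1 _ _ ha; have [b2 c2] := IH2 _ _ ha.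
  exists (maxn b1 b2); apply: (coefficient_ext (f := fun g => f1 g * h g + f2 g * h g)).
    by move=> g _; rewrite mulrDl.
  apply: coefficientD; [apply: coefficient_widen c1|apply: coefficient_widen c2].
    exact: leq_maxl.
  exact: leq_maxr.
- have [b2 c2] := IH2 _ _ ha; have [b c] := IH1 _ _ c2.
  by exists b; apply: coefficient_ext c => g _; rewrite mulrA.
Qed.

(** The entries of a row of [S] are coefficients of a common tensor power of
    [generating_rep]. *)
Lemma indecomposable_in_power S : indecomposable S -> exists a U,
  rep_iso (tensor_power generating_rep a) (rep_sum S U).
Proof.
move=> Si; have [S0 _] := Si; pose i0 := Ordinal S0.
have H j : exists b, coefficient (tensor_power generating_rep b) (fun g => S g i0 j).
  have [f fr fE] := @rmap_regular _ _ _ _ S i0 j.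
  have [b c] := regular_coefficient fr (coefficient_const 1 : coefficient (tensor_power generating_rep 0) _).
  by exists b; apply: coefficient_ext c => g Gg; rewrite mulr1 fE.
have [b bP] := choice H; exists (\max_j b j).
have [j|P hP P0] := @coefficient_hom (tensor_power generating_rep (\max_j b j)) S i0.
  by apply: coefficient_widen (bP j); exact: leq_bigmax.
exact: indecomposable_summand hP P0.
Qed.

(** Add one tensor power of [generating_rep] at each step, by means of the finitely many
    classes in a decomposition.  A summand [S] of that power must occur among them,
    since [hom_index S] would vanish otherwise. *)
Theorem exists_good_filtration : exists F, good_filtration basis F.
Proof.
have /choice[s sP] : forall a, exists s : seq (rep_ring G),
    (forall b, b \in s -> basis b) /\ cls (tensor_power generating_rep a) = \sum_(b <- s) b.
  by move=> a; have [s sb E] := cls_decompose (tensor_power generating_rep a); exists s.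
pose F n : {fset rep_ring G} := [fset x in 1 :: flatten [seq s i | i <- seq.iota 0 n]]%fset.
have b1 : basis (1 : rep_ring G) by exists (rep1 G); [exact: rep1_indecomposable|].
have FE n x : (x \in F n) = (x == 1) || (x \in flatten [seq s i | i <- seq.iota 0 n]).
  by rewrite in_fset in_cons.
exists F; split.
- by apply/fsetP => x; rewrite FE in_fset1 in_nil orbF.
- move=> n; apply/fsubsetP => x; rewrite !FE => /orP[->//|/flattenP[_ /mapP[i + ->] xs]].
  rewrite mem_iota add0n => /andP[_ i_n]; apply/orP; right; apply/flattenP; exists (s i) => //.
  by apply: map_f; rewrite mem_iota add0n leq0n ltnS ltnW.
apply/seteqP; split=> [x [n _] /=|_ [S Si <-]].
  rewrite FE => /orP[/eqP ->//|/flattenP[_ /mapP[i _ ->] xs]].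
  by case: (sP i) => H _; exact: H.
have [a [U iso]] := indecomposable_in_power Si.
exists a.+1 => //; change (cls S \in F a.+1); rewrite FE; apply/orP; right; apply/flattenP; exists (s a).
  by apply: map_f; rewrite mem_iota /= add0n.
have [sb sE] := sP a; apply: contraT => nS.
have := congr1 (hom_index S) sE; rewrite (cls_iso iso) cls_sum hom_indexD !hom_index_cls.
have : forall t, {subset t <= s a} -> hom_index S (\sum_(b <- t) b) = 0.
  elim=> [|b t IH] ts.
    by rewrite big_nil; have := hom_indexD S 0 0; rewrite addr0 -[X in X = _]addr0 => /addrI <-.
  rewrite big_cons hom_indexD IH ?addr0; last by move=> x xt; apply: ts; rewrite inE xt orbT.
  have bs : b \in s a by apply: ts; rewrite mem_head.
  have [V Vi VE] := sb b bs; rewrite -VE hom_index_cls.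
  rewrite (hom_dim_indecomposable char0k Gred Gsimple Si Vi) // VE => bS.
  by move: nS; rewrite -bS bs.
move=> -> //; have := hom_dim_self Si; case: (hom_dim S S) => //.
Qed.
End Coefficients.

(** * PF admissibility *)

Theorem proposition3p0p16 (R : realType) (k : fieldType) (K : closedFieldType)
    (iota : {rmorphism k -> K}) (G : algebraic_group iota) (X : rep G) :
  [pchar k]%R =i pred0 -> reductive G -> simple G ->
  PF_admissible R (rep_growth_problem X).
Proof.
move=> char0 Gred Gsimple.
have based : based_ring (@gp_basis (rep_growth_problem X)).
  split; [|by exists (rep1 G); [exact: rep1_indecomposable|]|exact: basisM].
  apply: Zbasis_criterion; last exact: basis_span.
  move=> _ [S Si <-]; exists (hom_index S); first exact: hom_indexD.
  split; first by rewrite hom_index_cls; have := hom_dim_self Si; case: (hom_dim S S).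
  move=> _ [V Vi <-] VS.
  by rewrite hom_index_cls (hom_dim_indecomposable char0 Gred Gsimple Si Vi VS).
split; [exact: based|exact: cls_decompose|].
have [F Fg] := exists_good_filtration char0 Gred Gsimple; exists F; split=> //.
apply: (PF_filtration_good R based) Fg => _ [V Vi <-].
exact: (power_contains_unit char0 Gred Gsimple Vi).
Qed.
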